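(* Let $N$ be a squarefree positive integer with $\gcd(N,6)=1$, and let $d$ be a positive divisor of $N$. Then $$\chi_{N/d}(0)+C(d,N)(N/d)^{(N-3)/2}\frac{1-N}{B_{(N-1)/2,\chi_N}}\sum_{n\ge1}\sigma_{(N-3)/2}(\chi_{N/d},\chi_d;n)q^n=\frac Nd(q;q)_\infty^N\sum_{n\ge0}P\!\left(\frac{N}{d^2}n-\frac{N^2-d^2}{24d^2}\right)q^n+C_2(z)$$ for some cusp form $C_2(z)\in S_{(N-1)/2}(\Gamma_0(N),\chi_N)$.
   Context: $q=e^{2\pi iz}$, $(q;q)_\infty=\prod_{n\ge1}(1-q^n)$. $P(n)$ is the partition function, with $P(x)=0$ when $x$ is not a nonnegative integer. For an odd squarefree positive integer $a$ and $b\in\mathbb{Z}$, $\chi_a(b)$ is the Kronecker symbol $\left(\frac{(-1)^{(a-1)/2}a}{b}\right)$ (so $\chi_1(0)=1$, $\chi_a(0)=0$ for $a>1$). $S_k(\Gamma_0(N),\chi_N)$ is the space of cusp forms of weight $k$ on $\Gamma_0(N)$ with character $\chi_N$. $\sigma_{k-1}(\chi_{N/d},\chi_d;n)=\sum_{1\le t\mid n}\chi_{N/d}(n/t)\chi_d(t)t^{k-1}$. $B_{k,\chi_N}$ is defined by $\sum_{k\ge0}B_{k,\chi_N}t^k/k!=\sum_{a=1}^N\chi_N(a)te^{at}/(e^{Nt}-1)$. $\epsilon_c=1$ if $c\equiv1\pmod4$, $\epsilon_c=i$ if $c\equiv3\pmod4$; $A(d,N)=(-1)^{(d+1)(N/d-1)/4}\epsilon_{N/d}$;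 $C(d,N)=i^{(1-Nd)/2}/A(d,N)$. *)

(* Defs.v *)
From HB Require Import structures.
From mathcomp Require Import all_boot all_order all_algebra archimedean.
From mathcomp Require Import all_classical all_reals all_analysis.
From mathcomp Require Import complex.

Set Implicit Arguments.
Unset Strict Implicit.
Unset Printing Implicit Defensive.

Import Order.TTheory GRing.Theory Num.Theory.
Import numFieldNormedType.Exports.

Local Open Scope ring_scope.

Definition squarefree (n : nat) : Prop :=
  (0 < n)%N /\ forall m : nat, (m ^ 2 %| n)%N -> m = 1%N.

(* (D / p) for a prime p: the Legendre symbol for odd p, with the usual values
   at p = 2. *)
Definition kronecker_prime (D : int) (p : nat) : int :=
  if (p%:Z %| D)%Z then 0
  else if p == 2 then
    if ((D %% 8)%Z == 1) || ((D %% 8)%Z == 7) then 1 else -1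
  else if [exists x : 'I_p, (x%:Z ^+ 2 == D %[mod p%:Z])%Z] then 1 else -1.

(* (D / b), with (D / 0) = [D = +-1] and (D / -1) the sign of D. *)
Definition kronecker (D b : int) : int :=
  if b == 0 then (`|D|%N == 1%N)%:R
  else (if (b < 0) && (D < 0) then -1 else 1) *
       \prod_(p <- primes `|b|%N) kronecker_prime D p ^+ logn p `|b|%N.

Definition chi (a : nat) (b : int) : int :=
  kronecker ((-1) ^+ ((a - 1) %/ 2) * a%:Z) b.

(* A partition of n is encoded by its multiplicities: m i is the number of
   parts equal to i + 1. *)
Definition partition_count (n : nat) : nat :=
  #|[set m : {ffun 'I_n -> 'I_n.+1} | \sum_(i < n) (m i * i.+1) == n]|%N.

Definition partition_fun (x : rat) : nat :=
  if x \is a Num.nat then partition_count (Num.truncn x) else 0%N.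

(* The coefficient of t^n in e^(c t). *)
Definition exp_coef (c : nat) (n : nat) : rat := c%:R ^+ n / n`!%:R.

(* B is the sequence of generalized Bernoulli numbers attached to chi N, i.e.
   (sum_k B k t^k / k!) (e^(N t) - 1) = sum_(1 <= a <= N) (chi N a) t e^(a t)
   as formal power series in t, compared coefficient by coefficient. *)
Definition bernoulli_gf (N : nat) (B : nat -> rat) : Prop :=
  forall n : nat,
    \sum_(j < n.+1) B j / j`!%:R * (exp_coef N (n - j) - (n - j == 0)%N%:R)
    = \sum_(1 <= a < N.+1)
        (chi N a)%:~R * (if n is m.+1 then exp_coef a m else 0).

Definition gen_bernoulli (N : nat) : nat -> rat :=
  xget (fun=> 0) [set B | bernoulli_gf N B]%classic.

Lemma bernoulli_gf_rec N B : bernoulli_gf N B <-> forall m : nat,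
    \sum_(j < m) B j / j`!%:R * exp_coef N (m.+1 - j) + B m / m`!%:R * N%:R
    = \sum_(1 <= a < N.+1) (chi N a)%:~R * exp_coef a m.
Proof.
have e0 (n : nat) : exp_coef N (n - n) - (n - n == 0)%N%:R = 0.
  by rewrite subnn /exp_coef expr0 fact0 divr1 subrr.
have e1 (m : nat) :
  \sum_(j < m.+2) B j / j`!%:R * (exp_coef N (m.+1 - j) - (m.+1 - j == 0)%N%:R)
  = \sum_(j < m) B j / j`!%:R * exp_coef N (m.+1 - j) + B m / m`!%:R * N%:R.
  rewrite big_ord_recr /= e0 mulr0 addr0 big_ord_recr /=; congr (_ + _).
    apply: eq_bigr => j _; rewrite subn_eq0 leqNgt ltnS (ltnW (ltn_ord j)).
    by rewrite subr0.
  by rewrite subSnn /exp_coef expr1 divr1 subr0.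
split=> H m; first by rewrite -e1 (H m.+1).
case: m => [|m]; last by rewrite e1 H.
by rewrite big_ord_recr big_ord0 /= e0 mulr0 addr0 big1 // => a _; rewrite mulr0.
Qed.

Lemma bernoulli_gf_exists N : (0 < N)%N -> exists B, bernoulli_gf N B.
Proof.
move=> N0; have N_neq0 : N%:R != 0 :> rat by rewrite pnatr_eq0 -lt0n.
have fact_neq0 m : m`!%:R != 0 :> rat by rewrite pnatr_eq0 -lt0n fact_gt0.
pose nxt (s : seq rat) : rat := let m := size s in
  (\sum_(1 <= a < N.+1) (chi N a)%:~R * exp_coef a m
   - \sum_(j < m) s`_j / j`!%:R * exp_coef N (m.+1 - j)) / N%:R * m`!%:R.
pose L n : seq rat := iter n (fun s => rcons s (nxt s)) [::].
have szL n : size (L n) = n by elim: n => //= n IH; rewrite size_rcons IH.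
have L_nth n j : (j < n)%N -> (L n)`_j = nxt (L j).
  elim: n => //= n IH; rewrite ltnS leq_eqVlt nth_rcons szL => /orP[/eqP->|jn].
    by rewrite ltnn eqxx.
  by rewrite jn IH.
exists (fun n => nxt (L n)); apply/bernoulli_gf_rec => m.
rewrite {2}/nxt szL mulfK // mulfVK // addrC.
under [X in _ - X + _]eq_bigr => j _ do rewrite L_nth //.
by rewrite subrK.
Qed.

Lemma bernoulli_gf_unique N B B' : (0 < N)%N ->
  bernoulli_gf N B -> bernoulli_gf N B' -> B = B'.
Proof.
move=> N0 /bernoulli_gf_rec H /bernoulli_gf_rec H'; apply/funext => n.
have N_neq0 : N%:R != 0 :> rat by rewrite pnatr_eq0 -lt0n.
have fact_neq0 m : m`!%:R != 0 :> rat by rewrite pnatr_eq0 -lt0n fact_gt0.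
elim/ltn_ind: n => n IH; move: (H n); rewrite -(H' n).
under eq_bigr => j _ do rewrite IH //.
by move=> /addrI /(mulIf N_neq0) /(mulIf (invr_neq0 (fact_neq0 n))).
Qed.

Lemma gen_bernoulliP N : (0 < N)%N -> bernoulli_gf N (gen_bernoulli N).
Proof.
by move=> /bernoulli_gf_exists[B HB]; rewrite /gen_bernoulli; case: xgetP => // /(_ B).
Qed.

(* The usual topology of the complex numbers, from the norm of R[i]. *)
HB.instance Definition _ (R : rcfType) := NormedModule.copy R[i] R[i]^o.

Section Complex.
Variable R : realType.
Local Notation C := R[i].

Definition imunit : C := Complex 0 1.

Definition cexp (z : C) : C :=
  real_complex R (expR (complex.Re z)) * Complex (cos (complex.Im z)) (sin (complex.Im z)).

Definition qvar (z : C) : C := cexp (real_complex R (2 * pi) * imunit * z).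

Definition qpoch (q : C) : C := limn (fun n => \prod_(1 <= j < n.+1) (1 - q ^+ j)).

(* The exponent may be -1 (this happens for weight 0). *)
Definition sigma (e : int) (psi phi : int -> int) (n : nat) : C :=
  \sum_(t <- divisors n) (psi (n %/ t)%N%:Z)%:~R * (phi t%:Z)%:~R * t%:R ^ e.

Definition epsilon (c : nat) : C := if (c %% 4 == 1)%N then 1 else imunit.

Definition Acoef (d N : nat) : C :=
  (-1) ^+ ((d + 1) * (N %/ d - 1) %/ 4) * epsilon (N %/ d).

Definition Ccoef (d N : nat) : C :=
  imunit ^ ((1 - (N * d)%N%:Z) %/ 2)%Z / Acoef d N.

Definition autj (g : 'M[int]_2) (z : C) : C := (g 1 0)%:~R * z + (g 1 1)%:~R.

Definition moebius (g : 'M[int]_2) (z : C) : C :=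
  ((g 0 0)%:~R * z + (g 0 1)%:~R) / autj g z.

Definition SL2Z (g : 'M[int]_2) : Prop := \det g = 1.

Definition Gamma0 (N : nat) (g : 'M[int]_2) : Prop :=
  SL2Z g /\ (N%:Z %| (g 1 0)%R)%Z.

(* Only the values of f on the upper half-plane matter; [derivable _ z 1] is
   complex differentiability, the scalar field being C.  The last clause is
   vanishing at all cusps: f|_k g tends to 0 at i oo for every g in SL_2(Z). *)
Definition cusp_form (k N : nat) (psi : int -> int) (f : C -> C) : Prop :=
  [/\ forall z : C, 0 < complex.Im z -> derivable f z 1,
      forall (g : 'M[int]_2) (z : C), Gamma0 N g -> 0 < complex.Im z ->
        f (moebius g z) = (psi (g 1 1))%:~R * autj g z ^+ k * f z
    & forall g : 'M[int]_2, SL2Z g ->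
        forall e : R, 0 < e -> exists A : R, forall z : C, 0 < complex.Im z -> A < complex.Im z ->
          `|autj g z ^- k * f (moebius g z)| < real_complex R e].

End Complex.

Arguments Ccoef : clear implicits.
Arguments sigma : clear implicits.

(* Main.v *)
Require Import Defs.
From mathcomp Require Import all_boot all_order all_algebra archimedean.
From mathcomp Require Import all_fingroup all_solvable all_field.
From mathcomp Require Import all_classical all_reals all_analysis.
From mathcomp Require Import complex.
From mathcomp Require Import ring lra zify.
Import Order.TTheory GRing.Theory Num.Theory.
Import numFieldNormedType.Exports.
Local Open Scope ring_scope.
Set Implicit Arguments.
Unset Strict Implicit.
Unset Printing Implicit Defensive.

(** Write N = d e and k = (N - 1) / 2, and let h(z) = eta(z)^N / eta(N z), of weight k and
    character chi_N on Gamma_0(N), with value 1 at the cusp i oo and 0 at the others.  If g in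
    SL_2(Z) has bottom row (0, 1) modulo d and (1, 0) modulo e, then the sum F of h|_k(g T^j)
    over j modulo e is, up to a Gauss-sum constant kd, the right-hand side
    e (q;q)^N sum P(e n / d - (e^2 - 1) / 24) q^n.  The Eisenstein series E of the function
    Phi(m, n) = [d | m] chi_e(m) chi_d(n), summed over the whole lattice, has the divisor sums
    sigma_{k-1}(chi_e, chi_d; n) as Fourier coefficients, and its constant term at the cusp
    g(i oo), g = (a, b; c, d'), is [d | c] chi_e(-c) chi_d(a) times 2 L(k, chi_N).  This is
    also the limit of F|_k g, so (E / 2 L(k, chi_N) - F) / kd is a cusp form.  The value
    L(k, chi_N) is expressed through B_{k, chi_N} by letting tau tend to 0 in the Lipschitz
    formula twisted by chi_N and comparing with the recursion that the periodicity of chi_N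
    imposes on sum chi_N(t) t^j q^t.  The transformation law of h for prime N = p
    is found by following h and the p functions eta(z)^p / eta((z + 24 x) / p), x in F_p, under
    z -> z + 1 and z -> -1/z, and extends to N by multiplicativity. *)

(** * Unconditional summation in the complex numbers *)

(** The sign of eta is the first obstacle. Integrating the weight 2 Eisenstein series and inducting
    on words in S and T determine an explicit multiplier for eta^2 only, so each relation between
    values of eta carries an unknown sign. At prime level these signs are fixed all at once: the
    pentagonal series makes the sum of the eta((z + 24 x) / p) a multiple of eta(p z); transported
    by S and taken to i oo, this says that i^k times a sum of terms +w^x or -w^x, w = exp(2 pi i /
    p), is a known constant. Squaring shows that the sum is the Gauss sum up to sign, linear
    independence of the w^x makes each sign a Legendre symbol up to one global sign, and a relation
    in SL_2(Z) fixes that one. The value of the quadratic Gauss sum, hence epsilon in A(d, N), comes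
    out of the same computation. The second obstacle is convergence: N = 5 has weight 2, where
    lattice sums converge only conditionally and have to be taken by rows. The condition gcd(N, 6) =
    1 enters through e^2 = 1 modulo 24 and the invertibility of 24 modulo p. Cusps are never listed:
    limits at i oo are taken after an arbitrary g in SL_2(Z). N = 1 has weight 0 and is treated
    apart. *)

Arguments cexp : simpl never.
Arguments qvar : simpl never.

Section Modulus.
Variable R : realType.
Local Notation C := R[i].
Local Open Scope complex_scope.

(** The norm of R[i] takes its values in R[i]; a real-valued modulus keeps all estimates in an
    ordered field. *)
Definition nm (z : C) : R := Normc.normc z.
Arguments nm : simpl never.

Lemma nmE (z : C) : `|z| = (nm z)%:C.
Proof. by []. Qed.

Lemma nm_ge0 z : 0 <= nm z.
Proof. by rewrite -lecR -nmE normr_ge0. Qed.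

Lemma nm0 : nm 0 = 0. Proof. exact: Normc.normc0. Qed.
Lemma nm1 : nm 1 = 1. Proof. exact: Normc.normc1. Qed.
Lemma nmM z w : nm (z * w) = nm z * nm w. Proof. exact: Normc.normcM. Qed.
Lemma nmV z : nm z^-1 = (nm z)^-1. Proof. exact: Normc.normcV. Qed.
Lemma nmN z : nm (- z) = nm z. Proof. exact: normcN. Qed.
Lemma nmD z w : nm (z + w) <= nm z + nm w. Proof. exact: le_normcD. Qed.
Lemma nmB z w : nm (z - w) <= nm z + nm w.
Proof. by rewrite -(nmN w) nmD. Qed.
Lemma nm_subC z w : nm (z - w) = nm (w - z).
Proof. by rewrite -nmN opprB. Qed.
Lemma nmX z n : nm (z ^+ n) = nm z ^+ n.
Proof. by elim: n => [|n IH]; rewrite ?expr0 ?nm1 // !exprS nmM IH. Qed.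
Lemma nm_eq0 z : (nm z == 0) = (z == 0).
Proof. by apply/eqP/eqP => [/Normc.eq0_normc|->]; rewrite ?nm0. Qed.
Lemma nm_gt0 z : (0 < nm z) = (z != 0).
Proof. by rewrite lt_neqAle eq_sym nm_eq0 nm_ge0 andbT. Qed.
Lemma nm_real (x : R) : nm x%:C = `|x|.
Proof. by rewrite /nm /= expr0n /= addr0 sqrtr_sqr. Qed.
Lemma nm_nat n : nm n%:R = n%:R.
Proof. by rewrite -(rmorph_nat (real_complex R)) nm_real normr_nat. Qed.
Lemma nm_int (n : int) : nm n%:~R = `|n|%:~R.
Proof. by rewrite -(rmorph_int (real_complex R)) nm_real intr_norm. Qed.
Lemma nm_i : nm 'i = 1.
Proof. by rewrite /nm /= expr0n /= add0r expr1n sqrtr1. Qed.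

Lemma nm_sum (I : Type) (s : seq I) (P : pred I) (f : I -> C) :
  nm (\sum_(i <- s | P i) f i) <= \sum_(i <- s | P i) nm (f i).
Proof.
elim/big_rec2: _ => [|i x y _ H]; first by rewrite nm0.
by rewrite (le_trans (nmD _ _)) // lerD2l.
Qed.

Lemma nm_sub_ge z w : nm z - nm w <= nm (z - w).
Proof. by rewrite lerBlDr (le_trans _ (nmD _ _)) // subrK. Qed.

Lemma Re_le_nm z : `|complex.Re z| <= nm z.
Proof.
case: z => a b; rewrite /nm /= -sqrtr_sqr ler_sqrt ?addr_ge0 ?sqr_ge0 //.
by rewrite lerDl sqr_ge0.
Qed.

Lemma Im_le_nm z : `|complex.Im z| <= nm z.
Proof.
case: z => a b; rewrite /nm /= -sqrtr_sqr ler_sqrt ?addr_ge0 ?sqr_ge0 //.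
by rewrite lerDr sqr_ge0.
Qed.

Lemma nm_le_ReIm z : nm z <= `|complex.Re z| + `|complex.Im z|.
Proof.
rewrite {1}(complexE z) (le_trans (nmD _ _)) // nmM nm_i mul1r !nm_real.
by [].
Qed.

Lemma nm_sqr z : nm z ^+ 2 = complex.Re z ^+ 2 + complex.Im z ^+ 2.
Proof. by case: z => a b; rewrite /nm /= sqr_sqrtr // addr_ge0 ?sqr_ge0. Qed.

Lemma nm_eq (z w : C) : (forall e : R, 0 < e -> nm (z - w) < e) -> z = w.
Proof.
move=> H; apply/eqP; rewrite -subr_eq0 -nm_eq0 eq_le nm_ge0 andbT.
by apply/ler_addgt0Pr => e e0; rewrite add0r ltW // H.
Qed.

End Modulus.

Arguments nm {R} : simpl never.

(** * Limits along a filter *)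

Section CLim.
Variable R : realType.
Local Notation C := R[i].
Variables (T : Type) (F : set_system T).
Hypothesis FF : ProperFilter F.

(** The filter is arbitrary: the same lemmas serve sequences, z tending to i oo, and s tending to 0
    from the right. *)
Definition clim (u : T -> C) (l : C) :=
  forall e : R, 0 < e -> \forall x \near F, nm (u x - l) < e.

Lemma clim_unique u l l' : clim u l -> clim u l' -> l = l'.
Proof.
move=> H H'; apply: nm_eq => e e0.
have e2 : 0 < e / 2 by rewrite divr_gt0.
have [x [h1 h2]] := filter_ex (filterI (H _ e2) (H' _ e2)).
have -> : l - l' = (u x - l') - (u x - l) by ring.
by rewrite (le_lt_trans (nmB _ _)) // (splitr e) ltrD.
Qed.

Lemma eq_near_clim u v l : (\forall x \near F, u x = v x) -> clim u l -> clim v l.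
Proof. by move=> H K e e0; apply: filterS2 H (K _ e0) => x ->. Qed.

Lemma clim_cst l : clim (fun=> l) l.
Proof. by move=> e e0; apply: nearW => x; rewrite subrr nm0. Qed.

Lemma climD u v l m : clim u l -> clim v m -> clim (fun x => u x + v x) (l + m).
Proof.
move=> H K e e0; have e2 : 0 < e / 2 by rewrite divr_gt0.
apply: filterS2 (H _ e2) (K _ e2) => x h k.
have -> : u x + v x - (l + m) = (u x - l) + (v x - m) by ring.
by rewrite (le_lt_trans (nmD _ _)) // (splitr e) ltrD.
Qed.

Lemma climN u l : clim u l -> clim (fun x => - u x) (- l).
Proof. by move=> H e /H; apply: filterS => x; rewrite -opprD nmN. Qed.

Lemma climB u v l m : clim u l -> clim v m -> clim (fun x => u x - v x) (l - m).
Proof. by move=> H K; apply: climD => //; apply: climN. Qed.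

Lemma clim_bounded u l : clim u l -> \forall x \near F, nm (u x) < nm l + 1.
Proof.
move=> /(_ 1 ltr01); apply: filterS => x h.
by rewrite -ltrBlDl (le_lt_trans _ h) // nm_sub_ge.
Qed.

Lemma climM u v l m : clim u l -> clim v m -> clim (fun x => u x * v x) (l * m).
Proof.
move=> H K e e0.
pose M := nm l + nm m + 1.
have M0 : 0 < M by rewrite /M ltr_wpDl // addr_ge0 ?nm_ge0.
have e2 : 0 < e / 2 / M by rewrite !divr_gt0.
apply: filterS3 (H _ e2) (K _ e2) (clim_bounded K) => x h k b.
have -> : u x * v x - l * m = (u x - l) * v x + l * (v x - m) by ring.
rewrite (le_lt_trans (nmD _ _)) // !nmM.
have h1 : nm (u x - l) * nm (v x) <= e / 2 / M * nm (v x).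
  by rewrite ler_wpM2r ?nm_ge0 // ltW.
have h2 : nm l * nm (v x - m) <= nm l * (e / 2 / M).
  by rewrite ler_wpM2l ?nm_ge0 // ltW.
apply: le_lt_trans (lerD h1 h2) _; rewrite mulrC -mulrDl.
have h3 : nm (v x) + nm l < 2 * M.
  by rewrite /M; move: b (nm_ge0 l) (nm_ge0 m) => *; lra.
apply: (@lt_le_trans _ _ (2 * M * (e / 2 / M))); first by rewrite ltr_pM2r.
by rewrite le_eqVlt; apply/orP; left; apply/eqP; field; rewrite gt_eqF.
Qed.

Lemma climX u l n : clim u l -> clim (fun x => u x ^+ n) (l ^+ n).
Proof.
move=> H; elim: n => [|n IH].
  by under eq_fun do rewrite expr0; rewrite expr0; exact: clim_cst.
by under eq_fun do rewrite exprS; rewrite exprS; exact: climM.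
Qed.

Lemma climV u l : l != 0 -> clim u l -> clim (fun x => (u x)^-1) l^-1.
Proof.
move=> l0 H e e0; have nl : 0 < nm l by rewrite nm_gt0.
have d1 : 0 < nm l / 2 by rewrite divr_gt0.
have d2 : 0 < e * nm l ^+ 2 / 2 by rewrite divr_gt0 // mulr_gt0 // exprn_gt0.
apply: filterS2 (H _ d1) (H _ d2) => x h k.
have hu : nm l / 2 < nm (u x).
  have := nm_sub_ge l (u x); rewrite nm_subC => h'; lra.
have u0 : u x != 0 by rewrite -nm_gt0 (lt_trans d1).
have -> : (u x)^-1 - l^-1 = (l - u x) * ((u x)^-1 * l^-1) by field; rewrite l0 u0.
rewrite nmM nmM !nmV nm_subC -invfM ltr_pdivrMr; last by rewrite mulr_gt0 // nm_gt0.
apply: (lt_le_trans k); rewrite expr2 mulrA -mulrA -mulrA ler_pM2l // mulrC ler_wpM2r ?ltW //.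
Qed.

Lemma clim_sum (I : Type) (s : seq I) (P : pred I) (u : I -> T -> C) l :
  (forall i, P i -> clim (u i) (l i)) ->
  clim (fun x => \sum_(i <- s | P i) u i x) (\sum_(i <- s | P i) l i).
Proof.
move=> H; elim: s => [|i s IH].
  by under eq_fun do rewrite big_nil; rewrite big_nil; exact: clim_cst.
under eq_fun do rewrite big_cons; rewrite big_cons.
by case: ifPn => // /H Hi; apply: climD.
Qed.

Lemma clim_squeeze u l (g : T -> R) :
  (\forall x \near F, nm (u x - l) <= g x) ->
  (forall e : R, 0 < e -> \forall x \near F, g x < e) -> clim u l.
Proof. by move=> H K e /K; apply: filterS2 H => x; apply: le_lt_trans. Qed.

Lemma clim_nm_le u l (M : R) :
  clim u l -> (\forall x \near F, nm (u x) <= M) -> nm l <= M.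
Proof.
move=> H K; apply/ler_addgt0Pr => e e0.
have [x [h k]] := filter_ex (filterI (H _ e0) K).
have := nm_sub_ge l (u x); rewrite nm_subC => h'; lra.
Qed.

End CLim.

(** * Unconditional sums over an arbitrary index set *)

Section HasSum.
Variable R : realType.
Local Notation C := R[i].
Implicit Type I J : eqType.

(** For a nonnegative family this is summability, with duplicate-free lists standing for finite
    sets. *)
Definition bsum I (g : I -> R) :=
  exists M : R, forall B : seq I, uniq B -> \sum_(i <- B) g i <= M.

(** Convergence along the net of finite subsets: the index set carries no order, so reindexing and
    regrouping are formal. *)
Definition has_sum I (f : I -> C) (l : C) :=
  forall e : R, 0 < e -> exists A : seq I, forall B : seq I,
    uniq B -> {subset A <= B} -> nm (\sum_(i <- B) f i - l) < e.

Lemma uniq_undup_cat I (A B : seq I) : exists D : seq I,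
  [/\ uniq D, {subset A <= D} & {subset B <= D}].
Proof.
exists (undup (A ++ B)); split; first exact: undup_uniq.
  by move=> x xA; rewrite mem_undup mem_cat xA.
by move=> x xA; rewrite mem_undup mem_cat xA orbT.
Qed.

Lemma has_sum_unique I (f : I -> C) l l' : has_sum f l -> has_sum f l' -> l = l'.
Proof.
move=> H H'; apply: nm_eq => e e0; have e2 : 0 < e / 2 by rewrite divr_gt0.
have [A HA] := H _ e2; have [B HB] := H' _ e2.
have [D [uD AD BD]] := uniq_undup_cat A B.
have -> : l - l' = (\sum_(i <- D) f i - l') - (\sum_(i <- D) f i - l) by ring.
by rewrite (le_lt_trans (nmB _ _)) // (splitr e) ltrD // ?HA ?HB.
Qed.

Lemma eq_has_sum I (f g : I -> C) l : f =1 g -> has_sum f l -> has_sum g l.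
Proof. by move=> /funext ->. Qed.

Lemma has_sum0 I (f : I -> C) : (forall i, f i = 0) -> has_sum f 0.
Proof. by move=> H e e0; exists [::] => B _ _; rewrite big1 ?subrr ?nm0. Qed.

Lemma has_sumD I (f g : I -> C) l m :
  has_sum f l -> has_sum g m -> has_sum (fun i => f i + g i) (l + m).
Proof.
move=> H K e e0; have e2 : 0 < e / 2 by rewrite divr_gt0.
have [A HA] := H _ e2; have [B HB] := K _ e2.
exists (A ++ B) => D uD ABD; rewrite big_split /=.
have -> : \sum_(i <- D) f i + \sum_(i <- D) g i - (l + m) =
  (\sum_(i <- D) f i - l) + (\sum_(i <- D) g i - m) by ring.
rewrite (le_lt_trans (nmD _ _)) // (splitr e) ltrD ?HA ?HB // => x xA;
by rewrite ABD // mem_cat xA ?orbT.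
Qed.

Lemma has_sumZ I (f : I -> C) l c : has_sum f l -> has_sum (fun i => c * f i) (c * l).
Proof.
move=> H e e0; have c0 : 0 < nm c + 1 by rewrite ltr_wpDl ?nm_ge0.
have [A HA] := H _ (divr_gt0 e0 c0).
exists A => B uB AB; rewrite -mulr_sumr -mulrBr nmM.
have := HA B uB AB; rewrite ltr_pdivlMr // => h.
rewrite (le_lt_trans _ h) // mulrC ler_wpM2l ?nm_ge0 //; lra.
Qed.

Lemma has_sumMr I (f : I -> C) l c : has_sum f l -> has_sum (fun i => f i * c) (l * c).
Proof. by move=> /(has_sumZ c); rewrite mulrC; apply: eq_has_sum => i; rewrite mulrC. Qed.

Lemma has_sumN I (f : I -> C) l : has_sum f l -> has_sum (fun i => - f i) (- l).
Proof. by move=> /(has_sumZ (-1)); rewrite mulN1r; apply: eq_has_sum => i; rewrite mulN1r. Qed.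

Lemma has_sumB I (f g : I -> C) l m :
  has_sum f l -> has_sum g m -> has_sum (fun i => f i - g i) (l - m).
Proof. by move=> H K; apply: has_sumD => //; apply: has_sumN. Qed.

Lemma has_sum_sum I (K : Type) (s : seq K) (P : pred K) (f : K -> I -> C) l :
  (forall j, P j -> has_sum (f j) (l j)) ->
  has_sum (fun i => \sum_(j <- s | P j) f j i) (\sum_(j <- s | P j) l j).
Proof.
move=> H; elim: s => [|j s IH].
  by rewrite big_nil; apply: has_sum0 => i; rewrite big_nil.
rewrite big_cons; case: ifPn => Pj.
  apply: eq_has_sum (has_sumD (H _ Pj) IH) => i; by rewrite big_cons Pj.
by apply: eq_has_sum IH => i; rewrite big_cons (negPf Pj).
Qed.

Lemma has_sum_fin I (f : I -> C) (A : seq I) :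
  uniq A -> (forall i, i \notin A -> f i = 0) -> has_sum f (\sum_(i <- A) f i).
Proof.
move=> uA H e e0; exists A => B uB AB.
suff -> : \sum_(i <- B) f i = \sum_(i <- A) f i by rewrite subrr nm0.
rewrite (bigID (mem A)) /= [X in _ + X]big1 ?addr0; last by move=> i /H.
rewrite -big_filter; apply/perm_big/uniq_perm => //; first exact: filter_uniq.
by move=> i; rewrite mem_filter; apply/andP/idP => [[]//|iA]; split=> //; apply: AB.
Qed.

Lemma has_sum1 I (f : I -> C) (i0 : I) :
  (forall i, i != i0 -> f i = 0) -> has_sum f (f i0).
Proof.
move=> H; have <- : \sum_(i <- [:: i0]) f i = f i0 by rewrite big_seq1.
by apply: has_sum_fin => // i; rewrite inE => /H.
Qed.

Lemma has_sum_reindex I J (f : I -> C) l (h : J -> I) (k : I -> J) :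
  cancel h k -> cancel k h -> has_sum f l -> has_sum (fun j => f (h j)) l.
Proof.
move=> hk kh H e /H[A HA]; exists (map k A) => B uB AB.
rewrite -(big_map h xpredT f); apply: HA; first by rewrite map_inj_uniq //; exact: can_inj hk.
by move=> i iA; rewrite -(kh i); apply: map_f; apply: AB; apply: map_f.
Qed.

Lemma le_bsum I (f g : I -> R) : (forall i, f i <= g i) -> bsum g -> bsum f.
Proof. by move=> H [M HM]; exists M => B /HM; apply: le_trans; apply: ler_sum. Qed.

Lemma bsumD I (f g : I -> R) : bsum f -> bsum g -> bsum (fun i => f i + g i).
Proof.
move=> [M HM] [M' HM']; exists (M + M') => B uB.
by rewrite big_split lerD ?HM ?HM'.
Qed.

Lemma bsumZ I (f : I -> R) c : 0 <= c -> bsum f -> bsum (fun i => c * f i).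
Proof. by move=> c0 [M HM]; exists (c * M) => B uB; rewrite -mulr_sumr ler_wpM2l ?HM. Qed.

Lemma bsum_inj I J (g : I -> R) (h : J -> I) : injective h -> bsum g -> bsum (fun j => g (h j)).
Proof.
move=> hi [M HM]; exists M => B uB.
by rewrite -(big_map h xpredT g); apply: HM; rewrite map_inj_uniq.
Qed.

Lemma sub_sum_le I (g : I -> R) (A B : seq I) : (forall i, 0 <= g i) ->
  uniq A -> {subset A <= B} -> \sum_(i <- A) g i <= \sum_(i <- B) g i.
Proof.
move=> g0 uA AB.
have -> : \sum_(i <- A) g i = \sum_(i <- undup B | i \in A) g i.
  rewrite -[RHS]big_filter; apply/perm_big/uniq_perm => //; first by rewrite filter_uniq ?undup_uniq.
  move=> i; rewrite mem_filter mem_undup; apply/idP/andP => [iA|[]//].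
  by split=> //; exact: AB.
apply: (@le_trans _ _ (\sum_(i <- undup B) g i)).
  by rewrite [leRHS](bigID (mem A)) /= lerDl sumr_ge0.
elim: B {AB} => [|x B IH]; first by [].
rewrite /= big_cons; case: ifP => _; first by rewrite (le_trans IH) // lerDr.
by rewrite big_cons lerD2l.
Qed.

(** A finite set whose sum is within e of the supremum of all finite sums leaves less than e
    outside. *)
Lemma bsum_tail I (g : I -> R) : (forall i, 0 <= g i) -> bsum g ->
  forall e : R, 0 < e -> exists2 A : seq I, uniq A & forall B : seq I, uniq B ->
    {in B, forall i, i \notin A} -> \sum_(i <- B) g i < e.
Proof.
move=> g0 [M HM] e e0.
pose S := [set x | exists2 A : seq I, uniq A & x = \sum_(i <- A) g i]%classic.
have hS : has_sup S.
  split; first by exists 0; exists [::] => //; rewrite big_nil.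
  by exists M => _ [A uA ->]; exact: HM.
have [_ [A uA ->] HA] := sup_adherent e0 hS.
exists A => // B uB BA.
have uAB : uniq (A ++ B).
  rewrite cat_uniq uA uB andbT /=; apply/hasPn => x /BA; exact.
have : \sum_(i <- A ++ B) g i <= sup S by apply: sup_upper_bound => //; exists (A ++ B).
by rewrite big_cat /= => h; lra.
Qed.

Lemma bsum_sup I (g : I -> R) : (forall i, 0 <= g i) -> bsum g ->
  exists l : R, forall e : R, 0 < e -> exists A : seq I, forall B, uniq B ->
    {subset A <= B} -> `|\sum_(i <- B) g i - l| < e.
Proof.
move=> g0 [M HM].
pose S := [set x | exists2 A : seq I, uniq A & x = \sum_(i <- A) g i]%classic.
have hS : has_sup S.
  split; first by exists 0; exists [::] => //; rewrite big_nil.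
  by exists M => _ [A uA ->]; exact: HM.
exists (sup S) => e e0.
have [_ [A uA ->] HA] := sup_adherent e0 hS.
exists A => B uB AB.
have h1 : \sum_(i <- B) g i <= sup S by apply: sup_upper_bound => //; exists B.
have h2 := sub_sum_le g0 uA AB.
by rewrite ler0_norm; lra.
Qed.

Definition asum I (f : I -> C) := bsum (fun i => nm (f i)).

Lemma real_has_sum I (f : I -> R) : bsum (fun i => `|f i|) ->
  exists l : R, has_sum (fun i => real_complex R (f i)) (real_complex R l).
Proof.
move=> Hf.
have pos (g : I -> R) : (forall i, 0 <= g i) -> (forall i, g i <= `|f i|) ->
    exists l : R, has_sum (fun i => real_complex R (g i)) (real_complex R l).
  move=> g0 gf; have [l Hl] := bsum_sup g0 (le_bsum gf Hf).
  exists l => e /Hl[A HA]; exists A => B uB AB.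
  by rewrite -(rmorph_sum (real_complex R)) -(rmorphB (real_complex R)) nm_real; apply: HA.
have [l1 H1] := pos (fun i => (`|f i| + f i) / 2)
  ltac:(move=> i; have := ler_norm (- f i); rewrite normrN; lra)
  ltac:(move=> i; have := ler_norm (f i); lra).
have [l2 H2] := pos (fun i => (`|f i| - f i) / 2)
  ltac:(move=> i; have := ler_norm (f i); lra)
  ltac:(move=> i; have := ler_norm (- f i); rewrite normrN; lra).
exists (l1 - l2); rewrite rmorphB; apply: eq_has_sum (has_sumB H1 H2) => i.
by rewrite -rmorphB; congr (real_complex R _); field.
Qed.

Lemma asum_has_sum I (f : I -> C) : asum f -> exists l, has_sum f l.
Proof.
move=> Hf.
have [a Ha] := @real_has_sum I (fun i => complex.Re (f i)) (le_bsum (fun i => Re_le_nm _) Hf).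
have [b Hb] := @real_has_sum I (fun i => complex.Im (f i)) (le_bsum (fun i => Im_le_nm _) Hf).
exists (real_complex R a + 'i%C * real_complex R b).
by apply: eq_has_sum (has_sumD Ha (has_sumZ 'i%C Hb)) => i; rewrite -complexE.
Qed.

Lemma has_sum_nm_le I (f : I -> C) (g : I -> R) l M :
  has_sum f l -> (forall i, nm (f i) <= g i) ->
  (forall B, uniq B -> \sum_(i <- B) g i <= M) -> nm l <= M.
Proof.
move=> H fg HM; apply/ler_addgt0Pr => e /H[A HA].
have [D [uD AD _]] := uniq_undup_cat A A.
have h := HA _ uD AD.
have h2 : nm (\sum_(i <- D) f i) <= M.
  apply: le_trans (nm_sum _ _ _) _; apply: le_trans (HM _ uD); exact: ler_sum.
have := nm_sub_ge l (\sum_(i <- D) f i); rewrite nm_subC => h'; lra.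
Qed.

(** Given finitely many rows, each row sum is approximated within an equal share of e / 2 by a
    finite piece of the row; the union of the pieces contains the set beyond which the total is
    within e / 2. *)
Lemma has_sum_pair I J (f : I * J -> C) (S : I -> C) l :
  has_sum f l -> (forall i, has_sum (fun j => f (i, j)) (S i)) -> has_sum S l.
Proof.
move=> H HS e e0; have e2 : 0 < e / 2 by rewrite divr_gt0.
have [A HA] := H _ e2.
exists (map fst A) => B uB AB.
have nB : 0 < e / 2 / (size B).+1%:R by rewrite divr_gt0.
have /all_sig[D HD] (i : I) : { D : seq J | [/\ uniq D,
    (forall j, (i, j) \in A -> j \in D) &
    nm (\sum_(j <- D) f (i, j) - S i) < e / 2 / (size B).+1%:R] }.
  apply: cid; have [D HD] := HS i _ nB.
  exists (undup (D ++ map snd A)); split; first exact: undup_uniq.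
    by move=> j jA; rewrite mem_undup mem_cat (map_f snd jA) orbT.
  by apply: HD (undup_uniq _) _ => j jD; rewrite mem_undup mem_cat jD.
pose E := [seq (i, j) | i <- B, j <- D i].
have uE : uniq E.
  apply: allpairs_uniq_dep => // [i _|[i j] [i' j'] _ _ [-> ->]] //.
  by have [] := HD i.
have AE : {subset A <= E}.
  move=> [i j] ijA; apply/allpairsPdep; exists i, j; split=> //.
    by apply: AB; exact: (map_f fst ijA).
  by have [_ h _] := HD i; exact: h.
have h1 := HA E uE AE; rewrite /E big_allpairs_dep /= in h1.
have -> : \sum_(i <- B) S i - l = (\sum_(i <- B) \sum_(j <- D i) f (i, j) - l)
   - \sum_(i <- B) (\sum_(j <- D i) f (i, j) - S i).
  by rewrite sumrB; ring.
rewrite (le_lt_trans (nmB _ _)) // (splitr e) ltr_leD //.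
rewrite (le_trans (nm_sum _ _ _)) //.
apply: (@le_trans _ _ (\sum_(i <- B) e / 2 / (size B).+1%:R)).
  by apply: ler_sum => i _; have [_ _ /ltW] := HD i.
rewrite big_const_seq count_predT iter_addr_0 -[X in X <= _]mulr_natr mulrAC.
by rewrite ler_pdivrMr // ler_wpM2l // ?ltW // ltr_nat.
Qed.

Lemma asum_has_sum_pair I J (f : I * J -> C) (S : I -> C) :
  asum f -> (forall i, has_sum (fun j => f (i, j)) (S i)) ->
  exists2 l, has_sum f l & has_sum S l.
Proof. by move=> /asum_has_sum[l Hl] HS; exists l => //; exact: has_sum_pair HS. Qed.

Lemma asum_row I J (f : I * J -> C) i : asum f -> asum (fun j => f (i, j)).
Proof. by move=> h; apply: (@bsum_inj _ _ _ (fun j => (i, j))) h => j j' []. Qed.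

Lemma has_sum_swap I J (f : I -> J -> C) (S : I -> C) (T : J -> C) l :
  asum (fun x : I * J => f x.1 x.2) ->
  (forall i, has_sum (f i) (S i)) -> (forall j, has_sum (f^~ j) (T j)) ->
  has_sum S l -> has_sum T l.
Proof.
move=> af HS HT Sl.
have [l1 h1 h1'] := @asum_has_sum_pair _ _ (fun x => f x.1 x.2) _ af HS.
rewrite (has_sum_unique Sl h1').
apply: (@has_sum_pair _ _ (fun x : J * I => f x.2 x.1)) HT.
by apply: (@has_sum_reindex _ _ _ _ (fun x => (x.2, x.1)) (fun x => (x.2, x.1)) _ _ h1);
  case.
Qed.

Lemma bsum_pair I J (g : I * J -> R) (G : I -> R) :
  (forall i j, 0 <= g (i, j)) ->
  (forall i B, uniq B -> \sum_(j <- B) g (i, j) <= G i) -> bsum G -> bsum g.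
Proof.
move=> g0 HG [M HM]; exists M => B uB.
pose B1 := undup (map fst B); pose B2 := undup (map snd B).
have uE : uniq [seq (i, j) | i <- B1, j <- B2].
  by apply: allpairs_uniq; rewrite ?undup_uniq // => -[i j] [i' j'] _ _.
apply: (@le_trans _ _ (\sum_(x <- [seq (i, j) | i <- B1, j <- B2]) g x)).
  apply: sub_sum_le => // [[i j]|] //; move=> [i j] ijB; apply/allpairsP.
  by exists (i, j); rewrite !mem_undup (map_f fst ijB) (map_f snd ijB).
rewrite big_allpairs /=; apply: le_trans (HM _ (undup_uniq _)).
by apply: ler_sum => i _; apply: HG; exact: undup_uniq.
Qed.

Lemma bsum_prod I J (f : I -> R) (g : J -> R) :
  (forall i, 0 <= f i) -> (forall j, 0 <= g j) -> bsum f -> bsum g ->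
  bsum (fun x : I * J => f x.1 * g x.2).
Proof.
move=> f0 g0 bf [M HM]; apply: (@bsum_pair _ _ _ (fun i => M * f i)) => /=.
- by move=> i j; rewrite mulr_ge0.
- by move=> i B uB; rewrite -mulr_sumr mulrC ler_wpM2r ?HM.
apply: bsumZ bf; have := HM [::] isT; by rewrite big_nil.
Qed.

(** Dominated convergence for sums. Off a finite set where the majorant has tail below e / 4, both
    [u x] and [f] contribute at most e / 4; on that set the convergence is termwise. *)
Lemma tannery (T : Type) (F : set_system T) (FF : ProperFilter F) I
    (u : T -> I -> C) (f : I -> C) (g : I -> R) (L : T -> C) l :
  bsum g -> (\forall x \near F, forall i, nm (u x i) <= g i) ->
  (forall i, clim F (fun x => u x i) (f i)) ->
  (\forall x \near F, has_sum (u x) (L x)) -> has_sum f l -> clim F L l.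
Proof.
move=> bg ug uf hu hf e e0.
have fg i : nm (f i) <= g i.
  by apply: clim_nm_le (uf i) _; apply: filterS ug => x; exact.
have g0 i : 0 <= g i by apply: le_trans (fg i); exact: nm_ge0.
have e4 : 0 < e / 4 by rewrite divr_gt0.
have [A uA HA] := bsum_tail g0 bg e4.
have tail (h : I -> C) m : (forall i, nm (h i) <= g i) -> has_sum h m ->
    nm (m - \sum_(i <- A) h i) <= e / 4.
  move=> hg hm; apply/ler_addgt0Pr => e' /hm[B HB].
  pose D := undup (A ++ B).
  have uD : uniq D := undup_uniq _.
  have AD : {subset A <= D} by move=> x xA; rewrite mem_undup mem_cat xA.
  have BD : {subset B <= D} by move=> x xA; rewrite mem_undup mem_cat xA orbT.
  have hD := HB _ uD BD.
  have e1 : \sum_(i <- D) h i = \sum_(i <- A) h i + \sum_(i <- D | i \notin A) h i.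
    rewrite (bigID (mem A)) /=; congr (_ + _); rewrite -big_filter.
    apply/perm_big/uniq_perm; rewrite ?filter_uniq // => i; rewrite mem_filter.
    by apply/andP/idP => [[]//|iA]; split=> //; exact: AD.
  have h2 : nm (\sum_(i <- D | i \notin A) h i) < e / 4.
    rewrite -big_filter (le_lt_trans (nm_sum _ _ _)) //.
    apply: le_lt_trans (HA [seq i <- D | i \notin A] _ _).
    - by apply: ler_sum => i _.
    - by rewrite filter_uniq.
    - by move=> i; rewrite mem_filter => /andP[].
  have -> : m - \sum_(i <- A) h i = \sum_(i <- D | i \notin A) h i - (\sum_(i <- D) h i - m).
    by rewrite e1; ring.
  by rewrite (le_trans (nmB _ _)) // lerD // ltW.
have hA : \forall x \near F, nm (\sum_(i <- A) u x i - \sum_(i <- A) f i) < e / 4.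
  by apply: (clim_sum FF) => // i _; exact: uf.
apply: filterS3 ug hu hA => x hx1 hx2 hx3.
have -> : L x - l = (L x - \sum_(i <- A) u x i) + (\sum_(i <- A) u x i - \sum_(i <- A) f i)
   - (l - \sum_(i <- A) f i) by ring.
have := tail _ _ hx1 hx2; have := tail _ _ fg hf => t1 t2.
rewrite (le_lt_trans (nmB _ _)) //.
have := nmD (L x - \sum_(i <- A) u x i) (\sum_(i <- A) u x i - \sum_(i <- A) f i).
lra.
Qed.

End HasSum.

Section TotalSum.
Variable R : realType.
Local Notation C := R[i].

(** A total function, 0 when there is no sum, so that series can be named before their convergence
    is known. *)
Definition tsum (I : eqType) (f : I -> C) : C := xget 0 [set l | has_sum f l]%classic.

Lemma tsumE (I : eqType) (f : I -> C) l : has_sum f l -> tsum f = l.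
Proof.
move=> H; rewrite /tsum; case: xgetP => [y _ /= Hy|/(_ l)/(_ H)//].
exact: has_sum_unique Hy H.
Qed.

Lemma tsumP (I : eqType) (f : I -> C) : asum f -> has_sum f (tsum f).
Proof. by move=> /asum_has_sum[l Hl]; rewrite (tsumE Hl). Qed.

Lemma eq_tsum (I : eqType) (f g : I -> C) : f =1 g -> tsum f = tsum g.
Proof. by move=> /funext ->. Qed.

End TotalSum.

(** * Sums over natural numbers and integers *)

Section IndexSums.
Variable R : realType.
Local Notation C := R[i].

Lemma bsum_nat (g : nat -> R) M : (forall i, 0 <= g i) ->
  (forall n, \sum_(i < n) g i <= M) -> bsum g.
Proof.
move=> g0 HM; exists M => B uB.
apply: le_trans (HM (\max_(i <- B) i).+1).
rewrite -(big_mkord xpredT g); apply: sub_sum_le => // i iB.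
by rewrite mem_index_iota ltnS /=; apply: (leq_bigmax_seq (F := id)).
Qed.

Lemma bsum_int (g : int -> R) (h : nat -> R) : (forall n, 0 <= h n) ->
  (forall n : int, g n <= h `|n|%N) -> bsum h -> bsum g.
Proof.
move=> h0 gh [M HM]; exists (M + M) => B uB.
apply: le_trans (ler_sum _ (fun n _ => gh n)) _.
rewrite (bigID (fun n : int => 0 <= n)) /=.
have aux (P : pred int) : {in P &, injective absz} -> \sum_(i <- B | P i) h `|i|%N <= M.
  move=> inj; rewrite -big_filter -(big_map absz xpredT h); apply: HM.
  rewrite map_inj_in_uniq ?filter_uniq // => x y.
  by rewrite !mem_filter => /andP[xP _] /andP[yP _]; apply: inj.
apply: lerD; apply: aux => x y; rewrite /in_mem /= => hx hy; lia.
Qed.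

(** The exponent 3/2 is summable, and the product of two such weights dominates the inverse cube of
    m + n + 1; this reduces absolute convergence over pairs of integers to a product of simple
    sums. *)
Definition w32 (n : nat) : R := (n.+1%:R * Num.sqrt n.+1%:R)^-1.

Lemma w32_gt0 n : 0 < w32 n.
Proof. by rewrite invr_gt0 mulr_gt0 // sqrtr_gt0. Qed.

(** Comparison with the telescoping differences 2 / sqrt(n) - 2 / sqrt(n + 1). *)
Lemma w32_bsum : bsum w32.
Proof.
apply: (@bsum_nat _ 3) => [i|[|n]]; first exact/ltW/w32_gt0.
  by rewrite big_ord0.
suff : \sum_(i < n.+1) w32 i <= 3 - 2 * (Num.sqrt n.+1%:R)^-1.
  move=> h; apply: le_trans h _; rewrite lerBlDr lerDl mulr_ge0 // invr_ge0 sqrtr_ge0 //.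
elim: n => [|n IH]; first by rewrite big_ord1 /w32 sqrtr1 mulr1 invr1; lra.
rewrite big_ord_recr /=; apply: le_trans (lerD IH (lexx _)) _.
rewrite /w32; set a := Num.sqrt n.+1%:R; set b := Num.sqrt n.+2%:R.
have a0 : 0 < a by rewrite sqrtr_gt0.
have b0 : 0 < b by rewrite sqrtr_gt0.
have b2 : n.+2%:R = b ^+ 2 by rewrite sqr_sqrtr.
have a2 : a ^+ 2 = b ^+ 2 - 1 by rewrite -b2 sqr_sqrtr // -[n.+2%:R]natr1 addrK.
have ab : a <= b by rewrite ler_sqrt // ler_nat.
have hh : a <= 2 * b ^+ 2 * (b - a).
  have ba : (b - a) * (b + a) = 1 by rewrite -subr_sqr a2; ring.
  have s0 : 0 < b + a by rewrite addr_gt0.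
  rewrite -(ler_pM2r s0) -[leRHS]mulrA ba; nra.
rewrite b2.
suff : (b ^+ 2 * b)^-1 <= 2 * a^-1 - 2 * b^-1 by lra.
rewrite -subr_ge0.
have -> : 2 * a^-1 - 2 * b^-1 - (b ^+ 2 * b)^-1 = (2 * b ^+ 2 * (b - a) - a) / (b ^+ 3 * a).
  by field; rewrite !gt_eqF.
by rewrite divr_ge0 ?subr_ge0 // mulr_ge0 ?exprn_ge0 // ltW.
Qed.

Lemma w32_sqr n : (n.+1%:R ^+ 2)^-1 <= w32 n.
Proof.
have s1 : 1 <= Num.sqrt n.+1%:R :> R by rewrite -[X in X <= _]sqrtr1 ler_sqrt // ler1n.
rewrite /w32 lef_pV2 ?posrE ?exprn_gt0 ?mulr_gt0 ?sqrtr_gt0 // expr2 ler_pM2l //.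
by rewrite -[leRHS](sqr_sqrtr (ler0n _ _)) expr2 ler_peMl // (le_trans ler01).
Qed.

(** With s = m + n + 1, s^3 is the square of s sqrt(s), and each of the two factors dominates the
    one built on m + 1 or on n + 1. *)
Lemma w32_cube m n :
  ((m%:R + n%:R + 1) ^+ 3)^-1 <= w32 m * w32 n.
Proof.
rewrite /w32 -invfM lef_pV2 ?posrE ?exprn_gt0 ?mulr_gt0 ?sqrtr_gt0 ?ltr_wpDl //.
set s : R := _ + 1.
have sE : s = (m + n).+1%:R by rewrite /s -natrD natr1.
have s0 : 0 <= s by rewrite sE.
have bd k : (k <= m + n)%N -> k.+1%:R <= s /\ Num.sqrt k.+1%:R <= Num.sqrt s.
  move=> h; have h1 : k.+1%:R <= s by rewrite sE ler_nat ltnS.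
  by rewrite ler_sqrt.
have [h1 h2] := bd m (leq_addr _ _); have [h3 h4] := bd n (leq_addl _ _).
have -> : s ^+ 3 = (s * Num.sqrt s) * (s * Num.sqrt s).
  by rewrite mulrACA -[Num.sqrt s * _]expr2 sqr_sqrtr // -expr2 -exprSr.
by rewrite ler_pM ?mulr_ge0 ?sqrtr_ge0 // ler_pM ?sqrtr_ge0.
Qed.

Lemma has_sum_clim (u : nat -> C) l : has_sum u l -> clim \oo%classic (fun n => \sum_(i < n) u i) l.
Proof.
move=> H e /H[A HA]; exists (\max_(i <- A) i).+1 => // n /= An.
rewrite -(big_mkord xpredT u); apply: HA; first exact: iota_uniq.
move=> i iA; rewrite mem_index_iota /=; apply: leq_trans An.
by rewrite ltnS; apply: (leq_bigmax_seq (F := id)).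
Qed.

Lemma clim_cvg (u : nat -> C) l : clim \oo%classic u l -> (u n @[n --> \oo] --> l)%classic.
Proof.
move=> H; apply/cvgrPdist_lt => e e0.
have e1 : e = real_complex R (nm e) by rewrite -nmE gtr0_norm.
have : 0 < nm e by rewrite nm_gt0 gt_eqF.
by move=> /H; apply: filterS => n; rewrite nm_subC nmE e1 ltcR -e1.
Qed.

Lemma has_sum_series (u : nat -> C) l : has_sum u l -> \big[+%R/0]_(0 <= n <oo) u n = l.
Proof.
move=> /has_sum_clim H; apply: cvg_lim => //; apply: clim_cvg.
by under eq_fun do rewrite big_mkord.
Qed.

Lemma has_sum_succ (u : nat -> C) l :
  has_sum (fun n => u n.+1) l -> has_sum u (u 0%N + l).
Proof.
move=> H e /H[A HA]; exists (0%N :: map succn A) => B uB AB.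
have B0 : 0%N \in B by apply: AB; rewrite inE.
rewrite (big_rem _ B0) /= opprD addrACA subrr add0r.
have e1 : rem 0%N B = map succn (map predn (rem 0%N B)).
  rewrite -map_comp -[LHS]map_id; apply/eq_in_map => -[|x] //=.
  by rewrite mem_rem_uniq // inE eqxx.
rewrite e1 big_map; apply: HA.
  rewrite map_inj_in_uniq ?rem_uniq // => -[|x] [|y] //=; try by rewrite mem_rem_uniq // inE eqxx.
    by move=> _; rewrite mem_rem_uniq // inE eqxx.
  by move=> _ _ ->.
move=> x xA; apply/mapP; exists x.+1 => //; rewrite mem_rem_uniq // inE /=.
by apply: AB; rewrite inE map_f.
Qed.

Lemma has_sum_succE (u : nat -> C) l :
  has_sum u l -> asum u -> has_sum (fun n => u n.+1) (l - u 0%N).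
Proof.
move=> H au; have [m Hm] := asum_has_sum (@bsum_inj _ _ _ _ succn succn_inj au).
by rewrite -(has_sum_unique (has_sum_succ Hm) H) addrC addKr.
Qed.

Lemma has_sum_series1 (u : nat -> C) l :
  has_sum (fun n => u n.+1) l -> \big[+%R/0]_(1 <= n <oo) u n = l.
Proof.
move=> H; pose v n := if n == 0%N then 0 else u n.
have Hv : has_sum v l by rewrite -[l]add0r; apply: (@has_sum_succ v).
rewrite -(has_sum_series Hv); congr (limn _); apply/funext => -[|n].
  by rewrite !big_geq.
by rewrite [RHS]big_ltn // /v /= add0r; apply: eq_big_nat => i /andP[i0 _]; rewrite gtn_eqF.
Qed.

End IndexSums.

(** * Transport of a sum along an embedding that covers the support *)

Section Support.
Variable R : realType.
Local Notation C := R[i].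
Variables (I J : eqType) (f : I -> C) (h : J -> I) (g : I -> J).
Hypotheses (hg : forall i, f i != 0 -> h (g i) = i) (gh : cancel h g).

Lemma has_sum_supp l : has_sum f l <-> has_sum (fun j => f (h j)) l.
Proof.
have hi : injective h := can_inj gh.
split=> H e /H[A HA].
  exists (map g A) => B uB AB.
  pose D := undup (map h B ++ A).
  have -> : \sum_(j <- B) f (h j) = \sum_(i <- D) f i.
    rewrite -(big_map h xpredT f) [RHS](bigID (mem (map h B))) /= [X in _ + X]big_seq_cond.
    rewrite [X in _ + X]big1 ?addr0; last first.
      move=> i /andP[]; rewrite mem_undup mem_cat => /orP[->//|iA].
      apply: contraNeq => fi; rewrite -(hg fi); apply: map_f; apply: AB; exact: map_f.
    rewrite -[RHS]big_filter; apply/perm_big/uniq_perm; rewrite ?filter_uniq ?undup_uniq //.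
      by rewrite map_inj_uniq.
    by move=> i; rewrite mem_filter mem_undup mem_cat; case: (i \in map h B).
  apply: HA; first exact: undup_uniq.
  by move=> i iA; rewrite mem_undup mem_cat iA orbT.
exists (map h A) => B uB AB.
pose D := [seq g i | i <- B & h (g i) == i].
have -> : \sum_(i <- B) f i = \sum_(j <- D) f (h j).
  rewrite /D big_map big_filter (bigID (fun i => h (g i) == i)) /= [X in _ + X]big1 ?addr0.
    by apply: eq_bigr => i /eqP ->.
  by move=> i; apply: contraNeq => /hg ->.
apply: HA.
  rewrite map_inj_in_uniq ?filter_uniq // => x y; rewrite !mem_filter.
  by move=> /andP[/eqP ex _] /andP[/eqP ey _] e1; rewrite -ex e1.
move=> j jA; apply/mapP; exists (h j); last by rewrite gh.
by rewrite mem_filter gh eqxx AB // map_f.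
Qed.

End Support.

(** * The complex exponential and its estimates *)

Section Exponential.
Variable R : realType.
Local Notation C := R[i].
Local Open Scope complex_scope.

(* Sealed copies, so that unification does not unfold them into products. *)
Lemma ce_seal : {f : C -> C | f = @cexp R}. Proof. by exists (@cexp R). Qed.
Definition ce : C -> C := sval ce_seal.
Lemma ceE z : ce z = cexp z. Proof. by rewrite /ce (svalP ce_seal). Qed.

Lemma ee_seal : {f : C -> C | f = @qvar R}. Proof. by exists (@qvar R). Qed.
Definition ee : C -> C := sval ee_seal.
Lemma eeE z : ee z = qvar z. Proof. by rewrite /ee (svalP ee_seal). Qed.

Lemma tpi_seal : {c : C | c = (2 * pi)%:C * 'i}. Proof. by exists ((2 * pi)%:C * 'i). Qed.
Definition tpi : C := sval tpi_seal.
Lemma tpiE : tpi = (2 * pi)%:C * 'i. Proof. exact: (svalP tpi_seal). Qed.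

Lemma sin_le (x : R) : 0 <= x -> sin x <= x.
Proof.
move=> x0; have [|c _ h] := @MVT_segment R sin cos 0 x x0 (fun y _ => is_derive_sin y).
  by apply: continuous_subspaceT => y; exact: continuous_sin.
by rewrite sin0 !subr0 in h; rewrite h ler_piMl // cos_le1.
Qed.

Lemma sin_sqr_le (x : R) : sin x ^+ 2 <= x ^+ 2.
Proof.
wlog x0 : x / 0 <= x => [H|].
  have [|x0] := leP 0 x; first exact: H.
  by rewrite -(sqrrN x) -(sqrrN (sin x)) -sinN H // oppr_ge0 ltW.
have [x1|x1] := leP 1 x.
  have := cos2Dsin2 x; nra.
have s0 : 0 <= sin x.
  apply: sin_ge0_pi; rewrite x0 /=.
  have := @pi_ge2 R; lra.
by rewrite ler_sqr ?nnegrE // sin_le.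
Qed.

Lemma cos_ge (x : R) : 1 - x ^+ 2 / 2 <= cos x.
Proof.
have -> : cos x = 1 - 2 * sin (x / 2) ^+ 2.
  have h := cosD (x / 2) (x / 2); have := cos2Dsin2 (x / 2).
  by rewrite -splitr in h; rewrite h => h2; nra.
have := sin_sqr_le (x / 2); nra.
Qed.

(** Duplication formula: sin(x / 2) is (x / 2) cos c by the mean value theorem, and cos c and cos(x
    / 2) are at least 1/2 because x / 2 is at most 1. *)
Lemma sin_ge_quarter (x : R) : 0 <= x <= pi / 2 -> x / 4 <= sin x.
Proof.
move=> /andP[x0 xpi].
have p4 : pi / 2 <= 2 :> R by have /andP[_ /ltW] := @pihalf_02 R.
have [||c cx h] := @MVT_segment R sin cos 0 (x / 2) _ (fun y _ => is_derive_sin y).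
- by rewrite divr_ge0.
- by apply: continuous_subspaceT => y; exact: continuous_sin.
move: cx; rewrite in_itv /= => /andP[c0 cx].
rewrite sin0 !subr0 in h.
have hc := cos_ge c; have hx := cos_ge (x / 2).
have e1 := sinD (x / 2) (x / 2); rewrite -splitr h in e1; rewrite e1.
have c1 : 1 / 2 <= cos c by nra.
have c2 : 1 / 2 <= cos (x / 2) by nra.
have c3 : 1 / 4 <= cos c * cos (x / 2) by nra.
nra.
Qed.

Lemma sin_sub_le (x : R) : `|x| <= 1 -> `|sin x - x| <= x ^+ 2.
Proof.
wlog x0 : x / 0 <= x => [H x1|x1].
  have [x0|x0] := leP 0 x; first exact: H.
  have -> : sin x - x = - (sin (- x) - - x) by rewrite sinN; ring.
  by rewrite normrN -sqrrN; apply: H; rewrite ?normrN // oppr_ge0 ltW.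
rewrite ger0_norm // in x1.
have [|c cx h] := @MVT_segment R sin cos 0 x x0 (fun y _ => is_derive_sin y).
  by apply: continuous_subspaceT => y; exact: continuous_sin.
move: cx; rewrite in_itv /= => /andP[c0 cx]; rewrite sin0 !subr0 in h.
have := cos_ge c; have := cos_le1 c => hc1 hc2.
rewrite h ler0_norm; nra.
Qed.

Lemma expR_sub_le (x : R) : `|x| <= 1 / 2 -> `|expR x - 1 - x| <= 2 * x ^+ 2.
Proof.
rewrite ler_norml => /andP[xl xu].
have h1 := expR_ge1Dx x; have h2 := expR_ge1Dx (- x).
have h3 : expR x * expR (- x) = 1 by rewrite expRxMexpNx_1.
have h4 : expR x * (1 - x) <= 1 by rewrite -[leRHS]h3 ler_pM2l ?expR_gt0.
rewrite ger0_norm; first by have := expR_gt0 x; nra.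
lra.
Qed.

Lemma cexpD (z w : C) : ce (z + w) = ce z * ce w.
Proof.
case: z w => a b [c d]; rewrite !ceE /cexp /= expRD cosD sinD rmorphM /=.
by simpc; apply/eqP; rewrite eq_complex /=; apply/andP; split; apply/eqP; ring.
Qed.

Lemma cexp0 : ce (0 : C) = 1.
Proof. by rewrite !ceE /cexp /= expR0 cos0 sin0; simpc. Qed.

Lemma nm_cis (t : R) : nm (Complex (cos t) (sin t)) = 1.
Proof. by rewrite /nm /= cos2Dsin2 sqrtr1. Qed.

Lemma nm_cexp (z : C) : nm (ce z) = expR (complex.Re z).
Proof. by rewrite ceE /cexp nmM nm_real nm_cis mulr1 ger0_norm ?expR_ge0. Qed.

Lemma cexp_neq0 z : ce z != 0 :> C.
Proof. by rewrite -nm_gt0 nm_cexp expR_gt0. Qed.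

Lemma cexpN z : ce (- z) = (ce z)^-1 :> C.
Proof.
by apply: (mulfI (cexp_neq0 z)); rewrite -cexpD subrr cexp0 divff ?cexp_neq0.
Qed.

Lemma cexpMn z n : ce (z *+ n) = ce z ^+ n :> C.
Proof. by elim: n => [|n IH]; rewrite ?mulr0n ?cexp0 // mulrS cexpD IH exprS. Qed.

Lemma cexp_sub_le (z : C) : nm z <= 1 / 2 -> nm (ce z - 1 - z) <= 10 * nm z ^+ 2.
Proof.
move=> hz; have := Re_le_nm z; have := Im_le_nm z; have := nm_sqr z.
case: z hz => x y /= hz hn hy hx.
have h1 : `|expR x - 1 - x| <= 2 * x ^+ 2 by apply: expR_sub_le; lra.
have h2 : `|sin y - y| <= y ^+ 2 by apply: sin_sub_le; lra.
have h3 := cos_ge y; have h4 := cos_le1 y.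
have -> : ce (Complex x y) - 1 - Complex x y =
   (expR x - 1 - x)%:C + (Complex (cos y - 1) (sin y - y)) +
   (expR x - 1)%:C * Complex (cos y - 1) (sin y).
  rewrite !ceE /cexp /=; simpc; apply/eqP; rewrite eq_complex /=.
  by apply/andP; split; apply/eqP; ring.
have b2 : nm (Complex (cos y - 1) (sin y - y)) <= 2 * y ^+ 2.
  apply: le_trans (nm_le_ReIm _) _ => /=.
  have : `|cos y - 1| <= y ^+ 2 / 2 by rewrite ler0_norm; lra.
  nra.
have b3 : nm (Complex (cos y - 1) (sin y)) <= 2 * `|y|.
  have : nm (Complex (cos y - 1) (sin y)) <= nm (Complex (cos y - 1) (sin y - y)) + nm (Complex 0 y).
    by apply: le_trans (nmD _ _); simpc; rewrite subrK.
  have : nm (Complex 0 y) <= `|y| by apply: le_trans (nm_le_ReIm _) _; rewrite /= normr0 add0r.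
  rewrite -(real_normK (num_real y)) in b2.
  have := normr_ge0 y; nra.
have b4 : `|expR x - 1| <= 2 * `|x|.
  have : `|expR x - 1| <= `|expR x - 1 - x| + `|x|.
    by apply: le_trans (ler_normD _ _); rewrite subrK.
  rewrite -(real_normK (num_real x)) in h1.
  have := normr_ge0 x; nra.
have := nmD ((expR x - 1 - x)%:C + (Complex (cos y - 1) (sin y - y)))
   ((expR x - 1)%:C * Complex (cos y - 1) (sin y)).
have := nmD (expR x - 1 - x)%:C (Complex (cos y - 1) (sin y - y)).
rewrite nmM !nm_real => t1 t2.
have t3 : `|expR x - 1| * nm (Complex (cos y - 1) (sin y)) <= (2 * `|x|) * (2 * `|y|).
  by rewrite ler_pM ?nm_ge0.
have := normr_ge0 x; have := normr_ge0 y.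
have ex : x ^+ 2 = `|x| ^+ 2 by rewrite real_normK ?num_real.
have ey : y ^+ 2 = `|y| ^+ 2 by rewrite real_normK ?num_real.
have : 0 <= (`|x| - `|y|) ^+ 2 by rewrite sqr_ge0.
nra.
Qed.

Lemma qvarE (z : C) : ee z = ce (tpi * z).
Proof. by rewrite eeE ceE tpiE. Qed.

Lemma qvarD (z w : C) : ee (z + w) = ee z * ee w.
Proof. by rewrite !qvarE mulrDr cexpD. Qed.

Lemma qvar0 : ee (0 : C) = 1.
Proof. by rewrite qvarE mulr0 cexp0. Qed.

Lemma qvar_neq0 z : ee z != 0 :> C. Proof. by rewrite qvarE cexp_neq0. Qed.

Lemma qvarN (z : C) : ee (- z) = (ee z)^-1.
Proof. by rewrite !qvarE mulrN cexpN. Qed.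

Lemma qvarMn (z : C) n : ee (z * n%:R) = ee z ^+ n.
Proof. by rewrite !qvarE mulrA mulr_natr cexpMn. Qed.

Lemma qvar1 : ee (1 : C) = 1.
Proof.
rewrite qvarE mulr1 ceE tpiE /cexp /=; simpc; rewrite expR0 mul1r.
by rewrite mulr_natl cos2pi sin2pi; simpc.
Qed.

Lemma qvar_nat n : ee (n%:R : C) = 1.
Proof. by rewrite -[n%:R]mul1r qvarMn qvar1 expr1n. Qed.

Lemma qvar_int (n : int) : ee (n%:~R : C) = 1.
Proof. by case: n => n; rewrite ?NegzE ?mulrNz ?qvarN qvar_nat ?invr1. Qed.

Lemma qvarDint (z : C) (n : int) : ee (z + n%:~R) = ee z.
Proof. by rewrite qvarD qvar_int mulr1. Qed.

Lemma nm_qvar (z : C) : nm (ee z) = expR (- (2 * pi * complex.Im z)).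
Proof. by case: z => x y; rewrite qvarE nm_cexp tpiE /=; congr expR; ring. Qed.

Lemma nm_qvar_lt1 (z : C) : 0 < complex.Im z -> nm (ee z) < 1.
Proof. by move=> h; rewrite nm_qvar expR_lt1 oppr_lt0 !mulr_gt0 // pi_gt0. Qed.

Lemma tpi_neq0 : tpi != 0.
Proof.
by rewrite -nm_gt0 tpiE nmM nm_real nm_i mulr1 normr_gt0 mulf_neq0 // gt_eqF // pi_gt0 //.
Qed.

(* |1 - r e^(i t)|^2 = (1 - r)^2 + 4 r sin(t/2)^2 *)
Lemma qvar_sub1_ge (Y : R) : exists2 c : R, 0 < c & forall x : C,
  `|complex.Re x| <= 3 / 4 -> 0 <= complex.Im x <= Y -> c * nm x <= nm (1 - ee x).
Proof.
exists (expR (- (2 * pi * Y)) / 3); first by rewrite divr_gt0 ?expR_gt0.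
case=> a b /= ha /andP[b0 bY]; set r0 := expR _.
set r := expR (- (2 * pi * b)).
have pi2 : 2 <= pi :> R := pi_ge2 _.
have pi0 : 0 < pi :> R := pi_gt0 _.
have r00 : 0 < r0 by exact: expR_gt0.
have r0r : r0 <= r by rewrite ler_expR lerN2 ler_wpM2l // mulr_ge0 // ltW.
have r1 : r <= 1 by rewrite expR_le1 oppr_le0 !mulr_ge0 // ltW.
have b1 : 2 * pi * b * r <= 1 - r.
  have h := expR_ge1Dx (2 * pi * b); have h3 := expRxMexpNx_1 (2 * pi * b).
  rewrite -/r in h3; have : 0 < r by exact: expR_gt0.
  nra.
have sa : a ^+ 2 / 36 <= sin (pi * a) ^+ 2.
  wlog a0 : a ha / 0 <= a => [H|].
    have [|a0] := leP 0 a; first exact: H.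
    by rewrite -(sqrrN a) -(sqrrN (sin _)) -sinN -mulrN H ?normrN // oppr_ge0 ltW.
  rewrite ger0_norm // in ha.
  have h : a / 6 <= sin (pi * a).
    have [ha2|ha2] := leP a (1 / 2).
      have : pi * a / 4 <= sin (pi * a).
        by apply: sin_ge_quarter; rewrite mulr_ge0 ?(ltW pi0) //= ler_pM2l //; lra.
      nra.
    have : pi * (1 - a) / 4 <= sin (pi * (1 - a)).
      by apply: sin_ge_quarter; rewrite mulr_ge0 ?(ltW pi0) ?ler_pM2l //=; lra.
    have -> : sin (pi * (1 - a)) = sin (pi * a).
      by rewrite mulrBr mulr1 sinB sinpi cospi mul0r sub0r mulN1r opprK.
    nra.
  nra.
rewrite -(@ler_pXn2r _ 2) ?nnegrE ?nm_ge0 //; last by rewrite mulr_ge0 ?nm_ge0 // divr_ge0 // ltW.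
rewrite exprMn.
have -> : ee (Complex a b) = Complex (r * cos (2 * (pi * a))) (r * sin (2 * (pi * a))).
  rewrite qvarE ceE tpiE /cexp /=; simpc; rewrite !mulrA -/r.
  by congr (Complex (_ * cos _) (_ * sin _)).
rewrite !nm_sqr /= mulr_natl mulr2n cosD sinD.
have cs := cos2Dsin2 (pi * a).
set S := sin _ in sa cs *; set K := cos _ in cs *.
have -> : (1 - r * (K * K - S * S)) ^+ 2 + (0 - r * (S * K + K * S)) ^+ 2 =
   (1 - r) ^+ 2 + 4 * r * S ^+ 2.
  have -> : K * K = 1 - S ^+ 2 by rewrite -cs; ring.
  have -> : (0 - r * (S * K + K * S)) ^+ 2 = 4 * r ^+ 2 * S ^+ 2 * (K ^+ 2) by ring.
  have -> : K ^+ 2 = 1 - S ^+ 2 by rewrite -cs; ring.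
  by ring.
have q1 : r0 ^+ 2 * b ^+ 2 <= (1 - r) ^+ 2.
  have t1 : r0 * b <= r * b by rewrite ler_wpM2r.
  have t2 : 0 <= r * b by rewrite mulr_ge0 // expR_ge0.
  have t3 : r * b <= 2 * pi * b * r by nra.
  have t4 : 0 <= r0 * b by rewrite mulr_ge0 // ltW.
  have t5 : r0 * b <= 1 - r by lra.
  by rewrite -exprMn ler_pXn2r ?nnegrE // (le_trans t4).
have q2 : r0 ^+ 2 * a ^+ 2 / 9 <= 4 * r * S ^+ 2.
  have a2 : 0 <= a ^+ 2 by exact: sqr_ge0.
  have t1 : r0 ^+ 2 <= r by nra.
  have t2 : r0 ^+ 2 * a ^+ 2 <= r * a ^+ 2 by rewrite ler_wpM2r.
  have t3 : r * (a ^+ 2 / 36) <= r * S ^+ 2 by rewrite ler_wpM2l // expR_ge0.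
  lra.
have -> : (r0 / 3) ^+ 2 * (a ^+ 2 + b ^+ 2) = (r0 ^+ 2 * a ^+ 2 + r0 ^+ 2 * b ^+ 2) / 9.
  by field.
have : 0 <= (1 - r) ^+ 2 by exact: sqr_ge0.
lra.
Qed.

Lemma qvar_neq1 (a : R) : 0 < a < 1 -> ee a%:C != 1.
Proof.
move=> /andP[a0 a1]; apply/eqP => h.
have : complex.Re (ee a%:C) = 1 by rewrite h.
rewrite qvarE ceE tpiE /cexp /=.
rewrite !(mulr0, mul0r, subr0, addr0, mulr1, add0r, sub0r, oppr0) expR0 mul1r.
rewrite -mulrA mulr_natl mulr2n cosD => h2.
have cs := cos2Dsin2 (pi * a).
have s0 : 0 < sin (pi * a).
  by apply: sin_gt0_pi; rewrite mulr_gt0 ?pi_gt0 //= gtr_pMr ?pi_gt0.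
nra.
Qed.

End Exponential.

(** * The Lipschitz summation formula *)

Section Lipschitz.
Variable R : realType.
Local Notation C := R[i].
Local Open Scope complex_scope.

(** The coefficient of q^t in (1 - q)^-(i + 1). *)
Definition mbin (i t : nat) : nat := 'C(t + i, i).

Lemma mbin_rec i t : mbin i.+1 t.+1 = (mbin i t.+1 + mbin i.+1 t)%N.
Proof. by rewrite /mbin !addnS !addSn binS addnC. Qed.

Lemma mbin0 i : mbin i 0 = 1%N. Proof. by rewrite /mbin add0n binn. Qed.
Lemma mbin_0 t : mbin 0 t = 1%N. Proof. by rewrite /mbin bin0. Qed.

Lemma mbin_mul i t : (i.+1 * mbin i.+1 t = (t + i.+1) * mbin i t)%N.
Proof. by rewrite /mbin addnS -mul_bin_diag. Qed.

Lemma bsum_mbin i (r : R) : 0 <= r < 1 -> bsum (fun t => (mbin i t)%:R * r ^+ t).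
Proof.
move=> /andP[r0 r1].
suff [M HM] : exists M, forall n, \sum_(t < n) (mbin i t)%:R * r ^+ t <= M.
  by apply: (bsum_nat (M := M)) => // t; rewrite mulr_ge0 ?exprn_ge0.
elim: i => [|i [M HM]].
  exists ((1 - r)^-1) => n.
  under eq_bigr do rewrite mbin_0 mul1r.
  have h : (\sum_(i < n) r ^+ i) * (1 - r) = 1 - r ^+ n.
    by rewrite -[RHS]opprB subrX1 -mulNr opprB mulrC.
  rewrite -[leRHS]mul1r ler_pdivlMr ?subr_gt0 // h.
  by rewrite lerBlDr lerDl exprn_ge0.
exists (M / (1 - r)) => -[|n].
  rewrite big_ord0 divr_ge0 ?subr_ge0 ?(ltW r1) //.
  by have := HM 0%N; rewrite big_ord0.
rewrite ler_pdivlMr ?subr_gt0 //; apply: le_trans (HM n.+1).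
rewrite mulrBr mulr1 lerBlDr [X in X <= _]big_ord_recl [X in _ <= X + _]big_ord_recl !mbin0 -addrA.
rewrite lerD2l; under eq_bigr do rewrite /= /bump /= add1n mbin_rec natrD mulrDl.
rewrite big_split /= lerD2l.
under eq_bigr do rewrite exprSr mulrA.
rewrite -mulr_suml ler_wpM2r // [leRHS]big_ord_recr /= lerDl mulr_ge0 ?exprn_ge0 //.
Qed.

Lemma pow_le_mbin j t : (t ^ j <= j`! * mbin j t)%N.
Proof.
elim: j => [|j IH]; first by rewrite mbin_0.
rewrite expnS factS mulnAC mbin_mul mulnAC -mulnA leq_mul ?leq_addr //.
Qed.

Lemma bsum_pow j (r : R) : 0 <= r < 1 -> bsum (fun t => t%:R ^+ j * r ^+ t).
Proof.
move=> hr; have /andP[r0 _] := hr.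
apply: le_bsum (bsumZ (ler0n _ j`!) (bsum_mbin j hr)) => t.
by rewrite mulrA ler_wpM2r ?exprn_ge0 // -natrM -natrX ler_nat pow_le_mbin.
Qed.

Lemma asum_pow j (q : C) : nm q < 1 -> asum (fun t : nat => t%:R ^+ j * q ^+ t).
Proof.
move=> q1; have := @bsum_pow j (nm q); rewrite nm_ge0 q1 => /(_ isT).
by apply: le_bsum => t; rewrite nmM !nmX nm_nat.
Qed.

Definition Tser j (q : C) := tsum (fun t : nat => t%:R ^+ j * q ^+ t).

Lemma TserP j q : nm q < 1 -> has_sum (fun t : nat => t%:R ^+ j * q ^+ t) (Tser j q).
Proof. by move=> /(asum_pow j)/tsumP. Qed.

Lemma one_sub_neq0 (q : C) : nm q < 1 -> 1 - q != 0.
Proof. by move=> q1; rewrite subr_eq0; apply: contraTneq q1 => <-; rewrite nm1 ltxx. Qed.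

Lemma has_sum_mbin i (q : C) : nm q < 1 ->
  has_sum (fun t => (mbin i t)%:R * q ^+ t) ((1 - q) ^- i.+1).
Proof.
move=> q1; have n0 := one_sub_neq0 q1.
have as_ k : asum (fun t => (mbin k t)%:R * q ^+ t).
  have := @bsum_mbin k (nm q); rewrite nm_ge0 q1 => /(_ isT).
  by apply: le_bsum => t; rewrite nmM !nmX nm_nat.
elim: i => [|i IH].
  have [l Hl] := asum_has_sum (as_ 0%N).
  suff <- : l = (1 - q) ^- 1 by [].
  have H2 := has_sum_succ (u := fun t => (mbin 0 t)%:R * q ^+ t) (l := q * l).
  rewrite mbin0 expr0 mulr1 in H2.
  have := has_sum_unique Hl (H2 _) => h.
  have {}h : l = 1 + q * l.
    by apply: h; apply: eq_has_sum (has_sumZ q Hl) => t; rewrite !mbin_0 exprS; ring.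
  by apply: (mulfI n0); rewrite expr1 divff // mulrBl mul1r {1}h addrK.
have [l Hl] := asum_has_sum (as_ i.+1).
suff <- : l = (1 - q) ^- i.+2 by [].
have h1 := has_sum_succE IH (as_ i); rewrite mbin0 expr0 mulr1 in h1.
have H2 := has_sum_succ (u := fun t => (mbin i.+1 t)%:R * q ^+ t)
  (l := (1 - q) ^- i.+1 - 1 + q * l).
rewrite mbin0 expr0 mulr1 in H2.
have := has_sum_unique Hl (H2 _) => h.
have {}h : l = 1 + ((1 - q) ^- i.+1 - 1 + q * l).
  apply: h; apply: eq_has_sum (has_sumD h1 (has_sumZ q Hl)) => t.
  by rewrite mbin_rec natrD exprS; ring.
apply: (mulfI n0); rewrite exprS invfM mulrA divff // mul1r mulrBl mul1r {1}h; ring.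
Qed.

(** Consequently sum t^j q^t is a polynomial in 1 / (1 - q). Only the leading coefficient is
    recorded, since the lower ones disappear in the limit that yields the Lipschitz formula. *)
Lemma pow_mbin j : exists a : nat -> int, a j = j`!%:Z /\
  forall t : nat, t%:Z ^+ j = \sum_(i < j.+1) a i * (mbin i t)%:Z.
Proof.
elim: j => [|j [a [aj Ha]]].
  by exists (fun=> 1); split=> // t; rewrite big_ord1 mbin_0 expr0.
exists (fun i => (if i == 0%N then 0 else i%:Z * a i.-1) - (if (i <= j)%N then i.+1%:Z * a i else 0)).
split; first by rewrite /= ltnn subr0 aj factS PoszM.
move=> t; rewrite exprS Ha mulr_sumr.
under eq_bigr => i _.
  have -> : t%:Z * (a i * (mbin i t)%:Z) =
     i.+1%:Z * a i * (mbin i.+1 t)%:Z - i.+1%:Z * a i * (mbin i t)%:Z.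
    have := congr1 Posz (mbin_mul i t); rewrite !PoszM PoszD => h.
    rewrite -[i.+1%:Z * a i * (mbin i.+1 t)%:Z]mulrAC h; ring.
  over.
rewrite sumrB; under [RHS]eq_bigr do rewrite mulrBl.
rewrite [RHS]sumrB; congr (_ - _).
  by rewrite [RHS]big_ord_recl /= !mul0r add0r; apply: eq_bigr => i _.
rewrite [RHS]big_ord_recr /= ltnn mul0r addr0; apply: eq_bigr => i _.
by rewrite -ltnS ltn_ord.
Qed.

Lemma Tser_rat j : exists a : nat -> C, a j = j`!%:R /\
  forall q, nm q < 1 -> Tser j q = \sum_(i < j.+1) a i * (1 - q) ^- i.+1.
Proof.
have [a [aj Ha]] := pow_mbin j; exists (fun i => (a i)%:~R); split; first by rewrite aj.
move=> q q1; apply: tsumE.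
have := has_sum_sum (index_enum 'I_j.+1) (P := xpredT)
  (fun i _ => has_sumZ (a (i : 'I_j.+1))%:~R (has_sum_mbin i q1)).
apply: eq_has_sum => t /=.
rewrite -[t%:R]/(t%:Z%:~R) -rmorphXn /= Ha rmorph_sum /= mulr_suml.
by apply: eq_bigr => i _; rewrite rmorphM /= mulrA.
Qed.

Lemma Im_gt0_div (z : C) (r : R) : 0 < r -> 0 < complex.Im z -> 0 < complex.Im (z / r%:C).
Proof.
move=> r0 z0; have -> : z / r%:C = (r^-1)%:C * z by rewrite fmorphV /= mulrC.
by case: z z0 => x y /= y0; rewrite mul0r addr0 mulr_gt0 // invr_gt0.
Qed.

Lemma ImZ (r : R) (z : C) : complex.Im (r%:C * z) = r * complex.Im z.
Proof. by case: z => x y /=; rewrite mul0r addr0. Qed.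

Lemma ReZ (r : R) (z : C) : complex.Re (r%:C * z) = r * complex.Re z.
Proof. by case: z => x y /=; rewrite mul0r subr0. Qed.

Lemma ImD (z w : C) : complex.Im (z + w) = complex.Im z + complex.Im w.
Proof. by case: z w => [a b] [c d]. Qed.

Lemma ReD (z w : C) : complex.Re (z + w) = complex.Re z + complex.Re w.
Proof. by case: z w => [a b] [c d]. Qed.

Lemma intC (n : int) : n%:~R = (n%:~R : R)%:C.
Proof. by rewrite rmorph_int. Qed.

Lemma natC (n : nat) : n%:R = (n%:R : R)%:C.
Proof. by rewrite rmorph_nat. Qed.

Lemma Im_int (n : int) : complex.Im (n%:~R : C) = 0.
Proof. by rewrite intC. Qed.

Lemma Re_int (n : int) : complex.Re (n%:~R : C) = n%:~R.
Proof. by rewrite intC. Qed.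

Lemma Im_gt0_neq0 (z : C) : 0 < complex.Im z -> z != 0.
Proof. by move=> h; apply: contraTneq h => ->; rewrite ltxx. Qed.

Lemma invC (r : R) : (r%:C)^-1 = (r^-1)%:C.
Proof. by rewrite fmorphV. Qed.

Lemma unity_sum (n : nat) (t : int) : (0 < n)%N ->
  \sum_(i < n) ee ((t * i%:Z)%:~R / n%:R : C) = if (n%:Z %| t)%Z then n%:R else 0.
Proof.
move=> n0; have nn : n%:R != 0 :> C by rewrite pnatr_eq0 -lt0n.
pose x := ee (t%:~R / n%:R : C).
have e i : ee ((t * i%:Z)%:~R / n%:R : C) = x ^+ i.
  by rewrite -qvarMn intrM mulrAC.
under eq_bigr do rewrite e.
case: ifPn => [/dvdzP[s ts]|ndvd].
  have -> : x = 1 by rewrite /x ts intrM mulfK // qvar_int.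
  under eq_bigr do rewrite expr1n.
  by rewrite sumr_const card_ord.
have xn : x ^+ n = 1 by rewrite -qvarMn divfK // qvar_int.
have x1 : x != 1.
  have xr : x = ee ((t %% n)%Z%:~R / n%:R : C).
    rewrite /x {1}(divz_eq t n) intrD intrM mulrDl mulfK //.
    by rewrite addrC qvarDint.
  have r0 : 0 <= (t %% n)%Z by rewrite modz_ge0 // -lt0n.
  have r1 : (t %% n)%Z < n%:Z by rewrite ltz_pmod.
  have r2 : (t %% n)%Z != 0 by apply: contra ndvd => /eqP h; apply/dvdz_mod0P.
  rewrite xr intC natC invC -rmorphM /=; apply: qvar_neq1.
  have nR : 0 < n%:R :> R by rewrite ltr0n.
  have r3 : 0 < (t %% n)%Z by rewrite lt_neqAle r0 eq_sym r2.
  rewrite divr_gt0 ?ltr0z //= ltr_pdivrMr // mul1r.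
  by rewrite -[n%:R]/(n%:Z%:~R) ltr_int.
have := subrX1 x n; rewrite xn subrr => /esym/eqP.
by rewrite mulf_eq0 subr_eq0 (negPf x1) /= => /eqP.
Qed.

(** Distribution relation: with n = 2 M + 1, summing over n consecutive translates before division
    by n keeps only the exponents divisible by n. The translates are centred at 0 so that they
    exhaust the integers as M grows. *)
Lemma Tser_dist j (tau : C) (M : nat) : 0 < complex.Im tau ->
  \sum_(i < M.*2.+1) Tser j (ee ((tau + (i%:Z - M%:Z)%:~R) / (M.*2.+1)%:R)) =
  (M.*2.+1)%:R ^+ j.+1 * Tser j (ee tau).
Proof.
move=> tau0; set n := M.*2.+1.
have n0 : (0 < n)%N by [].
have nn : n%:R != 0 :> C by rewrite pnatr_eq0.
pose y i := (tau + (i%:Z - M%:Z)%:~R) / n%:R : C.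
have yH i : 0 < complex.Im (y i).
  by rewrite /y natC; apply: Im_gt0_div => //; rewrite ImD Im_int addr0.
have H := has_sum_sum (index_enum 'I_n) (P := xpredT)
  (fun (i : 'I_n) _ => TserP j (nm_qvar_lt1 (yH i))).
pose h (s : nat) := (n * s)%N; pose g (t : nat) := (t %/ n)%N.
have Hf t : \sum_(i < n) t%:R ^+ j * ee (y i) ^+ t =
   if (n %| t)%N then t%:R ^+ j * n%:R * ee ((tau - M%:R) / n%:R) ^+ t else 0.
  rewrite -mulr_sumr.
  have e (i : 'I_n) : ee (y i) ^+ t =
     ee ((tau - M%:R) / n%:R) ^+ t * ee ((t%:Z * i%:Z)%:~R / n%:R).
    rewrite -!qvarMn -qvarD; congr ee; rewrite /y intrB intrM; field; exact: nn.
  under eq_bigr do rewrite e.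
  rewrite -mulr_sumr unity_sum // -[(n%:Z %| t%:Z)%Z]/(n %| t)%N.
  by case: ifP => _; ring.
have hg t : (if (n %| t)%N then t%:R ^+ j * n%:R * ee ((tau - M%:R) / n%:R) ^+ t
    else 0) != 0 -> h (g t) = t.
  by case: ifP; rewrite ?eqxx // /h /g => d _; rewrite mulnC divnK.
have gh : cancel h g by move=> t; rewrite /h /g mulKn.
have H2 := (has_sum_supp hg gh _).1 (eq_has_sum Hf H).
apply: has_sum_unique H2 _.
apply: eq_has_sum (has_sumZ (n%:R ^+ j.+1) (TserP j (nm_qvar_lt1 tau0))) => s.
have e1 : ee ((tau - M%:R) / n%:R) ^+ (n * s) = ee tau ^+ s.
  by rewrite exprM -qvarMn divfK // -(qvarDint tau (- M%:Z)) rmorphN.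
rewrite /h dvdn_mulr // e1 (natrM _ n s) (exprMn j n%:R s%:R) exprSr; ring.
Qed.

Lemma clim_qvar_sub1 (T : Type) (F : set_system T) (FF : ProperFilter F) (x : T -> C) :
  clim F x 0 -> (\forall t \near F, x t != 0) ->
  clim F (fun t => (1 - ee (x t)) / x t) (- tpi R).
Proof.
move=> Hx x0.
have tp0 : 0 < nm (tpi R) by rewrite nm_gt0 tpi_neq0.
set A := nm (tpi R) in tp0.
apply: (@clim_squeeze _ _ F _ _ _ (fun t => 10 * A ^+ 2 * nm (x t))).
  have e0 : 0 < 1 / 2 / A by rewrite !divr_gt0.
  apply: filterS2 (Hx _ e0) x0 => t; rewrite subr0 => h1 h2.
  have h3 : nm (tpi R * x t) <= 1 / 2 by rewrite nmM mulrC -ler_pdivlMr // ltW.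
  have := cexp_sub_le h3; rewrite -qvarE => h4.
  have -> : (1 - ee (x t)) / x t - - tpi R = - ((ee (x t) - 1 - tpi R * x t) / x t).
    by field.
  rewrite nmN nmM nmV ler_pdivrMr ?nm_gt0 //; apply: le_trans h4 _.
  by rewrite nmM exprMn -/A expr2 !mulrA.
move=> e e0; have e1 : 0 < e / (10 * A ^+ 2) by rewrite divr_gt0 // mulr_gt0 // exprn_gt0.
apply: filterS (Hx _ e1) => t; rewrite subr0 ltr_pdivlMr 1?mulrC //.
by rewrite mulr_gt0 // exprn_gt0.
Qed.

(** The constant of the Lipschitz formula. *)
Definition lipc (k : nat) : C := (- tpi R) ^+ k / (k.-1)`!%:R.

Lemma lipc_neq0 k : lipc k != 0.
Proof.
by rewrite mulf_neq0 ?expf_neq0 ?oppr_eq0 ?tpi_neq0 // invr_neq0 // pnatr_eq0 -lt0n fact_gt0 //.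
Qed.

(** The imaginary part of w = m z + n controls |m|, and then n = w - m z controls |n|. *)
Lemma lattice_ge (z : C) : 0 < complex.Im z -> exists2 c : R, 0 < c &
  forall m n : int, c * (`|m|%:~R + `|n|%:~R) <= nm (m%:~R * z + n%:~R).
Proof.
move=> y0; set y := complex.Im z in y0.
pose D := y^-1 + 1 + nm z / y.
have D0 : 0 < D.
  by rewrite /D addr_gt0 ?ltr_wpDl ?invr_ge0 ?ltW // 1?mulr_ge0 ?nm_ge0 ?invr_ge0 ?(ltW y0) // divr_gt0 // nm_gt0 Im_gt0_neq0.
exists D^-1; first by rewrite invr_gt0.
move=> m n; rewrite mulrC ler_pdivrMr //; set w := m%:~R * z + _.
have h1 : `|m|%:~R * y <= nm w.
  apply: le_trans (Im_le_nm w); rewrite /w ImD Im_int addr0 intC ImZ normrM -intr_norm.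
  by rewrite ler_wpM2l ?ler0z // ger0_norm // ltW.
have h1' : `|m|%:~R <= nm w / y by rewrite ler_pdivlMr.
have h2 : `|n|%:~R <= nm w + `|m|%:~R * nm z.
  rewrite -!nm_int -nmM; have -> : n%:~R = w - m%:~R * z by rewrite /w; ring.
  exact: nmB.
have h3 : `|m|%:~R * nm z <= nm w / y * nm z by rewrite ler_wpM2r ?nm_ge0.
rewrite /D; have -> : nm w * (y^-1 + 1 + nm z / y) = nm w / y + (nm w + nm w / y * nm z).
  by rewrite !mulrDr mulr1 -!addrA; congr (_ + (_ + _)); rewrite mulrA mulrAC.
by rewrite lerD // (le_trans h2) // lerD2l.
Qed.

Lemma asum_lattice_row (z : C) k : (1 < k)%N -> 0 < complex.Im z ->
  bsum (fun n : int => nm (z + n%:~R) ^- k).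
Proof.
move=> k1 /lattice_ge[c c0 Hc].
have h1 (n : int) : nm (z + n%:~R) ^- k <= c ^- k * w32 R `|n|%N.
  have := Hc 1 n; rewrite mul1r normr1 => h.
  have p0 : 0 < (`|n|%N).+1%:R :> R by [].
  have e : 1%:~R + `|n|%:~R = (`|n|%N).+1%:R :> R.
    by rewrite -[(`|n|%N).+1%:R]natr1 addrC natr_absz.
  rewrite e in h.
  have q0 : 0 < c * (`|n|%N).+1%:R by rewrite mulr_gt0.
  apply: (@le_trans _ _ ((c * (`|n|%N).+1%:R) ^- k)).
    rewrite lef_pV2 ?posrE ?exprn_gt0 ?(lt_le_trans q0 h) //.
    by apply: lerXn2r; rewrite ?nnegrE ?nm_ge0 ?(ltW q0).
  rewrite exprMn invfM ler_wpM2l ?invr_ge0 ?exprn_ge0 ?(ltW c0) //.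
  apply: le_trans (w32_sqr _ _).
  by rewrite lef_pV2 ?posrE ?exprn_gt0 // ler_weXn2l // ler1n.
apply: (bsum_int (h := fun n => c ^- k * w32 R n)) h1 _.
  by move=> n; rewrite mulr_ge0 ?invr_ge0 ?exprn_ge0 ?(ltW c0) // ltW // w32_gt0.
by apply: bsumZ (w32_bsum _); rewrite invr_ge0 exprn_ge0 // ltW.
Qed.

Definition zr (M : nat) : seq int := [seq i%:Z - M%:Z | i <- iota 0 M.*2.+1].

Lemma mem_zr M (j : int) : (j \in zr M) = (`|j|%N <= M)%N.
Proof.
apply/mapP/idP => [[i + ->]|h]; first by rewrite mem_iota; lia.
exists (absz (j + M%:Z)); last lia.
rewrite mem_iota; lia.
Qed.

Lemma zr_uniq M : uniq (zr M).
Proof. by rewrite map_inj_uniq ?iota_uniq // => i j; lia. Qed.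

Lemma sum_zr M (F : int -> C) : \sum_(j <- zr M) F j = \sum_(i < M.*2.+1) F (i%:Z - M%:Z).
Proof. by rewrite /zr big_map -(big_mkord xpredT (fun i => F (i%:Z - M%:Z))) /index_iota subn0. Qed.

Lemma clim_div_nat (w : C) : clim \oo%classic (fun M : nat => w / (M.*2.+1)%:R) 0.
Proof.
move=> e e0; exists (Num.truncn (nm w / e)).+1 => // M /= hM.
rewrite subr0 nmM nmV nm_nat ltr_pdivrMr // mulrC -ltr_pdivrMr //.
have h := truncnS_gt (nm w / e).
apply: lt_le_trans h _; rewrite ler_nat ltnS (leq_trans (ltnW hM)) // -addnn leq_addr //.
Qed.

Lemma near_strip (tau : C) (j : int) (M : nat) : `|complex.Re tau| <= 1 / 2 ->
  0 < complex.Im tau -> (`|j|%N <= M)%N ->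
  let x := (tau + j%:~R) / (M.*2.+1)%:R in
  [/\ `|complex.Re x| <= 1 / 2, 0 < complex.Im x, complex.Im x <= complex.Im tau &
      x != 0].
Proof.
move=> r2 i0 jM x.
have n0 : 0 < (M.*2.+1)%:R :> R by [].
have xE : x = ((M.*2.+1)%:R^-1)%:C * (tau + j%:~R) by rewrite /x mulrC natC invC.
have iE : complex.Im x = (M.*2.+1)%:R^-1 * complex.Im tau.
  by rewrite xE ImZ ImD Im_int addr0.
have i1 : 0 < complex.Im x by rewrite iE mulr_gt0 // invr_gt0.
split=> //; last exact: Im_gt0_neq0.
  rewrite xE ReZ ReD Re_int normrM ger0_norm ?invr_ge0 // mulrC ler_pdivrMr //.
  apply: le_trans (ler_normD _ _) _; rewrite -intr_norm.
  have : `|j|%:~R <= M%:R :> R by rewrite -[M%:R]/(M%:Z%:~R) ler_int; lia.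
  rewrite -[(M.*2.+1)%:R]natr1 -mul2n natrM; lra.
by rewrite iE ler_piMl ?(ltW i0) // invf_le1 // ler1n.
Qed.

(** By the distribution relation the right-hand side is, for every M, a sum over |j| <= M of values
    at the small points x = (tau + j) / (2 M + 1). Near 0 the rational function [Tser] has leading
    term (k - 1)! / (- 2 pi i x)^k, so the term of index j tends to (tau + j)^-k, and dominated
    convergence gives the limit. *)
Lemma lipschitz_strip (k : nat) (tau : C) : (1 < k)%N -> `|complex.Re tau| <= 1 / 2 ->
  0 < complex.Im tau ->
  has_sum (fun n : int => (tau + n%:~R) ^- k) (lipc k * Tser k.-1 (ee tau)).
Proof.
move=> k1 r2 i0.
have k0 : k = k.-1.+1 by rewrite prednK // ltnW.
pose nn M : nat := M.*2.+1.
have [x xE] : exists x : nat -> int -> C, forall M j, x M j = (tau + j%:~R) / (nn M)%:R.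
  by exists (fun M j => (tau + j%:~R) / (nn M)%:R).
(* Truncated families indexed by M, all with the same sum. *)
pose u M (j : int) := if (`|j|%N <= M)%N then
  lipc k * (nn M)%:R ^- k * Tser k.-1 (ee (x M j)) else 0.
have nnC M : (nn M)%:R != 0 :> C by rewrite pnatr_eq0.
have tj (j : int) : tau + j%:~R != 0.
  by apply: Im_gt0_neq0; rewrite ImD Im_int addr0.
have claim1 M : has_sum (u M) (lipc k * Tser k.-1 (ee tau)).
  have := @has_sum_fin _ _ (u M) (zr M) (zr_uniq M).
  rewrite sum_zr (eq_bigr (fun i : 'I_(nn M) => lipc k * (nn M)%:R ^- k *
      Tser k.-1 (ee ((tau + (i%:Z - M%:Z)%:~R) / (nn M)%:R)))); last first.
    move=> i _; rewrite /u xE ifT //; have := ltn_ord i; rewrite /nn; lia.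
  rewrite -mulr_sumr Tser_dist // -k0 mulrA mulfVK ?expf_neq0 //.
  by apply=> j; rewrite mem_zr /u => /negPf ->.
have [a [ak Ha]] := Tser_rat k.-1.
have Hx M j : (`|j|%N <= M)%N -> Tser k.-1 (ee (x M j)) =
    x M j ^- k * \sum_(i < k) a i * (x M j ^+ (k.-1 - i) * (x M j / (1 - ee (x M j))) ^+ i.+1).
  move=> jM; have [] := near_strip r2 i0 jM; rewrite -xE => _ h1 _ xn0.
  have q1 := nm_qvar_lt1 h1.
  rewrite Ha // -k0 mulr_sumr; apply: eq_bigr => i _.
  have e1 : x M j ^+ k = x M j ^+ (k.-1 - i) * x M j ^+ i.+1.
    by rewrite -exprD; congr (_ ^+ _); have := ltn_ord i; lia.
  have q2 := one_sub_neq0 q1.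
  move: (x M j) q2 e1 xn0 => X Q0 e1 X0.
  by rewrite e1 exprMn exprVn; field; rewrite !expf_neq0 ?Q0.
have [c c0 Hc] := qvar_sub1_ge (complex.Im tau).
pose X := 1 + complex.Im tau.
pose D := \sum_(i < k) nm (a i) * (X ^+ (k.-1 - i) * c ^- i.+1).
have X0 : 0 <= X by rewrite /X addr_ge0 // ltW.
have D0 : 0 <= D.
  by apply: sumr_ge0 => i _; rewrite !mulr_ge0 ?nm_ge0 ?exprn_ge0 // invr_ge0 exprn_ge0 // ltW.
have claim2 M j : nm (u M j) <= nm (lipc k) * D * nm (tau + j%:~R) ^- k.
  rewrite /u; case: ifPn => [jM|_]; last first.
    by rewrite nm0 !mulr_ge0 ?nm_ge0 // invr_ge0 exprn_ge0 ?nm_ge0.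
  have [] := near_strip r2 i0 jM; rewrite -xE => h1 h2 h3 h4.
  rewrite Hx //; set S := \sum_(i < k) _.
  have e1 : (nn M)%:R ^- k * x M j ^- k = (tau + j%:~R) ^- k.
    by rewrite -invfM -exprMn xE mulrC divfK.
  rewrite -mulrA (mulrA _ _ S) e1 -(mulrA (nm _)) (nmM (lipc k)) ler_wpM2l ?nm_ge0 //.
  rewrite (nmM _ S) nmV nmX mulrC ler_wpM2r ?invr_ge0 ?exprn_ge0 ?nm_ge0 //.
  apply: le_trans (nm_sum _ _ _) _; apply: ler_sum => i _.
  move: (x M j) h1 h2 h3 h4 => y h1 h2 h3 h4.
  rewrite !nmM ler_wpM2l ?nm_ge0 // !nmX ler_pM ?exprn_ge0 ?nm_ge0 //.
    apply: lerXn2r; rewrite ?nnegrE ?nm_ge0 //.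
    apply: le_trans (nm_le_ReIm _) _; rewrite (gtr0_norm h2) /X; lra.
  rewrite -exprVn; apply: lerXn2r; rewrite ?nnegrE ?nm_ge0 ?invr_ge0 ?(ltW c0) //.
  rewrite nmM nmV ler_pdivrMr; last by rewrite nm_gt0 one_sub_neq0 // nm_qvar_lt1.
  rewrite ler_pdivlMl // Hc ?(ltW h2) //; lra.
have claim3 j : clim \oo%classic (fun M => u M j) ((tau + j%:~R) ^- k).
  have e1 : \forall M \near \oo%classic, lipc k * (tau + j%:~R) ^- k *
      (\sum_(i < k) a i * (x M j ^+ (k.-1 - i) * ((1 - ee (x M j)) / x M j)^-1 ^+ i.+1))
      = u M j.
    exists `|j|%N => // M /= jM; rewrite /u jM Hx //.
    set S := \sum_(i < k) _; set S' := \sum_(i < k) _.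
    rewrite -mulrA -[RHS]mulrA; congr (_ * _); rewrite [RHS]mulrA.
    have -> : ((nn M)%:R ^- k) * (x M j ^- k) = (tau + j%:~R) ^- k.
      by rewrite -invfM -exprMn xE mulrC divfK.
    by congr (_ * _); apply: eq_bigr => i _; rewrite invf_div.
  apply: eq_near_clim e1 _.
  have cx : clim \oo%classic (fun M => x M j) 0.
    by under eq_fun do rewrite xE; exact: clim_div_nat.
  have nx : \forall M \near \oo%classic, x M j != 0.
    by apply: nearW => M; rewrite xE mulf_neq0 ?invr_neq0.
  have tp0 : - tpi R != 0 by rewrite oppr_eq0 tpi_neq0.
  have lq : clim \oo%classic (fun M => ((1 - ee (x M j)) / x M j)^-1) (- tpi R)^-1.
    by apply: climV => //; apply: clim_qvar_sub1.
  suff e2 : lipc k * (tau + j%:~R) ^- k *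
      (\sum_(i < k) a i * (0 ^+ (k.-1 - i) * (- tpi R)^-1 ^+ i.+1)) = (tau + j%:~R) ^- k.
    rewrite -[X in clim _ _ X]e2.
    apply: climM; first exact: clim_cst.
    apply: clim_sum => i _; apply: climM; first exact: clim_cst.
    by apply: climM; apply: climX => //; apply: lq.
  have [k' kE] : exists k', k = k'.+1 by exists k.-1.
  (* Only i = k - 1 survives, the other terms carrying a positive power of 0; its coefficient (k -
     1)! cancels the one in [lipc]. *)
  rewrite kE big_ord_recr /= subnn expr0 mul1r big1 ?add0r; last first.
    by move=> i _; rewrite expr0n subn_eq0 leqNgt ltn_ord mul0r mulr0.
  move: ak; rewrite kE /= => ->; rewrite /lipc /= exprVn.
  rewrite mulrAC [X in X * _](_ : _ = 1) ?mul1r //.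
  by rewrite mulrA divfK ?mulfV ?expf_neq0 // pnatr_eq0 -lt0n fact_gt0.
have bs := asum_lattice_row k1 i0.
have [l Hl] : exists l, has_sum (fun n : int => (tau + n%:~R) ^- k) l.
  by apply: asum_has_sum; apply: le_bsum bs => j; rewrite nmV nmX.
have D1 : 0 <= nm (lipc k) * D by rewrite mulr_ge0 ?nm_ge0.
have cl : clim \oo%classic (fun _ : nat => lipc k * Tser k.-1 (ee tau)) l.
  apply: (tannery (u := u) _ (bsumZ D1 bs) _ claim3 _ Hl); by apply: nearW => M //; exact: claim2.
by rewrite -(clim_unique _ cl (clim_cst _ _)).
Qed.

Lemma lipschitz_formula (k : nat) (tau : C) : (1 < k)%N -> 0 < complex.Im tau ->
  has_sum (fun n : int => (tau + n%:~R) ^- k) (lipc k * Tser k.-1 (ee tau)).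
Proof.
move=> k1 i0; pose m := Num.floor (complex.Re tau + 1 / 2).
have h1 : `|complex.Re (tau - m%:~R)| <= 1 / 2.
  rewrite -rmorphN /= ReD Re_int rmorphN /=.
  have := floor_le_tmp (complex.Re tau + 1 / 2).
  have := floorD1_gt (complex.Re tau + 1 / 2).
  rewrite -/m intrD ler_norml => *; apply/andP; split; lra.
have := @lipschitz_strip k (tau - m%:~R) k1 h1.
rewrite -rmorphN /= ImD Im_int addr0 => /(_ i0).
rewrite qvarDint => /(has_sum_reindex (h := fun n => n + m) (k := fun n => n - m)) H.
apply: eq_has_sum (H _ _) => n; rewrite ?addrK ?subrK //.
by rewrite intrD rmorphN /=; congr (_ ^- _); ring.
Qed.

End Lipschitz.

(** * Complex derivatives and q-series *)

Section ComplexDerivative.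
Variable R : realType.
Local Notation C := R[i].
Local Open Scope complex_scope.

(** First-order expansion in terms of the real modulus; it is converted to [derivable] only for the
    final cusp form. *)
Definition cderiv (f : C -> C) (z l : C) := forall e : R, 0 < e ->
  exists2 d : R, 0 < d & forall h, nm h < d -> nm (f (z + h) - f z - l * h) <= e * nm h.

Lemma cderiv_derivable f z l : cderiv f z l -> derivable f z 1.
Proof.
move=> H; apply/cvg_ex; exists l; apply/cvgrPdist_le => e e0.
have e1 : e = (nm e)%:C by rewrite -nmE gtr0_norm.
have e2 : 0 < nm e by rewrite nm_gt0 gt_eqF.
have [d d0 Hd] := H _ e2.
exists d%:C => /=; first by rewrite ltcR.
move=> h /=; rewrite sub0r normrN nmE ltcR => hd h0.
rewrite nmE e1 lecR -[h *: _]/(h * _) mulr1 -[_ *: _]/(h^-1 * _) (addrC h z).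
have -> : l - h^-1 * (f (z + h) - f z) = - (h^-1 * (f (z + h) - f z - l * h)).
  by field.
rewrite nmN nmM nmV mulrC ler_pdivrMr ?nm_gt0 //; exact: Hd.
Qed.

Lemma cderiv_cst (c z : C) : cderiv (fun=> c) z 0.
Proof. by move=> e e0; exists 1 => // h _; rewrite mul0r !subrr nm0 mulr_ge0 ?nm_ge0 ?ltW. Qed.

Lemma cderiv_id (z : C) : cderiv id z 1.
Proof.
move=> e e0; exists 1 => // h _.
by rewrite mul1r [z + h]addrC addrK subrr nm0 mulr_ge0 ?nm_ge0 ?ltW.
Qed.

Lemma cderivD f g z l m : cderiv f z l -> cderiv g z m -> cderiv (fun w => f w + g w) z (l + m).
Proof.
move=> H K e e0; have e2 : 0 < e / 2 by rewrite divr_gt0.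
have [d d0 Hd] := H _ e2; have [d' d0' Hd'] := K _ e2.
exists (Num.min d d'); first by rewrite lt_min d0 d0'.
move=> h; rewrite lt_min => /andP[hd hd'].
have -> : f (z + h) + g (z + h) - (f z + g z) - (l + m) * h =
  (f (z + h) - f z - l * h) + (g (z + h) - g z - m * h) by ring.
by rewrite (le_trans (nmD _ _)) // (splitr e) mulrDl lerD ?Hd ?Hd'.
Qed.

Lemma cderiv_lip f z l : cderiv f z l -> exists2 d : R, 0 < d & forall h, nm h < d ->
  nm (f (z + h) - f z) <= (nm l + 1) * nm h.
Proof.
move=> /(_ 1 ltr01)[d d0 Hd]; exists d => // h /Hd h1.
have -> : f (z + h) - f z = (f (z + h) - f z - l * h) + l * h by ring.
by rewrite (le_trans (nmD _ _)) // nmM; lra.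
Qed.

Lemma cderivM f g z l m : cderiv f z l -> cderiv g z m ->
  cderiv (fun w => f w * g w) z (l * g z + f z * m).
Proof.
move=> H K e e0.
have [d1 d10 H1] := cderiv_lip H.
pose A := nm l + 1; pose B := nm (f z) + A + 1; pose D := nm (g z) + 1.
have A0 : 0 < A by rewrite ltr_wpDl ?nm_ge0.
have B0 : 0 < B by rewrite /B; have := nm_ge0 (f z); lra.
have D0 : 0 < D by rewrite /D; have := nm_ge0 (g z); lra.
have M0 : 0 < nm m + 1 by have := nm_ge0 m; lra.
have [d2 d20 H2] := H (e / 3 / D) ltac:(by rewrite !divr_gt0).
have [d3 d30 H3] := K (e / 3 / B) ltac:(by rewrite !divr_gt0).
pose d4 := e / 3 / (A * (nm m + 1)).
have d40 : 0 < d4 by rewrite !divr_gt0 // mulr_gt0.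
exists (Num.min (Num.min d1 d2) (Num.min (Num.min d3 d4) 1)).
  by rewrite !lt_min d10 d20 d30 d40 ltr01.
move=> h; rewrite !lt_min => /andP[/andP[h1 h2] /andP[/andP[h3 h4] h5]].
have -> : f (z + h) * g (z + h) - f z * g z - (l * g z + f z * m) * h =
  (f (z + h) - f z - l * h) * g z + f (z + h) * (g (z + h) - g z - m * h)
  + (f (z + h) - f z) * (m * h) by ring.
have t1 := H1 _ h1; have t2 := H2 _ h2; have t3 := H3 _ h3.
have n0 := nm_ge0 h.
have fb : nm (f (z + h)) <= B.
  have : nm (f (z + h)) <= nm (f z) + nm (f (z + h) - f z).
    by rewrite -{1}[f (z + h)](subrK (f z)) addrC nmD.
  rewrite -/A in t1 => ?; have : A * nm h <= A by rewrite ler_piMr ?ltW.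
  rewrite /B; lra.
have b1 : nm ((f (z + h) - f z - l * h) * g z) <= e / 3 * nm h.
  rewrite nmM; apply: le_trans (ler_pM (nm_ge0 _) (nm_ge0 _) t2 (_ : nm (g z) <= D)) _.
    by rewrite /D lerDl.
  by rewrite mulrAC divfK // gt_eqF.
have b2 : nm (f (z + h) * (g (z + h) - g z - m * h)) <= e / 3 * nm h.
  rewrite nmM; apply: le_trans (ler_pM (nm_ge0 _) (nm_ge0 _) fb t3) _.
  by rewrite mulrA (mulrC B) divfK // gt_eqF.
have b3 : nm ((f (z + h) - f z) * (m * h)) <= e / 3 * nm h.
  rewrite !nmM mulrA ler_wpM2r //.
  apply: (@le_trans _ _ (A * nm h * (nm m + 1))).
    by rewrite ler_pM ?nm_ge0 // lerDl.
  rewrite mulrAC mulrC -ler_pdivlMr ?mulr_gt0 //; exact: ltW.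
have := nmD ((f (z + h) - f z - l * h) * g z + f (z + h) * (g (z + h) - g z - m * h)) ((f (z + h) - f z) * (m * h)).
have := nmD ((f (z + h) - f z - l * h) * g z) (f (z + h) * (g (z + h) - g z - m * h)).
have -> : e * nm h = e / 3 * nm h + e / 3 * nm h + e / 3 * nm h by field.
lra.
Qed.

Lemma cderivZ (c : C) f z l : cderiv f z l -> cderiv (fun w => c * f w) z (c * l).
Proof.
by move=> H; have := cderivM (cderiv_cst c z) H; rewrite mul0r add0r.
Qed.

Lemma cderivN f z l : cderiv f z l -> cderiv (fun w => - f w) z (- l).
Proof.
move=> /(cderivZ (-1)); rewrite mulN1r.
by congr (cderiv _ _ _); apply/funext => w; rewrite mulN1r.
Qed.

Lemma cderivB f g z l m : cderiv f z l -> cderiv g z m -> cderiv (fun w => f w - g w) z (l - m).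
Proof. by move=> H /cderivN; exact: cderivD. Qed.

Lemma cderiv_comp f g z l m : cderiv f z l -> cderiv g (f z) m ->
  cderiv (fun w => g (f w)) z (m * l).
Proof.
move=> H K e e0.
have [d1 d10 H1] := cderiv_lip H.
pose A := nm l + 1; have A0 : 0 < A by rewrite ltr_wpDl ?nm_ge0.
pose M := nm m + 1; have M0 : 0 < M by rewrite ltr_wpDl ?nm_ge0.
have [d2 d20 H2] := H (e / 2 / M) ltac:(by rewrite !divr_gt0).
have [d3 d30 H3] := K (e / 2 / A) ltac:(by rewrite !divr_gt0).
exists (Num.min (Num.min d1 d2) (d3 / A)).
  by rewrite !lt_min d10 d20 divr_gt0.
move=> h; rewrite !lt_min => /andP[/andP[h1 h2] h3].
have t1 := H1 _ h1; have t2 := H2 _ h2.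
pose k := f (z + h) - f z.
have kd : nm k < d3 by rewrite (le_lt_trans t1) // mulrC -ltr_pdivlMr.
have t3 := H3 _ kd.
have -> : g (f (z + h)) - g (f z) - m * l * h =
  (g (f z + k) - g (f z) - m * k) + m * (f (z + h) - f z - l * h).
  have -> : f z + k = f (z + h) by rewrite /k addrC subrK.
  by rewrite /k; ring.
have b1 : e / 2 / A * nm k <= e / 2 * nm h.
  apply: le_trans (_ : e / 2 / A * (A * nm h) <= _); first by rewrite ler_wpM2l // ltW // !divr_gt0.
  by rewrite mulrA divfK ?gt_eqF.
have b2 : nm (m * (f (z + h) - f z - l * h)) <= e / 2 * nm h.
  rewrite nmM; apply: le_trans (ler_pM (nm_ge0 _) (nm_ge0 _) (_ : nm m <= M) t2) _.
    by rewrite /M lerDl.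
  by rewrite mulrA (mulrC M) divfK // gt_eqF.
rewrite (le_trans (nmD _ _)) //.
have -> : e * nm h = e / 2 * nm h + e / 2 * nm h by field.
lra.
Qed.

Lemma cderiv_inv (z : C) : z != 0 -> cderiv (fun w => w^-1) z (- z ^- 2).
Proof.
move=> z0 e e0; have n0 : 0 < nm z by rewrite nm_gt0.
pose d := e * nm z ^+ 3 / 2.
have d0 : 0 < d by rewrite divr_gt0 // mulr_gt0 // exprn_gt0.
exists (Num.min d (nm z / 2)); first by rewrite lt_min d0 divr_gt0.
move=> h; rewrite lt_min => /andP[h1 h2].
have hz : nm z / 2 <= nm (z + h).
  have := nm_sub_ge z (- h); rewrite nmN opprK; lra.
have zh : z + h != 0 by rewrite -nm_gt0; lra.
have -> : (z + h)^-1 - z^-1 - - z ^- 2 * h = h ^+ 2 / (z ^+ 2 * (z + h)).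
  by field; rewrite z0 zh.
rewrite nmM nmV nmM !nmX ler_pdivrMr ?mulr_gt0 ?exprn_gt0 ?nm_gt0 //.
rewrite expr2 mulrAC ler_wpM2r ?nm_ge0 //.
apply: le_trans (ltW h1) _; rewrite /d.
have -> : e * nm z ^+ 3 / 2 = e * (nm z ^+ 2 * (nm z / 2)) by field.
by rewrite ler_pM2l // ler_pM2l // exprn_gt0.
Qed.

Lemma Im_add_small (z h : C) : nm h < complex.Im z -> 0 < complex.Im (z + h).
Proof.
move=> hz; rewrite ImD; have := Im_le_nm h; rewrite ler_norml => /andP[h1 _].
lra.
Qed.

Lemma eq_cderiv f g (z : C) l : (forall w : C, 0 < complex.Im w -> f w = g w) ->
  0 < complex.Im z -> cderiv f z l -> cderiv g z l.
Proof.
move=> fg z0 H e /H[d d0 Hd]; exists (Num.min d (complex.Im z)).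
  by rewrite lt_min d0 z0.
move=> h; rewrite lt_min => /andP[hd hz].
by rewrite -!fg ?Im_add_small //; exact: Hd.
Qed.

Lemma real_cderiv0 (f : C -> C) (z v : C) (L : C -> R) (t : R) :
  (forall a b, L (a - b) = L a - L b) -> (forall a, `|L a| <= nm a) ->
  cderiv f (z + t%:C * v) 0 -> is_derive t (1 : R) (fun s => L (f (z + s%:C * v))) 0.
Proof.
move=> LB Ln H.
suff cv : ((fun h : R => h^-1 *: (L (f (z + (h *: 1 + t)%:C * v)) -
    L (f (z + t%:C * v)))) @ 0^' --> (0 : R))%classic.
  apply: DeriveDef; first by apply/cvg_ex; exists 0; exact: cv.
  exact: cvg_lim cv.
apply/cvgrPdist_le => e e0.
have V0 : 0 < nm v + 1 by have := nm_ge0 v; lra.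
have [d d0 Hd] := H (e / (nm v + 1)) (divr_gt0 e0 V0).
exists (d / (nm v + 1)) => /=; first by rewrite divr_gt0.
move=> h /=; rewrite sub0r normrN => hd h0; rewrite sub0r normrN.
rewrite -LB -[_ *: _]/(h^-1 * _) normrM normfV mulrC ler_pdivrMr ?normr_gt0 //.
apply: le_trans (Ln _) _.
have hv : nm (h%:C * v) <= `|h| * (nm v + 1) by rewrite nmM nm_real ler_wpM2l // lerDl.
have hd2 : nm (h%:C * v) < d by rewrite (le_lt_trans hv) // -ltr_pdivlMr.
have := Hd _ hd2; rewrite mul0r subr0.
have -> : z + t%:C * v + h%:C * v = z + (h *: 1 + t)%:C * v.
  rewrite -[h *: 1]/(h * 1) mulr1 rmorphD /=; ring.
move=> /le_trans; apply.
apply: le_trans (_ : e / (nm v + 1) * (`|h| * (nm v + 1)) <= _).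
  by rewrite ler_wpM2l // ltW // divr_gt0.
by rewrite mulrCA divfK ?gt_eqF // mulrC.
Qed.

(** Mean value theorem for the real and imaginary parts along the segment from z to w, which stays
    in the upper half-plane by convexity. *)
Lemma cderiv0_cst (f : C -> C) : (forall z : C, 0 < complex.Im z -> cderiv f z 0) ->
  forall z w : C, 0 < complex.Im z -> 0 < complex.Im w -> f z = f w.
Proof.
move=> H z w z0 w0.
have inH (t : R) : 0 <= t <= 1 -> 0 < complex.Im (z + t%:C * (w - z)).
  move=> /andP[t0 t1]; rewrite ImD ImZ.
  have -> : complex.Im (w - z) = complex.Im w - complex.Im z by case: (w) (z) => [? ?] [? ?].
  have -> : complex.Im z + t * (complex.Im w - complex.Im z) = (1 - t) * complex.Im z + t * complex.Im w by ring.
  have [->|t00] := eqVneq t 0; first by rewrite subr0 mul1r mul0r addr0.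
  by rewrite ltr_wpDl ?mulr_ge0 ?subr_ge0 ?(ltW z0) // mulr_gt0 // lt_neqAle eq_sym t00.
have key (L : C -> R) : (forall a b, L (a - b) = L a - L b) -> (forall a, `|L a| <= nm a) ->
    L (f z) = L (f w).
  move=> LB Ln; pose g s := L (f (z + s%:C * (w - z))).
  have dg (t : R) : 0 <= t <= 1 -> is_derive t (1 : R) g 0.
    by move=> /inH ht; apply: (real_cderiv0 (f := f) LB Ln); exact: H.
  have [||c _] := @MVT_segment R g (fun=> 0) 0 1 ler01.
  - by move=> t; rewrite in_itv /= => /andP[/ltW t0 /ltW t1]; apply: dg; rewrite t0 t1.
  - apply: derivable_within_continuous => t; rewrite in_itv /= => ht.
    by have := dg _ ht; case.
  rewrite mul0r => /eqP; rewrite subr_eq0 => /eqP.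
  by rewrite /g mul0r addr0 mul1r addrC subrK.
have eR := key (@complex.Re R) _ (@Re_le_nm R).
have eI := key (@complex.Im R) _ (@Im_le_nm R).
rewrite [f z]complexE [f w]complexE eR ?eI // => -[a b] [c d] //.
Qed.

Lemma cexp_sub_le_gen (w : C) : nm (ce w - 1 - w) <= 10 * nm w ^+ 2 * expR (nm w).
Proof.
have n0 := nm_ge0 w.
have e1 : 1 <= expR (nm w) by rewrite -[leLHS]expR0 ler_expR.
have [h|h] := leP (nm w) (1 / 2).
  apply: le_trans (cexp_sub_le h) _; rewrite ler_peMr // mulr_ge0 // sqr_ge0 //.
have h1 : nm (ce w) <= expR (nm w).
  by rewrite nm_cexp ler_expR (le_trans (ler_norm _)) // Re_le_nm.
have h2 := expR_ge1Dx (nm w).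
have h3 := nmB (ce w - 1) w; have h4 := nmB (ce w) 1; rewrite nm1 in h4.
have h5 : 1 <= 4 * nm w ^+ 2 by nra.
have : 2 * expR (nm w) <= 8 * nm w ^+ 2 * expR (nm w) by nra.
nra.
Qed.

Lemma cderiv_cexp (z : C) : cderiv (@ce R) z (ce z).
Proof.
move=> e e0; have c0 : 0 < nm (ce z) by rewrite nm_gt0 cexp_neq0.
pose d := e / (10 * nm (ce z)).
have d0 : 0 < d by rewrite divr_gt0 // mulr_gt0.
exists (Num.min (1 / 2) d); first by rewrite lt_min d0 divr_gt0.
move=> h; rewrite lt_min => /andP[h1 h2].
rewrite cexpD -{2}[ce z]mulr1 -mulrBr -mulrBr nmM.
apply: le_trans (ler_wpM2l (nm_ge0 _) (cexp_sub_le (ltW h1))) _.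
rewrite expr2 !mulrA ler_wpM2r ?nm_ge0 // mulrC (mulrC _ 10) -ler_pdivlMr ?mulr_gt0 //.
exact: ltW.
Qed.

Lemma cderiv_qvar (z : C) : cderiv (@ee R) z (tpi R * ee z).
Proof.
have h := cderiv_comp (cderivZ (tpi R) (cderiv_id z)) (cderiv_cexp _).
rewrite mulr1 mulrC -qvarE in h.
by move: h; congr (cderiv _ _ _); apply/funext => w; rewrite qvarE.
Qed.

(** * Power series in q and Lambert series *)

Definition radius1 (a : nat -> C) := forall r : R, 0 <= r < 1 ->
  bsum (fun n => nm (a n) * r ^+ n).

Definition qser (a : nat -> C) (z : C) := tsum (fun n => a n * ee z ^+ n).

Lemma radius1_asum a (z : C) : radius1 a -> 0 < complex.Im z -> asum (fun n => a n * ee z ^+ n).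
Proof.
move=> ra z0; have := ra (nm (ee z)); rewrite nm_ge0 nm_qvar_lt1 // => /(_ isT).
by apply: le_bsum => n; rewrite nmM nmX.
Qed.

Lemma qserP a (z : C) : radius1 a -> 0 < complex.Im z ->
  has_sum (fun n => a n * ee z ^+ n) (qser a z).
Proof. by move=> ra z0; apply: tsumP; exact: radius1_asum. Qed.

Lemma pow_geom_bound j (r s : R) : 0 <= r -> r < s -> exists2 K : R, 0 <= K &
  forall n : nat, n%:R ^+ j * r ^+ n <= K * s ^+ n.
Proof.
move=> r0 rs; have s0 : 0 < s by apply: le_lt_trans rs.
have x1 : 0 <= r / s < 1 by rewrite divr_ge0 ?(ltW s0) //= ltr_pdivrMr // mul1r.
have [K HK] := bsum_pow j x1.
exists K; first by have := HK [::] isT; rewrite big_nil.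
move=> n; have := HK [:: n] isT; rewrite big_seq1 expr_div_n mulrA.
by rewrite ler_pdivrMr // exprn_gt0.
Qed.

Lemma radius1_pow j a : radius1 a -> radius1 (fun n => n%:R ^+ j * a n).
Proof.
move=> ra r /andP[r0 r1]; pose s := (r + 1) / 2.
have rs : r < s by rewrite /s; lra.
have s1 : 0 <= s < 1 by rewrite /s; apply/andP; split; lra.
have [K K0 HK] := pow_geom_bound j r0 rs.
apply: le_bsum (bsumZ K0 (ra _ s1)) => n.
rewrite nmM nmX nm_nat mulrAC (mulrCA K) [leRHS]mulrC.
by rewrite ler_wpM2r ?nm_ge0.
Qed.

Lemma radius1_poly j (a : nat -> C) (K : R) : (forall n, nm (a n) <= K * n%:R ^+ j) -> radius1 a.
Proof.
move=> H r /andP[r0 r1].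
have K0 : 0 <= K by have := le_trans (nm_ge0 _) (H 1%N); rewrite expr1n mulr1.
have hr : 0 <= r < 1 by rewrite r0 r1.
apply: le_bsum (bsumZ K0 (bsum_pow j hr)) => n.
by rewrite mulrA ler_wpM2r ?exprn_ge0.
Qed.

(** Termwise differentiation: the remainder of the n-th term is bounded by h^2 times the n-th term
    of one convergent series. *)
Lemma cderiv_qser a (z : C) : radius1 a -> 0 < complex.Im z ->
  cderiv (qser a) z (tpi R * qser (fun n => n%:R * a n) z).
Proof.
move=> ra z0; pose y := complex.Im z.
have ra1 : radius1 (fun n => n%:R * a n).
  by have := radius1_pow 1 ra; congr radius1; apply/funext => n; rewrite expr1.
have pi0 : 0 < pi :> R := pi_gt0 _.
pose A := nm (tpi R).
have AE : A = 2 * pi by rewrite /A tpiE nmM nm_real nm_i mulr1 gtr0_norm // mulr_gt0.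
pose rho := expR (- (pi * y)).
have rho1 : 0 <= rho < 1 by rewrite expR_ge0 /= expR_lt1 oppr_lt0 mulr_gt0.
have [M HM] := radius1_pow 2 ra rho1.
have M0 : 0 <= M by have := HM [::] isT; rewrite big_nil.
pose K := 10 * A ^+ 2 * M.
have A0 : 0 <= A ^+ 2 := sqr_ge0 A.
have K0 : 0 <= K by rewrite /K mulr_ge0 // mulr_ge0.
have K1 : 0 < K + 1 by lra.
move=> e e0; exists (Num.min (y / 2) (e / (K + 1))).
  by rewrite lt_min !divr_gt0.
move=> h; rewrite lt_min => /andP[hy he].
have zh : 0 < complex.Im (z + h) by apply: Im_add_small; rewrite -/y; move: z0; rewrite -/y; lra.
have S := has_sumB (has_sumB (qserP ra zh) (qserP ra z0)) (has_sumMr h (has_sumZ (tpi R) (qserP ra1 z0))).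
suff nb : nm (qser a (z + h) - qser a z - tpi R * qser (fun n => n%:R * a n) z * h) <= K * nm h ^+ 2.
  apply: le_trans nb _; rewrite expr2 mulrA ler_wpM2r ?nm_ge0 //.
  move: he; rewrite ltr_pdivlMr // mulrC mulrDl mul1r.
  have := nm_ge0 h; nra.
apply: (has_sum_nm_le (g := fun n => 10 * A ^+ 2 * nm h ^+ 2 * (nm (n%:R ^+ 2 * a n) * rho ^+ n))) S _ _; last first.
  move=> B uB; rewrite -mulr_sumr /K [leRHS]mulrAC ler_wpM2l ?HM //.
  by rewrite mulr_ge0 ?sqr_ge0 // mulr_ge0.
move=> n.
have -> : a n * ee (z + h) ^+ n - a n * ee z ^+ n - tpi R * (n%:R * a n * ee z ^+ n) * h =
  a n * ee z ^+ n * (ce (tpi R * (h * n%:R)) - 1 - tpi R * (h * n%:R)).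
  have -> : ee (z + h) ^+ n = ee z ^+ n * ce (tpi R * (h * n%:R)).
    by rewrite qvarD exprMn -(qvarMn h n) [in LHS](qvarE (h * _)).
  by ring.
rewrite !nmM nmX.
have := cexp_sub_le_gen (tpi R * (h * n%:R)); rewrite !nmM nm_nat -/A => hc.
apply: le_trans (ler_wpM2l _ hc) _; first by rewrite mulr_ge0 ?exprn_ge0 ?nm_ge0.
have -> : rho ^+ n = nm (ee z) ^+ n * expR (pi * y * n%:R).
  rewrite nm_qvar /rho -!expRM_natr -expRD -/y; congr expR; ring.
have hx : expR (A * (nm h * n%:R)) <= expR (pi * y * n%:R).
  rewrite ler_expR AE; have : 0 <= n%:R :> R by [].
  move: (n%:R : R) => N N0; have := mulr_ge0 N0 (ltW pi0).
  have : nm h <= y / 2 by apply: ltW.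
  nra.
have -> : 10 * A ^+ 2 * nm h ^+ 2 * (n%:R * n%:R * nm (a n) * (nm (ee z) ^+ n * expR (pi * y * n%:R))) =
  nm (a n) * nm (ee z) ^+ n * (10 * (A * (nm h * n%:R)) ^+ 2 * expR (pi * y * n%:R)).
  by ring.
rewrite ler_wpM2l ?mulr_ge0 ?exprn_ge0 ?nm_ge0 // ler_wpM2l // mulr_ge0 ?sqr_ge0 //.
Qed.

(** Regrouping of the pairs (j, t) of positive integers by their product n = j t. *)
Lemma lambert (f : nat -> nat -> C) l :
  asum (fun x : nat * nat => f x.1.+1 x.2.+1) ->
  has_sum (fun x : nat * nat => f x.1.+1 x.2.+1) l ->
  has_sum (fun n : nat => if n == 0%N then 0 else \sum_(t <- divisors n) f (n %/ t)%N t) l.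
Proof.
move=> _ H.
pose F (x : nat * nat) := if (0 < x.1)%N && (x.2 %| x.1)%N then f (x.1 %/ x.2)%N x.2 else 0.
pose h (x : nat * nat) := ((x.1.+1 * x.2.+1)%N, x.2.+1).
pose g (x : nat * nat) := ((x.1 %/ x.2).-1, x.2.-1).
have hg x : F x != 0 -> h (g x) = x.
  case: x => n t; rewrite /F /h /g /=; case: ifP; rewrite ?eqxx //.
  move=> /andP[n0 tn] _; have t0 : (0 < t)%N by apply: dvdn_gt0 tn.
  have q0 : (0 < n %/ t)%N by rewrite divn_gt0 // dvdn_leq.
  by rewrite (prednK t0) (prednK q0) divnK.
have gh : cancel h g by case=> a b; rewrite /h /g /= mulnK.
have HF : has_sum F l.
  apply/(has_sum_supp hg gh); apply: eq_has_sum H => -[a b].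
  by rewrite /F /h /= dvdn_mull // mulnK.
apply: has_sum_pair HF _ => n.
have [->|n0] := posnP n.
  by apply: has_sum0 => t; rewrite /F.
have -> : \sum_(t <- divisors n) f (n %/ t)%N t = \sum_(t <- divisors n) F (n, t).
  rewrite [LHS]big_seq [RHS]big_seq; apply: eq_bigr => t.
  by rewrite -dvdn_divisors // /F /= n0 => ->.
apply: has_sum_fin; first exact: divisors_uniq.
by move=> t; rewrite -dvdn_divisors // /F /= n0 => /negPf ->.
Qed.

End ComplexDerivative.

(** * The Dedekind eta function *)

Section EisensteinTwo.
Variable R : realType.
Local Notation C := R[i].
Local Open Scope complex_scope.

Lemma has_sum_clim_zr (f : int -> C) l : has_sum f l ->
  clim \oo%classic (fun M => \sum_(j <- zr M) f j) l.
Proof.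
move=> H e /H[A HA]; exists (\max_(j <- A) `|j|)%N => // M /= AM.
apply: HA; first exact: zr_uniq.
move=> j jA; rewrite mem_zr; apply: leq_trans AM.
by apply: (leq_bigmax_seq (F := absz)).
Qed.

Lemma sum_zrN M (F : int -> C) : \sum_(j <- zr M) F (- j) = \sum_(j <- zr M) F j.
Proof.
rewrite -(big_map -%R xpredT F); apply/perm_big/uniq_perm.
- by rewrite map_inj_uniq ?zr_uniq //; exact: oppr_inj.
- exact: zr_uniq.
move=> j; rewrite mem_zr; apply/mapP/idP => [[i + ->]|jM]; first by rewrite mem_zr abszN.
by exists (- j); rewrite ?opprK // mem_zr abszN.
Qed.

Lemma sum_zr_telescope M (f : int -> C) :
  \sum_(j <- zr M) (f j - f (j + 1)) = f (- M%:Z) - f (M%:Z + 1).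
Proof.
rewrite sum_zr; pose g (i : nat) := f (i%:Z - M%:Z).
under eq_bigr => i _.
  have -> : f (i%:Z - M%:Z + 1) = g i.+1 by rewrite /g; congr f; lia.
  rewrite -/(g i); over.
rewrite -(big_mkord xpredT (fun i => g i - g i.+1)).
rewrite (eq_big_nat _ _ (F2 := fun i => - (g i.+1 - g i))); last by move=> i _; rewrite opprB.
rewrite sumrN telescope_sumr // opprB /g sub0r; congr (_ - f _); lia.
Qed.

Lemma Tser0E (q : C) : nm q < 1 -> Tser 0 q = (1 - q)^-1.
Proof.
move=> q1; apply: tsumE; have := has_sum_mbin 0 q1; rewrite expr1.
by apply: eq_has_sum => t; rewrite mbin_0 expr0.
Qed.

Lemma Tser1E (q : C) : nm q < 1 -> Tser 1 q = q / (1 - q) ^+ 2.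
Proof.
move=> q1; have n0 := one_sub_neq0 q1; apply: tsumE.
have := has_sumB (has_sum_mbin 1 q1) (has_sum_mbin 0 q1).
have -> : (1 - q) ^- 2 - (1 - q) ^- 1 = q / (1 - q) ^+ 2 by field.
apply: eq_has_sum => t; rewrite mbin_0 -mulrBl expr1; congr (_ * _).
by rewrite /mbin bin1 addn1 -natr1 addrK.
Qed.

Lemma qvar_sub1_le (w : C) : nm (tpi R * w) <= 1 / 2 -> nm (1 - ee w) <= 6 * (nm (tpi R) * nm w).
Proof.
move=> h; have := cexp_sub_le h; rewrite -qvarE -nmM => h1.
have := nmD (ee w - 1 - tpi R * w) (tpi R * w); rewrite subrK nm_subC.
have := nm_ge0 (tpi R * w); nra.
Qed.

(** This is pi cot(pi x). *)
Definition ctg (x : C) : C := - (tpi R / 2) * ((1 + ee x) / (1 - ee x)).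

Lemma ctgE x : 0 < complex.Im x -> ctg x = - (tpi R / 2) * (2 * Tser 0 (ee x) - 1).
Proof.
move=> x0; have q1 := nm_qvar_lt1 x0; have n0 := one_sub_neq0 q1.
by rewrite /ctg Tser0E //; congr (_ * _); field.
Qed.

Lemma ctg_pair (a b : C) : 1 - ee (a + b) != 0 -> 1 - ee (a - b) != 0 ->
  ctg (a + b) + ctg (a - b) = - tpi R * ((1 - ee (a + a)) / ((1 - ee (a + b)) * (1 - ee (a - b)))).
Proof.
have -> : ee (a + a) = ee (a + b) * ee (a - b) by rewrite -qvarD; congr ee; ring.
by rewrite /ctg; move: (ee (a + b)) (ee (a - b)) => X Y X0 Y0; field; rewrite X0 Y0.
Qed.

Lemma invr_mul_le (a b : R) : a^-1 * b^-1 <= a ^- 2 + b ^- 2.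
Proof.
rewrite -!exprVn; move: (a^-1) (b^-1) => x y.
have : 0 <= (x - y) ^+ 2 by exact: sqr_ge0.
have := sqr_ge0 x; have := sqr_ge0 y; nra.
Qed.

(** The scheme of the Lipschitz formula in weight 1. The terms at m and -m are paired because a
    single one decays only like 1 / m; summing over all m counts each pair twice, whence the factor
    2. *)
Lemma cotangent (u : C) : 0 < complex.Im u ->
  has_sum (fun m : int => (u + m%:~R)^-1 + (u - m%:~R)^-1) (2 * ctg u).
Proof.
move=> i0.
pose nn M : nat := M.*2.+1.
have nnC M : (nn M)%:R != 0 :> C by rewrite pnatr_eq0.
have nnR M : 0 < (nn M)%:R :> R by [].
have [x xE] : exists x : nat -> int -> C, forall M j, x M j = (u + j%:~R) / (nn M)%:R.
  by exists (fun M j => (u + j%:~R) / (nn M)%:R).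
have Imx M j : complex.Im (x M j) = (nn M)%:R^-1 * complex.Im u.
  by rewrite xE mulrC natC invC ImZ ImD Im_int addr0.
have xH M j : 0 < complex.Im (x M j) by rewrite Imx mulr_gt0 // invr_gt0.
have x1 M j := one_sub_neq0 (nm_qvar_lt1 (xH M j)).
pose f M (j : int) := if (`|j|%N <= M)%N then (nn M)%:R^-1 * (ctg (x M j) + ctg (x M (- j))) else 0.
have claim1 M : has_sum (f M) (2 * ctg u).
  have := @has_sum_fin _ _ (f M) (zr M) (zr_uniq M).
  rewrite (eq_big_seq (fun j => (nn M)%:R^-1 * (ctg (x M j) + ctg (x M (- j))))); last first.
    by move=> j; rewrite mem_zr /f => ->.
  rewrite -mulr_sumr big_split /= (sum_zrN M (fun j => ctg (x M j))).
  have -> : \sum_(j <- zr M) ctg (x M j) = (nn M)%:R * ctg u.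
    under eq_bigr do rewrite ctgE // mulrBr mulr1 mulrA xE.
    rewrite sumrB sum_zr -mulr_sumr Tser_dist // expr1 ctgE //.
    by rewrite sum_zr sumr_const card_ord -[X in _ - X]mulr_natr /nn; ring.
  have -> : (nn M)%:R^-1 * ((nn M)%:R * ctg u + (nn M)%:R * ctg u) = 2 * ctg u by field.
  by apply=> j; rewrite mem_zr /f => /negPf ->.
have uj (j : int) : u + j%:~R != 0.
  by apply: Im_gt0_neq0; rewrite ImD Im_int addr0.
have uN (j : int) : u - j%:~R = u + (- j)%:~R by rewrite rmorphN.
have claim3 j : clim \oo%classic (fun M => f M j) ((u + j%:~R)^-1 + (u - j%:~R)^-1).
  have one (i : int) : clim \oo%classic (fun M => (nn M)%:R^-1 * ctg (x M i)) (u + i%:~R)^-1.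
    have e1 : \forall M \near \oo%classic, (u + i%:~R)^-1 * (- (tpi R / 2)) * ((1 + ee (x M i)) *
        ((1 - ee (x M i)) / x M i)^-1) = (nn M)%:R^-1 * ctg (x M i).
      apply: nearW => M; rewrite /ctg invf_div {2}(xE M i); field.
      by rewrite uj x1 nnC.
    apply: eq_near_clim e1 _.
    have cx : clim \oo%classic (fun M => x M i) 0.
      by under eq_fun do rewrite xE; exact: clim_div_nat.
    have nx : \forall M \near \oo%classic, x M i != 0.
      by apply: nearW => M; exact: Im_gt0_neq0.
    have tp0 : - tpi R != 0 by rewrite oppr_eq0 tpi_neq0.
    have l1 := clim_qvar_sub1 _ cx nx.
    have l2 : clim \oo%classic (fun M => ee (x M i)) 1.
      have l3 : clim \oo%classic (fun M => (1 - ee (x M i)) / x M i * x M i) (- tpi R * 0).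
        by apply: climM => //; exact: l1.
      have : clim \oo%classic (fun M => 1 - (1 - ee (x M i)) / x M i * x M i) (1 - - tpi R * 0).
        by apply: climB => //; exact: clim_cst.
      rewrite mulr0 subr0; apply: eq_near_clim; apply: nearW => M.
      by rewrite divfK ?Im_gt0_neq0 // opprB addrC subrK.
    suff e2 : (u + i%:~R)^-1 * (- (tpi R / 2)) * ((1 + 1) * (- tpi R)^-1) = (u + i%:~R)^-1.
      rewrite -[X in clim _ _ X]e2.
      apply: climM; first exact: clim_cst.
      apply: climM; first by apply: climD => //; exact: clim_cst.
      by apply: climV => //; exact: l1.
    by field; rewrite uj tpi_neq0.
  have := climD _ (one j) (one (- j)); rewrite -uN => /(_ _).
  apply: eq_near_clim; exists `|j|%N => // M /= jM.
  by rewrite /f jM mulrDr.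
have [c c0 Hc] := qvar_sub1_ge (complex.Im u).
pose A := nm (tpi R).
have A0 : 0 < A by rewrite nm_gt0 tpi_neq0.
pose K := 12 * A ^+ 2 * nm u * c ^- 2.
have K0 : 0 <= K by rewrite !mulr_ge0 ?nm_ge0 ?sqr_ge0 // invr_ge0 sqr_ge0.
(* The first bound keeps the real parts of the points (u + j) / (2 M + 1) within 3/4, as
   [qvar_sub1_ge] requires; the second brings 2 u / (2 M + 1) into the range of the linear estimate
   of 1 - exp. *)
pose M0 := maxn (Num.truncn (2 * `|complex.Re u|)).+1 (Num.truncn (4 * A * nm u)).+1.
have claim2 : \forall M \near \oo%classic, forall j : int,
    nm (f M j) <= K * (nm (u + j%:~R) ^- 2 + nm (u + (- j)%:~R) ^- 2).
  exists M0 => // M /= hM j.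
  have r1 : 2 * `|complex.Re u| <= M%:R.
    apply: le_trans (ltW (truncnS_gt _)) _; rewrite ler_nat.
    by apply: leq_trans hM; exact: leq_maxl.
  have r2 : 4 * A * nm u <= M%:R.
    apply: le_trans (ltW (truncnS_gt _)) _; rewrite ler_nat.
    by apply: leq_trans hM; exact: leq_maxr.
  have nE : (nn M)%:R = 2 * M%:R + 1 :> R by rewrite /nn -natr1 -mul2n natrM.
  rewrite /f; case: ifPn => [jM|_]; last first.
    by rewrite nm0 mulr_ge0 // addr_ge0 // invr_ge0 sqr_ge0.
  have lb (i : int) : (`|i| <= M)%N -> c * nm (x M i) <= nm (1 - ee (x M i)).
    move=> iM; apply: Hc; last first.
      rewrite (ltW (xH _ _)) /= Imx ler_piMl ?(ltW i0) // invf_le1 // ler1n //.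
    rewrite xE mulrC natC invC ReZ ReD Re_int normrM ger0_norm ?invr_ge0 // mulrC ler_pdivrMr //.
    apply: le_trans (ler_normD _ _) _; rewrite -intr_norm nE.
    have : `|i|%:~R <= M%:R :> R by rewrite -[M%:R]/(M%:Z%:~R) ler_int; lia.
    move: r1; lra.
  pose a := u / (nn M)%:R; pose b := j%:~R / (nn M)%:R : C.
  have xa : x M j = a + b by rewrite xE mulrDl.
  have xb : x M (- j) = a - b by rewrite xE mulrDl rmorphN mulNr.
  have lb1 := lb j jM; have := lb (- j); rewrite abszN => /(_ jM) lb2.
  rewrite xa xb ctg_pair -?xa -?xb // !nmM nmN nmV nm_nat nmV (nmM (1 - _)) -/A.
  have ub : nm (1 - ee (a + a)) <= 12 * A * nm u / (nn M)%:R.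
    have aE : nm (a + a) = 2 * nm u / (nn M)%:R.
      have -> : a + a = 2%:R * (u / (nn M)%:R) by rewrite /a; ring.
      by rewrite nmM nm_nat nmM nmV nm_nat mulrA.
    apply: le_trans (qvar_sub1_le _) _; rewrite ?nmM aE -/A; last by rewrite !mulrA; lra.
    rewrite !mulrA ler_pdivrMr // nE; have := mulr_ge0 (ltW A0) (nm_ge0 u); move: r2; lra.
  have p1 : 0 < c * nm (x M j) by rewrite mulr_gt0 // nm_gt0 Im_gt0_neq0.
  have p2 : 0 < c * nm (x M (- j)) by rewrite mulr_gt0 // nm_gt0 Im_gt0_neq0.
  have ib : (nm (1 - ee (x M j)) * nm (1 - ee (x M (- j))))^-1 <=
     (c * nm (x M j) * (c * nm (x M (- j))))^-1.
    have q3 : 0 < nm (1 - ee (x M j)) * nm (1 - ee (x M (- j))).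
      by rewrite mulr_gt0 // nm_gt0 x1.
    have q4 : 0 < c * nm (x M j) * (c * nm (x M (- j))) by rewrite mulr_gt0.
    by rewrite lef_pV2 ?posrE // ler_pM // ltW.
  have xn i : nm (x M i) = nm (u + i%:~R) / (nn M)%:R by rewrite xE nmM nmV nm_nat.
  apply: (@le_trans _ _ ((nn M)%:R^-1 * (A * (12 * A * nm u / (nn M)%:R *
      (c * nm (x M j) * (c * nm (x M (- j))))^-1)))).
    rewrite ler_wpM2l ?invr_ge0 // ler_wpM2l ?(ltW A0) // ler_pM ?nm_ge0 //.
    by rewrite invr_ge0 mulr_ge0 ?nm_ge0.
  have -> : (nn M)%:R^-1 * (A * (12 * A * nm u / (nn M)%:R *
      (c * nm (x M j) * (c * nm (x M (- j))))^-1)) =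
      K * ((nm (u + j%:~R))^-1 * (nm (u + (- j)%:~R))^-1).
    rewrite !xn /K; field.
    by rewrite !gt_eqF // nm_gt0.
  by rewrite ler_wpM2l // invr_mul_le.
have bs0 := asum_lattice_row (isT : (1 < 2)%N) i0.
have bs1 : bsum (fun j : int => nm (u + (- j)%:~R) ^- 2).
  exact: (bsum_inj (@oppr_inj int) bs0).
have bs := bsumZ K0 (bsumD bs0 bs1).
have [l Hl] : exists l, has_sum (fun m : int => (u + m%:~R)^-1 + (u - m%:~R)^-1) l.
  apply: asum_has_sum; apply: le_bsum bs => j.
  by apply: clim_nm_le (claim3 j) _; apply: filterS claim2 => M; exact.
have cl : clim \oo%classic (fun _ : nat => 2 * ctg u) l.
  by apply: (tannery (u := f) _ bs claim2 claim3 _ Hl); apply: nearW.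
by rewrite -(clim_unique _ cl (clim_cst _ _)).
Qed.

Lemma lambert_asum k (q : C) : nm q < 1 ->
  asum (fun x : nat * nat => x.2.+1%:R ^+ k * q ^+ (x.1.+1 * x.2.+1)).
Proof.
move=> q1; pose r := nm q; have r0 : 0 <= r := nm_ge0 q.
have hr : 0 <= r < 1 by rewrite r0.
have [M HM] := bsum_pow k hr.
have b2 : bsum (fun t : nat => t.+1%:R ^+ k * r ^+ t.+1) := bsum_inj succn_inj (bsum_pow k hr).
have b1 : bsum (fun j : nat => r ^+ j).
  by apply: le_bsum (bsum_pow 0 hr) => n; rewrite expr0 mul1r.
apply: le_bsum (bsum_prod _ _ b1 b2) => [[j t] /=|j|t]; last 2 first.
- exact: exprn_ge0.
- by rewrite mulr_ge0 ?exprn_ge0.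
rewrite nmM !nmX nm_nat -/r mulrCA ler_wpM2l ?exprn_ge0 // -exprD.
by rewrite ler_wiXn2l // ?(ltW q1) //; nia.
Qed.

Lemma lambert_sum k (psi phi : nat -> C) (q : C) (T : nat -> C) : (0 < k)%N -> nm q < 1 ->
  (forall n, nm (psi n) <= 1) -> (forall n, nm (phi n) <= 1) ->
  (forall m, (0 < m)%N -> has_sum (fun t : nat => phi t * t%:R ^+ k * q ^+ (m * t)) (T m)) ->
  exists2 L, has_sum (fun n : nat => (if n == 0%N then 0 else
      \sum_(t <- divisors n) psi (n %/ t)%N * phi t * t%:R ^+ k) * q ^+ n) L &
    has_sum (fun m : nat => psi m.+1 * T m.+1) L.
Proof.
move=> k0 q1 hpsi hphi HT.
pose f (j t : nat) := psi j * phi t * t%:R ^+ k * q ^+ (j * t).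
have af : asum (fun x : nat * nat => f x.1.+1 x.2.+1).
  apply: le_bsum (lambert_asum k q1) => -[j t] /=.
  rewrite /f -[X in nm X]mulrA nmM ler_piMl ?nm_ge0 // nmM.
  by rewrite mulr_ile1 ?nm_ge0.
have Hrow (j : nat) : has_sum (fun t : nat => f j.+1 t.+1) (psi j.+1 * T j.+1).
  have h := HT j.+1 isT.
  have at0 : asum (fun t : nat => phi t * t%:R ^+ k * q ^+ (j.+1 * t)).
    apply: le_bsum (asum_pow k q1) => t; rewrite -mulrA nmM.
    rewrite -[leRHS]mul1r ler_pM ?nm_ge0 //.
    rewrite !nmM !nmX ler_wpM2l ?exprn_ge0 ?nm_ge0 // ler_wiXn2l ?nm_ge0 ?(ltW q1) //.
    by rewrite mulSn leq_addr.
  have := has_sumZ (psi j.+1) (has_sum_succE h at0).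
  rewrite expr0n gtn_eqF // mulr0 mul0r subr0; apply: eq_has_sum => t.
  by rewrite /f !mulrA.
have [L HL HL'] := asum_has_sum_pair af Hrow.
exists L => //; have := lambert af HL; apply: eq_has_sum => n.
have [->|n0] := eqVneq n 0%N; first by rewrite mul0r.
rewrite mulr_suml [LHS]big_seq [RHS]big_seq; apply: eq_bigr => t.
rewrite -dvdn_divisors ?lt0n // => tn.
by rewrite /f divnK.
Qed.

(** The divisor sum sigma_1(n), extended by 0. *)
Definition su (n : nat) : C := if n == 0%N then 0 else \sum_(t <- divisors n) t%:R.

Lemma nm_su n : nm (su n) <= 2 * n%:R ^+ 2.
Proof.
rewrite /su; case: eqP => [->|/eqP n0]; first by rewrite nm0 expr0n mulr0.
apply: le_trans (nm_sum _ _ _) _; under eq_bigr do rewrite nm_nat.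
apply: (@le_trans _ _ (\sum_(t <- index_iota 0 n.+1) n%:R)).
  apply: (@le_trans _ _ (\sum_(t <- divisors n) n%:R)).
    rewrite big_seq [leRHS]big_seq; apply: ler_sum => t.
    by rewrite -dvdn_divisors ?lt0n // => /dvdn_leq h; rewrite ler_nat h // lt0n.
  apply: sub_sum_le => // [|t]; first exact: divisors_uniq.
  by rewrite -dvdn_divisors ?lt0n // mem_index_iota ltnS => /dvdn_leq; apply; rewrite lt0n.
rewrite big_const_seq count_predT iter_addr_0 size_iota subn0 -mulr_natr -natr1 expr2.
have : 1 <= n%:R :> R by rewrite ler1n lt0n.
nra.
Qed.

Definition lam := qser su.

Lemma lam_rows (z : C) : 0 < complex.Im z ->
  has_sum (fun m : nat => Tser 1 (ee (z * m.+1%:R))) (lam z).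
Proof.
move=> z0; have q1 := nm_qvar_lt1 z0.
have n1 (n : nat) : nm (1 : C) <= 1 by rewrite nm1.
have HT m : (0 < m)%N -> has_sum (fun t : nat => 1 * t%:R ^+ 1 * ee z ^+ (m * t)) (Tser 1 (ee (z * m%:R))).
  move=> m0; have qm : nm (ee (z * m%:R)) < 1.
    by apply: nm_qvar_lt1; rewrite mulrC natC ImZ mulr_gt0 // ltr0n.
  by apply: eq_has_sum (TserP 1 qm) => t; rewrite mul1r exprM qvarMn.
have [L H1 H2] := @lambert_sum 1 (fun=> 1) (fun=> 1) (ee z) _ isT q1 n1 n1 HT.
have -> : lam z = L.
  apply: tsumE; apply: eq_has_sum H1 => n; congr (_ * _); rewrite /su.
  by case: eqP => // _; apply: eq_bigr => t _; rewrite !mul1r expr1.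
by apply: eq_has_sum H2 => m; rewrite mul1r.
Qed.

Lemma has_sum_int (f : int -> C) a b :
  has_sum (fun n : nat => f n.+1%:Z) a -> has_sum (fun n : nat => f (- n.+1%:Z)) b ->
  has_sum f (f 0 + a + b).
Proof.
move=> Ha Hb.
have Hp : has_sum (fun n => if 0 < n then f n else 0) a.
  apply/(has_sum_supp (h := fun n : nat => n.+1%:Z) (g := fun n => `|n|.-1)%N).
  - move=> n; case: ifP; rewrite ?eqxx // => n0 _; lia.
  - by move=> n; lia.
  by apply: eq_has_sum Ha => n; rewrite ltz_nat.
have Hn : has_sum (fun n => if n < 0 then f n else 0) b.
  apply/(has_sum_supp (h := fun n : nat => - n.+1%:Z) (g := fun n => `|n|.-1)%N).
  - move=> n; case: ifP; rewrite ?eqxx // => n0 _; lia.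
  - by move=> n; lia.
  by apply: eq_has_sum Hb => n.
have H0 : has_sum (fun n : int => if n == 0 then f n else 0) (f 0).
  have := @has_sum1 _ _ (fun n : int => if n == 0 then f n else 0) 0.
  by rewrite eqxx; apply=> i /negPf ->.
apply: eq_has_sum (has_sumD (has_sumD H0 Hp) Hn) => n.
by case: ltrgt0P => // _; rewrite ?addr0 ?add0r.
Qed.

Lemma w32_int_bsum : bsum (fun n : int => w32 R `|n|%N).
Proof. by apply: (bsum_int (h := w32 R)) (w32_bsum R) => // n; rewrite ltW // w32_gt0. Qed.

Lemma int_inv2_asum : asum (fun n : int => (n%:~R : C) ^- 2).
Proof.
apply: le_bsum (bsumZ (ler0n _ 4) w32_int_bsum) => n.
have [->|n0] := eqVneq n 0.
  by rewrite expr0n invr0 nm0 mulr_ge0 // ltW // w32_gt0.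
rewrite nmV nmX nm_int.
apply: le_trans (ler_wpM2l (ler0n _ 4) (w32_sqr _ _)).
have nE : `|n|%:~R = (`|n|%N)%:R :> R by rewrite natr_absz.
have n1 : 1 <= (`|n|%N)%:R :> R by rewrite ler1n absz_gt0.
rewrite nE -[(`|n|%N).+1%:R]natr1; move: ((`|n|%N)%:R : R) n1 => x x1.
have -> : 4 / (x + 1) ^+ 2 = (((x + 1) / 2) ^+ 2)^-1.
  by field; lra.
rewrite lef_pV2 ?posrE ?exprn_gt0 //; try lra.
by apply: lerXn2r; rewrite ?nnegrE; lra.
Qed.

(** Twice zeta(2): the term n = 0 is the inverse of 0, which is 0. *)
Definition Z2 : C := tsum (fun n : int => (n%:~R : C) ^- 2).

Lemma Im_mul_nat (z : C) n : (0 < n)%N -> 0 < complex.Im z -> 0 < complex.Im (z * n%:R).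
Proof. by move=> n0 z0; rewrite mulrC natC ImZ mulr_gt0 // ltr0n. Qed.

Definition row2 (z : C) (m : int) : C :=
  if m == 0 then Z2 else lipc R 2 * Tser 1 (ee (z * `|m|%N%:R)).

Lemma row2P (z : C) (m : int) : 0 < complex.Im z ->
  has_sum (fun n : int => (m%:~R * z + n%:~R) ^- 2) (row2 z m).
Proof.
move=> z0; rewrite /row2; case: eqP => [->|/eqP m0].
  by apply: eq_has_sum (tsumP int_inv2_asum) => n; rewrite mul0r add0r.
have H := lipschitz_formula (isT : (1 < 2)%N) (Im_mul_nat (n := `|m|%N) _ z0).
rewrite absz_gt0 in H; have {}H := H m0.
have [mp|mn] := leP 0 m.
  by apply: eq_has_sum H => n; rewrite natr_absz ger0_norm // (mulrC z).
have := has_sum_reindex (@opprK int) (@opprK int) H; apply: eq_has_sum => n.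
rewrite natr_absz ltr0_norm // !rmorphN /= (mulrC z) mulNr -opprD; congr (_^-1).
by rewrite sqrrN.
Qed.

(** The Eisenstein series of weight 2, summed over n within each row and then over the rows; in this
    weight the order of summation matters. *)
Definition G2 (z : C) : C := Z2 + 2 * (lipc R 2 * lam z).

Lemma G2P (z : C) : 0 < complex.Im z -> has_sum (row2 z) (G2 z).
Proof.
move=> z0; have H := has_sumZ (lipc R 2) (lam_rows z0).
have := has_sum_int (f := row2 z) H H.
rewrite /row2 eqxx -addrA -mulr2n -mulr_natl; exact.
Qed.

Lemma clim_inv_nat (u : nat -> C) (k : R) : 0 < k ->
  (forall M : nat, k * M%:R <= nm (u M)) -> clim \oo%classic (fun M => (u M)^-1) 0.
Proof.
move=> k0 H e e0; exists (Num.truncn (k^-1 / e)).+1 => // M /= hM.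
have M0 : 0 < M%:R :> R by rewrite ltr0n (leq_trans _ hM).
have p0 : 0 < k * M%:R by rewrite mulr_gt0.
rewrite subr0 nmV; apply: (@le_lt_trans _ _ (k * M%:R)^-1).
  by rewrite lef_pV2 ?posrE // (lt_le_trans p0).
rewrite invfM ltr_pdivrMr // mulrC -ltr_pdivrMr //.
by apply: lt_le_trans (truncnS_gt _) _; rewrite ler_nat.
Qed.

Lemma oppV_Im (z : C) : 0 < complex.Im z -> 0 < complex.Im (- z^-1).
Proof.
case: z => x y /= y0; rewrite opprK divr_gt0 //.
by rewrite ltr_wpDl ?sqr_ge0 // exprn_gt0.
Qed.

Lemma expR_natN_lt (k e : R) : 0 < k -> 0 < e ->
  \forall M \near \oo%classic, expR (- (k * M%:R)) < e.
Proof.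
move=> k0 e0; exists (Num.truncn (k^-1 / e)).+1 => // M /= hM.
have M0 : 0 < M%:R :> R by rewrite ltr0n (leq_trans _ hM).
have h : k^-1 / e < M%:R by apply: lt_le_trans (truncnS_gt _) _; rewrite ler_nat.
rewrite expRN; apply: (@le_lt_trans _ _ (k * M%:R)^-1).
  rewrite lef_pV2 ?posrE ?mulr_gt0 ?expR_gt0 //.
  by apply: le_trans (expR_ge1Dx _); rewrite lerDr.
by rewrite invfM ltr_pdivrMr // mulrC -ltr_pdivrMr.
Qed.

Lemma clim_ctg (v : C) : 0 < complex.Im v ->
  clim \oo%classic (fun M : nat => ctg ((M%:R + 2^-1) * v)) (- (tpi R / 2)).
Proof.
move=> v0.
have ce0 : clim \oo%classic (fun M : nat => ee ((M%:R + 2^-1) * v)) 0.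
  apply: (@clim_squeeze _ _ _ _ _ _ (fun M : nat => expR (- (2 * pi * complex.Im v * M%:R)))).
    apply: nearW => M; rewrite subr0 nm_qvar ler_expR lerN2.
    have -> : (M%:R + 2^-1 : C) = (M%:R + 2^-1 : R)%:C by rewrite rmorphD /= rmorph_nat fmorphV /= rmorph_nat.
    rewrite ImZ; have := pi_gt0 R; move: v0 => *.
    have : 0 <= pi * complex.Im v by rewrite mulr_ge0 // ltW.
    nra.
  move=> e e0; apply: expR_natN_lt => //; by rewrite !mulr_gt0 // pi_gt0.
have : clim \oo%classic (fun M : nat => ctg ((M%:R + 2^-1) * v)) (- (tpi R / 2) * ((1 + 0) / (1 - 0))).
  apply: climM; first exact: clim_cst.
  apply: climM; first by apply: climD => //; exact: clim_cst.
  apply: climV; first by rewrite subr0 oner_neq0.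
  by apply: climB => //; exact: clim_cst.
by rewrite addr0 subr0 divr1 mulr1.
Qed.

(** With w = m z + n, subtracting 1 / (w - 1/2) - 1 / (w + 1/2) from w^-2 leaves an absolutely
    summable family, for which rows and columns may be exchanged. The subtracted terms telescope:
    they sum to 0 along rows, but summing their columns over |n| <= M gives a cotangent whose limit
    is the anomaly. *)
Lemma G2_S (z : C) : 0 < complex.Im z -> G2 (- z^-1) = z ^+ 2 * G2 z - tpi R * z.
Proof.
move=> z0; have zn0 := Im_gt0_neq0 z0; have z'0 := oppV_Im z0.
have [c c0 Hc] := lattice_ge z0.
pose w (m n : int) : C := m%:~R * z + n%:~R.
pose f (m n : int) : C := (w m n - 2^-1)^-1.
pose B m n := f m n - f m (n + 1).
pose a m n := w m n ^- 2 - B m n.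
pose s (m n : int) : R := `|m|%:~R + `|n|%:~R.
(* Twice w + 1/2 or w - 1/2 is the lattice vector with coordinates 2 m and 2 n + 1 or 2 n - 1, which
   is never 0. *)
have shalf (m n : int) (b : bool) : c / 2 * s m n <= nm (w m n + (-1) ^+ b * 2^-1) /\
    c / 2 <= nm (w m n + (-1) ^+ b * 2^-1).
  have -> : w m n + (-1) ^+ b * 2^-1 = ((2 * m)%:~R * z + (2 * n + (-1) ^+ b)%:~R) / 2%:R.
    by rewrite intrD !intrM rmorphXn /= rmorphN /w; field.
  rewrite nmM nmV nm_nat; have := Hc (2 * m) (2 * n + (-1) ^+ b).
  have h1 : `|n|%:~R <= `|2 * n + (-1) ^+ b|%:~R :> R by rewrite ler_int; case: (b); rewrite ?expr1 ?expr0; lia.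
  have h2 : 1 <= `|2 * n + (-1) ^+ b|%:~R :> R by rewrite ler1z; case: (b); rewrite ?expr1 ?expr0; lia.
  have h3 : `|m|%:~R <= `|2 * m|%:~R :> R by rewrite ler_int; lia.
  have h4 : 0 <= `|2 * m|%:~R :> R by rewrite ler0z.
  rewrite /s => h; split; rewrite ler_pdivlMr //.
    have -> : c / 2 * (`|m|%:~R + `|n|%:~R) * 2 = c * (`|m|%:~R + `|n|%:~R) by field.
    by apply: le_trans h; rewrite ler_wpM2l ?(ltW c0) // lerD.
  by rewrite divfK //; apply: le_trans h; rewrite ler_peMr ?(ltW c0) //; lra.
have wm m n : c / 2 * s m n <= nm (w m n - 2^-1) /\ c / 2 <= nm (w m n - 2^-1).
  by have := shalf m n true; rewrite expr1 mulN1r.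
have wp m n : c / 2 * s m n <= nm (w m n + 2^-1) /\ c / 2 <= nm (w m n + 2^-1).
  by have := shalf m n false; rewrite expr0 mul1r.
have c20 : 0 < c / 2 by rewrite divr_gt0.
have wm0 m n : w m n - 2^-1 != 0 by rewrite -nm_gt0 (lt_le_trans c20) //; case: (wm m n).
have wp0 m n : w m n + 2^-1 != 0 by rewrite -nm_gt0 (lt_le_trans c20) //; case: (wp m n).
have fS m n : f m (n + 1) = (w m n + 2^-1)^-1.
  by rewrite /f /w intrD; congr (_^-1); field.
pose K := 16 * c ^- 4 + 4.
have K0 : 0 <= K by rewrite addr_ge0 // mulr_ge0 // invr_ge0 exprn_ge0 // ltW.
have ab m n : nm (a m n) <= K * (w32 R `|m|%N * w32 R `|n|%N).
  have ww : 0 < w32 R `|m|%N * w32 R `|n|%N by rewrite mulr_gt0 ?w32_gt0.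
  have [mn0|mn0] := eqVneq (s m n) 0.
    have [m0 n0] : m = 0 /\ n = 0.
      move: mn0; rewrite /s -intrD => /eqP; rewrite intr_eq0 => /eqP h; split; lia.
    rewrite m0 n0 /a /B fS /f /w mul0r addr0 expr0n /= invr0 sub0r sub0r add0r.
    rewrite !invrN !invrK -opprD opprK [X in nm X](_ : _ = 4%:R); last by ring.
    rewrite nm_nat /w32 /= sqrtr1 mulr1 invr1 mulr1 /K.
    by rewrite mulr1 lerDr mulr_ge0 // invr_ge0 exprn_ge0 // ltW.
  have s1 : 1 <= s m n.
    rewrite /s -intrD ler1z; move: mn0; rewrite /s -intrD intr_eq0; lia.
  have wn0 : w m n != 0.
    by rewrite -nm_gt0 (lt_le_trans _ (Hc m n)) // mulr_gt0 // (lt_le_trans ltr01).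
  have -> : a m n = - (4^-1 * (w m n ^- 2 * ((w m n - 2^-1)^-1 * (w m n + 2^-1)^-1))).
    rewrite /a /B fS /f; move: (wm0 m n) (wp0 m n) wn0.
    move: (w m n) => W h1 h2 h3; field.
    have -> : W * 2 - 1 = 2 * (W - 2^-1) by field.
    have -> : W * 2 + 1 = 2 * (W + 2^-1) by field.
    by rewrite !mulf_neq0 // ?h3.
  rewrite nmN !nmM !nmV nmX nm_nat.
  have [w1 _] := wm m n; have [w2 _] := wp m n.
  have sp : 0 < s m n by lra.
  have i1 : (nm (w m n - 2^-1))^-1 <= (c / 2 * s m n)^-1.
    by rewrite lef_pV2 ?posrE ?mulr_gt0 // nm_gt0 wm0.
  have i2 : (nm (w m n + 2^-1))^-1 <= (c / 2 * s m n)^-1.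
    by rewrite lef_pV2 ?posrE ?mulr_gt0 // nm_gt0 wp0.
  have i3 : (nm (w m n) ^+ 2)^-1 <= ((c * s m n) ^+ 2)^-1.
    rewrite lef_pV2 ?posrE ?exprn_gt0 ?nm_gt0 ?mulr_gt0 //.
    by apply: lerXn2r; rewrite ?nnegrE ?nm_ge0 ?mulr_ge0 ?(ltW c0) ?(ltW sp) //; exact: Hc.
  apply: (@le_trans _ _ (4^-1 * (((c * s m n) ^+ 2)^-1 * ((c / 2 * s m n)^-1 * (c / 2 * s m n)^-1)))).
    rewrite ler_wpM2l ?invr_ge0 // ler_pM ?invr_ge0 ?sqr_ge0 // ?mulr_ge0 ?invr_ge0 ?nm_ge0 //.
    by rewrite ler_pM ?invr_ge0 ?nm_ge0.
  have -> : 4^-1 * (((c * s m n) ^+ 2)^-1 * ((c / 2 * s m n)^-1 * (c / 2 * s m n)^-1)) =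
      c ^- 4 * (s m n ^+ 4)^-1.
    by field; rewrite !gt_eqF.
  have cube := w32_cube R `|m|%N `|n|%N.
  rewrite !natr_absz -/(s m n) in cube.
  have s4 : (s m n ^+ 4)^-1 <= 16 * ((s m n + 1) ^+ 3)^-1.
    have -> : 16 * ((s m n + 1) ^+ 3)^-1 = ((s m n + 1) ^+ 3 / 16)^-1 by field; lra.
    rewrite lef_pV2 ?posrE ?exprn_gt0 ?divr_gt0 ?exprn_gt0 //; try lra.
    rewrite ler_pdivrMr //.
    have h1 : (s m n + 1) ^+ 3 <= (2 * s m n) ^+ 3.
      by apply: lerXn2r; rewrite ?nnegrE; lra.
    apply: le_trans h1 _; rewrite exprMn [s m n ^+ 4]exprS.
    have : 0 <= s m n ^+ 3 by rewrite exprn_ge0 // ltW.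
    nra.
  have c4 : 0 <= c ^- 4 by rewrite invr_ge0 exprn_ge0 // ltW.
  apply: le_trans (ler_wpM2l c4 (le_trans s4 (ler_wpM2l (ler0n _ 16) cube))) _.
  by rewrite mulrA (mulrC _ 16) /K ler_wpM2r ?(ltW ww) // lerDl.
have aA : asum (fun x : int * int => a x.1 x.2).
  have := bsumZ K0 (bsum_prod _ _ w32_int_bsum w32_int_bsum).
  move=> H; apply: (le_bsum _ (H _ _)) => [x|n|n]; first exact: ab.
  - exact/ltW/w32_gt0.
  - exact/ltW/w32_gt0.
have f0 m (u : nat -> int) : (forall M, (M <= `|u M|)%N) -> clim \oo%classic (fun M => f m (u M)) 0.
  move=> hu; apply: (clim_inv_nat c20) => M; apply: le_trans (wm m (u M)).1.
  rewrite ler_wpM2l ?(ltW c20) // /s; apply: (@le_trans _ _ (`|u M|%:~R)).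
    rewrite -[M%:R]/(M%:Z%:~R) ler_int; have := hu M; lia.
  by rewrite lerDr ler0z.
have Brow m : has_sum (B m) 0.
  have aw : asum (fun n : int => w m n ^- 2).
    have [m0|m0] := eqVneq m 0.
      apply: le_bsum int_inv2_asum => n; by rewrite /w m0 mul0r add0r.
    have H := asum_lattice_row (isT : (1 < 2)%N) (Im_mul_nat (n := `|m|%N) _ z0).
    rewrite absz_gt0 in H; have {}H := H m0.
    have [mp|mn] := leP 0 m.
      by apply: le_bsum H => n; rewrite nmV nmX natr_absz ger0_norm // (mulrC z).
    apply: le_bsum (bsum_inj (@oppr_inj int) H) => n.
    rewrite nmV nmX natr_absz ltr0_norm // !rmorphN /= (mulrC z) mulNr -opprD nmN.
    by [].
  have [l Hl] : exists l, has_sum (B m) l.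
    apply: asum_has_sum; apply: le_bsum (bsumD aw (asum_row m aA)) => n.
    have -> : B m n = w m n ^- 2 - a m n by rewrite /a; ring.
    exact: nmB.
  have cl := has_sum_clim_zr Hl.
  have : clim \oo%classic (fun M => \sum_(j <- zr M) B m j) (0 - 0).
    under eq_fun do rewrite sum_zr_telescope.
    by apply: climB; apply: f0 => M; lia.
  by rewrite subr0 => /(clim_unique _ cl) <-.
have arow m : has_sum (a m) (row2 z m).
  by rewrite -[row2 z m]subr0; apply: has_sumB (row2P m z0) (Brow m).
have wcol n : has_sum (fun m => w m n ^- 2) (z ^- 2 * row2 (- z^-1) n).
  have := has_sumZ (z ^- 2) (has_sum_reindex (@opprK int) (@opprK int) (row2P n z'0)).
  apply: eq_has_sum => m; rewrite -invfM -exprMn rmorphN /= /w.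
  have -> : z * (n%:~R * - z^-1 - m%:~R) = - (m%:~R * z + n%:~R) by field.
  by rewrite sqrrN.
have /all_sig[Bc HBc] n : {l : C | has_sum (fun m => B m n) l}.
  apply: cid; have [l Hl] : exists l, has_sum (fun m => a m n) l.
    apply: asum_has_sum; apply: (bsum_inj (h := fun m => (m, n))) aA.
    by move=> m m' [].
  exists (z ^- 2 * row2 (- z^-1) n - l).
  by apply: eq_has_sum (has_sumB (wcol n) Hl) => m; rewrite /a; ring.
have acol n : has_sum (fun m => a m n) (z ^- 2 * row2 (- z^-1) n - Bc n).
  exact: has_sumB (wcol n) (HBc n).
have HA := has_sum_swap aA arow acol (G2P z0).
have HBs : has_sum Bc (z ^- 2 * G2 (- z^-1) - G2 z).
  by apply: eq_has_sum (has_sumB (has_sumZ (z ^- 2) (G2P z'0)) HA) => n; ring.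
have cl := has_sum_clim_zr HBs.
(* The sum over n telescopes for each m; what is left is the partial fraction series of the
   cotangent in m. *)
have e1 M : \sum_(n <- zr M) Bc n = z^-1 * (2 * ctg ((M%:R + 2^-1) * (- z^-1))).
  have h1 := has_sum_sum (zr M) (P := xpredT) (fun n _ => HBc n).
  apply: has_sum_unique h1 _.
  have u0 : 0 < complex.Im ((M%:R + 2^-1) * (- z^-1)).
    have -> : (M%:R + 2^-1 : C) = (M%:R + 2^-1 : R)%:C by rewrite rmorphD /= rmorph_nat fmorphV /= rmorph_nat.
    by rewrite ImZ mulr_gt0 // ltr_wpDl // invr_gt0.
  apply: eq_has_sum (has_sumZ z^-1 (cotangent u0)) => m.
  rewrite sum_zr_telescope fS /f /w.
  set u := (M%:R + 2^-1) * - z^-1.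
  have -> : m%:~R * z + (- M%:Z)%:~R - 2^-1 = z * (u + m%:~R).
    by rewrite rmorphN /= /u; field.
  have -> : m%:~R * z + (M%:Z)%:~R + 2^-1 = - (z * (u - m%:~R)).
    by rewrite /u; field.
  by rewrite invrN opprK !invfM mulrDr.
have cl2 : clim \oo%classic (fun M => \sum_(n <- zr M) Bc n) (z^-1 * (2 * - (tpi R / 2))).
  under eq_fun do rewrite e1.
  apply: climM; first exact: clim_cst.
  by apply: climM; [exact: clim_cst|exact: clim_ctg].
have := clim_unique _ cl cl2 => h.
have {}h : z ^- 2 * G2 (- z^-1) - G2 z = - tpi R / z by rewrite h //; field.
move: (G2 (- z^-1)) (G2 z) h => X Y h.
have -> : X = z ^+ 2 * (z ^- 2 * X - Y) + z ^+ 2 * Y by field.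
by rewrite h; field.
Qed.

Lemma clim_ee1 (T : Type) (F : set_system T) (FF : ProperFilter F) (x : T -> C) :
  clim F x 0 -> (\forall t \near F, x t != 0) -> clim F (fun t => ee (x t)) 1.
Proof.
move=> cx nx; have l1 := clim_qvar_sub1 _ cx nx.
have : clim F (fun M => 1 - (1 - ee (x M)) / x M * x M) (1 - - tpi R * 0).
  apply: climB; first exact: clim_cst.
  by apply: climM => //; exact: l1.
rewrite mulr0 subr0; apply: eq_near_clim; apply: filterS nx => M xM.
by rewrite divfK // opprB addrC subrK.
Qed.

Lemma ee_half : ee (2^-1 : C) = -1.
Proof.
have h : ee (2^-1 : C) ^+ 2 == 1.
  by rewrite -qvarMn mulVf ?pnatr_eq0 // qvar1.
move: h; rewrite sqrf_eq1 => /orP[|/eqP //].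
have -> : (2^-1 : C) = (2^-1 : R)%:C by rewrite fmorphV /= rmorph_nat.
rewrite (negPf (qvar_neq1 _)) //; lra.
Qed.

Lemma lipc2E : lipc R 2 = tpi R ^+ 2.
Proof. by rewrite /lipc /= sqrrN divr1. Qed.

(** The Lipschitz formula of weight 2 at 1/2 + i / (M + 1), M growing: there q tends to -1 and q /
    (1 - q)^2 to -1/4. *)
Lemma half_sum : has_sum (fun n : int => (2^-1 + n%:~R : C) ^- 2) (- (tpi R ^+ 2 / 4)).
Proof.
pose x (M : nat) : C := 'i * (M.+1%:R)^-1.
have xI M : complex.Im (x M) = M.+1%:R^-1 by rewrite /x natC invC mulrC ImZ mulr1.
have x0 M : x M != 0 by apply: Im_gt0_neq0; rewrite xI invr_gt0.
have cx : clim \oo%classic x 0.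
  rewrite -[0](mulr0 'i); apply: climM; first exact: clim_cst.
  apply: (@clim_inv_nat (fun M => M.+1%:R) 1) => // M.
  by rewrite nm_nat mul1r ler_nat.
have tH M : 0 < complex.Im (2^-1 + x M).
  have -> : (2^-1 : C) = (2^-1 : R)%:C by rewrite fmorphV /= rmorph_nat.
  by rewrite ImD xI /= add0r invr_gt0.
have nM (M : nat) (n : int) : (`|n|%N).+1%:R / 4 <= nm (2^-1 + x M + n%:~R).
  apply: le_trans (Re_le_nm _).
  have -> : (2^-1 : C) = (2^-1 : R)%:C by rewrite fmorphV /= rmorph_nat.
  have xR : complex.Re (x M) = 0 by rewrite /x natC invC mulrC ReZ mulr0.
  rewrite !ReD xR Re_int /= addr0 -[(`|n|%N).+1%:R]natr1 natr_absz.
  have [n0|n0] := leP 0 n.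
    rewrite ger0_norm //.
    have : 0 <= n%:~R :> R by rewrite ler0z.
    by move=> ?; rewrite ger0_norm; lra.
  have : n%:~R <= -1 :> R by rewrite -[-1]/((-1)%:~R) ler_int; lia.
  rewrite ltr0_norm // rmorphN /= => ?.
  by rewrite ler0_norm; lra.
have bs := bsumZ (ler0n R 16) w32_int_bsum.
have dom M (n : int) : nm ((2^-1 + x M + n%:~R) ^- 2) <= 16 * w32 R `|n|%N.
  rewrite nmV nmX; apply: (@le_trans _ _ (((`|n|%N).+1%:R / 4) ^+ 2)^-1).
    rewrite lef_pV2 ?posrE ?exprn_gt0 ?divr_gt0 //; last by rewrite (lt_le_trans _ (nM M n)) // divr_gt0.
    by apply: lerXn2r; rewrite ?nnegrE ?nm_ge0 ?divr_ge0.
  have -> : (((`|n|%N).+1%:R / 4) ^+ 2)^-1 = 16 * ((`|n|%N).+1%:R ^+ 2)^-1 :> R.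
    have : 0 < (`|n|%N).+1%:R :> R by [].
    by move: ((`|n|%N).+1%:R : R) => X X0; field; rewrite gt_eqF.
  by rewrite ler_wpM2l ?w32_sqr.
have pt (n : int) : clim \oo%classic (fun M => (2^-1 + x M + n%:~R) ^- 2) ((2^-1 + n%:~R) ^- 2).
  apply: climV.
    rewrite expf_neq0 //.
    have -> : (2^-1 : C) + n%:~R = (2 * n + 1)%:~R / 2%:R.
      by rewrite intrD intrM; field.
    by rewrite mulf_neq0 ?invr_eq0 ?pnatr_eq0 // intr_eq0; lia.
  apply: climX; rewrite -[X in clim _ _ (X + _)]addr0.
  by apply: climD; [apply: climD => //; exact: clim_cst|exact: clim_cst].
have [l Hl] : exists l, has_sum (fun n : int => (2^-1 + n%:~R : C) ^- 2) l.
  apply: asum_has_sum; apply: le_bsum bs => n.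
  by apply: clim_nm_le (pt n) _; apply: nearW => M.
have cl : clim \oo%classic (fun M => lipc R 2 * Tser 1 (ee (2^-1 + x M))) l.
  apply: (tannery (u := fun M (n : int) => (2^-1 + x M + n%:~R) ^- 2) _ bs _ pt _ Hl); apply: nearW => M //.
  exact: lipschitz_formula.
have cl2 : clim \oo%classic (fun M => lipc R 2 * Tser 1 (ee (2^-1 + x M))) (lipc R 2 * (-1 / (1 - -1) ^+ 2)).
  apply: climM; first exact: clim_cst.
  have ce : clim \oo%classic (fun M => ee (2^-1 + x M)) (-1).
    have c1 : clim \oo%classic (fun M => -1 * ee (x M)) (-1 * 1).
      by apply: climM; [exact: clim_cst|apply: clim_ee1 => //; apply: nearW].
    rewrite mulr1 in c1; apply: eq_near_clim c1; apply: nearW => M.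
    by rewrite qvarD ee_half.
  have c2 : clim \oo%classic (fun M => ee (2^-1 + x M) / (1 - ee (2^-1 + x M)) ^+ 2) (-1 / (1 - -1) ^+ 2).
    apply: climM => //; apply: climV.
      by rewrite expf_neq0 // opprK -[1 + 1]/(2%:R) pnatr_eq0.
    by apply: climX; apply: climB => //; exact: clim_cst.
  by apply: eq_near_clim c2; apply: nearW => M; rewrite Tser1E ?nm_qvar_lt1.
suff <- : l = - (tpi R ^+ 2 / 4) by [].
by rewrite (clim_unique _ cl cl2) lipc2E; field.
Qed.

(** Even n contribute Z2 / 4 and odd n a quarter of the sum over the half-integers, which leaves a
    linear equation for Z2. *)
Lemma Z2E : Z2 = - (tpi R ^+ 2 / 12).
Proof.
pose f (n : int) : C := n%:~R ^- 2.
have Hf : has_sum f Z2 := tsumP int_inv2_asum.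
have He : has_sum (fun n => if (2 %| n)%Z then f n else 0) (4^-1 * Z2).
  apply/(has_sum_supp (h := fun n : int => 2 * n) (g := fun n => (n %/ 2)%Z)).
  - by move=> n; case: ifP; rewrite ?eqxx // => d _; rewrite mulrC divzK.
  - by move=> n; rewrite mulKz.
  apply: eq_has_sum (has_sumZ 4^-1 Hf) => n; rewrite dvdz_mulr // /f intrM.
  have [->|n0] := eqVneq n 0; first by rewrite !mulr0 expr0n invr0 mulr0.
  by field; rewrite intr_eq0.
have Ho : has_sum (fun n => if (2 %| n)%Z then 0 else f n) (4^-1 * - (tpi R ^+ 2 / 4)).
  have od (n : int) : (2 %| 2 * n + 1)%Z = false.
    by apply/negbTE/negP => /dvdzP[m]; lia.
  apply/(has_sum_supp (h := fun n : int => 2 * n + 1) (g := fun n => ((n - 1) %/ 2)%Z)).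
  - move=> n; case: ifP; rewrite ?eqxx // => d _.
    have : (2 %| n - 1)%Z.
      have [m [h|h]] : exists m, n = 2 * m \/ n = 2 * m + 1 by exists (n %/ 2)%Z; lia.
        by rewrite h dvdz_mulr in d.
      by rewrite h addrK dvdz_mulr.
    by move=> h; rewrite mulrC divzK // subrK.
  - by move=> n; rewrite addrK mulKz.
  apply: eq_has_sum (has_sumZ 4^-1 half_sum) => n; rewrite od /f.
  have -> : (2 * n + 1)%:~R = 2 * (2^-1 + n%:~R) :> C by rewrite intrD intrM; field.
  move: (2^-1 + n%:~R : C) => X.
  have -> : (2 * X) ^+ 2 = 4 * X ^+ 2 by ring.
  by rewrite (invfM 4).
have := has_sum_unique Hf (eq_has_sum _ (has_sumD He Ho)) => h.
have {}h : Z2 = 4^-1 * Z2 + 4^-1 * - (tpi R ^+ 2 / 4).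
  by apply: h => n; case: ifP; rewrite ?addr0 ?add0r.
have -> : Z2 = 4 / 3 * (Z2 - 4^-1 * Z2) by field.
by rewrite {1}h; field.
Qed.

Definition usr : C -> C := qser (fun n => su n / n%:R).
(** A logarithm of eta given by a convergent series; eta is defined as its exponential, so no branch
    has to be chosen. *)
Definition etal (z : C) : C := tpi R / 24 * z - usr z.
Lemma eta_seal : {f : C -> C | f = fun z => ce (etal z)}. Proof. by exists (fun z => ce (etal z)). Qed.
Definition eta : C -> C := sval eta_seal.
Lemma eta_ce z : eta z = ce (etal z). Proof. by rewrite /eta (svalP eta_seal). Qed.

Lemma radius1_usr : radius1 (fun n => su n / n%:R).
Proof.
apply: (radius1_poly (j := 2) (K := 2)) => -[|n]; first by rewrite /su /= mul0r nm0 mulr_ge0 ?exprn_ge0.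
rewrite nmM nmV nm_nat; apply: le_trans (nm_su _); rewrite ler_piMr ?nm_ge0 //.
by rewrite invf_le1 // ler1n.
Qed.

(** The 24 in eta is what makes the constant terms match, through the value of Z2. *)
Lemma cderiv_etal (z : C) : 0 < complex.Im z -> cderiv etal z (- (G2 z / (2 * tpi R))).
Proof.
move=> z0; have t0 := tpi_neq0 R.
have h := cderivB (cderivZ (tpi R / 24) (cderiv_id z)) (cderiv_qser radius1_usr z0).
have e : qser (fun n => n%:R * (su n / n%:R)) z = lam z.
  apply: eq_tsum => -[|n]; first by rewrite /su /= !mul0r.
  by rewrite (mulrC n.+1%:R) divfK // pnatr_eq0.
rewrite e mulr1 in h.
have -> : - (G2 z / (2 * tpi R)) = tpi R / 24 - tpi R * lam z; last exact: h.
by rewrite /G2 Z2E lipc2E; field.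
Qed.

Lemma eta_neq0 z : eta z != 0. Proof. by rewrite eta_ce cexp_neq0. Qed.

Lemma eta_T (z : C) : eta (z + 1) = ee (24^-1) * eta z.
Proof.
rewrite !eta_ce /etal.
have -> : usr (z + 1) = usr z.
  by apply: eq_tsum => n; rewrite qvarD qvar1 mulr1.
by rewrite qvarE -cexpD; congr ce; ring.
Qed.

Lemma ce_sqr (a b : C) : ce a ^+ 2 = ce (2 * a - 2 * b) * ce b ^+ 2.
Proof. by rewrite -!cexpMn -cexpD; congr ce; ring. Qed.

(* The quotient eta(-1/z)^2 / (z eta(z)^2) has derivative 0, by the quasi-modularity of G2. *)
Lemma eta_S (z : C) : 0 < complex.Im z -> eta (- z^-1) ^+ 2 = z / 'i * eta z ^+ 2.
Proof.
move=> z0; have t0 := tpi_neq0 R.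
pose Q (w : C) := ce (2 * etal (- w^-1) - 2 * etal w) * w^-1.
have dQ (w : C) : 0 < complex.Im w -> cderiv Q w 0.
  move=> w0; have wn := Im_gt0_neq0 w0.
  have d1 := cderiv_comp (cderivN (cderiv_inv wn)) (cderiv_etal (oppV_Im w0)).
  have d2 := cderivB (cderivZ 2 d1) (cderivZ 2 (cderiv_etal w0)).
  have d3 := cderivM (cderiv_comp d2 (cderiv_cexp _)) (cderiv_inv wn).
  move: d3; congr (cderiv _ _ _).
  rewrite (G2_S w0); move: (ce _) (G2 w) => X Y; field.
  by rewrite wn t0.
have i0 : 0 < complex.Im ('i : C) by rewrite /= ltr01.
have := cderiv0_cst dQ z0 i0.
have -> : Q 'i = 'i^-1.
  have ii : ('i : C) != 0 by exact: Im_gt0_neq0.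
  have iN : - ('i)^-1 = 'i :> C.
    by apply: (mulfI ii); rewrite mulrN divff // -expr2 sqr_i.
  by rewrite /Q iN subrr cexp0 mul1r.
rewrite /Q => h.
have zn := Im_gt0_neq0 z0; rewrite !eta_ce.
move: (etal (- z^-1)) (etal z) h => a b; rewrite (ce_sqr a b).
move: (ce _) (ce b) => X Y h.
by rewrite -h; congr (_ * _); rewrite mulrC divfK.
Qed.

End EisensteinTwo.

(** * The product expansion of eta and the pentagonal number theorem *)

Section EtaProduct.
Variable R : realType.
Local Notation C := R[i].
Local Open Scope complex_scope.

Lemma qser_infty (a : nat -> C) : radius1 a -> exists2 K : R, 0 <= K &
  forall z : C, 1 <= complex.Im z -> nm (qser a z - a 0%N) <= K * nm (ee z).
Proof.
move=> ra; pose r := expR (- (2 * pi)) : R.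
have r0 : 0 < r by exact: expR_gt0.
have r1 : r < 1 by rewrite expR_lt1 oppr_lt0 mulr_gt0 // pi_gt0.
have hr : 0 <= r < 1 by rewrite (ltW r0).
have [M HM] := ra _ hr.
have M0 : 0 <= M by have := HM [::] isT; rewrite big_nil.
exists (M / r); first by rewrite divr_ge0 // ltW.
move=> z z1; have z0 : 0 < complex.Im z by apply: lt_le_trans z1.
have qr : nm (ee z) <= r.
  by rewrite nm_qvar ler_expR lerN2 ler_peMr // mulr_ge0 // ltW // pi_gt0.
have H := has_sum_succE (qserP ra z0) (radius1_asum ra z0).
rewrite expr0 mulr1 in H.
apply: (has_sum_nm_le (g := fun n => nm (ee z) / r * (nm (a n.+1) * r ^+ n.+1))) H _ _.
  move=> n; have -> : nm (ee z) / r * (nm (a n.+1) * r ^+ n.+1) = nm (a n.+1) * (nm (ee z) * r ^+ n).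
    by rewrite exprS; move: (r ^+ n) => X; field; rewrite gt_eqF.
  rewrite nmM nmX ler_wpM2l ?nm_ge0 // exprS ler_wpM2l ?nm_ge0 //.
  by apply: lerXn2r; rewrite ?nnegrE ?nm_ge0 // ltW.
move=> B uB; rewrite -mulr_sumr (_ : M / r * nm (ee z) = nm (ee z) / r * M); last by ring.
rewrite ler_wpM2l ?divr_ge0 ?nm_ge0 ?(ltW r0) //.
have := HM (map succn B); rewrite big_map; apply.
by rewrite map_inj_uniq //; exact: succn_inj.
Qed.

Lemma clim_ce (T : Type) (F : set_system T) (FF : ProperFilter F) (u : T -> C) l :
  clim F u l -> clim F (fun t => ce (u t)) (ce l).
Proof.
move=> H; apply: (@clim_squeeze _ _ F _ _ _ (fun t => nm (ce l) * (6 * nm (u t - l)))).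
  have h2 : 0 < 1 / 2 :> R by rewrite divr_gt0.
  apply: filterS (H _ h2) => t h.
  have -> : ce (u t) - ce l = ce l * (ce (u t - l) - 1).
    by rewrite mulrBr mulr1 -cexpD [l + _]addrC subrK.
  rewrite nmM ler_wpM2l ?nm_ge0 //.
  have := cexp_sub_le (ltW h).
  have := nmD (ce (u t - l) - 1 - (u t - l)) (u t - l); rewrite subrK.
  have := nm_ge0 (u t - l); nra.
move=> e e0; have c0 : 0 < nm (ce l) by rewrite nm_gt0 cexp_neq0.
have e1 : 0 < e / (nm (ce l) * 6) by rewrite divr_gt0 // mulr_gt0.
by apply: filterS (H _ e1) => t; rewrite mulrA ltr_pdivlMr ?mulr_gt0 // mulrC.
Qed.

Definition ell : C -> C := qser (fun m => m%:R^-1).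

Lemma radius1_inv : radius1 (fun m : nat => m%:R^-1 : C).
Proof.
apply: (radius1_poly (j := 0) (K := 1)) => -[|n]; first by rewrite invr0 nm0 expr0 mulr1.
by rewrite nmV nm_nat expr0 mulr1 invf_le1 // ler1n.
Qed.

(** The quotient of the two sides has derivative 0 and tends to 1 along the imaginary axis. *)
Lemma ce_ell (z : C) : 0 < complex.Im z -> ce (- ell z) = 1 - ee z.
Proof.
pose W (w : C) := ce (- ell w) * (1 - ee w)^-1.
have dW (w : C) : 0 < complex.Im w -> cderiv W w 0.
  move=> w0; have n0 := one_sub_neq0 (nm_qvar_lt1 w0).
  have e1 : qser (fun n => n%:R * n%:R^-1) w = ee w / (1 - ee w).
    apply: tsumE; have := has_sumB (TserP 0 (nm_qvar_lt1 w0)) (@has_sum1 _ _ (fun n => (n == 0%N)%:R) 0%N _).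
    rewrite Tser0E ?nm_qvar_lt1 // eqxx => H.
    have -> : ee w / (1 - ee w) = (1 - ee w)^-1 - 1%:R by field.
    apply: eq_has_sum (H _) => [[|n]|n /negPf -> //].
      by rewrite mul0r mul0r expr0 expr0 mulr1 subrr.
    by rewrite expr0 mul1r subr0 divff ?pnatr_eq0 // mul1r.
  have d1 := cderiv_comp (cderivN (cderiv_qser radius1_inv w0)) (cderiv_cexp _).
  have d2 := cderiv_comp (cderivB (cderiv_cst 1 w) (cderiv_qvar w)) (cderiv_inv n0).
  have := cderivM d1 d2; congr (cderiv _ _ _).
  by rewrite e1 -/(ell w); move: (ce _) => X; field.
have i1 : 0 < complex.Im ('i : C) by rewrite /= ltr01.
have [K K0 HK] := qser_infty radius1_inv.
pose x (M : nat) : C := M.+1%:R * 'i.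
have xI M : complex.Im (x M) = M.+1%:R by rewrite /x natC ImZ /= mulr1.
have xH M : 0 < complex.Im (x M) by rewrite xI.
have ex : clim \oo%classic (fun M => ee (x M)) 0.
  apply: (@clim_squeeze _ _ _ _ _ _ (fun M : nat => expR (- (2 * pi * M%:R)))).
    apply: nearW => M; rewrite subr0 nm_qvar ler_expR lerN2 xI ler_wpM2l ?ler_nat //.
    by rewrite mulr_ge0 // ltW // pi_gt0.
  by move=> e e0; apply: expR_natN_lt => //; rewrite mulr_gt0 // pi_gt0.
have lx : clim \oo%classic (fun M => ell (x M)) 0.
  apply: (@clim_squeeze _ _ _ _ _ _ (fun M : nat => K * nm (ee (x M)))).
    apply: nearW => M; have := HK (x M); rewrite invr0; apply.
    by rewrite xI ler1n.
  move=> e e0; have e1 : 0 < e / (K + 1) by rewrite divr_gt0 //; lra.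
  apply: filterS (ex _ e1) => M; rewrite subr0 ltr_pdivlMr; last by lra.
  have := nm_ge0 (ee (x M)); nra.
have W1 : clim \oo%classic (fun M => W (x M)) (ce (- 0) * (1 - 0)^-1).
  apply: climM; first by apply: clim_ce; apply: climN.
  apply: climV; first by rewrite subr0 oner_neq0.
  by apply: climB => //; exact: clim_cst.
have WE (w : C) : 0 < complex.Im w -> W w = 1.
  move=> w0; rewrite oppr0 cexp0 addr0 invr1 mulr1 in W1.
  apply/esym; apply: clim_unique W1 _.
  have -> : (fun M => W (x M)) = (fun=> W w).
    by apply/funext => M; exact: (cderiv0_cst dW).
  exact: clim_cst.
move=> z0; have n0 := one_sub_neq0 (nm_qvar_lt1 z0).
have := WE z z0; rewrite /W => /(congr1 (fun t => t * (1 - ee z))).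
by rewrite divfK // mul1r.
Qed.

Lemma usr_rows (z : C) : 0 < complex.Im z ->
  has_sum (fun t : nat => ell (z * t.+1%:R)) (usr z).
Proof.
move=> z0; have q1 := nm_qvar_lt1 z0.
pose f (j t : nat) : C := j%:R^-1 * ee z ^+ (j * t).
have af : asum (fun x : nat * nat => f x.1.+1 x.2.+1).
  apply: le_bsum (lambert_asum 0 q1) => -[j t] /=.
  rewrite expr0 mul1r /f nmM nmV nm_nat ler_piMl ?nm_ge0 // invf_le1 // ler1n //.
have [L HL] := asum_has_sum af.
have HU := lambert af HL.
have -> : usr z = L.
  apply: tsumE; apply: eq_has_sum HU => n; rewrite /su.
  case: eqP => [_|/eqP n0]; first by rewrite mul0r mul0r.
  rewrite mulr_suml mulr_suml [LHS]big_seq [RHS]big_seq; apply: eq_bigr => t.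
  rewrite -dvdn_divisors ?lt0n // => tn; rewrite /f divnK //; congr (_ * _).
  have t0 : t%:R != 0 :> C by rewrite pnatr_eq0 -lt0n (dvdn_gt0 _ tn) // lt0n.
  have nn : n%:R != 0 :> C by rewrite pnatr_eq0.
  have e : n%:R = (n %/ t)%N%:R * t%:R :> C by rewrite -natrM divnK.
  rewrite e invfM mulrCA divff // mulr1 //.
apply: (@has_sum_pair _ _ _ (fun x : nat * nat => f x.2.+1 x.1.+1)).
  by apply: (@has_sum_reindex _ _ _ _ _ (fun x => (x.2, x.1)) (fun x => (x.2, x.1)) _ _ HL); case.
move=> t; have zt : 0 < complex.Im (z * t.+1%:R) by exact: Im_mul_nat.
have := has_sum_succE (qserP radius1_inv zt) (radius1_asum radius1_inv zt).
rewrite invr0 mul0r subr0; apply: eq_has_sum => j.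
by rewrite /f mulnC exprM qvarMn.
Qed.

Lemma eta_product (z : C) : 0 < complex.Im z ->
  clim \oo%classic (fun n => \prod_(j < n) (1 - ee z ^+ j.+1)) (ce (- usr z)).
Proof.
move=> z0; have H := has_sum_clim (usr_rows z0).
have c1 : clim \oo%classic (fun n : nat => ce (- \sum_(i < n) ell (z * i.+1%:R))) (ce (- usr z)).
  by apply: clim_ce; apply: climN.
apply: eq_near_clim c1; apply: nearW => n.
elim: n => [|n IH]; first by rewrite !big_ord0 oppr0 cexp0.
rewrite !big_ord_recr /= opprD cexpD IH ce_ell ?qvarMn //; exact: Im_mul_nat.
Qed.

Lemma qpochE (z : C) : 0 < complex.Im z -> qpoch (ee z) = ce (- usr z).
Proof.
move=> z0; apply: cvg_lim => //; apply: clim_cvg.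
have := eta_product z0; apply: eq_near_clim; apply: nearW => n.
by rewrite big_add1 big_mkord.
Qed.

Lemma etaE (z : C) : 0 < complex.Im z -> eta z = ee (z / 24) * qpoch (ee z).
Proof. by move=> z0; rewrite qpochE // qvarE -cexpD eta_ce /etal; congr ce; ring. Qed.

(** * Shanks's finite form of the pentagonal number theorem *)

Section Shanks.
Variable q : C.

Definition shD (n s : nat) : C := \prod_(s <= j < n) (1 - q ^+ j.+1).
Definition shF (n s : nat) : C := (-1) ^+ s * shD n s * q ^+ (s * n + 'C(s.+1, 2)).
Definition shG (m s : nat) : C :=
  if s is t.+1 then (-1) ^+ s * shD m t * q ^+ (s * m + 'C(s.+1, 2)) else 0.

(** The telescoping certificate: the increment in the length of the product is a difference in the
    summation index. *)
Lemma shanks_step m s : (s <= m)%N -> shF m.+1 s - shF m s = shG m s.+1 - shG m s.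
Proof.
move=> sm; have DS : shD m.+1 s = shD m s * (1 - q ^+ m.+1) by rewrite /shD big_nat_recr.
rewrite /shF DS; case: s sm DS => [|t] tm DS.
  rewrite /shG expr0 !mul0n (_ : 'C(1, 2) = 0%N) // (_ : 'C(2, 2) = 1%N) // mul1n addn1.
  by rewrite expr0 expr1; move: (q ^+ m.+1) (shD m 0) => X Y; ring.
have Dt : shD m t = (1 - q ^+ t.+1) * shD m t.+1 by rewrite /shD big_ltn.
rewrite /shG Dt [(-1) ^+ t.+2]exprS.
have -> : (t.+1 * m.+1 + 'C(t.+2, 2) = t.+1 * m + 'C(t.+2, 2) + t.+1)%N by lia.
have -> : (t.+2 * m + 'C(t.+3, 2) = t.+1 * m + 'C(t.+2, 2) + (m + t.+2))%N.
  by rewrite [in LHS]binS bin1; lia.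
rewrite !exprD [q ^+ m.+1]exprS [q ^+ t.+2]exprS [q ^+ t.+1]exprS.
by ring.
Qed.

Lemma shanks n : \sum_(s < n.+1) shF n s =
  1 + \sum_(s < n) (-1) ^+ s.+1 * (q ^+ (s.+1 * s + 'C(s.+2, 2)) + q ^+ (s.+1 * s.+1 + 'C(s.+2, 2))).
Proof.
elim: n => [|m IH].
  by rewrite big_ord1 big_ord0 addr0 /shF /shD big_geq // expr0 !mul1r.
rewrite big_ord_recr /=.
have -> : \sum_(s < m.+1) shF m.+1 s = \sum_(s < m.+1) shF m s + shG m m.+1.
  apply/eqP; rewrite addrC -subr_eq -sumrB; apply/eqP.
  rewrite (eq_bigr (fun s : 'I_m.+1 => shG m s.+1 - shG m s)); last first.
    by move=> s _; rewrite shanks_step // -ltnS.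
  by rewrite -(big_mkord xpredT (fun s => shG m s.+1 - shG m s)) telescope_sumr // subr0.
rewrite IH [in RHS]big_ord_recr /= /shG /shF /shD !big_geq // -!addrA; congr (_ + (_ + _)).
by rewrite !mulr1 -mulrDr.
Qed.

Hypothesis q1 : nm q < 1.

Lemma shD_bound : exists2 K : R, 0 < K & forall n s, nm (shD n s) <= K.
Proof.
pose r := nm q; have r0 : 0 <= r := nm_ge0 q.
have hr : 0 <= r < 1 by rewrite r0.
have [M HM] := bsum_pow 0 hr.
exists (expR M); first exact: expR_gt0.
move=> n s; rewrite /shD.
have -> : nm (\prod_(s <= j < n) (1 - q ^+ j.+1)) = \prod_(s <= j < n) nm (1 - q ^+ j.+1).
  by apply: (big_morph (@nm R)); [exact: nmM|exact: nm1].
apply: (@le_trans _ _ (\prod_(s <= j < n) expR (r ^+ j.+1))).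
  apply: ler_prod => j _; rewrite nm_ge0 /=; apply: le_trans (nmB _ _) _.
  by rewrite nm1 nmX expR_ge1Dx.
have <- : expR (\sum_(s <= j < n) r ^+ j.+1) = \prod_(s <= j < n) expR (r ^+ j.+1).
  by apply: (big_morph (@expR R)); [exact: expRD|exact: expR0].
rewrite ler_expR; have := HM (map succn (index_iota s n)); rewrite big_map => h.
apply: le_trans (h _); last by rewrite map_inj_uniq ?iota_uniq //; exact: succn_inj.
by under [leRHS]eq_bigr do rewrite expr0 mul1r.
Qed.

(** A term with s >= 1 carries q^(s n), so only s = 0, the partial product itself, survives in the
    limit. *)
Lemma shanks_limit L : clim \oo%classic (fun n => shD n 0) L ->
  clim \oo%classic (fun n => \sum_(s < n.+1) shF n s) L.
Proof.
move=> HL; have [K K0 HK] := shD_bound.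
pose r := nm q; have r0 : 0 <= r := nm_ge0 q.
have hr : 0 <= r < 1 by rewrite r0.
have [M HM] := bsum_pow 0 hr.
have M0 : 0 <= M by have := HM [::] isT; rewrite big_nil.
have H0 : clim \oo%classic (fun n => \sum_(s < n) shF n s.+1) 0.
  apply: (@clim_squeeze _ _ _ _ _ _ (fun n => K * M * r ^+ n)).
    apply: nearW => n; rewrite subr0; apply: le_trans (nm_sum _ _ _) _.
    apply: (@le_trans _ _ (\sum_(s < n) K * r ^+ n * r ^+ s)).
      apply: ler_sum => s _; rewrite /shF !nmM !nmX nmN nm1 expr1n mul1r -/r.
      rewrite -mulrA ler_pM ?nm_ge0 ?exprn_ge0 // -exprD.
      apply: ler_wiXn2l => //; first exact: ltW.
      have := ltn_ord s; nia.
    rewrite -mulr_sumr mulrAC ler_wpM2r ?exprn_ge0 // ler_wpM2l ?(ltW K0) //.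
    have := HM (index_iota 0 n) (iota_uniq _ _); apply: le_trans.
    by rewrite big_mkord; apply: ler_sum => s _; rewrite expr0 mul1r.
  move=> e e0; have [r00|rp] := eqVneq r 0.
    by exists 1%N => // n /= n0; rewrite r00 expr0n gtn_eqF // mulr0.
  have rp0 : 0 < r by rewrite lt_neqAle eq_sym rp.
  have [k k0 kE] : exists2 k : R, 0 < k & expR (- k) = r.
    exists (- ln r); first by rewrite oppr_gt0 ln_lt0 // rp0.
    by rewrite opprK lnK.
  have e1 : 0 < e / (K * M + 1) by rewrite divr_gt0 // ltr_wpDl // mulr_ge0 // ltW.
  apply: filterS (expR_natN_lt k0 e1) => n.
  rewrite -mulNr expRM_natr kE ltr_pdivlMr; last by rewrite ltr_wpDl // mulr_ge0 // ltW.
  by move=> h; apply: le_lt_trans h; rewrite mulrC ler_wpM2l ?exprn_ge0 // lerDl.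
have := climD _ HL H0; rewrite addr0 => /(_ _).
apply: eq_near_clim; apply: nearW => n.
by rewrite big_ord_recl /= /shF /= expr0 mul1r mul0n add0n bin_small // expr0 mulr1.
Qed.

End Shanks.

(** Completing the square in the pentagonal exponents absorbs the factor q^(1/24) of eta and makes
    eta a theta series. *)
Definition th (z : C) (s : int) : C := (-1) ^+ `|s|%N * ee ((6 * s + 1)%:~R ^+ 2 / 24 * z).

Lemma pent_exp (s : nat) :
  ((s.+1 * s + 'C(s.+2, 2)) * 2 = s.+1 * (3 * s.+1 - 1))%N /\
  ((s.+1 * s.+1 + 'C(s.+2, 2)) * 2 = s.+1 * (3 * s.+1 + 1))%N.
Proof.
have h : ('C(s.+2, 2) * 2 = s.+2 * s.+1)%N by rewrite mulnC -mul_bin_diag bin1.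
by split; rewrite mulnDl h; nia.
Qed.

Lemma thE (z : C) (s : nat) :
  th z (- s.+1%:Z) = ee (z / 24) * ((-1) ^+ s.+1 * ee z ^+ (s.+1 * s + 'C(s.+2, 2))) /\
  th z s.+1%:Z = ee (z / 24) * ((-1) ^+ s.+1 * ee z ^+ (s.+1 * s.+1 + 'C(s.+2, 2))).
Proof.
have [h1 h2] := pent_exp s.
have key (e : nat) (x : int) : (e * 2)%:Z = x * (3 * x + 1) ->
    ee ((6 * x + 1)%:~R ^+ 2 / 24 * z) = ee (z / 24) * ee z ^+ e.
  move=> h; rewrite -qvarMn -qvarD; congr ee.
  have hx : (6 * x + 1)%:~R ^+ 2 = 24 * e%:R + 1 :> C.
    rewrite -rmorphXn /= (_ : (6 * x + 1) ^+ 2 = 24 * e%:Z + 1); last by nia.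
    by rewrite intrD intrM.
  by rewrite hx; field.
split; rewrite /th ?abszN /= mulrCA; congr (_ * _); apply: key; nia.
Qed.

Lemma th_asum (z : C) : 0 < complex.Im z -> asum (th z).
Proof.
move=> z0; pose r := nm (ee (z / 24)).
have z24 : 0 < complex.Im (z / 24).
  by rewrite (natC R 24); apply: Im_gt0_div.
have r1 : r < 1 by exact: nm_qvar_lt1.
have r0 : 0 <= r := nm_ge0 _.
have hr : 0 <= r < 1 by rewrite r0.
have bs : bsum (fun n : nat => r ^+ n).
  by apply: le_bsum (bsum_pow 0 hr) => n; rewrite expr0 mul1r.
apply: (bsum_int (h := fun n => r ^+ n)) bs => [n|s]; first exact: exprn_ge0.
rewrite /th nmM nmX nmN nm1 expr1n mul1r.
have -> : (6 * s + 1)%:~R ^+ 2 / 24 * z = z / 24 * (`|(6 * s + 1)%R| ^ 2)%N%:R :> C.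
  rewrite natrX natr_absz.
  have -> : (`|6 * s + 1|%:~R : C) ^+ 2 = (6 * s + 1)%:~R ^+ 2.
    by rewrite -!rmorphXn /=; congr (_%:~R); nia.
  by ring.
rewrite qvarMn nmX -/r; apply: ler_wiXn2l => //; first exact: ltW.
nia.
Qed.

Lemma pentagonal (z : C) : 0 < complex.Im z -> has_sum (th z) (eta z).
Proof.
move=> z0; have q1 := nm_qvar_lt1 z0.
have [l Hl] := asum_has_sum (th_asum z0).
have cl := has_sum_clim_zr Hl.
have cD : clim \oo%classic (fun n => shD (ee z) n 0) (qpoch (ee z)).
  rewrite qpochE //; have := eta_product z0; apply: eq_near_clim; apply: nearW => n.
  by rewrite /shD big_mkord.
have cS : clim \oo%classic (fun n => ee (z / 24) * \sum_(s < n.+1) shF (ee z) n s) (ee (z / 24) * qpoch (ee z)).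
  by apply: climM; [exact: clim_cst|exact: shanks_limit].
rewrite -etaE // in cS.
have {}cS : clim \oo%classic (fun n => \sum_(j <- zr n) th z j) (eta z).
  apply: eq_near_clim cS; apply: nearW => n; rewrite shanks mulrDr mulr1 mulr_sumr.
  have zrS m : \sum_(j <- zr m.+1) th z j = \sum_(j <- zr m) th z j + (th z (- m.+1%:Z) + th z m.+1%:Z).
    have hp : perm_eq (zr m.+1) (zr m ++ [:: - m.+1%:Z; m.+1%:Z]).
      apply: uniq_perm; rewrite ?zr_uniq //.
        rewrite cat_uniq zr_uniq /= !mem_zr /= ?inE; lia.
      move=> j; rewrite mem_cat !mem_zr !inE; lia.
    rewrite (perm_big _ hp) big_cat.
    by rewrite [X in _ + X = _]big_cons [X in _ + (_ + X) = _]big_seq1.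
  elim: n => [|n IH].
    rewrite big_ord0 addr0 /zr /= big_seq1 /th /= expr0 mul1r; congr ee.
    by rewrite subrr mulr0 add0r expr1n mul1r mulrC.
  rewrite big_ord_recr /= addrA IH zrS; congr (_ + _).
  by have [-> ->] := thE z n; ring.
by rewrite -(clim_unique _ cl cS).
Qed.

End EtaProduct.

(** * Partitions *)

Section Partitions.

Definition pwt K b (m : {ffun 'I_K -> 'I_b.+1}) : nat := (\sum_(i < K) m i * i.+1)%N.

(** Partitions with parts at most K and multiplicities at most b; [partition_count] is the case K =
    b = n. Bounding both makes the generating function a polynomial. *)
Definition pcount (K b n : nat) : nat := #|[set m : {ffun 'I_K -> 'I_b.+1} | pwt m == n]|.

Lemma pwt_le K b (m : {ffun 'I_K -> 'I_b.+1}) : (pwt m <= K * (b * K))%N.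
Proof.
rewrite -[X in (_ <= X * _)%N]card_ord -sum_nat_const; apply: leq_sum => i _.
by apply: leq_mul; [rewrite -ltnS|].
Qed.

Lemma pcountE K b n : pcount K b n = (\sum_(m : {ffun 'I_K -> 'I_b.+1}) (pwt m == n))%N.
Proof. by rewrite /pcount -sum1dep_card big_mkcond. Qed.

Lemma pcount_gt K b n : (K * (b * K) < n)%N -> pcount K b n = 0%N.
Proof.
move=> h; rewrite pcountE big1 // => m _; apply/eqP; rewrite eqb0; apply: contraL h => /eqP <-.
by rewrite -leqNgt pwt_le.
Qed.

Lemma pcount_gf (F : comNzRingType) K b (x : F) :
  \prod_(i < K) \sum_(j < b.+1) x ^+ (j * i.+1) =
  \sum_(n < (K * (b * K)).+1) (pcount K b n)%:R * x ^+ n.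
Proof.
rewrite bigA_distr_bigA /=.
under [RHS]eq_bigr => n _ do rewrite pcountE natr_sum mulr_suml.
rewrite exchange_big /=; apply: eq_bigr => m _.
have wm : (pwt m < (K * (b * K)).+1)%N by rewrite ltnS pwt_le.
rewrite (bigD1 (Ordinal wm)) //= eqxx mul1r [X in _ + X]big1 ?addr0.
  by rewrite /pwt; elim/big_rec2: _ => [|i y e _ ->]; rewrite ?expr0 // exprD.
move=> n nm0; rewrite (_ : (pwt m == n) = false) ?mul0r //.
by apply: contraNF nm0 => /eqP h; apply/eqP/val_inj.
Qed.

(** Parts and multiplicities in a partition of n are at most n, so truncating or extending the
    multiplicities by 0 is injective. *)
Lemma pcount_le K b K' b' n : (n <= K')%N -> (n <= b')%N -> (pcount K b n <= pcount K' b' n)%N.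
Proof.
move=> nK nb.
pose g (m : {ffun 'I_K -> 'I_b.+1}) (i : nat) : nat := if insub i is Some j then m j else 0%N.
have gE m (i : 'I_K) : g m i = m i by rewrite /g valK.
have g0 m i : (K <= i)%N -> g m i = 0%N by move=> h; rewrite /g insubF // ltnNge h.
pose f (m : {ffun 'I_K -> 'I_b.+1}) : {ffun 'I_K' -> 'I_b'.+1} := [ffun i : 'I_K' => inord (g m i)].
have gwt m L : (K <= L)%N -> (\sum_(i < L) g m i * i.+1 = pwt m)%N.
  move=> KL; rewrite -(big_mkord xpredT (fun i => g m i * i.+1)%N) (big_cat_nat (leq0n _) KL) //=.
  rewrite [X in (_ + X)%N]big1_seq ?addn0.
    by rewrite big_mkord; apply: eq_bigr => i _; rewrite gE.
  by move=> i /=; rewrite mem_index_iota => /andP[Ki _]; rewrite g0.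
have gle m i : pwt m = n -> (g m i * i.+1 <= n)%N.
  move=> <-; have [iK|iK] := ltnP i K; last by rewrite g0.
  by rewrite -(gwt m K (leqnn _)) (bigD1 (Ordinal iK)) //= leq_addr.
have glb m i : pwt m = n -> (g m i < b'.+1)%N.
  by move=> /(gle m i) h; rewrite ltnS (leq_trans _ nb) // (leq_trans _ h) // leq_pmulr.
have gz m i : pwt m = n -> (K' <= i)%N -> g m i = 0%N.
  move=> /(gle m i) h Ki; apply/eqP; rewrite -leqn0 leqNgt; apply/negP => h1.
  have : (i.+1 <= n)%N by apply: leq_trans h; rewrite leq_pmull.
  by rewrite ltnNge (leq_trans nK Ki).
have finj : {in [set m | pwt m == n] &, injective f}.
  move=> m m'; rewrite !inE => /eqP hm /eqP hm' /ffunP ff; apply/ffunP => i; apply: val_inj.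
  rewrite /= -!gE; have [iK|iK] := ltnP i K'; last by rewrite !gz.
  have := congr1 val (ff (Ordinal iK)); rewrite !ffunE /= !inordK //; exact: glb.
rewrite /pcount -(card_in_imset finj); apply: subset_leq_card.
apply/fintype.subsetP => _ /imsetP[m + ->]; rewrite !inE => /eqP hm; apply/eqP.
rewrite /pwt; under eq_bigr => i _ do rewrite ffunE inordK ?glb //.
rewrite -hm -(gwt m _ (leq_maxl K K')).
rewrite -!(big_mkord xpredT (fun i => g m i * i.+1)%N) [RHS](big_cat_nat (leq0n _) (leq_maxr K K')) //=.
rewrite [X in (_ + X)%N]big1_seq ?addn0 // => i /=; rewrite mem_index_iota => /andP[Ki _].
by rewrite gz.
Qed.

Lemma pcount_partition M n : (n <= M)%N -> pcount M M n = partition_count n.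
Proof. by move=> nM; apply/eqP; rewrite eqn_leq !pcount_le. Qed.

Lemma pcount_le_partition K b n : (pcount K b n <= partition_count n)%N.
Proof. exact: pcount_le. Qed.

Variable R : realType.
Local Notation C := R[i].
Local Open Scope complex_scope.

Lemma geom_fin (F : fieldType) (y : F) b : 1 - y != 0 ->
  \sum_(j < b.+1) y ^+ j = (1 - y ^+ b.+1) / (1 - y).
Proof. by move=> y0; rewrite -[1 - y ^+ _]opprB subrX1 -mulNr opprB mulrAC divff // mul1r. Qed.

Lemma pcount_prod (F : fieldType) K b (x : F) : (forall i, 1 - x ^+ i.+1 != 0) ->
  \sum_(n < (K * (b * K)).+1) (pcount K b n)%:R * x ^+ n =
  \prod_(i < K) (1 - x ^+ (i.+1 * b.+1)) / \prod_(i < K) (1 - x ^+ i.+1).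
Proof.
move=> x0; rewrite -pcount_gf -prodf_div; apply: eq_bigr => i _.
under eq_bigr => j _ do rewrite mulnC exprM.
by rewrite geom_fin // -exprM.
Qed.

Lemma pow_sum_le (r : R) : 0 <= r < 1 -> exists2 M : R, 0 <= M & forall a n, \sum_(a <= i < n) r ^+ i <= M.
Proof.
move=> hr; have [M HM] := bsum_pow 0 hr; exists M.
  by have := HM [::] isT; rewrite big_nil.
move=> a n; apply: le_trans (HM (index_iota a n) (iota_uniq _ _)).
by under [leRHS]eq_bigr do rewrite expr0 mul1r.
Qed.

(** A finite set of indices lies below some L, where the coefficients are those of a finite product
    with factors at most 1 + r^(i + 1) / (1 - r); the exponential of the geometric series bounds all
    these products. *)
Lemma radius1_partition : radius1 (fun n => (partition_count n)%:R : C).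
Proof.
move=> r hr; have /andP[r0 r1] := hr; have [M M0 HM] := pow_sum_le hr.
have x0 i : 0 < 1 - r ^+ i.+1 by rewrite subr_gt0 exprn_ilt1.
exists (expR (M / (1 - r))) => B uB.
pose L := \max_(i <- B) i.
apply: (@le_trans _ _ (\sum_(n <- index_iota 0 (L * (L * L)).+1) (pcount L L n)%:R * r ^+ n)).
  rewrite big_seq (eq_bigr (fun i => (pcount L L i)%:R * r ^+ i)); last first.
    move=> n nB; rewrite nm_nat pcount_partition // /L.
    exact: (leq_bigmax_seq (F := id)).
  rewrite -big_seq; apply: sub_sum_le => // [n|n nB].
    by rewrite mulr_ge0 ?exprn_ge0.
  have nL : (n <= L)%N by exact: (leq_bigmax_seq (F := id)).
  by rewrite mem_index_iota ltnS; nia.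
rewrite big_mkord pcount_prod => [|i]; last by rewrite gt_eqF.
rewrite -prodf_div.
apply: (@le_trans _ _ (\prod_(i < L) expR (r ^+ i.+1 / (1 - r)))).
  apply: ler_prod => i _; have xi := x0 i.
  have n0 : 0 <= r ^+ i.+1 by rewrite exprn_ge0.
  have d1 : 0 <= r ^+ (i.+1 * L.+1) by rewrite exprn_ge0.
  have d2 : r ^+ (i.+1 * L.+1) <= 1 by rewrite exprn_ile1 // ltW.
  have d3 : r ^+ i.+1 <= r by rewrite exprS ler_piMr // exprn_ile1 // ltW.
  rewrite divr_ge0 ?(ltW xi) ?subr_ge0 //=.
  apply: le_trans (expR_ge1Dx _).
  have s0 : 0 < 1 - r by rewrite subr_gt0.
  rewrite ler_pdivrMr // mulrDl mul1r -mulrA mulrC.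
  apply: (@le_trans _ _ 1); first by rewrite lerBlDr lerDl.
  have : 1 <= (1 - r)^-1 * (1 - r ^+ i.+1) by rewrite mulrC ler_pdivlMr // mul1r lerD2l lerN2.
  by move: ((1 - r)^-1 * (1 - r ^+ i.+1)) => X; nra.
have <- : expR (\sum_(i < L) r ^+ i.+1 / (1 - r)) = \prod_(i < L) expR (r ^+ i.+1 / (1 - r)).
  by apply: (big_morph (@expR R)); [exact: expRD|exact: expR0].
rewrite ler_expR -mulr_suml ler_wpM2r ?invr_ge0 ?subr_ge0 ?(ltW r1) //.
by apply: le_trans (HM 1%N L.+1); rewrite big_add1 big_mkord.
Qed.

Lemma prod_near1 n (x : nat -> C) (S : R) : \sum_(i < n) nm (x i) <= S ->
  nm (\prod_(i < n) (1 - x i) - 1) <= expR S * S.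
Proof.
have pb m : nm (\prod_(i < m) (1 - x i)) <= expR (\sum_(i < m) nm (x i)).
  elim: m => [|m IH]; first by rewrite !big_ord0 nm1 expR0.
  rewrite !big_ord_recr /= nmM expRD ler_pM ?nm_ge0 //.
  by apply: le_trans (nmB _ _) _; rewrite nm1 expR_ge1Dx.
move=> hS; suff h m : (m <= n)%N -> nm (\prod_(i < m) (1 - x i) - 1) <= expR S * \sum_(i < m) nm (x i).
  by apply: le_trans (h _ (leqnn _)) _; rewrite ler_wpM2l // ltW // expR_gt0.
elim: m => [|m IH] mn; first by rewrite !big_ord0 subrr nm0 mulr0.
rewrite !big_ord_recr /=.
have -> : \prod_(i < m) (1 - x i) * (1 - x m) - 1 =
   (\prod_(i < m) (1 - x i) - 1) - \prod_(i < m) (1 - x i) * x m by ring.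
apply: le_trans (nmB _ _) _; rewrite mulrDr; apply: lerD; first exact: IH (ltnW mn).
rewrite nmM ler_wpM2r ?nm_ge0 //; apply: le_trans (pb m) _; rewrite ler_expR.
apply: le_trans hS; rewrite -(subnKC (ltnW mn)) big_split_ord /= lerDl.
by apply: sumr_ge0 => i _; exact: nm_ge0.
Qed.

Lemma clim_pow0 (r : R) : 0 <= r < 1 -> forall e, 0 < e -> \forall n \near \oo%classic, r ^+ n < e.
Proof.
move=> /andP[r0 r1] e e0; have [r00|rp] := eqVneq r 0.
  by exists 1%N => // n /= n0; rewrite r00 expr0n gtn_eqF.
have rp0 : 0 < r by rewrite lt_neqAle eq_sym rp.
have [k k0 kE] : exists2 k : R, 0 < k & expR (- k) = r.
  exists (- ln r); first by rewrite oppr_gt0 ln_lt0 // rp0.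
  by rewrite opprK lnK.
apply: filterS (expR_natN_lt k0 e0) => n.
by rewrite -mulNr expRM_natr kE.
Qed.

Lemma qpoch_neq0 (z : C) : 0 < complex.Im z -> qpoch (ee z) != 0.
Proof. by move=> z0; rewrite qpochE // cexp_neq0. Qed.

(** Dominated convergence for the counts with K = b = M: their generating function is a quotient of
    products whose numerator, with exponents above M, tends to 1. *)
Lemma partition_gf (z : C) : 0 < complex.Im z ->
  has_sum (fun n : nat => (partition_count n)%:R * ee z ^+ n) (qpoch (ee z))^-1.
Proof.
move=> z0; have q1 := nm_qvar_lt1 z0; pose r := nm (ee z).
have r0 : 0 <= r := nm_ge0 _.
have hr : 0 <= r < 1 by rewrite r0.
have x0 i : 1 - ee z ^+ i.+1 != 0.
  by apply: one_sub_neq0; rewrite nmX exprn_ilt1.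
have H := qserP radius1_partition z0.
suff -> : (qpoch (ee z))^-1 = qser (fun n => (partition_count n)%:R) z by [].
pose L M := \prod_(i < M) (1 - ee z ^+ (i.+1 * M.+1)) / \prod_(i < M) (1 - ee z ^+ i.+1).
have c1 : clim \oo%classic L (qser (fun n => (partition_count n)%:R) z).
  apply: (tannery (u := fun M n => (pcount M M n)%:R * ee z ^+ n) _ (radius1_partition hr) _ _ _ H).
  - apply: nearW => M n; rewrite nmM !nm_nat nmX ler_wpM2r ?exprn_ge0 //.
    by rewrite ler_nat pcount_le_partition.
  - move=> n; have c0 : clim \oo%classic (fun=> (partition_count n)%:R * ee z ^+ n) ((partition_count n)%:R * ee z ^+ n).
      exact: clim_cst.
    apply: eq_near_clim c0; exists n => // M /= nM; by rewrite pcount_partition.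
  apply: nearW => M.
  have := @has_sum_fin _ _ (fun n : nat => (pcount M M n)%:R * ee z ^+ n)
      (index_iota 0 (M * (M * M)).+1) (iota_uniq _ _).
  rewrite big_mkord pcount_prod //; apply=> n.
  by rewrite mem_index_iota /= -leqNgt => /pcount_gt ->; rewrite mul0r.
have [S S0 HS] := pow_sum_le hr.
have c2 : clim \oo%classic (fun M => \prod_(i < M) (1 - ee z ^+ (i.+1 * M.+1))) 1.
  apply: (@clim_squeeze _ _ _ _ _ _ (fun M => expR S * (S * r ^+ M))).
    apply: nearW => M.
    have b : \sum_(i < M) nm (ee z ^+ (i.+1 * M.+1)) <= S * r ^+ M.
      apply: (@le_trans _ _ (\sum_(i < M) r ^+ i * r ^+ M)).
        apply: ler_sum => i _; rewrite nmX -exprD; apply: ler_wiXn2l => //; first exact: ltW.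
        nia.
      rewrite -mulr_suml ler_wpM2r ?exprn_ge0 //.
      by apply: le_trans (HS 0%N M); rewrite big_mkord.
    apply: le_trans (prod_near1 (x := fun i => ee z ^+ (i.+1 * M.+1)) b) _; rewrite ler_wpM2r ?mulr_ge0 ?exprn_ge0 //.
    by rewrite ler_expR ler_piMr // exprn_ile1 // ltW.
  move=> e e0; have e1 : 0 < e / (expR S * S + 1).
    by rewrite divr_gt0 // ltr_wpDl // mulr_ge0 // expR_ge0.
  apply: filterS (clim_pow0 hr e1) => n.
  rewrite ltr_pdivlMr; last by rewrite ltr_wpDl // mulr_ge0 // expR_ge0.
  move=> h; apply: le_lt_trans h; rewrite mulrA mulrC ler_wpM2l ?exprn_ge0 // lerDl //.
have c3 : clim \oo%classic L (1 * (qpoch (ee z))^-1).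
  apply: climM => //; apply: climV; first exact: qpoch_neq0.
  by rewrite qpochE //; exact: eta_product.
by rewrite (clim_unique _ c1 c3) mul1r.
Qed.

End Partitions.

(** * The characters chi *)

Section Legendre.

Definition lg (p : nat) (a : int) : int :=
  if (p%:Z %| a)%Z then 0
  else if [exists x : 'I_p, (x%:Z ^+ 2 == a %[mod p%:Z])%Z] then 1 else -1.

Lemma Fp_int_eq0 (p : nat) (a : int) : prime p -> (a%:~R == 0 :> 'F_p) = (p%:Z %| a)%Z.
Proof.
move=> pp; have ch := pchar_Fp pp.
have nat_case n : (n%:R == 0 :> 'F_p) = (p %| n)%N by rewrite (dvdn_pcharf ch).
case: a => n; first by rewrite /= -pmulrn nat_case.
by rewrite NegzE mulrNz oppr_eq0 -pmulrn nat_case dvdzE abszN.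
Qed.

Lemma Fp_int_eq (p : nat) (a b : int) : prime p ->
  (a%:~R == b%:~R :> 'F_p) = (a == b %[mod p%:Z])%Z.
Proof. by move=> pp; rewrite -subr_eq0 -intrB Fp_int_eq0 // eqz_mod_dvd. Qed.

Lemma lg_eqmod (p : nat) (a b : int) : (a = b %[mod p%:Z])%Z -> lg p a = lg p b.
Proof.
move=> ab; rewrite /lg ab; congr (if _ then _ else _).
by apply/dvdz_mod0P/dvdz_mod0P; rewrite ab.
Qed.

Lemma lg_dvd p a : (p%:Z %| a)%Z -> lg p a = 0.
Proof. by rewrite /lg => ->. Qed.

Lemma lg_cases p a : ~~ (p%:Z %| a)%Z -> lg p a = 1 \/ lg p a = -1.
Proof. by rewrite /lg => /negPf ->; case: ifP; [left|right]. Qed.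

Variable p : nat.
Hypotheses (pp : prime p) (p2 : (2 < p)%N).

Let podd : odd p.
Proof. by have [p_2|//] := even_prime pp; move: p2; rewrite p_2. Qed.

Lemma Fp_nat (x : 'F_p) : (x : nat)%:R = x.
Proof. by rewrite natr_Zp. Qed.

Lemma Fp_lt (x : 'F_p) : (x < p)%N.
Proof. by have := ltn_ord x; rewrite [X in (_ < X)%N -> _]Fp_cast. Qed.

Lemma unit_gen (F : finFieldType) : exists2 g : {unit F}, #[g]%g = #|F|.-1 &
  forall y : F, y != 0 -> exists i, y = FinRing.uval g ^+ i.
Proof.
have /cyclicP[g gE] := field_unit_group_cyclic [set: {unit F}]%G.
exists g; first by rewrite -card_finField_unit orderE -gE.
move=> y y0; have yu : y \is a GRing.unit by rewrite unitfE.
have : FinRing.unit F yu \in <[g]>%g by rewrite -gE inE.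
by move=> /cycleP[i h]; exists i; rewrite -FinRing.val_unitX -h.
Qed.

Lemma card_Fp_pred : #|'F_p|.-1 = ((p.-1)./2).*2.
Proof. by rewrite card_Fp // even_halfK // -subn1 oddB ?prime_gt0 // podd. Qed.

(** If the power is 1, then p - 1 divides i (p - 1) / 2 where a is the i-th power of a generator, so
    i is even and a is a square. *)
Lemma euler_crit (a : int) : (lg p a)%:~R = (a%:~R : 'F_p) ^+ (p.-1)./2.
Proof.
have h0 : (0 < (p.-1)./2)%N by rewrite half_gt0; lia.
rewrite /lg -Fp_int_eq0 //; case: eqP => [->|/eqP a0]; first by rewrite expr0n eqn0Ngt h0.
have [g go Hg] := unit_gen 'F_p.
have Xp (y : 'F_p) : y != 0 -> y ^+ ((p.-1)./2).*2 = 1.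
  move=> y0; apply: (mulIf y0); rewrite mul1r -exprSr.
  by rewrite -card_Fp_pred card_Fp // prednK ?prime_gt0 // -[p in y ^+ p](card_Fp pp) expf_card.
case: ifPn => [/existsP[x]|nsq].
  rewrite -Fp_int_eq // rmorphXn /= => /eqP xa; rewrite -xa -exprM mul2n Xp //.
  by apply: contra a0 => /eqP x0; rewrite -xa x0 expr0n.
have [i ai] := Hg _ a0.
have s2 : ((a%:~R : 'F_p) ^+ (p.-1)./2) ^+ 2 = 1 by rewrite -exprM muln2 Xp.
have /orP[/eqP e1|/eqP //] : (a%:~R ^+ (p.-1)./2 == 1 :> 'F_p) || (a%:~R ^+ (p.-1)./2 == -1 :> 'F_p).
  by rewrite -sqrf_eq1 s2.
case/negP: nsq.
have : (g ^+ (i * (p.-1)./2) == 1)%g.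
  by apply/eqP/val_inj; rewrite /= FinRing.val_unitX exprM -ai e1.
rewrite -order_dvdn go card_Fp_pred -mul2n mulnC mulnC dvdn_pmul2r // => i2.
pose y := FinRing.uval g ^+ (i %/ 2).
have py : ((y : nat) < p)%N := Fp_lt y.
apply/existsP; exists (Ordinal py) => /=.
by rewrite -Fp_int_eq // rmorphXn /= -pmulrn Fp_nat ai -exprM divnK.
Qed.

Lemma euler_crit_pchar (F : fieldType) (a : int) : p \in [pchar F] ->
  (lg p a)%:~R = (a%:~R : F) ^+ (p.-1)./2.
Proof.
move=> ch; have := euler_crit a.
rewrite -!rmorphXn /= => /eqP; rewrite Fp_int_eq // eqz_mod_dvd => /dvdzP[z hz].
apply/eqP; rewrite -subr_eq0 -intrB hz intrM -[p%:Z%:~R]pmulrn.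
by rewrite (pcharf0 ch) mulr0.
Qed.

Lemma Fp_sign_inj (x y : int) : `|x| <= 1 -> `|y| <= 1 -> x%:~R = y%:~R :> 'F_p -> x = y.
Proof.
move=> hx hy /eqP; rewrite Fp_int_eq // eqz_mod_dvd => /dvdzP[z hz].
have : z = 0 by move: p2 hz hx hy => *; nia.
by move=> z0; rewrite z0 mul0r in hz; apply/eqP; rewrite -subr_eq0 hz.
Qed.

Lemma lg_le1 a : `|lg p a| <= 1.
Proof. by rewrite /lg; case: ifP => // _; case: ifP. Qed.

Lemma lgM a b : lg p (a * b) = lg p a * lg p b.
Proof.
apply: Fp_sign_inj; first exact: lg_le1.
  by rewrite normrM mulr_ile1 ?lg_le1.
by rewrite intrM !euler_crit intrM exprMn.
Qed.

Lemma lg1 : lg p 1 = 1.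
Proof. by apply: Fp_sign_inj; rewrite ?lg_le1 // euler_crit expr1n. Qed.

Lemma lgX a n : lg p (a ^+ n) = lg p a ^+ n.
Proof. by elim: n => [|n IH]; rewrite ?expr0 ?lg1 // !exprS lgM IH. Qed.

Lemma lgN1 : lg p (-1) = (-1) ^+ (p.-1)./2.
Proof.
apply: Fp_sign_inj; rewrite ?lg_le1 ?normrX ?normrN1 ?expr1n //.
by rewrite euler_crit rmorphXn.
Qed.

Lemma lg_sqr a : ~~ (p%:Z %| a)%Z -> lg p a ^+ 2 = 1.
Proof. by move=> /lg_cases[] ->; rewrite ?expr1n ?sqrrN ?expr1n. Qed.

Lemma lg_nonres : exists2 a : int, ~~ (p%:Z %| a)%Z & lg p a = -1.
Proof.
have [g go Hg] := unit_gen 'F_p.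
pose y : 'F_p := FinRing.uval g.
have y0 : y != 0 by rewrite -unitfE; exact: (valP g).
have nd : ~~ (p%:Z %| (y : nat)%:Z)%Z by rewrite -Fp_int_eq0 // -pmulrn Fp_nat.
exists (y : nat)%:Z => //.
have [h|//] := lg_cases nd.
have := euler_crit (y : nat)%:Z; rewrite h -pmulrn Fp_nat => /esym e.
have h0 : (0 < (p.-1)./2)%N by rewrite half_gt0; lia.
have : (g ^+ (p.-1)./2 == 1)%g by apply/eqP/val_inj; rewrite /= FinRing.val_unitX -/y e.
rewrite -order_dvdn go card_Fp_pred => /(dvdn_leq h0).
by rewrite -addnn -[X in (_ <= X)%N]addn0 leq_add2l leqn0 => /eqP h1; rewrite h1 in h0.
Qed.

Definition lgF (x : 'F_p) : int := lg p (x : nat)%:Z.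

Lemma lgF_int a : lgF a%:~R = lg p a.
Proof.
by apply/lg_eqmod/eqP; rewrite -Fp_int_eq // -pmulrn Fp_nat.
Qed.

Lemma lgFM x y : lgF (x * y) = lgF x * lgF y.
Proof.
rewrite -[x in LHS]Fp_nat -[y in LHS]Fp_nat [_%:R]pmulrn [(y : nat)%:R]pmulrn -intrM lgF_int.
exact: lgM.
Qed.

Lemma lgF0 : lgF 0 = 0. Proof. by rewrite (lgF_int 0) lg_dvd. Qed.

Lemma lgF_sqr x : x != 0 -> lgF x ^+ 2 = 1.
Proof. by move=> x0; apply: lg_sqr; rewrite -Fp_int_eq0 // -pmulrn Fp_nat. Qed.

Lemma lgF_sum : \sum_x lgF x = 0.
Proof.
have [a na la] := lg_nonres.
have a0 : a%:~R != 0 :> 'F_p by rewrite Fp_int_eq0.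
have : \sum_x lgF x = - \sum_x lgF x.
  rewrite [LHS](reindex_inj (mulfI a0)) /= -sumrN; apply: eq_bigr => x _.
  by rewrite lgFM lgF_int la mulN1r.
lia.
Qed.

(** * Quadratic Gauss sums *)

Section GaussSum.
Variables (F : fieldType) (w : F).
Hypotheses (wp : w ^+ p = 1) (w1 : w != 1).

(** An additive character of F_p with values in any field containing a nontrivial p-th root of
    unity: characteristic q for reciprocity, the complex numbers for eta. *)
Definition psiF (x : 'F_p) : F := w ^+ (x : nat).

Lemma w_mod n : w ^+ (n %% p) = w ^+ n.
Proof. by rewrite [in RHS](divn_eq n p) exprD mulnC exprM wp expr1n mul1r. Qed.

Lemma psiF_nat n : psiF n%:R = w ^+ n.
Proof. by rewrite /psiF val_Fp_nat // w_mod. Qed.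

Lemma psiFD x y : psiF (x + y) = psiF x * psiF y.
Proof. by rewrite -[x in LHS]Fp_nat -[y in LHS]Fp_nat -natrD psiF_nat exprD. Qed.

Lemma psiF_sum (t : 'F_p) : \sum_x psiF (x * t) = if t == 0 then p%:R else 0.
Proof.
case: eqP => [->|/eqP t0].
  under eq_bigr do rewrite mulr0 /psiF expr0.
  by rewrite sumr_const card_Fp.
have e : \sum_x psiF (x * t) = psiF 1 * \sum_x psiF (x * t).
  rewrite [in RHS](reindex_inj (mulIf (invr_neq0 t0))) /= mulr_sumr.
  rewrite [LHS](reindex_inj (mulIf (invr_neq0 t0))) /=.
  rewrite [LHS](reindex_inj (addrI 1)) /=; apply: eq_bigr => x _.
  by rewrite !mulfVK // psiFD.
have : (1 - psiF 1) * \sum_x psiF (x * t) = 0 by rewrite mulrBl mul1r -e subrr.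
move/eqP; rewrite mulf_eq0 subr_eq0 => /orP[/eqP h|/eqP //].
by move: w1; rewrite -[w]expr1 -(psiF_nat 1) -h eqxx.
Qed.

Definition gaussF : F := \sum_x (lgF x)%:~R * psiF x.

Lemma gaussF_mul (t : 'F_p) : t != 0 ->
  \sum_x (lgF x)%:~R * psiF (x * t) = (lgF t)%:~R * gaussF.
Proof.
move=> t0; rewrite (reindex_inj (mulIf (invr_neq0 t0))) /= /gaussF mulr_sumr.
apply: eq_bigr => x _; rewrite mulfVK // mulrA -intrM; congr (_%:~R * _).
have tv : t^-1 != 0 by rewrite invr_eq0.
rewrite lgFM mulrC; congr (_ * _).
have h : lgF t * lgF t^-1 = 1.
  by rewrite -lgFM divff // -[1]/(1%:~R) lgF_int lg1.
by rewrite -[LHS]mul1r -(lgF_sqr t0) expr2 -mulrA h mulr1.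
Qed.

Lemma gaussF_sqr : gaussF ^+ 2 = (lg p (-1) * p%:Z)%:~R.
Proof.
rewrite expr2 {2}/gaussF mulr_sumr.
have e (x : 'F_p) : gaussF * ((lgF x)%:~R * psiF x) =
    \sum_y (lgF y)%:~R * (psiF (x * (y + 1)) - (x == 0)%:R).
  have [->|x0] := eqVneq x 0.
    rewrite lgF0 mul0r mulr0; rewrite big1 // => y _.
    by rewrite mul0r /psiF expr0 subrr mulr0.
  rewrite mulrA [gaussF * _]mulrC -gaussF_mul // mulr_suml; apply: eq_bigr => y _.
  by rewrite subr0 -mulrA -psiFD mulrDr mulr1 (mulrC y).
rewrite (eq_bigr _ (fun x _ => e x)) exchange_big /=.
have e2 (y : 'F_p) : \sum_x (lgF y)%:~R * (psiF (x * (y + 1)) - (x == 0)%:R) =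
   (lgF y)%:~R * (if y == -1 then p%:R else 0) - (lgF y)%:~R :> F.
  rewrite -mulr_sumr sumrB psiF_sum mulrBr addr_eq0; congr (_ - _).
  rewrite (bigD1 (0 : 'F_p)) //= [X in _ + X]big1 ?addr0 ?mulr1 //.
  by move=> x /negPf ->.
rewrite (eq_bigr _ (fun y _ => e2 y)) sumrB -rmorph_sum /= lgF_sum subr0.
rewrite (bigD1 (-1)) //= eqxx big1 ?addr0; last by move=> y /negPf ->; rewrite mulr0.
by rewrite -[-1]/((-1)%:~R) lgF_int intrM.
Qed.

End GaussSum.
End Legendre.

(** * Quadratic reciprocity and its second supplement *)

Lemma root_of_order (F : finFieldType) n : (n %| #|F|.-1)%N -> exists2 w : F,
  w ^+ n = 1 & forall m, (0 < m < n)%N -> w ^+ m != 1.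
Proof.
move=> nF; have [g go _] := unit_gen F.
have F0 : (0 < #|F|.-1)%N.
  by rewrite -ltnS prednK; [exact: finNzRing_gt1|exact: ltnW (finNzRing_gt1 F)].
exists (FinRing.uval (g ^+ (#|F|.-1 %/ n))%g).
  by rewrite -FinRing.val_unitX -expgM divnK // -go expg_order.
move=> m /andP[m0 mn]; apply/negP => /eqP h.
have : (g ^+ (#|F|.-1 %/ n * m) == 1)%g.
  by apply/eqP/val_inj; rewrite /= expgM FinRing.val_unitX h.
rewrite -order_dvdn go; move: (#|F|.-1) nF F0 => K nK K0.
have n0 : (0 < n)%N by apply: leq_trans mn.
have Kn : (0 < K %/ n)%N by rewrite divn_gt0 // dvdn_leq.
move=> /dvdn_leq; rewrite muln_gt0 Kn m0 => /(_ isT).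
by rewrite leqNgt -{2}(divnK nK) ltn_pmul2l // mn.
Qed.

(** In characteristic q the Gauss sum g satisfies g^q = (q/p) g by the Frobenius, and also g^q =
    (g^2)^((q - 1) / 2) g, which Euler's criterion in characteristic q evaluates since g^2 is p up
    to its sign. *)
Lemma quadratic_reciprocity (p q : nat) : prime p -> prime q -> (2 < p)%N -> (2 < q)%N ->
  lg q ((-1) ^+ (p.-1)./2 * p%:Z) = lg p q%:Z.
Proof.
move=> pp pq p2 q2.
have [pq_eq|npq] := eqVneq p q.
  by rewrite -pq_eq !lg_dvd ?dvdz_mull.
have cpq : coprime q p by rewrite prime_coprime // dvdn_prime2 // eq_sym.
have p10 : (0 < p.-1)%N by lia.
(* The field with q^(p - 1) elements contains p-th roots of unity by Fermat's little theorem. *)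
have [F ch cF] := pPrimePowerField pq p10.
have pF : (p %| #|F|.-1)%N.
  rewrite cF -subn1 -eqn_mod_dvd ?expn_gt0 ?prime_gt0 //.
  have := Euler_exp_totient cpq; rewrite totient_prime // => ->; by [].
have [w wp wm] := root_of_order pF.
have w1 : w != 1 by have := wm 1%N; rewrite expr1; apply; lia.
pose g := gaussF p w.
have g2 : g ^+ 2 = ((-1) ^+ (p.-1)./2 * p%:Z)%:~R by rewrite gaussF_sqr // lgN1.
set D := (-1) ^+ _ * _ in g2 *.
have qodd : odd q by have [q_2|//] := even_prime pq; rewrite q_2 in q2.
have int_inj (x y : int) : `|x| <= 1 -> `|y| <= 1 -> x%:~R = y%:~R :> F -> x = y.
  move=> hx hy /eqP; rewrite -subr_eq0 -intrB => h.
  apply/eqP; rewrite -subr_eq0; apply: contraLR h => nz.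
  have : `|x - y| <= 2 by rewrite (le_trans (ler_normB _ _)) //; lia.
  move=> h2; have h3 : (`|x - y|%N < q)%N by lia.
  suff : (`|x - y|%N%:R != 0 :> F).
    apply: contra => /eqP h; have : (`|x - y| : int)%:~R = 0 :> F.
      by case: (ger0P (x - y)) => _; rewrite ?rmorphN /= h ?oppr0.
    by rewrite -abszE -pmulrn => ->.
  by rewrite -(dvdn_pcharf ch); apply/negP => /dvdn_leq; lia.
have g0 : g != 0.
  apply: contraNneq (_ : g ^+ 2 != 0) => [->|]; first by rewrite expr0n.
  rewrite g2 intrM mulf_neq0 // ?rmorphXn /= ?expf_neq0 ?rmorphN /= ?oppr_eq0 ?oner_neq0 //.
  by rewrite -pmulrn -(dvdn_pcharf ch) dvdn_prime2 // eq_sym.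
have gq : g ^+ q = (lg p q%:Z)%:~R * g.
  rewrite -[g ^+ q]/(pFrobenius_aut ch g) rmorph_sum /=.
  have q0 : q%:R != 0 :> 'F_p.
    by rewrite -(dvdn_pcharf (pchar_Fp pp)) dvdn_prime2.
  rewrite -[q%:Z]/(q%:Z) -(lgF_int pp q%:Z) -pmulrn -gaussF_mul //.
  apply: eq_bigr => x _; rewrite rmorphM /= rmorph_int; congr (_ * _).
  by rewrite pFrobenius_autE -[x in RHS]Fp_nat -natrM (psiF_nat pp wp) -exprM.
have lgE : (lg q D)%:~R = D%:~R ^+ (q.-1)./2 :> F by exact: euler_crit_pchar.
have gq2 : g ^+ q = (lg q D)%:~R * g.
  rewrite lgE -g2 -exprM -exprSr; congr (_ ^+ _).
  by rewrite mulnC muln2 even_halfK ?prednK ?prime_gt0 // -subn1 oddB ?prime_gt0 // qodd.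
apply: int_inj; rewrite ?lg_le1 //.
by apply: (mulIf g0); rewrite -gq -gq2.
Qed.

(** In the field with p^2 elements take w of order 8: t = w + 1 / w has square 2, and the Frobenius
    sends t to w^p + w^-p, which depends only on p modulo 8. *)
Lemma second_supplement (p : nat) : prime p -> (2 < p)%N ->
  lg p 2 = if (p %% 8 == 1)%N || (p %% 8 == 7)%N then 1 else -1.
Proof.
move=> pp p2.
have podd : odd p by have [p_2|//] := even_prime pp; rewrite p_2 in p2.
have [F ch cF] := pPrimePowerField pp (isT : (0 < 2)%N).
have m8 : [|| p %% 8 == 1, p %% 8 == 3, p %% 8 == 5 | p %% 8 == 7]%N.
  have : (p %% 8 < 8)%N by rewrite ltn_mod.
  have : odd (p %% 8) by rewrite odd_mod.
  by case: (p %% 8)%N => [|[|[|[|[|[|[|[|]]]]]]]].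
have pF : (8 %| #|F|.-1)%N.
  rewrite cF -subn1 -eqn_mod_dvd ?expn_gt0 ?prime_gt0 // -modnXm.
  by case/or4P: m8 => /eqP ->.
have [w w8 wm] := root_of_order pF.
have w0 : w != 0 by apply: contra_eq_neq w8 => ->; rewrite expr0n eq_sym oner_neq0.
have w4 : w ^+ 4 = -1.
  have : (w ^+ 4) ^+ 2 == 1 by rewrite -exprM w8.
  by rewrite sqrf_eq1 (negPf (wm 4%N isT)) => /eqP.
pose t := w + w^-1.
have t2 : t ^+ 2 = 2%:R.
  have h : w ^+ 2 = - w^-1 ^+ 2.
    by rewrite exprVn; apply: (mulIf (expf_neq0 2 w0)); rewrite -exprD w4 mulNr mulVf ?expf_neq0.
  rewrite /t sqrrD h divff //; ring.
have two0 : 2%:R != 0 :> F.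
  by rewrite -(dvdn_pcharf ch); apply/negP => /dvdn_leq; lia.
have t0 : t != 0 by apply: contraNneq two0 => t0; rewrite -t2 t0 expr0n.
have wmod n : w ^+ n = w ^+ (n %% 8) by rewrite {1}(divn_eq n 8) exprD mulnC exprM w8 expr1n mul1r.
have tp : t ^+ p = w ^+ (p %% 8) + w^-1 ^+ (p %% 8).
  rewrite -[t ^+ p]/(pFrobenius_aut ch t) rmorphD /= !pFrobenius_autE.
  by rewrite !exprVn (wmod p).
have wV : w^-1 = - w ^+ 3.
  by apply: (mulfI w0); rewrite divff // mulrN -exprS w4 opprK.
have tp2 : t ^+ p = (if (p %% 8 == 1)%N || (p %% 8 == 7)%N then 1 else -1) * t.
  rewrite tp /t; have w5 : w ^+ 5 = - w by rewrite exprS w4 mulrN1.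
  have w6 : w ^+ 6 = - w ^+ 2 by rewrite (exprD w 2 4) w4 mulrN1.
  have w7 : w ^+ 7 = - w ^+ 3 by rewrite (exprD w 3 4) w4 mulrN1.
  have w9 : (w ^+ 3) ^+ 3 = w by rewrite -exprM (exprD w 8 1) w8 mul1r.
  have w15 : (w ^+ 3) ^+ 5 = - w ^+ 3 by rewrite -exprM (exprD w 8 7) w8 mul1r w7.
  have w21 : (w ^+ 3) ^+ 7 = - w.
    by rewrite -exprM (exprD w 16 5) (exprM w 8 2) w8 expr1n mul1r w5.
  rewrite wV; case/or4P: m8 => /eqP -> /=.
  - by rewrite !expr1 mul1r.
  - rewrite (exprNn (w ^+ 3)) w9; ring.
  - rewrite (exprNn (w ^+ 3)) w15 w5; ring.
  - rewrite (exprNn (w ^+ 3)) w21 w7; ring.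
have lgE : (lg p 2)%:~R = 2%:R ^+ (p.-1)./2 :> F by exact: (euler_crit_pchar pp p2 2).
have : (lg p 2)%:~R * t = (if (p %% 8 == 1)%N || (p %% 8 == 7)%N then 1 else -1) * t.
  rewrite -tp2 lgE -t2 -exprM -exprSr; congr (_ ^+ _).
  by rewrite mulnC muln2 even_halfK ?prednK ?prime_gt0 // -subn1 oddB ?prime_gt0 // podd.
move/(mulIf t0).
have n11 : (-1 != 1 :> F).
  by rewrite -subr_eq0 -opprD oppr_eq0 -[1 + 1]/(2%:R).
have nd : ~~ (p%:Z %| 2)%Z by rewrite dvdzE /=; apply/negP => /dvdn_leq; lia.
have [->|->] := lg_cases nd; case: ifP => // _ /eqP; rewrite ?rmorphN /=.
  by rewrite eq_sym (negPf n11).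
by rewrite (negPf n11).
Qed.

(** * The characters chi N for N squarefree and prime to 6 *)

Section KroneckerCharacter.

(** The discriminant in the Kronecker symbol [chi], with the sign that makes it 1 modulo 4 for odd
    a. *)
Definition star (a : nat) : int := (-1) ^+ ((a - 1) %/ 2) * a%:Z.

Lemma sign_half_mul m n : odd m -> odd n ->
  (-1) ^+ ((m * n - 1) %/ 2) = (-1) ^+ ((m - 1) %/ 2 + (n - 1) %/ 2) :> int.
Proof.
move=> mo no; rewrite -signr_odd -[RHS]signr_odd; congr (_ ^+ nat_of_bool _).
have [a ->] : exists a, m = (a * 2 + 1)%N by exists m./2; lia.
have [b ->] : exists b, n = (b * 2 + 1)%N by exists n./2; lia.
have -> : ((a * 2 + 1) * (b * 2 + 1) - 1 = (2 * (a * b) + (a + b)) * 2)%N by nia.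
by rewrite !addnK !mulnK // oddD oddM.
Qed.

Lemma star_mul m n : odd m -> odd n -> star (m * n) = star m * star n.
Proof.
move=> mo no; rewrite /star PoszM mulrACA -exprD; congr (_ * _).
exact: sign_half_mul.
Qed.

Lemma star_odd n : odd n -> ~~ (2 %| star n)%Z.
Proof. by move=> no; rewrite dvdzE abszMsign dvdn2 no. Qed.

Lemma mod8_odd (D : int) : ~~ (2 %| D)%Z -> [\/ (D %% 8)%Z = 1, (D %% 8)%Z = 3, (D %% 8)%Z = 5 | (D %% 8)%Z = 7].
Proof.
move=> nd; have h0 : 0 <= (D %% 8)%Z by rewrite modz_ge0.
have h1 : (D %% 8)%Z < 8 by rewrite ltz_pmod.
have h2 : ~~ (2 %| (D %% 8))%Z.
  apply: contra nd => h; rewrite (divz_eq D 8); apply: rpredD => //.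
  by apply: dvdz_mull.
case: (D %% 8)%Z h0 h1 h2 => [[|[|[|[|[|[|[|[|n]]]]]]]]|] //.
all: by [constructor 1|constructor 2|constructor 3|constructor 4|].
Qed.

Lemma kprime_lg D q : q != 2 -> kronecker_prime D q = lg q D.
Proof. by move=> /negPf q2; rewrite /kronecker_prime /lg q2. Qed.

Lemma kprimeM D1 D2 q : prime q -> ~~ (2 %| D1)%Z -> ~~ (2 %| D2)%Z ->
  kronecker_prime (D1 * D2) q = kronecker_prime D1 q * kronecker_prime D2 q.
Proof.
move=> pq o1 o2; have [->|q2] := eqVneq q 2%N; last first.
  by rewrite !kprime_lg // lgM // ltn_neqAle eq_sym q2 prime_gt1.
have o12 : ~~ (2 %| D1 * D2)%Z by move: o1 o2; rewrite !dvdzE abszM Euclid_dvdM // negb_or => -> ->.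
rewrite /kronecker_prime (negPf o1) (negPf o2) (negPf o12) eqxx -modzMm.
by case: (mod8_odd o1) => ->; case: (mod8_odd o2) => ->.
Qed.

Lemma kroneckerM D1 D2 b : ~~ (2 %| D1)%Z -> ~~ (2 %| D2)%Z ->
  kronecker (D1 * D2) b = kronecker D1 b * kronecker D2 b.
Proof.
move=> o1 o2; rewrite /kronecker; case: eqP => _.
  by rewrite abszM muln_eq1; case: eqP => _; case: eqP => _.
rewrite mulrACA -big_split /=; congr (_ * _).
  have n1 : D1 != 0 by apply: contraNneq o1 => ->.
  have n2 : D2 != 0 by apply: contraNneq o2 => ->.
  by rewrite mulr_lt0 n1 n2 /=; case: (b < 0) => //=; case: (D1 < 0); case: (D2 < 0).
rewrite [LHS]big_seq [RHS]big_seq; apply: eq_bigr => q.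
by rewrite mem_primes => /andP[pq _]; rewrite kprimeM // exprMn.
Qed.

Lemma chi_mulN m n b : odd m -> odd n -> chi (m * n) b = chi m b * chi n b.
Proof. by move=> mo no; rewrite /chi -!/(star _) star_mul // kroneckerM ?star_odd. Qed.

Lemma chi_1 b : chi 1 b = 1.
Proof.
rewrite /chi /= expr0 mul1r /kronecker; case: eqP => // _.
rewrite andbF mul1r big_seq big1 // => q; rewrite mem_primes => /andP[pq _].
have [->|q2] := eqVneq q 2%N; first by rewrite [kronecker_prime _ _](_ : _ = 1) ?expr1n.
by rewrite kprime_lg // lg1 ?expr1n // ltn_neqAle eq_sym q2 prime_gt1.
Qed.

Lemma half_pred p : odd p -> ((p - 1) %/ 2 = (p.-1)./2)%N.
Proof. by move=> _; rewrite subn1 divn2. Qed.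

(** Reciprocity at the odd primes dividing b, its second supplement at 2, and the value at -1 for
    the sign move b to the numerator; in this form periodicity modulo p is visible. *)
Lemma chi_prime p b : prime p -> (2 < p)%N -> chi p b = lg p b.
Proof.
move=> pp p2; have po : odd p by have [p_2|//] := even_prime pp; rewrite p_2 in p2.
have key q : prime q -> kronecker_prime (star p) q = lg p q%:Z.
  move=> pq; have [->|q2] := eqVneq q 2%N; last first.
    rewrite kprime_lg // /star half_pred // quadratic_reciprocity //.
    by rewrite ltn_neqAle eq_sym q2 prime_gt1.
  rewrite second_supplement // /kronecker_prime (negPf (star_odd po)) eqxx.
  congr (if _ then _ else _); rewrite /star half_pred // -signr_odd.
  have pE := odd_double_half p; rewrite po /= in pE.
  have p8 : ((p%:Z %% 8)%Z = (p %% 8)%N%:Z)%Z by rewrite modz_nat.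
  have [m mE] : exists m : nat, p = (8 * m + p %% 8)%N by exists (p %/ 8)%N; rewrite mulnC -divn_eq.
  have : odd (p %% 8) by rewrite odd_mod.
  have : (p %% 8 < 8)%N by rewrite ltn_mod.
  have hodd : odd ((p.-1)./2) = (p %% 8 == 3)%N || (p %% 8 == 7)%N.
    have : (p %% 8 < 8)%N by rewrite ltn_mod.
    have : odd (p %% 8) by rewrite odd_mod.
    have -> : (p.-1)./2 = (4 * m + ((p %% 8).-1)./2)%N.
      have : odd (p %% 8) by rewrite odd_mod.
      lia.
    rewrite oddD oddM /=.
    by case: (p %% 8)%N => [|[|[|[|[|[|[|[|]]]]]]]].
  rewrite {}hodd -modzMmr p8; move: (p %% 8)%N => r.
  by case: r => [|[|[|[|[|[|[|[|n]]]]]]]].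
rewrite /chi -/(star p) /kronecker; case: eqP => [->|b0].
  by rewrite lg_dvd // /star abszMsign /= gtn_eqF // ltnW.
have absE : lg p `|b|%N%:Z =
    \prod_(q <- primes `|b|) kronecker_prime (star p) q ^+ logn q `|b|.
  have b1 : (0 < `|b|)%N by rewrite absz_gt0; apply/eqP.
  rewrite {1}(prod_prime_decomp b1) prime_decompE big_map /=.
  have -> : (\prod_(j <- primes `|b|) j ^ logn j `|b|)%N%:Z =
      \prod_(j <- primes `|b|) j%:Z ^+ logn j `|b|.
    rewrite (big_morph Posz PoszM erefl); apply: eq_bigr => j _.
    by rewrite -natz natrX natz.
  rewrite (big_morph (lg p) (lgM pp p2) (lg1 pp p2)) [LHS]big_seq [RHS]big_seq.
  by apply: eq_bigr => q; rewrite mem_primes => /andP[pq _]; rewrite lgX // key.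
rewrite -absE.
have sgn : (star p < 0) = odd ((p.-1)./2).
  rewrite /star half_pred // -signr_odd; case: odd; rewrite ?expr1 ?expr0; lia.
have [b1|b1] := ltP b 0; last by rewrite mul1r gez0_abs.
rewrite ltz0_abs // -[- b]mulN1r lgM // lgN1 // mulrA /= sgn -[(-1) ^+ (p.-1)./2]signr_odd.
by case: odd; rewrite ?expr1 ?expr0 ?mulrNN ?mul1r.
Qed.

Definition good (N : nat) : Prop := squarefree N /\ coprime N 6.

Lemma good_odd N : good N -> odd N.
Proof.
move=> [_ c6]; have : coprime N 2 by apply: coprime_dvdr c6.
by rewrite coprimen2.
Qed.

Lemma good_gt0 N : good N -> (0 < N)%N. Proof. by case=> [] []. Qed.

Lemma good_dvd N d : good N -> (d %| N)%N -> good d.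
Proof.
move=> [[N0 sq] c6] dN; split; last exact: coprime_dvdl dN c6.
by split=> [|m md]; [apply: dvdn_gt0 dN|apply: sq; apply: dvdn_trans md dN].
Qed.

Lemma good_coprime m n : good (m * n) -> coprime m n.
Proof.
move=> [[N0 sq] _]; rewrite /coprime; apply/eqP; apply: sq.
by rewrite -mulnn dvdn_mul ?dvdn_gcdl ?dvdn_gcdr.
Qed.

(** Induction that splits off the least prime divisor, which is at least 5. *)
Lemma good_ind (P : nat -> Prop) : P 1%N ->
  (forall p M, prime p -> (4 < p)%N -> good (p * M) -> P M -> P (p * M)%N) ->
  forall N, good N -> P N.
Proof.
move=> P1 PS N; elim/ltn_ind: N => N IH gN.
have [->|N1] := eqVneq N 1%N; first exact: P1.
have N2 : (1 < N)%N by have := good_gt0 gN; lia.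
pose p := pdiv N; have pp : prime p by exact: pdiv_prime.
have pN : (p %| N)%N by exact: pdiv_dvd.
have NE : N = (p * (N %/ p))%N by rewrite mulnC divnK.
have p4 : (4 < p)%N.
  have [_ c6] := gN; have cp : coprime p 6 by apply: coprime_dvdl pN c6.
  by case: (p) pp cp => [|[|[|[|[|q]]]]].
rewrite NE; apply: PS => //; first by rewrite -NE.
apply: IH; last by apply: good_dvd gN (dvdn_div pN).
by rewrite ltn_Pdiv // ?prime_gt1 // ltnW.
Qed.

Record chi_spec (N : nat) : Prop := ChiSpec {
  chiM : forall a b, chi N (a * b) = chi N a * chi N b;
  chi_mod : forall a b, (a = b %[mod N%:Z])%Z -> chi N a = chi N b;
  chiN1 : chi N (-1) = (-1) ^+ ((N - 1) %/ 2);
  chi_sqr : forall a, coprime `|a| N -> chi N a ^+ 2 = 1;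
  chi_eq0 : forall a, ~~ coprime `|a| N -> chi N a = 0 }.

Lemma chiP N : good N -> chi_spec N.
Proof.
move: N; apply: good_ind => [|p M pp p4 gN [hM hm hN hs h0]].
  by split=> [a b|a b _||a _|a]; rewrite ?chi_1 // coprimen1.
have p2 : (2 < p)%N by lia.
have Mo : odd M by have := good_odd gN; rewrite oddM => /andP[].
have po : odd p by have := good_odd gN; rewrite oddM => /andP[].
have e b : chi (p * M) b = lg p b * chi M b by rewrite chi_mulN // chi_prime.
have nd a : coprime `|a| p = ~~ (p%:Z %| a)%Z.
  by rewrite coprime_sym prime_coprime // dvdzE.
split=> [a b|a b ab||a|a].
- by rewrite !e lgM // hM mulrACA.
- rewrite !e; congr (_ * _).
    by apply: lg_eqmod; apply/eqP; rewrite eqz_mod_dvd; apply: dvdz_trans (_ : _ %| (p * M)%N%:Z)%Z _; rewrite ?PoszM ?dvdz_mulr // -eqz_mod_dvd -PoszM ab.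
  by apply: hm; apply/eqP; rewrite eqz_mod_dvd; apply: dvdz_trans (_ : _ %| (p * M)%N%:Z)%Z _; rewrite ?PoszM ?dvdz_mull // -eqz_mod_dvd -PoszM ab.
- by rewrite e lgN1 // hN -half_pred // -exprD sign_half_mul.
- by rewrite coprimeMr nd => /andP[ap aM]; rewrite e exprMn lg_sqr // hs.
- rewrite coprimeMr nd negb_and negbK e => /orP[/lg_dvd ->|/h0 ->]; by rewrite ?mul0r ?mulr0.
Qed.

Lemma chi_one N : good N -> chi N 1 = 1.
Proof.
move=> gN; have h := chiM (chiP gN) 1 1; have := chi_sqr (chiP gN) (coprime1n N : coprime `|1%Z| N).
by rewrite mulr1 in h; rewrite expr2 -h.
Qed.

Lemma chi_le1 N a : good N -> `|chi N a| <= 1.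
Proof.
move=> gN; have [c|c] := boolP (coprime `|a| N); last by rewrite (chi_eq0 (chiP gN) c).
have := chi_sqr (chiP gN) c => /eqP; rewrite sqrf_eq1 => /orP[] /eqP -> //.
Qed.

Lemma chi0 N : good N -> chi N 0 = (N == 1%N)%:R.
Proof.
move=> gN; have [->|N1] := eqVneq N 1%N; first by rewrite chi_1.
by rewrite (chi_eq0 (chiP gN)) //= /coprime gcd0n.
Qed.

Lemma chi_reciprocity p M : prime p -> (4 < p)%N -> good M ->
  lg p M%:Z = chi M (star p).
Proof.
move=> pp p4; have p2 : (2 < p)%N by lia.
have po : odd p by have [p_2|//] := even_prime pp; rewrite p_2 in p4.
move: M; apply: good_ind => [|q M pq q4 gN IH]; first by rewrite chi_1 lg1.
have Mo : odd M by have := good_odd gN; rewrite oddM => /andP[].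
have qo : odd q by have := good_odd gN; rewrite oddM => /andP[].
rewrite PoszM lgM // chi_mulN // IH; congr (_ * _).
by rewrite chi_prime //; [rewrite /star half_pred // quadratic_reciprocity // ltnW|]; lia.
Qed.

End KroneckerCharacter.

(** * The modular group *)

(** Entries as plain fields keep products and determinants polynomial expressions; the passage from
    'M[int]_2 is made only for the final cusp form. *)
Record mat2 := Mat2 { ma : int; mb : int; mc : int; md : int }.

Definition mul2 (g h : mat2) : mat2 :=
  Mat2 (ma g * ma h + mb g * mc h) (ma g * mb h + mb g * md h)
       (mc g * ma h + md g * mc h) (mc g * mb h + md g * md h).
Definition sl2 (g : mat2) : Prop := ma g * md g - mb g * mc g = 1.
Definition one2 := Mat2 1 0 0 1.
Definition S2 := Mat2 0 (-1) 1 0.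
Definition T2 (n : int) := Mat2 1 n 0 1.
Definition inv2 (g : mat2) := Mat2 (md g) (- mb g) (- mc g) (ma g).

Lemma eq_mat2 a b c d a' b' c' d' : a = a' -> b = b' -> c = c' -> d = d' ->
  Mat2 a b c d = Mat2 a' b' c' d'.
Proof. by move=> -> -> -> ->. Qed.

Lemma sl2_mul g h : sl2 g -> sl2 h -> sl2 (mul2 g h).
Proof.
case: g h => [a b c d] [a' b' c' d']; rewrite /sl2 /= => h1 h2.
have -> : (a * a' + b * c') * (c * b' + d * d') - (a * b' + b * d') * (c * a' + d * c') =
  (a * d - b * c) * (a' * d' - b' * c') by ring.
by rewrite h1 h2.
Qed.

Lemma sl2_S : sl2 S2. Proof. by []. Qed.
Lemma sl2_T n : sl2 (T2 n). Proof. by rewrite /sl2 /=; lia. Qed.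

Lemma sl2_inv g : sl2 g -> sl2 (inv2 g).
Proof. by case: g => a b c d; rewrite /sl2 /= => <-; ring. Qed.

Lemma mul2V g h : sl2 h -> mul2 (mul2 g (inv2 h)) h = g.
Proof.
case: g h => [a b c d] [a' b' c' d']; rewrite /sl2 /= => h2.
have h3 x : x = x * (a' * d' - b' * c') by rewrite h2 mulr1.
apply: eq_mat2 => /=; [rewrite [RHS]h3|rewrite [RHS]h3|rewrite [RHS]h3|rewrite [RHS]h3]; ring.
Qed.

Section Generation.
Variable P : mat2 -> Prop.
Hypothesis P1 : P one2.
Hypothesis PT : forall g, sl2 g -> P g -> P (mul2 g (T2 1)).
Hypothesis PT' : forall g, sl2 g -> P g -> P (mul2 g (T2 (-1))).
Hypothesis PS : forall g, sl2 g -> P g -> P (mul2 g S2).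

Lemma sl2_ind_T g n : sl2 g -> P g -> P (mul2 g (T2 n)).
Proof.
have pos (m : nat) h : sl2 h -> P h -> P (mul2 h (T2 m)) /\ P (mul2 h (T2 (- m%:Z))).
  elim: m h => [|m IH] h sh Ph.
    have -> : mul2 h (T2 (- 0%:Z)) = h.
      by case: h {sh Ph} => a b c d; apply: eq_mat2 => /=; ring.
    by [].
  split.
    have -> : mul2 h (T2 m.+1) = mul2 (mul2 h (T2 1)) (T2 m).
      by apply: eq_mat2 => /=; rewrite -?[m.+1]addn1 ?PoszD; ring.
    by apply: (IH _ _ _).1; [exact: sl2_mul (sl2_T _)|exact: PT].
  have -> : mul2 h (T2 (- m.+1%:Z)) = mul2 (mul2 h (T2 (-1))) (T2 (- m%:Z)).
    by apply: eq_mat2 => /=; rewrite -?[m.+1]addn1 ?PoszD; ring.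
  by apply: (IH _ _ _).2; [exact: sl2_mul (sl2_T _)|exact: PT'].
move=> sg Pg; case: (intP n) => [|m|m]; first exact: (pos 0%N g sg Pg).1.
  exact: (pos m.+1 g sg Pg).1.
exact: (pos m.+1 g sg Pg).2.
Qed.

(* Euclid's algorithm on the bottom row. *)
Lemma sl2_ind g : sl2 g -> P g.
Proof.
have [n] := ubnP `|mc g|%N; elim: n g => // n IH g cn sg.
have PS3 h : sl2 h -> P (mul2 h S2) -> P h.
  move=> sh Ph; have s1 := sl2_mul sh sl2_S; have s2 := sl2_mul s1 sl2_S.
  have -> : h = mul2 (mul2 (mul2 (mul2 h S2) S2) S2) S2.
    by case: h {sh Ph s1 s2} => a b c d; apply: eq_mat2 => /=; ring.
  by apply: (PS (sl2_mul s2 sl2_S)); apply: (PS s2); apply: PS.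
have PTn h m : sl2 h -> P (mul2 h (T2 m)) -> P h.
  move=> sh Ph.
  have -> : h = mul2 (mul2 h (T2 m)) (T2 (- m)).
    by case: h {sh Ph} => a b c d; apply: eq_mat2 => /=; ring.
  by apply: sl2_ind_T => //; exact: sl2_mul (sl2_T _).
have [c0|c0] := eqVneq (mc g) 0.
  have sT h : sl2 h -> mc h = 0 -> ma h = 1 -> P h.
    case: h => a b c d; rewrite /sl2 /= => + c00 a1; rewrite c00 a1 mulr0 subr0 mul1r => d1.
    have -> : Mat2 1 b 0 d = mul2 one2 (T2 b) by apply: eq_mat2 => /=; rewrite ?d1; ring.
    exact: sl2_ind_T.
  have [a1|a1] : ma g = 1 \/ ma g = -1.
    have := sg; rewrite /sl2 c0 mulr0 subr0.
    move=> h; have : (`|ma g| * `|md g| = 1)%N by rewrite -abszM h.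
    move=> /eqP; rewrite muln_eq1 => /andP[/eqP h1 _]; lia.
    exact: sT.
  apply: (PS3 _ sg); apply: (PS3 _ (sl2_mul sg sl2_S)); apply: sT.
  - exact: sl2_mul (sl2_mul sg sl2_S) sl2_S.
  - by rewrite /= c0; ring.
  - by rewrite /= a1; ring.
pose m := - (md g %/ mc g)%Z.
apply: (PTn _ m sg); apply: (PS3 _ (sl2_mul sg (sl2_T _))).
apply: IH; last exact: sl2_mul (sl2_mul sg (sl2_T _)) sl2_S.
have -> : mc (mul2 (mul2 g (T2 m)) S2) = (md g %% mc g)%Z.
  by rewrite /= {2}(divz_eq (md g) (mc g)) /m; ring.
have := ltz_mod (md g) c0; have := modz_ge0 (md g) c0; move: cn; lia.
Qed.

End Generation.

(** The exponent modulo 12 of the multiplier of eta^2, in a closed form valid for both parities of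
    c. *)
Definition psi2 (g : mat2) : int := let: Mat2 a b c d := g in
  (1 - c ^+ 2) * (b * d + 3 * (c - 1) * d + c + 3) + c * (a + d - 3).

Lemma cube_mod3 (m : int) : exists t, m * (1 - m ^+ 2) = 3 * t.
Proof.
have [q [->|[->|->]]] : exists q, m = 3 * q \/ m = 3 * q + 1 \/ m = 3 * q + 2.
  by exists (m %/ 3)%Z; lia.
- by exists (q * (1 - 9 * q ^+ 2)); ring.
- by exists ((3 * q + 1) * (- q * (3 * q + 2))); ring.
- by exists (- (3 * q + 2) * (3 * q + 1) * (q + 1)); ring.
Qed.

Lemma psi2_T g : sl2 g -> exists m, psi2 (mul2 g (T2 1)) = psi2 g + 1 + 12 * m.
Proof.
case: g => a b c d; rewrite /sl2 /= => h.
suff [m Hm] : exists m, c * (1 - c ^+ 2) * (a + 2 * b + 3 * c - 3) = 12 * m.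
  exists m; rewrite -Hm.
  have h1 : (1 - c ^+ 2) * (a * d - b * c) = 1 - c ^+ 2 by rewrite h mulr1.
  apply/eqP; rewrite -subr_eq0; apply/eqP.
  transitivity ((1 - c ^+ 2) * (a * d - b * c) - (1 - c ^+ 2)); last by rewrite h1 subrr.
  by ring.
have [t Ht] := cube_mod3 c; rewrite Ht.
have [x [cx|cx]] : exists x, c = 2 * x \/ c = 2 * x + 1 by exists (c %/ 2)%Z; lia.
  have [y ay] : exists y, a = 2 * y + 1.
    exists (a %/ 2)%Z; have [//|e] : a = 2 * (a %/ 2)%Z + 1 \/ a = 2 * (a %/ 2)%Z by lia.
    by move: h; rewrite cx e -!mulrA (mulrCA b); lia.
  have : exists u, t = 2 * u.
    exists (t %/ 2)%Z; suff : exists w, 3 * t = 2 * w by case; lia.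
    by exists (x * (1 - c ^+ 2)); rewrite -Ht cx; ring.
  case=> u ->; exists (u * (y + b + 3 * x - 1)); rewrite ay cx; ring.
have : exists u, t = 4 * u.
  exists (t %/ 4)%Z; suff : exists w, 3 * t = 4 * w by case; lia.
  by exists (- (2 * x + 1) * x * (x + 1)); rewrite -Ht cx; ring.
by case=> u ->; exists (u * (a + 2 * b + 3 * c - 3)); ring.
Qed.

(** A finite check over all matrices modulo 4. *)
Lemma psi2_S_mod4 (a b c d : 'I_4) : a * d - b * c = 1 ->
  (1 - d ^+ 2) * (a * c - 3%:R * (d - 1) * c + d + 3%:R) + d * (b - c - 3%:R) + 3%:R =
  (1 - c ^+ 2) * (b * d + 3%:R * (c - 1) * d + c + 3%:R) + c * (a + d - 3%:R) :> 'I_4.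
Proof.
have chk : all (fun a => all (fun b => all (fun c => all (fun d =>
   let a := inZp a : 'I_4 in let b := inZp b : 'I_4 in
   let c := inZp c : 'I_4 in let d := inZp d : 'I_4 in
   (a * d - b * c == 1) ==> ((1 - d ^+ 2) * (a * c - 3%:R * (d - 1) * c + d + 3%:R) + d * (b - c - 3%:R) + 3%:R ==
  (1 - c ^+ 2) * (b * d + 3%:R * (c - 1) * d + c + 3%:R) + c * (a + d - 3%:R) :> 'I_4))
   (iota 0 4)) (iota 0 4)) (iota 0 4)) (iota 0 4) by vm_compute.
move=> h; have {chk} := chk; have m4 (x : 'I_4) : val x \in iota 0 4 by rewrite mem_iota /=.
move=> /allP/(_ _ (m4 a))/allP/(_ _ (m4 b))/allP/(_ _ (m4 c))/allP/(_ _ (m4 d)).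
by cbv zeta; rewrite !valZpK h eqxx => /eqP.
Qed.

Lemma intr_I4_eq0 (x : int) : x%:~R = 0 :> 'I_4 -> exists t, x = 4 * t.
Proof.
move=> h; suff /dvdnP[q hq] : (4 %| `|x|)%N.
  have [x0|x0] := leP 0 x; [exists q%:Z|exists (- q%:Z)]; lia.
have : (`|x|%N)%:R = 0 :> 'I_4.
  have [x0|x0] := leP 0 x; first by rewrite -h -[in RHS](gez0_abs x0).
  apply: oppr_inj; rewrite oppr0 -[RHS]h -[in RHS](opprK x) -(ltz0_abs x0) rmorphN //.
by move=> /(congr1 val); rewrite /= Zp_nat /= => /eqP.
Qed.

(** The congruence is proved modulo 3, where c^3 = c turns it into a polynomial identity, and modulo
    4 by exhaustion. *)
Lemma psi2_S g : sl2 g -> exists m, psi2 (mul2 g S2) = psi2 g - 3 + 12 * m.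
Proof.
move=> sg; suff [[t Ht] [u Hu]] : (exists t, psi2 (mul2 g S2) - psi2 g + 3 = 3 * t) /\
    (exists u, psi2 (mul2 g S2) - psi2 g + 3 = 4 * u).
  (* From x = 3 t = 4 u follows x = 4 x - 3 x = 12 (t - u). *)
  by exists (t - u); move: Ht Hu; lia.
split.
  case: g sg => a b c d; rewrite /sl2 /= => h.
  have [t Ht] := cube_mod3 c; have [s Hs] := cube_mod3 d.
  exists (- (d - 1) * c * (1 - d ^+ 2) - d * c + (1 - d ^+ 2) - d + s - t
      - (1 - c ^+ 2) * (c - 1) * d - (1 - c ^+ 2) + c + 1).
  apply/eqP; rewrite -subr_eq0; apply/eqP.
  transitivity (c * d * (1 - (a * d - b * c)) + (d * (1 - d ^+ 2) - 3 * s) - (c * (1 - c ^+ 2) - 3 * t));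
    last by rewrite h Ht Hs; ring.
  ring.
apply: intr_I4_eq0; case: g sg => a b c d; rewrite /sl2 /= => h.
have h' : a%:~R * d%:~R - b%:~R * c%:~R = 1 :> 'I_4 by rewrite -!intrM -intrB h.
have e := psi2_S_mod4 h'.
apply/eqP; rewrite (_ : _ - _ + 3 = ((1 - d ^+ 2) * (a * c - 3 * (d - 1) * c + d + 3) + d * (b - c - 3) + 3) -
   ((1 - c ^+ 2) * (b * d + 3 * (c - 1) * d + c + 3) + c * (a + d - 3))); last by ring.
rewrite !(rmorphD, rmorphB, rmorphM, rmorphXn, rmorph1, rmorph_nat, rmorphN) /=.
by rewrite subr_eq0; apply/eqP.
Qed.

(** * Moebius action, slash operator and the transformation of eta *)

Section EtaModular.
Variable R : realType.
Local Notation C := R[i].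
Local Open Scope complex_scope.

Definition j2 (g : mat2) (z : C) : C := (mc g)%:~R * z + (md g)%:~R.
Definition mob2 (g : mat2) (z : C) : C := ((ma g)%:~R * z + (mb g)%:~R) / j2 g z.

Lemma i_neq0 : ('i : C) != 0.
Proof. by apply: Im_gt0_neq0; rewrite /= ltr01. Qed.

Lemma j2_T g n (z : C) : j2 (mul2 g (T2 n)) z = j2 g (z + n%:~R).
Proof. by rewrite /j2 /= !(intrD, intrM); ring. Qed.

Lemma mob2_T g n (z : C) : mob2 (mul2 g (T2 n)) z = mob2 g (z + n%:~R).
Proof. by rewrite /mob2 j2_T; congr (_ / _); rewrite /= !(intrD, intrM); ring. Qed.

Lemma j2_S g (z : C) : z != 0 -> j2 (mul2 g S2) z = z * j2 g (- z^-1).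
Proof. by move=> z0; rewrite /j2 /= !(intrD, intrM, intrN); field. Qed.

Lemma mob2_S g (z : C) : z != 0 -> mob2 (mul2 g S2) z = mob2 g (- z^-1).
Proof.
move=> z0; rewrite /mob2 j2_S //.
have -> : (ma (mul2 g S2))%:~R * z + (mb (mul2 g S2))%:~R = z * ((ma g)%:~R * - z^-1 + (mb g)%:~R).
  by rewrite /= !(intrD, intrM, intrN); field.
by rewrite invfM mulrACA divff // mul1r.
Qed.

Lemma j2_one (z : C) : j2 one2 z = 1. Proof. by rewrite /j2 /=; ring. Qed.
Lemma mob2_one (z : C) : mob2 one2 z = z.
Proof. by rewrite /mob2 j2_one /= divr1 addr0 mul1r. Qed.

Lemma Im_add_int (z : C) (n : int) : complex.Im (z + n%:~R) = complex.Im z.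
Proof. by rewrite ImD Im_int addr0. Qed.

Lemma Im_add_nat (z : C) (n : nat) : complex.Im (z + n%:R) = complex.Im z.
Proof. exact: (Im_add_int z n). Qed.

Lemma mob2P g : sl2 g -> forall z : C, 0 < complex.Im z -> j2 g z != 0 /\ 0 < complex.Im (mob2 g z).
Proof.
apply: (sl2_ind (P := fun g => forall z : C, 0 < complex.Im z -> j2 g z != 0 /\ 0 < complex.Im (mob2 g z))).
- by move=> z z0; rewrite j2_one mob2_one oner_neq0.
- by move=> h _ IH z z0; rewrite j2_T mob2_T; apply: IH; rewrite Im_add_int.
- by move=> h _ IH z z0; rewrite j2_T mob2_T; apply: IH; rewrite Im_add_int.
move=> h _ IH z z0; have zn := Im_gt0_neq0 z0; rewrite j2_S // mob2_S //.
by have [h1 h2] := IH _ (oppV_Im z0); rewrite mulf_neq0.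
Qed.

Lemma j2_neq0 g (z : C) : sl2 g -> 0 < complex.Im z -> j2 g z != 0.
Proof. by move=> sg z0; have [] := mob2P sg z0. Qed.

Lemma mob2_Im g (z : C) : sl2 g -> 0 < complex.Im z -> 0 < complex.Im (mob2 g z).
Proof. by move=> sg z0; have [] := mob2P sg z0. Qed.

Lemma j2_mul g h (z : C) : j2 h z != 0 -> j2 (mul2 g h) z = j2 g (mob2 h z) * j2 h z.
Proof.
move=> n0; rewrite [j2 g _]/j2 mulrDl /mob2 mulrA divfK // /j2 /= !(intrD, intrM).
by ring.
Qed.

Lemma mob2_mul g h (z : C) : j2 h z != 0 -> mob2 (mul2 g h) z = mob2 g (mob2 h z).
Proof.
move=> n0; rewrite {1 2}/mob2 j2_mul //.
have -> : (ma (mul2 g h))%:~R * z + (mb (mul2 g h))%:~R =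
    ((ma g)%:~R * mob2 h z + (mb g)%:~R) * j2 h z.
  by rewrite mulrDl /mob2 mulrA divfK // /j2 /= !(intrD, intrM); ring.
by rewrite -mulf_div divff // mulr1.
Qed.

(** The slash operator f|_k g. *)
Definition sl (k : nat) (f : C -> C) (g : mat2) (z : C) : C := j2 g z ^- k * f (mob2 g z).

Lemma sl_mul k f g h (z : C) : sl2 h -> 0 < complex.Im z ->
  sl k f (mul2 g h) z = sl k (sl k f g) h z.
Proof.
move=> sh z0; have n0 := j2_neq0 sh z0.
rewrite /sl j2_mul // mob2_mul // exprMn (invfM (_ ^+ k)).
by rewrite mulrA [X in X * _]mulrC.
Qed.

Lemma eq_sl k f f' g (z : C) : (forall w : C, 0 < complex.Im w -> f w = f' w) ->
  sl2 g -> 0 < complex.Im z -> sl k f g z = sl k f' g z.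
Proof. by move=> e sg z0; rewrite /sl e // mob2_Im. Qed.

Lemma etaDint (z : C) (n : int) : eta (z + n%:~R) = ee (n%:~R / 24) * eta z.
Proof.
rewrite !eta_ce /etal.
have -> : usr (z + n%:~R) = usr z by apply: eq_tsum => m; rewrite qvarDint.
by rewrite qvarE -cexpD; congr ce; ring.
Qed.

Lemma ee_eqmod (x y : C) (m : int) : x = y + m%:~R -> ee x = ee y.
Proof. by move=> ->; rewrite qvarDint. Qed.

Lemma ee_quarter : ee (4^-1 : C) = 'i.
Proof.
have -> : (4^-1 : C) = (4^-1 : R)%:C by rewrite fmorphV /= rmorph_nat.
rewrite eeE /qvar /cexp /imunit.
have -> : (2 * pi : R)%:C * 'i * (4^-1 : R)%:C = (0 : R) +i* (pi / 2).
  apply/eqP; rewrite eq_complex /=; by apply/andP; split; apply/eqP; field.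
rewrite /= expR0 cos_pihalf sin_pihalf; apply/eqP; rewrite eq_complex /=.
by apply/andP; split; apply/eqP; ring.
Qed.

(** Induction on a word in S and T. The square avoids a root of c z + d, at the price of a sign
    recovered later. *)
Lemma eta_sqr_mod g : sl2 g -> forall z : C, 0 < complex.Im z ->
  eta (mob2 g z) ^+ 2 = ee ((psi2 g)%:~R / 12) * j2 g z * eta z ^+ 2.
Proof.
have stepT (h : mat2) (n : int) (m : int) (X Y : C) : psi2 (mul2 h (T2 n)) = psi2 h + n + 12 * m ->
    ee ((psi2 h)%:~R / 12) * X * (ee (n%:~R / 24) * Y) ^+ 2 =
    ee ((psi2 (mul2 h (T2 n)))%:~R / 12) * X * Y ^+ 2.
  move=> hm; have -> : ee ((psi2 (mul2 h (T2 n)))%:~R / 12) = ee ((psi2 h)%:~R / 12) * ee (n%:~R / 24) ^+ 2 :> C.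
    rewrite -qvarMn -qvarD; apply: (@ee_eqmod _ _ m); rewrite hm !(intrD, intrM).
    by field.
  by move: (ee _) (ee _) => a b; ring.
apply: (sl2_ind (P := fun g => forall z : C, 0 < complex.Im z ->
  eta (mob2 g z) ^+ 2 = ee ((psi2 g)%:~R / 12) * j2 g z * eta z ^+ 2)).
- by move=> z z0; rewrite j2_one mob2_one /= mulr1 (@ee_eqmod _ 0 0) ?qvar0 ?mul1r //; field.
- move=> h sh IH z z0; have [m hm] := psi2_T sh.
  rewrite mob2_T IH ?Im_add_int // etaDint j2_T.
  by apply: (@stepT _ _ m); rewrite hm; ring.
- move=> h sh IH z z0; have sh' := sl2_mul sh (sl2_T (-1)).
  have [m hm] := psi2_T sh'.
  have e : mul2 (mul2 h (T2 (-1))) (T2 1) = h.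
    by case: h {sh IH sh' hm} => a b c d; apply: eq_mat2 => /=; ring.
  rewrite mob2_T IH ?Im_add_int // etaDint j2_T.
  by apply: (@stepT _ _ (- m)); rewrite e in hm; rewrite hm; ring.
move=> h sh IH z z0; have zn := Im_gt0_neq0 z0; have [m hm] := psi2_S sh.
rewrite mob2_S // IH ?oppV_Im // eta_S // j2_S //.
have i0 : ('i : C) != 0 by exact: i_neq0.
have -> : ee ((psi2 (mul2 h S2))%:~R / 12) = ee ((psi2 h)%:~R / 12) / 'i :> C.
  apply: (mulIf i0); rewrite divfK // -ee_quarter -qvarD; apply: (@ee_eqmod _ _ m).
  by rewrite hm !(intrD, intrM, intrN); field.
by move: (ee _) (eta _) (j2 _ _) => a b c; field.
Qed.

Lemma nm_ee_real (r : R) : nm (ee r%:C) = 1.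
Proof. by rewrite nm_qvar /= mulr0 oppr0 expR0. Qed.

Lemma nm_eta_mod g (z : C) : sl2 g -> 0 < complex.Im z ->
  nm (eta (mob2 g z)) ^+ 2 = nm (j2 g z) * nm (eta z) ^+ 2.
Proof.
move=> sg z0; rewrite -!nmX eta_sqr_mod // !nmM.
have -> : (psi2 g)%:~R / 12 = ((psi2 g)%:~R / 12 : R)%:C.
  by rewrite rmorphM /= fmorphV /= rmorph_int rmorph_nat.
by rewrite nm_ee_real mul1r.
Qed.

Lemma cderiv_unique (f : C -> C) z l m : cderiv f z l -> cderiv f z m -> l = m.
Proof.
move=> Hl Hm; apply/eqP; rewrite -subr_eq0 -nm_eq0; apply/negPn/negP => n0.
have e0 : 0 < nm (l - m) / 3 by rewrite divr_gt0 // lt_neqAle eq_sym n0 nm_ge0.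
have [d1 d10 H1] := Hl _ e0; have [d2 d20 H2] := Hm _ e0.
pose r := Num.min d1 d2 / 2.
have m0 : 0 < Num.min d1 d2 by rewrite lt_min d10.
have r0 : 0 < r by rewrite divr_gt0.
have nr : nm (r%:C) = r by rewrite nm_real ger0_norm // ltW.
have r1 : nm (r%:C) < d1.
  rewrite nr /r; have : Num.min d1 d2 <= d1 by rewrite ge_min lexx.
  by move: m0; lra.
have r2 : nm (r%:C) < d2.
  rewrite nr /r; have : Num.min d1 d2 <= d2 by rewrite ge_min lexx orbT.
  by move: m0; lra.
have := nmB (f (z + r%:C) - f z - m * r%:C) (f (z + r%:C) - f z - l * r%:C).
have -> : f (z + r%:C) - f z - m * r%:C - (f (z + r%:C) - f z - l * r%:C) = (l - m) * r%:C by ring.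
rewrite nmM; have := H1 _ r1; have := H2 _ r2; rewrite nr.
have : 0 < nm (l - m) by rewrite lt_neqAle eq_sym n0 nm_ge0.
move: (nm (f (z + r%:C) - f z - m * r%:C)) (nm (f (z + r%:C) - f z - l * r%:C)) (nm (l - m)) => a b c.
move=> c0 ha hb hc; have : 0 < c * r by rewrite mulr_gt0.
by move: ha hb hc; lra.
Qed.

(** From 2 f f' = 0 and f nowhere zero follows f' = 0. This shows that a sign left undetermined by a
    squared identity does not depend on z. *)
Lemma sqr_cst (f : C -> C) (c : C) : c != 0 ->
  (forall z : C, 0 < complex.Im z -> exists l, cderiv f z l) ->
  (forall z : C, 0 < complex.Im z -> f z ^+ 2 = c) ->
  forall z w : C, 0 < complex.Im z -> 0 < complex.Im w -> f z = f w.
Proof.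
move=> c0 df fc; apply: cderiv0_cst => z z0; have [l Hl] := df z z0.
have d2 := cderivM Hl Hl.
have d0 : cderiv (fun w => f w * f w) z 0.
  apply: (eq_cderiv (f := fun=> c)) => // [w w0|]; first by rewrite -expr2 fc.
  exact: cderiv_cst.
have := cderiv_unique d2 d0.
have -> : l * f z + f z * l = 2 * (f z * l) by ring.
move=> /eqP; rewrite !mulf_eq0 pnatr_eq0 /=.
have /negPf -> : f z != 0 by apply: contraNneq c0 => h; rewrite -(fc z z0) h expr0n.
by move=> /eqP <-.
Qed.

Definition lv (z : C) : C := etal (- z^-1) - etal z.
Lemma vv_seal : {f : C -> C | f = fun z => ce (lv z)}. Proof. by exists (fun z => ce (lv z)). Qed.
(** The ratio eta(-1/z) / eta(z), used as a holomorphic square root of z / i. *)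
Definition vv : C -> C := sval vv_seal.
Lemma vv_ce z : vv z = ce (lv z). Proof. by rewrite /vv (svalP vv_seal). Qed.

Lemma eta_inv (z : C) : eta (- z^-1) = vv z * eta z.
Proof. by rewrite vv_ce !eta_ce -cexpD; congr ce; rewrite /lv subrK. Qed.

Lemma vv_neq0 z : vv z != 0. Proof. by rewrite vv_ce cexp_neq0. Qed.

Lemma vv_sqr (z : C) : 0 < complex.Im z -> vv z ^+ 2 = z / 'i.
Proof.
move=> z0; apply: (mulIf (expf_neq0 2 (eta_neq0 z))).
by rewrite -exprMn -(eta_inv z) (eta_S z0).
Qed.

Lemma cderiv_lv (z : C) : 0 < complex.Im z -> exists l, cderiv lv z l.
Proof.
move=> w0; have wn := Im_gt0_neq0 w0; eexists.
exact: cderivB (cderiv_comp (cderivN (cderiv_inv wn)) (cderiv_etal (oppV_Im w0))) (cderiv_etal w0).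
Qed.

(** A square root of N read off the branch [vv], which makes it multiplicative in N. *)
Definition kap (N : nat) : C := vv (N%:R * 'i).

Lemma cIm_i : complex.Im ('i : C) = 1. Proof. by []. Qed.

Lemma vv_i : vv 'i = 1.
Proof.
have ii : ('i : C) != 0 by exact: i_neq0.
have iN : - ('i)^-1 = 'i :> C by apply: (mulfI ii); rewrite mulrN divff // -expr2 sqr_i.
by rewrite vv_ce /lv iN subrr cexp0.
Qed.

Lemma Im_natM (N : nat) (z : C) : (0 < N)%N -> 0 < complex.Im z -> 0 < complex.Im (N%:R * z).
Proof. by move=> N0 z0; rewrite mulrC; apply: Im_mul_nat. Qed.

Lemma vv_natM (N : nat) (z : C) : (0 < N)%N -> 0 < complex.Im z -> vv (N%:R * z) = kap N * vv z.
Proof.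
move=> N0; have Nn : N%:R != 0 :> C by rewrite pnatr_eq0 -lt0n.
have ii : ('i : C) != 0 by exact: i_neq0.
pose f (w : C) := ce (lv (N%:R * w) - lv w).
have fE w : f w * vv w = vv (N%:R * w) by rewrite !vv_ce -cexpD subrK.
have f2 (w : C) : 0 < complex.Im w -> f w ^+ 2 = N%:R.
  move=> w0; have wn := Im_gt0_neq0 w0; apply: (mulIf (expf_neq0 2 (vv_neq0 w))).
  by rewrite -exprMn fE !vv_sqr ?Im_natM // mulrA.
have df (w : C) : 0 < complex.Im w -> exists l, cderiv f w l.
  move=> w0; have [l1 H1] := cderiv_lv (Im_natM N0 w0); have [l2 H2] := cderiv_lv w0.
  eexists; apply: (cderiv_comp (g := @ce R)); last exact: cderiv_cexp.
  by apply: cderivB H2; apply: (cderiv_comp (g := lv)) H1; exact: cderivZ (cderiv_id _).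
move=> z0; rewrite -fE; congr (_ * _).
have i0 : 0 < complex.Im ('i : C) by rewrite cIm_i.
by rewrite (sqr_cst Nn df f2 z0 i0) /kap -fE vv_i mulr1.
Qed.

Lemma kap_sqr N : (0 < N)%N -> kap N ^+ 2 = N%:R.
Proof.
move=> N0; have ii : ('i : C) != 0 by exact: i_neq0.
by rewrite /kap vv_sqr ?Im_natM // mulfK.
Qed.

Lemma kap_neq0 N : kap N != 0. Proof. exact: vv_neq0. Qed.

Lemma kapM M N : (0 < M)%N -> (0 < N)%N -> kap (M * N) = kap M * kap N.
Proof. by move=> M0 N0; rewrite /kap natrM -mulrA vv_natM // Im_natM. Qed.

(** Neighbourhoods of i oo, uniform in the real part, as in the vanishing clause of [cusp_form]. *)
Definition ioo : set_system C :=
  [set P | exists A : R, forall z : C, 0 < complex.Im z -> A < complex.Im z -> P z]%classic.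

Global Instance ioo_proper : ProperFilter ioo.
Proof.
apply: Build_ProperFilter_ex.
  move=> P [A HA]; exists ((Num.max 0 A + 1)%:C * 'i); apply: HA; rewrite ImZ mulr1.
    by rewrite ltr_wpDl // le_max lexx.
  by rewrite ltr_pwDr // le_max lexx orbT.
split.
- by exists 0.
- move=> P Q [A HA] [B HB]; exists (Num.max A B) => z z0; rewrite gt_max => /andP[h1 h2].
  by split; [exact: HA|exact: HB].
- by move=> P Q PQ [A HA]; exists A => z z0 Az; apply: PQ; exact: HA.
Qed.

Lemma near_ioo (P : C -> Prop) (A : R) :
  (forall z : C, 0 < complex.Im z -> A < complex.Im z -> P z) -> \forall z \near ioo, P z.
Proof. by move=> H; exists A. Qed.

Lemma clim_ee_ioo (u : C -> C) (c : R) : 0 < c ->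
  (forall z : C, 0 < complex.Im z -> c * complex.Im z <= complex.Im (u z)) ->
  clim ioo (fun z => ee (u z)) 0.
Proof.
move=> c0 hu e e0.
have p0 : 0 < 2 * pi :> R by rewrite mulr_gt0 // pi_gt0.
have pc : 0 < 2 * pi * c by rewrite mulr_gt0.
exists ((- ln e) / (2 * pi * c)) => z z0; rewrite ltr_pdivrMr // => h.
rewrite subr0 nm_qvar -[ltRHS](lnK (x := e)) ?posrE // ltr_expR ltrNl.
by apply: (lt_le_trans h); rewrite mulrC -[leLHS]mulrA ler_pM2l // hu.
Qed.

Lemma clim_qser_ioo (a : nat -> C) (u : C -> C) (c : R) : radius1 a -> 0 < c ->
  (forall z : C, 0 < complex.Im z -> c * complex.Im z <= complex.Im (u z)) ->
  clim ioo (fun z => qser a (u z)) (a 0%N).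
Proof.
move=> ra c0 hu; have [K K0 HK] := qser_infty ra.
apply: (@clim_squeeze _ _ _ _ _ _ (fun z => K * nm (ee (u z)))).
  apply: (near_ioo (A := c^-1)) => z z0 h; apply: HK; apply: le_trans (hu z z0).
  by rewrite -ler_pdivrMl // mulr1 ltW.
move=> e e0; have e1 : 0 < e / (K + 1) by rewrite divr_gt0 //; lra.
have := clim_ee_ioo c0 hu e1; apply: filterS => M; rewrite subr0 ltr_pdivlMr; last by lra.
have := nm_ge0 (ee (u M)); nra.
Qed.

Lemma eta_split (w : C) : eta w = ee (w / 24) * ce (- usr w).
Proof. by rewrite qvarE -cexpD eta_ce /etal; congr ce; ring. Qed.

Lemma clim_eta_ioo (u : C -> C) (c : R) : 0 < c ->
  (forall z : C, 0 < complex.Im z -> c * complex.Im z <= complex.Im (u z)) ->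
  clim ioo (fun z => ce (- usr (u z))) 1.
Proof.
move=> c0 hu; rewrite -[X in clim _ _ X]cexp0; apply: clim_ce; rewrite -oppr0; apply: climN.
have := clim_qser_ioo (@radius1_usr R) c0 hu.
by rewrite /su /= mul0r.
Qed.

End EtaModular.

(** * Gauss sums and eta quotients of prime level *)

Section RootsOfUnity.

Lemma sum_Fp (V : nmodType) p (G : nat -> V) : prime p -> \sum_(x : 'F_p) G x = \sum_(i < p) G i.
Proof.
move=> pp; rewrite -(big_mkord xpredT G) -(big_mkord xpredT G).
by congr (\sum_(0 <= i < _) _); exact: Fp_cast.
Qed.

Lemma geom_root (F : fieldType) p (z : F) : z != 1 -> z ^+ p = 1 -> (\sum_(i < p) 'X^i).[z] = 0.
Proof.
move=> z1 zp; rewrite horner_sum.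
under eq_bigr do rewrite hornerXn.
apply: (mulfI (x := z - 1)); first by rewrite subr_eq0.
by rewrite -subrX1 zp subrr mulr0.
Qed.

(* The powers w, ..., w^(p-1) are linearly independent over Q, because the
   cyclotomic polynomial is irreducible. *)
Lemma root_unity_indep p (F : numFieldType) (w : F) (c : 'F_p -> int) :
  prime p -> w ^+ p = 1 -> w != 1 ->
  \sum_(x : 'F_p | x != 0) (c x)%:~R * psiF w x = 0 -> forall x : 'F_p, x != 0 -> c x = 0.
Proof.
move=> pp wp w1 H; have p0 := prime_gt0 pp.
(* The relation divided by w: its degree is below p - 1, the degree of the cyclotomic polynomial. *)
pose P : {poly rat} := \poly_(i < p.-1) (c i.+1%:R)%:~R.
pose Phi : {poly rat} := \sum_(i < p) 'X^i.
have rP : root (map_poly ratr P) w.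
  rewrite /root; apply/eqP; apply: (mulIf (x := w)).
    by apply: contra_eq_neq wp => ->; rewrite expr0n gtn_eqF // eq_sym oner_neq0.
  rewrite mul0r -[RHS]H big_mkcond /=.
  pose G (n : nat) : F := if n == 0%N then 0 else (c n%:R)%:~R * w ^+ n.
  rewrite (eq_bigr (fun x : 'F_p => G x)); last first.
    by move=> x _; rewrite /G Fp_nat /psiF -[x == 0]val_eqE /=; case: eqP.
  rewrite (sum_Fp G pp) -(big_mkord xpredT G) big_ltn // {1}/G eqxx add0r big_add1 big_mkord.
  have -> : map_poly ratr P = \poly_(i < p.-1) (c i.+1%:R)%:~R :> {poly F}.
    by apply/polyP => i; rewrite coef_map /P !coef_poly /=; case: ifP => _; rewrite ?ratr_int ?raddf0.
  rewrite horner_poly mulr_suml; apply: eq_bigr => i _.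
  by rewrite /G /= -mulrA -exprSr.
have mPhi (K : numFieldType) : map_poly ratr Phi = \sum_(i < p) 'X^i :> {poly K}.
  by rewrite rmorph_sum; apply: eq_bigr => i _; rewrite /= map_polyXn.
have P0 : P = 0.
  apply/eqP/negPn/negP => P0.
  have cop : coprimep P Phi.
    rewrite coprimep_def; apply/negPn/negP => sz.
    have : size (map_poly (ratr : rat -> algC) (gcdp P Phi)) != 1%N by rewrite size_map_poly.
    move=> /closed_rootP[z]; rewrite gcdp_map root_gcd => /andP[zP zPhi].
    have zp : z ^+ p = 1.
      apply/eqP; rewrite -subr_eq0 subrX1; move: zPhi; rewrite mPhi /root horner_sum.
      by under eq_bigr do rewrite hornerXn; move=> /eqP ->; rewrite mulr0.
    have z1 : z != 1.
      apply: contraTneq zPhi => ->; rewrite mPhi /root horner_sum.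
      under eq_bigr do rewrite hornerXn expr1n.
      by rewrite sumr_const card_ord pnatr_eq0 -lt0n.
    have [m zm mp] := prim_order_exists p0 zp.
    have {}mp : m = p.
      have [_ /(_ m mp)] := primeP pp; case/pred2P => // m1.
      by move: zm; rewrite m1 => /prim_expr_order/eqP; rewrite expr1 (negPf z1).
    rewrite mp in zm; have [q [qE _] hq] := minCpolyP z.
    have := congr1 (fun r : {poly algC} => size r) (minCpoly_cyclotomic zm).
    rewrite qE size_map_poly size_cyclotomic totient_prime // prednK // => sq.
    have := dvdp_leq P0; rewrite hq in zP => /(_ _ zP); rewrite sq => h.
    have := leq_trans h (size_poly _ _); rewrite leqNgt ltn_predL p0 //.
  have /Bezout_eq1_coprimepP[[u v] /= uv] := cop.
  have := congr1 (fun r : {poly rat} => (map_poly (ratr : rat -> F) r).[w]) uv.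
  rewrite /= rmorphD !rmorphM rmorph1 /= hornerD !hornerM hornerC mPhi geom_root // mulr0 addr0.
  by move: rP => /eqP ->; rewrite mulr0 => /esym/eqP; rewrite oner_eq0.
move=> x x0; have xp : (x < p)%N := Fp_lt pp x.
have x1 : (0 < (x : nat))%N by rewrite lt0n; apply: contra x0 => /eqP h; apply/eqP/val_inj.
have := congr1 (fun r : {poly rat} => r`_((x : nat).-1)) P0.
rewrite /= coef0 coef_poly (_ : ((x : nat).-1 < p.-1)%N); last first.
  by rewrite -ltnS !prednK // (ltn_trans x1).
by rewrite prednK // Fp_nat => /eqP; rewrite intr_eq0 => /eqP.
Qed.

End RootsOfUnity.

(** * Arithmetic modulo a prime p > 3 *)

Section PrimeArith.
Variable p : nat.
Hypotheses (pp : prime p) (p4 : (4 < p)%N).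

Lemma prime_mod6 : (p %% 6 = 1 \/ p %% 6 = 5)%N.
Proof.
have h2 : ~~ (2 %| p)%N by rewrite dvdn2 negbK; case: (even_prime pp) => // h; move: p4; rewrite h.
have h3 : ~~ (3 %| p)%N by rewrite dvdn_prime2 //; apply/negP => /eqP h; move: p4; rewrite -h.
move: h2 h3; lia.
Qed.

Lemma prime_half : p = (p.-1)./2.*2.+1.
Proof. by have := prime_mod6; lia. Qed.

Lemma p_sqr24 : exists n : int, p%:Z ^+ 2 = 1 + 24 * n.
Proof.
have [q [h|h]] : exists q, p%:Z = 6 * q + 1 \/ p%:Z = 6 * q + 5.
  by exists (p %/ 6)%N%:Z; have := prime_mod6; lia.
  have [x [hx|hx]] : exists x, q = 2 * x \/ q = 2 * x + 1 by exists (q %/ 2)%Z; lia.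
    by exists (x * (6 * x + 1)); rewrite h hx; ring.
  by exists ((2 * x + 1) * (3 * x + 2)); rewrite h hx; ring.
have [x [hx|hx]] : exists x, q = 2 * x \/ q = 2 * x + 1 by exists (q %/ 2)%Z; lia.
  by exists ((3 * x + 1) * (2 * x + 1)); rewrite h hx; ring.
by exists ((6 * x + 5) * (x + 1) ); rewrite h hx; ring.
Qed.

Lemma Fp_nat_neq0 (n : nat) : (0 < n)%N -> (forall q, prime q -> (q %| n)%N -> (q <= 3)%N) -> n%:R != 0 :> 'F_p.
Proof.
move=> n0 h; rewrite -[n%:R]/(n%:Z%:~R) Fp_int_eq0 // dvdzE /=; apply/negP => /(h _ pp).
by move: p4; lia.
Qed.

Lemma Fp24 : 24%:R != 0 :> 'F_p.
Proof.
apply: Fp_nat_neq0 => // q qp; rewrite (_ : 24 = 2 ^ 3 * 3)%N // Euclid_dvdM // Euclid_dvdX //=.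
by rewrite andbT !dvdn_prime2 // => /orP[] /eqP ->.
Qed.

(** The involution induced by S on the translates eta((z + 24 x) / p): it is defined by (24 x) (24
    tau(x)) = -1 modulo p. *)
Definition tau (x : 'F_p) : 'F_p := - (24%:R ^+ 2 * x)^-1.

Lemma tauK (x : 'F_p) : x != 0 -> tau (tau x) = x.
Proof.
move=> x0; rewrite /tau mulrN invrN opprK invfM invrK mulrA mulVf ?mul1r //.
by rewrite expf_neq0 // Fp24.
Qed.

Lemma tau_neq0 (x : 'F_p) : x != 0 -> tau x != 0.
Proof. by move=> x0; rewrite /tau oppr_eq0 invr_eq0 mulf_neq0 // expf_neq0 // Fp24. Qed.

End PrimeArith.

(** With diagonal entries divisible by 24 and c^2 = 1 modulo 24 the multiplier depends on c alone;
    in particular it is the same for all x. *)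
Lemma psi2_special (X U m c n : int) : c ^+ 2 = 1 + 24 * n ->
  exists Z, psi2 (Mat2 (24 * X) (- m) c (- (24 * U))) = 12 * Z - 3 * c.
Proof.
move=> hc; exists (2 * (X - U) * c - 2 * n * (m * (24 * U) - 3 * (c - 1) * (24 * U) + c + 3)).
by rewrite /psi2 hc; ring.
Qed.

(** * The functions eta((z + 24 x) / p) under S *)

Section EtaPrime.
Variable R : realType.
Local Notation C := R[i].
Local Open Scope complex_scope.

Lemma sign_abs (a : int) : (-1) ^+ `|a|%N = (if (2 %| a)%Z then 1 else -1) :> C.
Proof. by rewrite -signr_odd dvdzE dvdn2; case: odd. Qed.

Lemma sign_absD (a b : int) : (-1) ^+ `|(a + b)%R|%N = (-1) ^+ `|a|%N * (-1) ^+ `|b|%N :> C.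
Proof.
rewrite !sign_abs; case: ifP; case: ifP; case: ifP => h1 h2 h3; rewrite ?mulr1 ?mulrN1 ?opprK //; exfalso; lia.
Qed.

Variable p : nat.
Hypotheses (pp : prime p) (p4 : (4 < p)%N).

Let k := (p.-1)./2.
Let p0 : (0 < p)%N. Proof. exact: prime_gt0. Qed.
Let p2 : (2 < p)%N. Proof. by rewrite (leq_trans _ p4). Qed.
Let pC : p%:R != 0 :> C. Proof. by rewrite pnatr_eq0 -lt0n. Qed.

Let p_mod6 : (p %% 6 = 1 \/ p %% 6 = 5)%N. Proof. exact: prime_mod6. Qed.
Let pE : p = k.*2.+1. Proof. exact: prime_half. Qed.
Let w : C := ee p%:R^-1.

Let wp : w ^+ p = 1. Proof. by rewrite /w -qvarMn mulVf // qvar1. Qed.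

Let w1 : w != 1.
Proof.
rewrite /w natC invC; apply: qvar_neq1; rewrite invr_gt0 ltr0n p0 /=.
by rewrite invf_lt1 ?ltr0n // ltr1n (ltn_trans _ p2).
Qed.

(** The shift by 24 x makes this independent of the representative of x modulo p, since eta has
    period 24. *)
Definition phi (x : 'F_p) (z : C) : C := eta ((z + 24 * (x : nat)%:R) / p%:R).

Lemma Im_phi (x : 'F_p) (z : C) : 0 < complex.Im z -> 0 < complex.Im ((z + 24 * (x : nat)%:R) / p%:R).
Proof.
move=> z0; rewrite (natC R p); apply: Im_gt0_div; rewrite ?ltr0n //.
by rewrite -natrM Im_add_nat.
Qed.

(** The integer for which 6 r12 + 1 is p or -p; the sign [c12] built on it is the Kronecker symbol
    (12/p). *)
Definition r12 : int := if (p %% 6 == 1)%N then (p.-1 %/ 6)%N%:Z else - (p.+1 %/ 6)%N%:Z.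
Definition c12 : C := (-1) ^+ `|r12|%N.
Let p' : int := 6 * r12 + 1.

Let p'E : p' = p%:Z \/ p' = - p%:Z.
Proof. by rewrite /p' /r12; case: p_mod6 => h; rewrite h /=; lia. Qed.

Let p'_sqr : p' ^+ 2 = p%:Z ^+ 2.
Proof. by case: p'E => ->; rewrite ?sqrrN. Qed.

(** Summing the theta series of eta over x retains the s with p dividing 6 s + 1. Writing p' for 6
    [r12] + 1, these are s = p' t + [r12], with 6 s + 1 = p' (6 t + 1): the theta series of eta(p z)
    reappears. *)
Lemma eta_sum (z : C) : 0 < complex.Im z ->
  \sum_(x : 'F_p) phi x z = p%:R * c12 * eta (p%:R * z).
Proof.
move=> z0.
have H : has_sum (fun s => \sum_(x <- index_enum 'F_p | xpredT x) th ((z + 24 * (x : nat)%:R) / p%:R) s)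
    (\sum_(x <- index_enum 'F_p | xpredT x) phi x z).
  by apply: has_sum_sum => x _; apply: pentagonal; exact: Im_phi.
apply: has_sum_unique H _.
pose f (s : int) : C := if (p%:Z %| 6 * s + 1)%Z then
   p%:R * ((-1) ^+ `|s|%N * ee ((6 * s + 1)%:~R ^+ 2 / 24 * (z / p%:R))) else 0.
apply: (eq_has_sum (f := f)) => [s|].
  pose n := (`|(6 * s + 1)%R| ^ 2)%N.
  have nE : n%:R = (6 * s + 1)%:~R ^+ 2 :> C.
    by rewrite /n natrX natr_absz -!rmorphXn /=; congr (_%:~R); nia.
  have -> : \sum_(x : 'F_p) th ((z + 24 * (x : nat)%:R) / p%:R) s =
      ((-1) ^+ `|s|%N * ee ((6 * s + 1)%:~R ^+ 2 / 24 * (z / p%:R))) * \sum_(x : 'F_p) psiF w (x * n%:R).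
    rewrite mulr_sumr; apply: eq_bigr => x _; rewrite /th -[RHS]mulrA; congr (_ * _).
    have -> : psiF w (x * n%:R) = ee (n%:R * (x : nat)%:R / p%:R).
      have -> : x * n%:R = ((x : nat) * n)%N%:R by rewrite natrM Fp_nat.
      by rewrite psiF_nat // /w -qvarMn natrM; congr ee; ring.
    by rewrite -qvarD nE; congr ee; field.
  rewrite psiF_sum // /f.
  have -> : (n%:R == 0 :> 'F_p) = (p%:Z %| 6 * s + 1)%Z.
    by rewrite -[n%:R]/(n%:Z%:~R) Fp_int_eq0 // /n !dvdzE /= Euclid_dvdX // andbT.
  by case: ifP => _; rewrite ?mulr0 // mulrC.
have pn0 : p' != 0 by case: p'E => ->; lia.
apply/(has_sum_supp (h := fun t => p' * t + r12) (g := fun s => ((s - r12) %/ p')%Z)).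
- move=> s; rewrite /f; case: ifP; rewrite ?eqxx // => /dvdzP[m hm] _.
  have [m' hm'] : exists m', 6 * s + 1 = p' * m'.
    by case: p'E => ->; [exists m|exists (- m)]; rewrite hm; ring.
  have [t ht] : exists t, m' = 6 * t + 1.
    exists (s - r12 * m'); have e : p' * m' = 6 * (r12 * m') + m' by rewrite /p'; ring.
    by move: hm'; rewrite e; lia.
  have -> : s - r12 = t * p'.
    have e : p' * m' = 6 * (t * p') + 6 * r12 + 1 by rewrite ht /p'; ring.
    by move: hm'; rewrite e; lia.
  rewrite mulzK // mulrC.
  have e : p' * m' = 6 * (t * p') + 6 * r12 + 1 by rewrite ht /p'; ring.
  by move: hm'; rewrite e; lia.
- by move=> t; rewrite addrK mulKz.
have := has_sumZ (p%:R * c12) (pentagonal (Im_natM p0 z0)).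
apply: eq_has_sum => t; rewrite /f.
have e : 6 * (p' * t + r12) + 1 = p' * (6 * t + 1) by rewrite /p'; ring.
have -> : (p%:Z %| 6 * (p' * t + r12) + 1)%Z.
  by rewrite e; apply: dvdz_mulr; case: p'E => ->; rewrite dvdzE ?abszN.
have sg : (-1) ^+ `|(p' * t + r12)%R|%N = c12 * (-1) ^+ `|t|%N :> C.
  rewrite sign_absD mulrC; congr (_ * _); rewrite !sign_abs.
  have -> // : (2 %| p' * t)%Z = (2 %| t)%Z.
  rewrite !dvdzE abszM Euclid_dvdM //= (_ : (2 %| `|p'|)%N = false) //.
  by case: p'E => ->; rewrite ?abszN /= dvdn2; have := p_mod6; lia.
have ex : (6 * (p' * t + r12) + 1)%:~R ^+ 2 / 24 * (z / p%:R) = (6 * t + 1)%:~R ^+ 2 / 24 * (p%:R * z) :> C.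
  rewrite e intrM exprMn.
  have -> : p'%:~R ^+ 2 = p%:R ^+ 2 :> C by rewrite -rmorphXn /= p'_sqr rmorphXn.
  by field.
by rewrite ex sg /th; move: (ee _) ((-1) ^+ `|t|) => X Y; ring.
Qed.

Lemma ee_nhalf (n : nat) : ee (n%:R / 2 : C) = (-1) ^+ n.
Proof. by rewrite mulrC qvarMn ee_half. Qed.

Lemma phi_S (x : 'F_p) : x != 0 -> exists s : C, s ^+ 2 = (-1) ^+ k /\
  forall z : C, 0 < complex.Im z -> phi x (- z^-1) = s * vv z * phi (tau x) z.
Proof.
move=> x0; pose u := tau x.
pose B : int := 24 * (x : nat)%:Z; pose B' : int := 24 * (u : nat)%:Z.
have : (p%:Z %| B * B' + 1)%Z.
  rewrite -Fp_int_eq0 // (_ : B * B' + 1 = (24 * x * (24 * u) + 1)%N%:Z); last by rewrite /B /B'; lia.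
  rewrite -[((_)%:Z)%:~R]/((_)%:R) natrD !natrM !Fp_nat /u /tau; apply/eqP.
  have := Fp24 pp p4; move: (24%:R : 'F_p) => a a0.
  have -> : a * x * (a * - (a ^+ 2 * x)^-1) = - ((a ^+ 2 * x) / (a ^+ 2 * x)) by ring.
  by rewrite divff ?addNr // mulf_neq0 // expf_neq0.
move=> /dvdzP[m hm].
pose g := Mat2 B (- m) p%:Z (- B').
have sg : sl2 g by rewrite /sl2 /=; move: hm; lia.
have BC : B%:~R = 24 * (x : nat)%:R :> C by rewrite /B intrM.
have BC' : B'%:~R = 24 * (u : nat)%:R :> C by rewrite /B' intrM.
pose W (z : C) := (z + B'%:~R) / p%:R.
pose V (z : C) := (- z^-1 + B%:~R) / p%:R.
have W0 (z : C) : 0 < complex.Im z -> 0 < complex.Im (W z).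
  by move=> z0; rewrite /W BC'; exact: Im_phi.
have V0 (z : C) : 0 < complex.Im z -> 0 < complex.Im (V z).
  by move=> z0; rewrite /V BC; apply: Im_phi; exact: oppV_Im.
have jE (z : C) : j2 g (W z) = z by rewrite /j2 /= /W intrN; field.
have mE (z : C) : 0 < complex.Im z -> mob2 g (W z) = V z.
  move=> z0; have zn := Im_gt0_neq0 z0; rewrite /mob2 jE /= /W /V.
  have -> : (- m)%:~R = - ((B * B' + 1)%:~R / p%:R) :> C.
    by rewrite hm intrM mulfK // intrN.
  by rewrite !(intrD, intrM); field; rewrite zn pC.
pose f (z : C) := ce (etal (V z) - lv z - etal (W z)).
have fE (z : C) : f z * vv z * eta (W z) = eta (V z).
  rewrite vv_ce !eta_ce /f; move: (etal (V z)) (lv z) (etal (W z)) => a b c.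
  by rewrite -!cexpD; congr ce; ring.
have f2 (z : C) : 0 < complex.Im z -> f z ^+ 2 = (-1) ^+ k.
  move=> z0; have zn := Im_gt0_neq0 z0.
  have nz : (vv z * eta (W z)) ^+ 2 != 0 by rewrite expf_neq0 // mulf_neq0 ?vv_neq0 ?eta_neq0.
  apply: (mulIf nz); rewrite -exprMn mulrA fE -mE // eta_sqr_mod ?W0 // jE exprMn vv_sqr //.
  suff -> : ee ((psi2 g)%:~R / 12) = (-1) ^+ k / 'i :> C by move: (eta _) => X; ring.
  apply: (mulIf (i_neq0 R)); rewrite divfK ?i_neq0 //.
  rewrite -ee_quarter -qvarD -ee_nhalf.
  have [n hn] := p_sqr24 pp p4.
  have [Z hZ] := psi2_special (x : nat)%:Z (u : nat)%:Z m hn.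
  apply: (@ee_eqmod _ _ _ (Z - k%:Z)); rewrite /g hZ !(intrB, intrM).
  have pk : p%:R = 2 * k%:R + 1 :> C by rewrite {1}pE -natr1 -mul2n natrM.
  by rewrite -[p%:~R]/(p%:R) pk -[k%:~R]/(k%:R); field.
have df (z : C) : 0 < complex.Im z -> exists l, cderiv f z l.
  move=> z0; have zn := Im_gt0_neq0 z0.
  have [l Hl] := cderiv_lv z0.
  have dV := cderivM (cderivD (cderivN (cderiv_inv zn)) (cderiv_cst B%:~R z)) (cderiv_cst p%:R^-1 z).
  have dW := cderivM (cderivD (cderiv_id z) (cderiv_cst B'%:~R z)) (cderiv_cst p%:R^-1 z).
  have d1 := cderiv_comp dV (cderiv_etal (V0 z z0)).
  have d2 := cderiv_comp dW (cderiv_etal (W0 z z0)).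
  have d3 := cderivB (cderivB d1 Hl) d2.
  by eexists; exact: (cderiv_comp d3 (cderiv_cexp _)).
have i0 : 0 < complex.Im ('i : C) by rewrite cIm_i.
exists (f 'i); split; first exact: f2.
move=> z z0; have kn : (-1) ^+ k != 0 :> C by rewrite signr_eq0.
by rewrite -(sqr_cst kn df f2 z0 i0) /phi -BC -BC' -/(V z) -/(W z) fE.
Qed.

Lemma phi0_S (z : C) : 0 < complex.Im z -> phi 0 (- z^-1) = kap R p * vv z * eta (p%:R * z).
Proof.
move=> z0; have zn := Im_gt0_neq0 z0; rewrite -vv_natM // -eta_inv /phi mulr0 addr0.
by congr eta; field; rewrite zn pC.
Qed.

Lemma etap_S (z : C) : 0 < complex.Im z -> eta (p%:R * - z^-1) = (kap R p)^-1 * vv z * phi 0 z.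
Proof.
move=> z0; have zn := Im_gt0_neq0 z0; rewrite /phi mulr0 addr0.
have zp : 0 < complex.Im (z / p%:R) by rewrite natC; apply: Im_gt0_div; rewrite ?ltr0n.
have -> : p%:R * - z^-1 = - (z / p%:R)^-1 by rewrite invf_div; field.
have e : vv z = kap R p * vv (z / p%:R) by rewrite -vv_natM //; congr vv; field.
by rewrite eta_inv e mulKf // kap_neq0.
Qed.

Lemma clim_phi (u : 'F_p) :
  clim (ioo (R := R)) (fun z => phi u z * ee (- (z / (24 * p%:R)))) (psiF w u).
Proof.
pose W (z : C) := (z + 24 * (u : nat)%:R) / p%:R.
have h : clim (ioo (R := R)) (fun z => psiF w u * ce (- usr (W z))) (psiF w u * 1).
  apply: climM; first exact: clim_cst.
  apply: (clim_eta_ioo (c := p%:R^-1)); first by rewrite invr_gt0 ltr0n.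
  move=> z z0; rewrite /W [X in _ <= complex.Im X]mulrC (natC R p) invC ImZ -natrM Im_add_nat //.
rewrite mulr1 in h; apply: eq_near_clim h; apply: nearW => z.
rewrite /phi eta_split -/(W z) mulrAC; congr (_ * _).
rewrite /psiF /w -qvarMn -qvarD; congr ee; rewrite /W; field.
by rewrite pC.
Qed.

Lemma ik_sqr : ('i ^+ k) ^+ 2 = (-1) ^+ k :> C.
Proof. by rewrite exprAC sqr_i. Qed.

Lemma c12_sqr : c12 ^+ 2 = 1.
Proof. by rewrite /c12 exprAC sqrrN !expr1n. Qed.

(** The relation [eta_sum] at -1/z, each term transformed and the common factor [vv] z removed. *)
Lemma phi_relation (s : 'F_p -> C) :
  (forall x, x != 0 -> forall z : C, 0 < complex.Im z -> phi x (- z^-1) = s x * vv z * phi (tau x) z) ->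
  forall z : C, 0 < complex.Im z ->
  kap R p * eta (p%:R * z) + \sum_(x | x != 0) s x * phi (tau x) z = kap R p * c12 * phi 0 z.
Proof.
move=> hs z z0; apply: (mulfI (vv_neq0 z)); have := eta_sum (oppV_Im z0).
rewrite (bigD1 0) //= phi0_S // etap_S // -kap_sqr // => h.
have -> : vv z * (kap R p * c12 * phi 0 z) = kap R p ^+ 2 * c12 * ((kap R p)^-1 * vv z * phi 0 z).
  by move: (kap R p) (kap_neq0 R p) (phi 0 z) (vv z) => K K0 a b; field.
rewrite -h mulrDr mulr_sumr; congr (_ + _); first by ring.
by apply: eq_bigr => x x0; rewrite hs //; ring.
Qed.

(** After multiplication by q^(-1/(24 p)) and z to i oo, eta(p z) disappears because p > 1 / p,
    while the function attached to x leaves the root of unity w^x. *)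
Lemma phi_limit (s : 'F_p -> C) :
  (forall x, x != 0 -> forall z : C, 0 < complex.Im z -> phi x (- z^-1) = s x * vv z * phi (tau x) z) ->
  \sum_(x | x != 0) s x * psiF w (tau x) = kap R p * c12.
Proof.
move=> hs; pose E (z : C) := ee (- (z / (24 * p%:R))).
pose c : R := (p%:R - p%:R^-1) / 24.
have c0 : 0 < c.
  have p5 : 5 <= p%:R :> R by rewrite ler_nat.
  rewrite divr_gt0 // subr_gt0 (@lt_trans _ _ 1) //; last by lra.
  by rewrite invf_lt1; lra.
have l1 : clim (ioo (R := R)) (fun z => eta (p%:R * z) * E z) (0 * 1).
  have e1 : \forall z \near ioo (R := R), ee (c%:C * z) * ce (- usr (p%:R * z)) = eta (p%:R * z) * E z.
    apply: nearW => z; rewrite eta_split mulrAC /E -qvarD; congr (ee _ * _).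
    by rewrite /c rmorphM rmorphB !fmorphV !rmorph_nat; field; rewrite pC.
  apply: eq_near_clim e1 _; apply: climM.
    by apply: (clim_ee_ioo c0) => z z0; rewrite ImZ.
  apply: (clim_eta_ioo (c := p%:R)) => [|z z0]; first by rewrite ltr0n.
  by rewrite natC ImZ.
have l2 : clim (ioo (R := R)) (fun z => kap R p * (eta (p%:R * z) * E z) + \sum_(x | x != 0) s x * (phi (tau x) z * E z))
    (kap R p * (0 * 1) + \sum_(x | x != 0) s x * psiF w (tau x)).
  apply: climD; first by apply: climM l1; exact: clim_cst.
  by apply: clim_sum => x x0; apply: climM; [exact: clim_cst|exact: clim_phi].
have l3 : clim (ioo (R := R)) (fun z => kap R p * c12 * (phi 0 z * E z)) (kap R p * c12 * psiF w (0 : 'F_p)).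
  by apply: climM; [exact: clim_cst|exact: clim_phi].
rewrite mul0r mulr0 add0r in l2; rewrite /psiF expr0 mulr1 in l3.
apply: clim_unique l2 _; apply: eq_near_clim l3; apply: (near_ioo (A := 0)) => z z0 _.
rewrite mulrA -(phi_relation hs z0) mulrDl mulr_suml; congr (_ + _); first by rewrite mulrA.
by apply: eq_bigr => x _; rewrite mulrA.
Qed.

Lemma sum_tau (f : 'F_p -> C) : \sum_(x | x != 0) f (tau x) = \sum_(x | x != 0) f x.
Proof.
rewrite [RHS](reindex_onto (@tau p) (@tau p)); last by move=> x; exact: tauK.
apply: eq_bigl => x; have [->|x0] := eqVneq x 0.
  by rewrite /tau mulr0 invr0 oppr0 eqxx.
by rewrite tau_neq0 // tauK // eqxx.
Qed.

(** Each factor s is i^k or -i^k, so the limit relation evaluates i^k times a signed sum of the w^x.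
    That sum and the Gauss sum have equal squares, hence agree up to sign; by linear independence
    the individual signs are then Legendre symbols times this common sign. *)
Lemma phi_sign : exists2 del : int, del = 1 \/ del = -1 &
  kap R p * c12 = 'i ^+ k * del%:~R * gaussF p w /\
  forall x, x != 0 -> forall z : C, 0 < complex.Im z ->
    phi x (- z^-1) = 'i ^+ k * (del * lgF (tau x))%:~R * vv z * phi (tau x) z.
Proof.
have : forall x : 'F_p, exists s : C, x != 0 -> s ^+ 2 = (-1) ^+ k /\
  forall z : C, 0 < complex.Im z -> phi x (- z^-1) = s * vv z * phi (tau x) z.
  move=> x; have [->|x0] := eqVneq x 0; first by exists 0.
  by have [s hs] := phi_S x0; exists s.
move=> /choice[s hs].
have ik0 : 'i ^+ k != 0 :> C by rewrite expf_neq0 // i_neq0.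
pose t x : int := if s x == 'i ^+ k then 1 else -1.
have st x : x != 0 -> s x = 'i ^+ k * (t x)%:~R.
  move=> x0; have [h _] := hs x x0; rewrite /t; case: eqP => [->|/eqP ne]; first by rewrite mulr1.
  have /eqP := h; rewrite -ik_sqr eqf_sqr (negPf ne) /= => /eqP ->.
  by rewrite mulrN1.
have lim := @phi_limit s (fun x x0 => (hs x x0).2).
pose G : C := \sum_(x | x != 0) (t (tau x))%:~R * psiF w x.
have GE : 'i ^+ k * G = kap R p * c12.
  rewrite -lim -[in RHS](sum_tau (fun x => s x * psiF w (tau x))) /G mulr_sumr.
  by apply: eq_bigr => x x0; rewrite tauK // st ?tau_neq0 // mulrA.
pose g := gaussF p w.
have gE : g = \sum_(x : 'F_p | x != 0) (lgF x)%:~R * psiF w x.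
  by rewrite /g /gaussF (bigD1 0) //= /lgF lg_dvd ?dvdz0 // mul0r add0r.
have G2 : G ^+ 2 = g ^+ 2.
  apply: (mulfI (x := (-1) ^+ k)); first by rewrite signr_eq0.
  rewrite gaussF_sqr // lgN1 // -/k -ik_sqr -exprMn GE exprMn c12_sqr mulr1 kap_sqr //.
  by rewrite ik_sqr intrM rmorphXn rmorphN1 mulrA -exprMn mulN1r opprK expr1n mul1r.
have key (del : int) : G = del%:~R * g -> forall x, x != 0 -> t (tau x) = del * lgF x.
  move=> h x x0; apply/eqP; rewrite -subr_eq0; apply/eqP.
  apply: (root_unity_indep (c := fun x => t (tau x) - del * lgF x) pp wp w1 _ x0).
  under eq_bigr do rewrite intrB mulrBl intrM -mulrA.
  by rewrite sumrB -mulr_sumr -gE -/G h subrr.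
have [del hd hG] : exists2 del : int, del = 1 \/ del = -1 & G = del%:~R * g.
  have /eqP := G2; rewrite eqf_sqr => /orP[/eqP->|/eqP->].
    by exists 1; [left|rewrite mul1r].
  by exists (-1); [right|rewrite mulN1r].
exists del => //; split; first by rewrite -mulrA -hG GE.
move=> x x0 z z0; rewrite (hs x x0).2 // st //; congr (_ * _%:~R * _ * _).
by rewrite -(key _ hG) ?tau_neq0 // tauK.
Qed.

End EtaPrime.

(** * The quotient eta(z)^N / eta(N z) under S and T *)

Section EtaQuotientGeneral.
Variable R : realType.
Local Notation C := R[i].
Local Open Scope complex_scope.

Definition hq (N : nat) (z : C) : C := eta z ^+ N / eta (N%:R * z).

Lemma hq_neq0 N z : hq N z != 0.
Proof. by rewrite /hq mulf_neq0 ?expf_neq0 ?invr_eq0 ?eta_neq0. Qed.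

Lemma eta_powT N (z : C) : eta (z + 1) ^+ N = ee (N%:R / 24) * eta z ^+ N.
Proof. by rewrite eta_T exprMn -qvarMn; congr (ee _ * _); rewrite mulrC. Qed.

Lemma hq_T N (z : C) : hq N (z + 1) = hq N z.
Proof.
rewrite /hq eta_powT mulrDr mulr1 (etaDint (N%:R * z) N).
by rewrite invfM mulrACA divff ?qvar_neq0 ?mul1r.
Qed.

Lemma vv_pow (z : C) m : 0 < complex.Im z -> z ^- m * vv z ^+ m.*2 = 'i ^- m.
Proof.
move=> z0; have zn := Im_gt0_neq0 z0; rewrite -mul2n exprM vv_sqr // expr_div_n.
by rewrite mulKf // expf_neq0.
Qed.

Lemma slS m (f : C -> C) (z : C) : sl m f S2 z = z ^- m * f (- z^-1).
Proof.
rewrite /sl /j2 /mob2 /j2 /= mul1r addr0 mul0r add0r.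
by rewrite rmorphN1 mulN1r.
Qed.

Lemma slT m (f : C -> C) (z : C) : sl m f (T2 1) z = f (z + 1).
Proof. by rewrite /sl /mob2 /j2 /= mul0r add0r expr1n invr1 mulr1 !mul1r. Qed.

Lemma slT' m (f : C -> C) (z : C) : sl m f (T2 (-1)) z = f (z - 1).
Proof. by rewrite /sl /mob2 /j2 /= mul0r add0r expr1n invr1 mulr1 !mul1r rmorphN1. Qed.

Lemma slZ m c (f : C -> C) g (z : C) : sl m (fun z => c * f z) g z = c * sl m f g z.
Proof. by rewrite /sl mulrCA. Qed.

Lemma hq_S N (z : C) : odd N -> 0 < complex.Im z ->
  sl (N.-1)./2 (hq N) S2 z = 'i ^- (N.-1)./2 * kap R N * (eta z ^+ N / eta (z / N%:R)).
Proof.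
move=> oN z0; have zn := Im_gt0_neq0 z0; have N0 : (0 < N)%N by case: (N) oN.
have NC : N%:R != 0 :> C by rewrite pnatr_eq0 -lt0n.
have zN : 0 < complex.Im (z / N%:R) by rewrite natC; apply: Im_gt0_div; rewrite ?ltr0n.
rewrite slS /hq eta_inv.
have -> : N%:R * - z^-1 = - (z / N%:R)^-1 by rewrite invf_div; field.
have e : vv z = kap R N * vv (z / N%:R) by rewrite -vv_natM //; congr vv; field.
have NE : N = ((N.-1)./2.*2).+1 by rewrite -[LHS]odd_double_half oN; lia.
have -> : (vv z * eta z) ^+ N = kap R N * vv (z / N%:R) * vv z ^+ (N.-1)./2.*2 * eta z ^+ N.
  by rewrite exprMn -e -exprS -NE.
rewrite -(vv_pow (N.-1)./2 z0) eta_inv.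
move: (vv_neq0 (z / N%:R)) (eta_neq0 (z / N%:R)); move: (vv (_ / _)) (eta (_ / _)) (kap R N) => a b c a0 b0.
move: (vv z ^+ _) (z ^- _) (eta z ^+ N) => x y t.
by field; rewrite a0 b0.
Qed.

Lemma imunitE : imunit R = 'i. Proof. by []. Qed.

Lemma i_pow4 : 'i ^+ 4 = 1 :> C.
Proof. by rewrite (exprM 'i 2 2) sqr_i sqrrN expr1n. Qed.

End EtaQuotientGeneral.

(** * The orbit of the eta quotient of prime level under SL_2(Z) *)

Section EtaQuotientPrime.
Variable R : realType.
Local Notation C := R[i].
Local Open Scope complex_scope.
Variable p : nat.
Hypotheses (pp : prime p) (p4 : (4 < p)%N).

Let k := (p.-1)./2.
Let p0 : (0 < p)%N. Proof. exact: prime_gt0. Qed.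
Let p2 : (2 < p)%N. Proof. by rewrite (leq_trans _ p4). Qed.
Let pC : p%:R != 0 :> C. Proof. by rewrite pnatr_eq0 -lt0n. Qed.
Let pE : p = k.*2.+1. Proof. exact: prime_half. Qed.
Let w : C := ee p%:R^-1.

(** With [hq p], these functions make up the orbit of [hq p] under the slash action, up to
    scalars. *)
Definition hx (x : 'F_p) (z : C) : C := eta z ^+ p / phi x z.

(** Modulo p, 1 + 24 x is 24 (x + 1/24) with 1/24 taken in F_p; the two arguments of eta differ by
    an integer whose class modulo 24 gives the root of unity. *)
Lemma phi_T (x : 'F_p) (z : C) : phi x (z + 1) = ee (p%:R / 24) * phi (x + 24%:R^-1) z.
Proof.
pose y := x + 24%:R^-1.
have : (p%:Z %| 24 * (y : nat)%:Z - 24 * (x : nat)%:Z - 1)%Z.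
  rewrite -eqz_mod_dvd -Fp_int_eq //.
  have -> : 24 * (y : nat)%:Z - 24 * (x : nat)%:Z = (24 * y)%N%:Z - (24 * x)%N%:Z by lia.
  rewrite intrB -![((_)%:Z)%:~R]/((_)%:R) !natrM !Fp_nat /y.
  by have := Fp24 pp p4; move: (24%:R : 'F_p) => a a0; apply/eqP; field.
move=> /dvdzP[m hm]; have [n hn] := p_sqr24 pp p4.
(* From m p = -1 modulo 24 and p^2 = 1 modulo 24, m = p (m p) = -p modulo 24. *)
have [l hl] : exists l, m = - p%:Z + 24 * l.
  exists (n * -m + p%:Z * ((y : nat)%:Z - (x : nat)%:Z)).
  have : p%:Z ^+ 2 * m = p%:Z * (24 * (y : nat)%:Z - 24 * (x : nat)%:Z - 1) by rewrite hm; ring.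
  rewrite hn => h.
  apply/eqP; rewrite -subr_eq0; apply/eqP.
  transitivity ((1 + 24 * n) * m - p%:Z * (24 * (y : nat)%:Z - 24 * (x : nat)%:Z - 1)); last by rewrite h subrr.
  by ring.
rewrite /phi -/y.
have -> : (z + 1 + 24 * (x : nat)%:R) / p%:R = (z + 24 * (y : nat)%:R) / p%:R + (- m)%:~R :> C.
  have : (m * p%:Z)%:~R = 24 * (y : nat)%:R - 24 * (x : nat)%:R - 1 :> C by rewrite -hm !(intrB, intrM).
  rewrite intrM intrN => h; have -> : m%:~R = (24 * (y : nat)%:R - 24 * (x : nat)%:R - 1) / p%:R :> C.
    by rewrite -h mulfK.
  by field.
rewrite etaDint; congr (_ * _); apply: (@ee_eqmod _ _ _ (- l)).
by rewrite hl !(intrN, intrD, intrM); field.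
Qed.

Lemma hx_T (x : 'F_p) (z : C) : hx x (z + 1) = hx (x + 24%:R^-1) z.
Proof. by rewrite /hx eta_powT phi_T invfM mulrACA divff ?qvar_neq0 ?mul1r. Qed.

Lemma hx0_S (z : C) : 0 < complex.Im z -> sl k (hx 0) S2 z = 'i ^- k / kap R p * hq p z.
Proof.
move=> z0; rewrite slS /hx /hq eta_inv phi0_S // -(vv_pow k z0) exprMn {1}pE exprS.
move: (vv_neq0 z) (eta_neq0 (p%:R * z)) (kap_neq0 R p).
move: (vv z) (eta (_ * _)) (kap R p) (eta z ^+ p) (z ^- k) => a b c d e a0 b0 c0.
rewrite [RHS]mulrC; move: (a ^+ k.*2) => a'.
by field; rewrite a0 b0 c0.
Qed.

Lemma lgF_tau (x : 'F_p) : x != 0 -> lgF (tau x) = (-1) ^+ k * lgF x.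
Proof.
move=> x0; have t0 := tau_neq0 pp p4 x0; have F24 := Fp24 pp p4.
have h : lgF (tau x * (-1 * (24%:R * 24%:R * x))) = 1.
  have -> : tau x * (-1 * (24%:R * 24%:R * x)) = 1%:~R.
    by rewrite /tau mulN1r mulrNN mulVf // mulf_neq0 // expf_neq0.
  by rewrite lgF_int // lg1.
rewrite !lgFM // -[lgF 24%:R * _]expr2 lgF_sqr // mul1r in h.
have l1 : lgF (-1 : 'F_p) = (-1) ^+ k by rewrite -[-1]/((-1)%:~R) lgF_int // lgN1.
rewrite l1 in h.
have e : lgF (tau x) * lgF (tau x) = 1 by rewrite -expr2 lgF_sqr.
apply: (@mulfI _ (lgF (tau x))); last by rewrite h e.
by apply: contra_eq_neq e => ->; rewrite mul0r eq_sym oner_neq0.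
Qed.

Section Sign.
Variable del : int.
Hypotheses (del1 : del = 1 \/ del = -1).
Hypothesis phiS : forall x : 'F_p, x != 0 -> forall z : C, 0 < complex.Im z ->
    phi x (- z^-1) = 'i ^+ k * (del * lgF (tau x))%:~R * vv z * phi (tau x) z.

Let del_sqr : del ^+ 2 = 1. Proof. by case: del1 => ->. Qed.

Lemma hx_S (x : 'F_p) (z : C) : x != 0 -> 0 < complex.Im z ->
  sl k (hx x) S2 z = (del * lgF x)%:~R * hx (tau x) z.
Proof.
move=> x0 z0; have t0 := tau_neq0 pp p4 x0.
rewrite slS /hx eta_inv phiS // exprMn {1}pE exprS.
have -> : (del * lgF x)%:~R = (-1) ^+ k * (del * lgF (tau x))%:~R :> C.
  have u2 : (-1) ^+ k * (-1) ^+ k = 1 :> C by rewrite -exprMn mulN1r opprK expr1n.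
  have e : ((-1) ^+ k : int)%:~R = (-1) ^+ k :> C by rewrite rmorphXn rmorphN1.
  rewrite lgF_tau // !intrM e; move: ((-1) ^+ k : C) u2 => u u2.
  by rewrite (mulrCA u) (mulrA u) u2 mul1r.
have sq : (del * lgF (tau x)) ^+ 2 = 1 by rewrite exprMn del_sqr lgF_sqr // mul1r.
have h := vv_pow k z0; have ik : 'i ^+ k != 0 :> C by rewrite expf_neq0 // i_neq0.
have s2 : (del * lgF (tau x))%:~R ^+ 2 = 1 :> C by rewrite -rmorphXn /= sq.
have A4 : ('i ^+ k) ^+ 2 * ('i ^+ k) ^+ 2 = 1 :> C.
  by rewrite ik_sqr -exprMn mulN1r opprK expr1n.
rewrite -ik_sqr; move: (vv_neq0 z) (eta_neq0 ((z + 24 * (tau x : nat)%:R) / p%:R)).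
rewrite -/(phi (tau x) z).
move: (phi (tau x) z) ('i ^+ k) ik A4 (vv z) (vv z ^+ k.*2) (z ^- k) h s2 (eta z ^+ p) => P A A0 A4 v V Z h.
move: ((del * _)%:~R : C) => s s2 E v0 P0.
have s0 : s != 0 by apply: contra_eq_neq s2 => ->; rewrite expr0n eq_sym oner_neq0.
have -> : Z * (v * V * E / (A * s * v * P)) = (Z * V) * (E / (A * s * P)).
  by field; rewrite v0 P0 A0 s0.
rewrite h -[LHS]mul1r -A4 -[LHS]mul1r -s2; field.
by rewrite s0 P0 A0.
Qed.

Let kappa : C := 'i ^- k * kap R p.

Lemma hqp_S (z : C) : 0 < complex.Im z -> sl k (hq p) S2 z = kappa * hx 0 z.
Proof.
move=> z0; rewrite hq_S //; last by rewrite pE /= odd_double.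
by rewrite /hx /phi mulr0 addr0.
Qed.

(* The relation (ST)^3 = -1, applied to hq p. *)
Lemma del_24 : del * lgF (24%:R^-1 : 'F_p) = 1.
Proof.
pose x : 'F_p := 24%:R^-1.
have F24 := Fp24 pp p4; have x0 : x != 0 by rewrite invr_eq0.
have tx : tau x + 24%:R^-1 = 0.
  by rewrite /tau /x expr2 mulfK // addNr.
have T1 := sl2_T 1; have S1 := sl2_S.
pose g1 := mul2 S2 (T2 1); have sg1 : sl2 g1 := sl2_mul S1 T1.
pose g2 := mul2 g1 S2; have sg2 : sl2 g2 := sl2_mul sg1 S1.
pose g3 := mul2 g2 (T2 1); have sg3 : sl2 g3 := sl2_mul sg2 T1.
pose g4 := mul2 g3 S2; have sg4 : sl2 g4 := sl2_mul sg3 S1.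
have z1 (z : C) : 0 < complex.Im z -> 0 < complex.Im (z + 1).
  by rewrite (Im_add_nat z 1).
have a1 (z : C) : 0 < complex.Im z -> sl k (hq p) g1 z = kappa * hx x z.
  by move=> z0; rewrite /g1 sl_mul // slT hqp_S ?z1 // hx_T add0r.
have a2 (z : C) : 0 < complex.Im z -> sl k (hq p) g2 z = kappa * (del * lgF x)%:~R * hx (tau x) z.
  by move=> z0; rewrite /g2 sl_mul // (eq_sl _ a1) // slZ hx_S // mulrA.
have a3 (z : C) : 0 < complex.Im z -> sl k (hq p) g3 z = kappa * (del * lgF x)%:~R * hx 0 z.
  by move=> z0; rewrite /g3 sl_mul // slT a2 ?z1 // hx_T tx.
have a4 (z : C) : 0 < complex.Im z -> sl k (hq p) g4 z =
    kappa * (del * lgF x)%:~R * ('i ^- k / kap R p * hq p z).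
  by move=> z0; rewrite /g4 sl_mul // (eq_sl _ a3) // slZ hx0_S.
have i0 : 0 < complex.Im ('i : C) by rewrite cIm_i.
have := a4 ('i : C) i0.
have -> : g4 = Mat2 (-1) 1 0 (-1) by apply: eq_mat2.
have -> : sl k (@hq R p) (Mat2 (-1) 1 0 (-1)) ('i : C) = (-1) ^+ k * hq p ('i : C).
  rewrite /sl /mob2 /j2 /=.
  have -> : ((-1)%:~R * 'i + 1%:~R) / (0%:~R * 'i + (-1)%:~R) = 'i - 1 :> C.
    by rewrite mul0r add0r rmorphN1 invrN1; ring.
  by rewrite mul0r add0r rmorphN1 -exprVn invrN1 -[in RHS](subrK 1 'i) hq_T.
rewrite -/x /kappa; have h0 : hq p ('i : C) != 0 := hq_neq0 p _.
have ik : 'i ^+ k != 0 :> C by rewrite expf_neq0 // i_neq0.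
have A2 := ik_sqr R p; rewrite -/k in A2; rewrite -A2.
have A4' : ('i ^+ k) ^+ 2 * ('i ^+ k) ^+ 2 = 1 :> C by rewrite A2 -exprMn mulN1r opprK expr1n.
move: ('i ^+ k) ik (kap R p) (kap_neq0 R p) (hq p ('i : C)) h0 A4' {A2} => A A0 K K0 h h0 A4' e.
apply: (@intr_inj C); rewrite -[RHS]A4'; apply: (mulIf h0).
rewrite -[RHS]mulrA e; field.
by rewrite A0 K0.
Qed.

(** The value of [hq p]|_k g in terms of the bottom row (c, d) of g alone; it only has to be checked
    against S and T. *)
Definition Hv (c d : int) (z : C) : C :=
  if (p%:Z %| c)%Z then (lg p d)%:~R * hq p z
  else (lg p c)%:~R * (kappa * hx (d%:~R / (24%:R * c%:~R)) z).

Lemma Hv_T c d (z : C) : Hv c d (z + 1) = Hv c (c + d) z.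
Proof.
rewrite /Hv; case: ifP => pc.
  by rewrite hq_T (@lg_eqmod p d (c + d)) //; apply/eqP; rewrite eqz_mod_dvd opprD addrCA subrr addr0 dvdzE abszN.
rewrite hx_T; congr (_ * (_ * hx _ _)); rewrite intrD.
have c0 : c%:~R != 0 :> 'F_p by rewrite Fp_int_eq0 // pc.
move: (24%:R : 'F_p) (Fp24 pp p4) (c%:~R : 'F_p) (d%:~R : 'F_p) c0 => a a0 x y x0.
by field; rewrite x0 a0.
Qed.

Lemma Hv_S c d (z : C) : 0 < complex.Im z -> ~~ ((p%:Z %| c)%Z && (p%:Z %| d)%Z) ->
  sl k (Hv c d) S2 z = Hv d (- c) z.
Proof.
move=> z0; have F24 := Fp24 pp p4; rewrite /Hv.
have lgN : lg p (- c) = (-1) ^+ k * lg p c by rewrite -[- c]mulN1r lgM // lgN1.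
case: (boolP (p%:Z %| c)%Z) => pc /= pd.
  rewrite (negPf pd) slZ hqp_S //; congr (_ * (_ * hx _ _)).
  rewrite intrN; have /eqP -> : c%:~R == 0 :> 'F_p by rewrite Fp_int_eq0.
  by rewrite oppr0 mul0r.
have c0 : c%:~R != 0 :> 'F_p by rewrite Fp_int_eq0.
rewrite slZ slZ; case: (boolP (p%:Z %| d)%Z) => pd'.
  have /eqP -> : d%:~R == 0 :> 'F_p by rewrite Fp_int_eq0.
  rewrite mul0r hx0_S // lgN intrM rmorphXn rmorphN1 /kappa.
  have ik : 'i ^+ k != 0 :> C by rewrite expf_neq0 // i_neq0.
  have A2 := ik_sqr R p; rewrite -/k in A2.
  have A4 : ('i ^+ k) ^+ 2 * ('i ^+ k) ^+ 2 = 1 :> C by rewrite A2 -exprMn mulN1r opprK expr1n.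
  rewrite -A2; move: ('i ^+ k) ik A4 (kap R p) (kap_neq0 R p) (hq p z) ((lg p c)%:~R : C) => A A0 A4 K K0 h l.
  by rewrite -[LHS]mul1r -A4; field; rewrite A0 K0.
have d0 : d%:~R != 0 :> 'F_p by rewrite Fp_int_eq0.
set x : 'F_p := d%:~R / _; have x0 : x != 0 by rewrite /x mulf_neq0 // invr_eq0 mulf_neq0.
rewrite hx_S //.
have -> : tau x = (- c)%:~R / (24%:R * d%:~R).
  rewrite /tau /x intrN; move: (24%:R : 'F_p) (c%:~R : 'F_p) (d%:~R : 'F_p) F24 c0 d0 => a b e a0 b0 e0.
  by field; rewrite a0 b0 e0.
suff <- : lg p c * (del * lgF x) = lg p d by rewrite [in RHS]intrM; move: (hx _ z) => h; ring.
have -> : lg p d = lgF x * (lgF (24%:R : 'F_p) * lg p c).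
  rewrite -(lgF_int pp d) -(lgF_int pp c) -!lgFM //; congr lgF; rewrite /x.
  by rewrite divfK // mulf_neq0.
have D24 : del = lgF (24%:R : 'F_p).
  have e : lgF (24%:R^-1 : 'F_p) * lgF (24%:R : 'F_p) = 1.
    by rewrite -lgFM // mulVf // -[1]/(1%:~R) lgF_int // lg1.
  by rewrite -[LHS]mulr1 -e mulrA del_24 mul1r.
by rewrite D24; ring.
Qed.

Lemma hqp_slash g : sl2 g -> forall z : C, 0 < complex.Im z -> sl k (hq p) g z = Hv (mc g) (md g) z.
Proof.
move: g.
apply: (sl2_ind (P := fun g => forall z : C, 0 < complex.Im z -> sl k (hq p) g z = Hv (mc g) (md g) z)).
- by move=> z z0; rewrite /sl j2_one mob2_one expr1n invr1 /Hv /= dvdz0 lg1.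
- move=> g sg IH z z0; rewrite (sl_mul _ _ _ (sl2_T 1) z0) slT.
  rewrite IH ?(Im_add_nat z 1) // Hv_T /=; congr (Hv _ _ _); ring.
- move=> g sg IH z z0; rewrite (sl_mul _ _ _ (sl2_T (-1)) z0) slT'.
  have z1 : 0 < complex.Im (z - 1) by have := Im_add_int z (-1); rewrite rmorphN1 => ->.
  rewrite IH // -{2}[z](subrK 1) Hv_T /=; congr (Hv _ _ _); ring.
move=> g sg IH z z0; rewrite (sl_mul _ _ _ sl2_S z0) (eq_sl _ IH) //.
rewrite Hv_S //=; first by congr (Hv _ _ _); ring.
apply/negP => /andP[/dvdzP[x hx'] /dvdzP[y hy]]; move: sg; rewrite /sl2 hx' hy.
have -> : ma g * (y * p) - mb g * (x * p) = (ma g * y - mb g * x) * p%:Z by ring.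
move=> h; have := congr1 absz h; rewrite abszM /= => /eqP; rewrite muln_eq1 => /andP[_ /eqP h1].
by move: p4; rewrite h1.
Qed.

End Sign.

Lemma hqp_mod g (z : C) : sl2 g -> (p%:Z %| mc g)%Z -> 0 < complex.Im z ->
  sl k (hq p) g z = (lg p (md g))%:~R * hq p z.
Proof.
move=> sg pc z0; have [del d1 [_ hS]] := phi_sign R pp p4.
by rewrite (hqp_slash d1 hS) // /Hv pc.
Qed.

(** Reciprocity with the prime 3 reduces this to the residue of p modulo 12. *)
Lemma lg3 : lg p 3 = (-1) ^+ `|r12 p|%N.
Proof.
have <- := quadratic_reciprocity pp (isT : prime 3) p2 isT; rewrite -/k.
have m1 a : (a = 1 %[mod 3])%Z -> lg 3 a = 1 by move=> h; rewrite (lg_eqmod h) lg1.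
have mN a : (a = -1 %[mod 3])%Z -> lg 3 a = -1 by move=> h; rewrite (lg_eqmod h) lgN1.
have ev n : odd n = false -> (-1) ^+ n = 1 :> int by move=> e; rewrite -signr_odd e.
have od n : odd n -> (-1) ^+ n = -1 :> int by move=> e; rewrite -signr_odd e.
have [q [h|[h|[h|h]]]] : exists q, p = (12 * q + 1)%N \/ p = (12 * q + 5)%N \/ p = (12 * q + 7)%N \/ p = (12 * q + 11)%N.
  by exists (p %/ 12)%N; have := prime_mod6 pp p4; lia.
- have kE : k = (6 * q + 0)%N by rewrite /k h; lia.
  have rE : `|r12 p|%N = (2 * q + 0)%N by rewrite /r12 h; case: ifP; lia.
  rewrite ev; last by rewrite kE oddD oddM.
  rewrite ev; last by rewrite rE oddD oddM.
  by rewrite m1 // h; lia.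
- have kE : k = (6 * q + 2)%N by rewrite /k h; lia.
  have rE : `|r12 p|%N = (2 * q + 1)%N by rewrite /r12 h; case: ifP; lia.
  rewrite ev; last by rewrite kE oddD oddM.
  rewrite od; last by rewrite rE oddD oddM.
  by rewrite mN // h; lia.
- have kE : k = (6 * q + 3)%N by rewrite /k h; lia.
  have rE : `|r12 p|%N = (2 * q + 1)%N by rewrite /r12 h; case: ifP; lia.
  rewrite od; last by rewrite kE oddD oddM.
  rewrite od; last by rewrite rE oddD oddM.
  by rewrite mN // h; lia.
- have kE : k = (6 * q + 5)%N by rewrite /k h; lia.
  have rE : `|r12 p|%N = (2 * q + 2)%N by rewrite /r12 h; case: ifP; lia.
  rewrite od; last by rewrite kE oddD oddM.
  rewrite ev; last by rewrite rE oddD oddM.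
  by rewrite m1 // h; lia.
Qed.

(** The limit relation says [kap] (12/p) = i^k del g, and the relation in SL_2(Z) gave del = (24/p)
    = (2/p) (3/p). The factors (3/p) and (12/p) cancel, and i^k (2/p) is the inverse of epsilon by
    the classes of p modulo 8. *)
Lemma gauss_prime : gaussF p w = epsilon R p * kap R p.
Proof.
have [del d1 [hg hS]] := phi_sign R pp p4.
have D24 : del = lg p 2 * lg p 3.
  have e : lgF (24%:R^-1 : 'F_p) * lgF (24%:R : 'F_p) = 1.
    by rewrite -lgFM // mulVf ?Fp24 // -[1]/(1%:~R) lgF_int // lg1.
  have -> : del = lgF (24%:R : 'F_p).
    by rewrite -[LHS]mulr1 -e mulrA (del_24 d1 hS) mul1r.
  rewrite -[24%:R]/(24%:Z%:~R) lgF_int // (_ : 24%:Z = 2 * 2 * 2 * 3) // !lgM // -expr2 lg_sqr ?mul1r //.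
  by rewrite dvdzE /=; apply/negP => /dvdn_leq h; have := h isT; move: p2; lia.
have ik : 'i ^+ k != 0 :> C by rewrite expf_neq0 // i_neq0.
have s3 : (lg p 3)%:~R = c12 R p by rewrite lg3 rmorphXn rmorphN1.
rewrite -/k D24 intrM s3 -/w in hg.
have l2 : (lg p 2) ^+ 2 = 1.
  by rewrite lg_sqr // dvdzE /=; apply/negP => /dvdn_leq h; have := h isT; move: p2; lia.
have key : 'i ^+ k * (lg p 2)%:~R * gaussF p w = kap R p.
  have cc := c12_sqr R p; have c0 : c12 R p != 0.
    by apply: contra_eq_neq cc => ->; rewrite expr0n eq_sym oner_neq0.
  by apply: (mulIf c0); rewrite hg; ring.
have l20 : (lg p 2)%:~R != 0 :> C.
  by rewrite intr_eq0; apply: contra_eq_neq l2 => ->; rewrite expr0n eq_sym oner_neq0.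
apply: (mulfI (mulf_neq0 ik l20)); rewrite key.
suff -> : 'i ^+ k * (lg p 2)%:~R * (epsilon R p * kap R p) = kap R p by [].
rewrite mulrA (_ : _ * epsilon R p = 1) ?mul1r // (second_supplement pp p2) /epsilon imunitE.
have [q [h|[h|[h|h]]]] : exists q, p = (8 * q + 1)%N \/ p = (8 * q + 3)%N \/ p = (8 * q + 5)%N \/ p = (8 * q + 7)%N.
  by exists (p %/ 8)%N; have := pE; lia.
- have -> : k = (4 * q)%N by rewrite /k h; lia.
  have -> : ((p %% 8 == 1) || (p %% 8 == 7))%N by lia.
  have -> : (p %% 4 == 1)%N by lia.
  by rewrite exprM i_pow4 expr1n !mulr1.
- have -> : k = (4 * q + 1)%N by rewrite /k h; lia.
  have -> : ((p %% 8 == 1) || (p %% 8 == 7))%N = false by lia.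
  have -> : (p %% 4 == 1)%N = false by lia.
  by rewrite exprD exprM i_pow4 expr1n mul1r rmorphN1 mulrN1 mulNr expr1 -expr2 sqr_i opprK.
- have -> : k = (4 * q + 2)%N by rewrite /k h; lia.
  have -> : ((p %% 8 == 1) || (p %% 8 == 7))%N = false by lia.
  have -> : (p %% 4 == 1)%N by lia.
  by rewrite exprD exprM i_pow4 expr1n mul1r sqr_i rmorphN1 mulrNN !mulr1.
have -> : k = (4 * q + 3)%N by rewrite /k h; lia.
have -> : ((p %% 8 == 1) || (p %% 8 == 7))%N by lia.
have -> : (p %% 4 == 1)%N = false by lia.
by rewrite exprD exprM i_pow4 expr1n mul1r mulr1 -exprSr i_pow4.
Qed.

End EtaQuotientPrime.

(** * The eta quotient of level N *)

Section EtaQuotient.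
Variable R : realType.
Local Notation C := R[i].
Local Open Scope complex_scope.

Definition wt (N : nat) : nat := (N.-1)./2.

Lemma wt_odd N : odd N -> N = (wt N).*2.+1.
Proof. by move=> oN; rewrite /wt; case: N oN => // n /= on; rewrite even_halfK. Qed.

Lemma wtM m n : odd m -> odd n -> wt (m * n) = (n * wt m + wt n)%N.
Proof.
move=> om on; have hm := wt_odd om; have hn := wt_odd on.
have omn : odd (m * n) by rewrite oddM om.
have e : (m * n = (n * wt m + wt n).*2.+1)%N.
  by rewrite {1}hm mulSn {1}hn; move: (wt m) (wt n) => x y; lia.
by apply: double_inj; apply: succn_inj; rewrite -wt_odd // e.
Qed.

Lemma sl_eqP k (f : C -> C) g (z c : C) : sl2 g -> 0 < complex.Im z ->
  sl k f g z = c * f z <-> f (mob2 g z) = j2 g z ^+ k * (c * f z).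
Proof.
move=> sg z0; have j0 : j2 g z ^+ k != 0 by rewrite expf_neq0 // j2_neq0.
rewrite /sl; split=> [<-|->]; first by rewrite mulVKf.
by rewrite mulKf.
Qed.

(** The middle factors eta(m z)^n cancel; this is what makes the transformation law multiplicative
    in the level. *)
Lemma hq_mul m n (z : C) : hq (m * n) z = hq m z ^+ n * hq n (m%:R * z).
Proof.
have e : (m * n)%:R * z = n%:R * (m%:R * z) by rewrite natrM; ring.
rewrite /hq e expr_div_n -exprM.
have := eta_neq0 (n%:R * (m%:R * z)); have := expf_neq0 n (eta_neq0 (m%:R * z)).
move: (eta z ^+ _) (eta (m%:R * z) ^+ n) (eta _) => X Y Z Y0 Z0.
by field; rewrite Y0 Z0.
Qed.

(** For N = p M the second factor of [hq_mul] is evaluated at p z, on which g acts through the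
    matrix with upper right entry p b and lower left entry c / p, an element of Gamma_0(M) with the
    same lower right entry. *)
Lemma hq_mod N : good N -> forall g (z : C), sl2 g -> (N%:Z %| mc g)%Z -> 0 < complex.Im z ->
  sl (wt N) (hq N) g z = (chi N (md g))%:~R * hq N z.
Proof.
move: N; apply: good_ind => [g z sg _ z0|p M pp p4 gpM IH g z sg pMc z0].
  by rewrite chi_1 /sl /hq !mul1r /wt expr0 invr1 !divff ?eta_neq0 // mul1r.
have gM : good M by apply: good_dvd gpM _; rewrite dvdn_mull.
have op : odd p by have /(good_dvd gpM)/good_odd : (p %| p * M)%N by rewrite dvdn_mulr.
have oM := good_odd gM; have p0 := prime_gt0 pp.
have pC : p%:R != 0 :> C by rewrite pnatr_eq0 -lt0n.
have [q hc] := dvdzP pMc; rewrite PoszM in hc.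
have pc : (p%:Z %| mc g)%Z by apply/dvdzP; exists (q * M%:Z); rewrite hc; ring.
have h1 := hqp_mod pp p4 sg pc z0.
pose g' := Mat2 (ma g) (p%:Z * mb g) (q * M%:Z) (md g).
have sg' : sl2 g'.
  by rewrite /sl2 /=; move: sg; rewrite /sl2 hc => <-; ring.
have z1 := Im_natM p0 z0.
have h2 := IH g' _ sg' _ z1; rewrite /= in h2.
have jE : j2 g' (p%:R * z) = j2 g z by rewrite /j2 /= hc !intrM; ring.
have mE : mob2 g' (p%:R * z) = p%:R * mob2 g z.
  by rewrite /mob2 jE /= intrM [RHS]mulrA; congr (_ / _); ring.
have {}h2 : sl (wt M) (hq M) g' (p%:R * z) = (chi M (md g))%:~R * hq M (p%:R * z).
  by apply: h2; apply/dvdzP; exists q.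
move/(sl_eqP _ _ _ sg z0): h1 => h1; move/(sl_eqP _ _ _ sg' z1): h2; rewrite jE mE => h2.
apply/(sl_eqP _ _ _ sg z0); rewrite !hq_mul h1 h2 wtM // exprD mulnC exprM -/(wt p).
have cE : chi (p * M) (md g) = lg p (md g) * chi M (md g).
  by rewrite chi_mulN // chi_prime // (leq_trans _ p4).
rewrite cE intrM.
(* M is odd and the Legendre symbol is a sign, p not dividing the lower right entry. *)
have lM : (lg p (md g))%:~R ^+ M = (lg p (md g))%:~R :> C.
  rewrite -rmorphXn /=; congr (_%:~R); rewrite (wt_odd oM) exprS -mul2n exprM lg_sqr ?expr1n ?mulr1 //.
  apply/negP => /dvdzP[t ht]; move: sg; rewrite /sl2 hc ht.
  have -> : ma g * (t * p) - mb g * (q * (p * M)) = (ma g * t - mb g * (q * M)) * p%:Z by ring.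
  move=> h; have := congr1 absz h; rewrite abszM /= => /eqP; rewrite muln_eq1 => /andP[_ /eqP e].
  by move: p4; rewrite e.
rewrite exprMn [((lg p _)%:~R * _) ^+ M]exprMn lM.
by move: ((lg p _)%:~R : C) ((chi M _)%:~R : C) (hq p z ^+ M) (hq M _) (_ ^+ M) (_ ^+ wt M) => a b c d e f; ring.
Qed.

(** If the bottom rows are proportional modulo N, the matrix taking [gb] to [ga] on the left lies in
    Gamma_0(N) and its lower right entry is the ratio lam. *)
Lemma hq_row N ga gb (lam : int) (z : C) : good N -> sl2 ga -> sl2 gb -> 0 < complex.Im z ->
  (N%:Z %| mc ga - lam * mc gb)%Z -> (N%:Z %| md ga - lam * md gb)%Z ->
  sl (wt N) (hq N) ga z = (chi N lam)%:~R * sl (wt N) (hq N) gb z.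
Proof.
move=> gN sa sb z0 /dvdzP[x hx] /dvdzP[y hy].
pose h := mul2 ga (inv2 gb); have sh : sl2 h := sl2_mul sa (sl2_inv sb).
have cE : mc ga = lam * mc gb + x * N%:Z by rewrite -hx; ring.
have dE : md ga = lam * md gb + y * N%:Z by rewrite -hy; ring.
have hc : mc h = (x * md gb - y * mc gb) * N%:Z by rewrite /= cE dE; ring.
have hd : md h = lam + (y * ma gb - x * mb gb) * N%:Z.
  have -> : lam = lam * (ma gb * md gb - mb gb * mc gb) by rewrite sb mulr1.
  by rewrite /= cE dE; ring.
have e (w : C) : 0 < complex.Im w -> sl (wt N) (hq N) h w = (chi N lam)%:~R * hq N w.
  move=> w0; rewrite hq_mod //; last by rewrite hc dvdz_mull.
  by rewrite (@chi_mod _ (chiP gN) (md h) lam) //; apply/eqP; rewrite eqz_mod_dvd hd addrC addKr dvdz_mull.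
by rewrite -(mul2V ga sb) -/h (sl_mul _ _ _ sb z0) (eq_sl _ e) // slZ.
Qed.

Lemma clim_hq N : (0 < N)%N -> clim (ioo (R := R)) (hq N) 1.
Proof.
move=> N0; have h : clim (ioo (R := R)) (fun z => ce (- usr z) ^+ N / ce (- usr (N%:R * z))) (1 ^+ N / 1).
  apply: climM.
    by apply: climX; apply: (clim_eta_ioo (u := id) (c := 1)) => // z z0; rewrite mul1r.
  apply: climV; first exact: oner_neq0.
  apply: (clim_eta_ioo (c := N%:R)); first by rewrite ltr0n.
  by move=> z z0; rewrite natC ImZ.
rewrite expr1n divr1 in h; apply: eq_near_clim h; apply: nearW => z.
rewrite /hq !eta_split exprMn -qvarMn (_ : N%:R * z / 24 = z / 24 * N%:R); last by ring.
rewrite invfM mulrACA divff ?qvar_neq0 ?mul1r //.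
Qed.

(* (N 0; 0 1) g = g' (A B; 0 D) with A = gcd(N, c): then N g z = g' ((A z + B) / D). *)
Lemma hecke_decomp (N : nat) g : (0 < N)%N -> sl2 g ->
  exists g' (A D : nat) (B : int), [/\ sl2 g', (A * D = N)%N, (A%:Z %| mc g)%Z &
   forall z : C, 0 < complex.Im z ->
     mob2 g' ((A%:R * z + B%:~R) / D%:R) = N%:R * mob2 g z /\
     j2 g' ((A%:R * z + B%:~R) / D%:R) = j2 g z / D%:R].
Proof.
case: g => a b c d N0 sg; rewrite /sl2 /= in sg.
pose A := gcdn N `|c|; have A0 : (0 < A)%N by rewrite gcdn_gt0 N0.
have [D hD] := dvdnP (dvdn_gcdl N `|c|); rewrite -/A in hD.
have /dvdzP[c' hc'] : (A%:Z %| c)%Z by rewrite dvdzE /= dvdn_gcdr.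
have [x [y hxy]] : exists x y, x * N%:Z + y * c = A%:Z.
  by have [u [v h]] := Bezoutz N%:Z c; exists u, v; rewrite h.
have D0 : (0 < D)%N by move: N0; rewrite hD muln_gt0 => /andP[].
have AC : A%:R != 0 :> C by rewrite pnatr_eq0 -lt0n.
have DC : D%:R != 0 :> C by rewrite pnatr_eq0 -lt0n.
pose u := x * d; pose v := y - x * N%:Z * b; pose a' := D%:Z * a.
have NE : N%:Z = D%:Z * A%:Z by rewrite hD PoszM.
have det : a' * u + v * c' = 1.
  apply: (@mulIf _ A%:Z); first by rewrite eqz_nat -lt0n.
  rewrite mul1r -[RHS]hxy; transitivity (x * N%:Z * (a * d - b * c) + y * c); last by rewrite sg mulr1.
  by rewrite /a' /u /v NE hc'; ring.
exists (Mat2 a' (- v) c' u), A, D, (u * N%:Z * b + v * d).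
have key1 : a' * (u * N%:Z * b + v * d) - v * D%:Z = N%:Z * b.
  transitivity (N%:Z * b * (a' * u) + v * D%:Z * (a * d - b * c) + v * D%:Z * b * c - v * D%:Z).
    by rewrite /a'; ring.
  rewrite sg; transitivity (N%:Z * b * (a' * u + v * c')); last by rewrite det mulr1.
  by rewrite NE hc'; ring.
have key2 : c' * (u * N%:Z * b + v * d) + u * D%:Z = d.
  transitivity (d * (a' * u + v * c') + u * D%:Z * (1 - (a * d - b * c))); last by rewrite det sg subrr mulr0 addr0 mulr1.
  by rewrite /a' NE hc'; ring.
split.
- by rewrite /sl2 /= -[RHS]det; ring.
- by rewrite mulnC.
- by rewrite /= hc' dvdz_mull.
move=> z z0.
have jE : j2 (Mat2 a' (- v) c' u) ((A%:R * z + (u * N%:Z * b + v * d)%:~R) / D%:R) = j2 (Mat2 a b c d) z / D%:R.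
  rewrite /j2 /= -[X in _ = (_ + X%:~R) / _]key2 [in RHS]hc'.
  by move: (u * _ * _ + _) => X; rewrite intrD !intrM; field.
split=> //; rewrite /mob2 jE /=.
have -> : a'%:~R * ((A%:R * z + (u * N%:Z * b + v * d)%:~R) / D%:R) + (- v)%:~R =
    (N%:R * (a%:~R * z + b%:~R)) / D%:R.
  have -> : N%:R * (a%:~R * z + b%:~R) = (a' * A%:Z)%:~R * z + (N%:Z * b)%:~R :> C.
    by rewrite -[N%:R]/(N%:Z%:~R) /a' NE !intrM; ring.
  rewrite -key1; move: (u * _ * _ + _) => X; rewrite intrB !intrM intrN; field.
  by [].
have := @j2_neq0 R (Mat2 a b c d) z sg z0; move: (j2 _ z) => J J0.
by rewrite invf_div mulrA divfK // -mulrA.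
Qed.

(** When N does not divide c, eta(N g z) is governed by eta((A z + B) / D) with A D = N and D > 1.
    The automorphy factors cancel in modulus, and the exponent (N - A / D) / 24 left in q is
    positive. *)
Lemma clim_hq_slash N g : good N -> sl2 g ->
  clim (ioo (R := R)) (sl (wt N) (hq N) g) (if (N%:Z %| mc g)%Z then (chi N (md g))%:~R else 0).
Proof.
move=> gN sg; have oN := good_odd gN; have N0 : (0 < N)%N by exact: odd_gt0.
case: (boolP (N%:Z %| mc g)%Z) => Nc.
  have h : clim (ioo (R := R)) (fun z => (chi N (md g))%:~R * hq N z) ((chi N (md g))%:~R * 1).
    by apply: climM; [exact: clim_cst|exact: clim_hq].
  rewrite mulr1 in h; apply: eq_near_clim h; apply: (near_ioo (A := 0)) => z z0 _.
  by rewrite hq_mod.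
have [g' [A [D [B [sg' AD Ac H]]]]] := hecke_decomp N0 sg.
have D0 : (0 < D)%N by move: N0; rewrite -AD muln_gt0 => /andP[].
have A0 : (0 < A)%N by move: N0; rewrite -AD muln_gt0 => /andP[].
have DC : D%:R != 0 :> C by rewrite pnatr_eq0 -lt0n.
have D1 : (1 < D)%N.
  rewrite ltn_neqAle D0 andbT; apply: contra Nc => /eqP D1; move: AD; rewrite -D1 muln1 => <-.
  by [].
pose W (z : C) := (A%:R * z + B%:~R) / D%:R.
have WI z : complex.Im (W z) = A%:R / D%:R * complex.Im z.
  by rewrite /W mulrC (natC R D) invC ImZ Im_add_int (natC R A) ImZ mulrA; congr (_ * _); rewrite mulrC.
have AD0 : 0 < A%:R / D%:R :> R by rewrite divr_gt0 ?ltr0n.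
pose F (z : C) := eta z ^+ N / eta (W z).
pose c : R := (N%:R - A%:R / D%:R) / 24.
have c0 : 0 < c.
  rewrite divr_gt0 // subr_gt0 ltr_pdivrMr ?ltr0n // -natrM ltr_nat -AD -mulnA.
  by apply: (@leq_trans (A * 2)); [rewrite muln2 -addnn -addn1 leq_add|rewrite leq_mul2l; nia].
have cF : clim (ioo (R := R)) F 0.
  have h : clim (ioo (R := R)) (fun z => ee (c%:C * z - B%:~R / D%:R / 24) *
      (ce (- usr z) ^+ N / ce (- usr (W z)))) (0 * (1 ^+ N / 1)).
    apply: climM.
      apply: (clim_ee_ioo c0) => z z0.
      have -> : B%:~R / D%:R / 24 = (B%:~R / D%:R / 24 : R)%:C.
        by rewrite !rmorphM !fmorphV /= rmorph_int !rmorph_nat.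
      by rewrite -rmorphN ImD ImZ /= addr0.
    apply: climM.
      by apply: climX; apply: (clim_eta_ioo (u := id) (c := 1)) => // z z0; rewrite mul1r.
    apply: climV; first exact: oner_neq0.
    by apply: (clim_eta_ioo AD0) => z z0; rewrite WI.
  rewrite mul0r in h; apply: eq_near_clim h; apply: nearW => z.
  rewrite /F !eta_split exprMn -qvarMn invfM mulrACA; congr (_ * _).
  rewrite -qvarN -qvarD; congr ee; rewrite /W /c rmorphM rmorphB rmorphM !fmorphV !rmorph_nat.
  by field.
have key (z : C) : 0 < complex.Im z -> nm (sl (wt N) (hq N) g z) <= D%:R * nm (F z).
  move=> z0; have W0 : 0 < complex.Im (W z) by rewrite WI mulr_gt0.
  have [mE jE] := H z z0; have j0 := j2_neq0 sg z0.
  have n1 := nm_eta_mod sg z0; have n2 := nm_eta_mod sg' W0; rewrite mE jE nmM nmV nm_nat in n2.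
  have sq : nm (sl (wt N) (hq N) g z) ^+ 2 = D%:R * nm (F z) ^+ 2.
    rewrite /sl /hq /F !nmM !nmV !nmX !exprMn !exprVn n2.
    rewrite -[(nm (eta (mob2 g z)) ^+ N) ^+ 2]exprAC n1 exprMn.
    have e : nm (j2 g z) ^+ N = nm (j2 g z) * nm (j2 g z) ^+ (wt N) ^+ 2.
      by rewrite -exprM muln2 -exprS -wt_odd.
    rewrite e -[(nm (eta z) ^+ N) ^+ 2]exprAC.
    have : nm (j2 g z) != 0 by rewrite nm_eq0.
    have : nm (eta (W z)) != 0 by rewrite nm_eq0 eta_neq0.
    have : (nm (j2 g z) ^+ (wt N)) ^+ 2 != 0 by rewrite !expf_neq0 // nm_eq0.
    have : D%:R != 0 :> R by rewrite pnatr_eq0 -lt0n.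
    move: (nm (j2 g z)) (nm (eta (W z))) ((_ ^+ _) ^+ 2) ((nm (eta z) ^+ 2) ^+ N) => a b e1 d h1 h2 h3 h4.
    by field; rewrite h1 h2 h3 h4.
  rewrite -(@ler_pXn2r _ 2) ?nnegrE ?mulr_ge0 ?nm_ge0 // sq exprMn ler_wpM2r ?sqr_ge0 //.
  by rewrite expr2 ler_peMr // ler1n.
apply: (@clim_squeeze _ _ _ _ _ _ (fun z => D%:R * nm (F z))).
  by apply: (near_ioo (A := 0)) => z z0 _; rewrite subr0; exact: key.
move=> e e0; have Dp : 0 < D%:R :> R by rewrite ltr0n.
have := cF (e / D%:R); rewrite divr_gt0 // => /(_ isT); apply: filterS => z.
by rewrite subr0 ltr_pdivlMr // mulrC.
Qed.

(** The constant by which a slash of the eta quotient differs from eta(z)^N / eta(d z / e), when the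
    bottom row is (0, 1) modulo d and (1, 0) modulo e. *)
Definition kd (d e : nat) : C := kap R e * (chi d e%:Z)%:~R * 'i ^- (d * wt e).

(** In the product formula of level e d, the factor of level e sees g as S times an element of
    Gamma_0(e) on the left; the factor of level d is evaluated at e z, where g acts on z / e through
    an element of Gamma_0(d). *)
Lemma hq_gamma0 d e g (z : C) : good (d * e) -> sl2 g -> 0 < complex.Im z ->
  (d%:Z %| mc g)%Z -> (d%:Z %| md g - 1)%Z -> (e%:Z %| mc g - 1)%Z -> (e%:Z %| md g)%Z ->
  sl (wt (d * e)) (hq (d * e)) g z = kd d e * (eta z ^+ (d * e) / eta (d%:R * (z / e%:R))).
Proof.
move=> gde sg z0 dc dd ec /dvdzP[m hm].
have gd : good d by apply: good_dvd gde _; rewrite dvdn_mulr.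
have ge : good e by apply: good_dvd gde _; rewrite dvdn_mull.
have od := good_odd gd; have oe := good_odd ge; have e0 : (0 < e)%N by exact: odd_gt0.
have eC : e%:R != 0 :> C by rewrite pnatr_eq0 -lt0n.
have zn := Im_gt0_neq0 z0; have j0 := j2_neq0 sg z0.
have ze : 0 < complex.Im (z / e%:R) by rewrite natC; apply: Im_gt0_div; rewrite ?ltr0n.
pose X := 'i ^- (wt e) * kap R e * (eta z ^+ e / eta (z / e%:R)).
have hE : hq e (mob2 g z) = j2 g z ^+ wt e * X.
  pose g1 := mul2 g (inv2 S2); have sg1 : sl2 g1 := sl2_mul sg (sl2_inv sl2_S).
  have c1 : mc g1 = - md g by rewrite /=; ring.
  have d1 : md g1 = mc g by rewrite /=; ring.
  have e1 (w : C) : 0 < complex.Im w -> sl (wt e) (hq e) g1 w = 1 * hq e w.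
    move=> w0; rewrite hq_mod //; last by rewrite c1 hm dvdzE abszN abszM dvdn_mull.
    by rewrite d1 (@chi_mod _ (chiP ge) _ 1) ?chi_one //; apply/eqP; rewrite eqz_mod_dvd.
  have : sl (wt e) (hq e) g z = X.
    by rewrite -(mul2V g sl2_S) -/g1 (sl_mul _ _ _ sl2_S z0) (eq_sl _ e1) // slZ mul1r hq_S.
  by move=> <-; rewrite /sl mulVKf // expf_neq0.
have cm : chi d m = chi d e.
  have chid1 : chi d (m * e%:Z) = 1.
    by rewrite -hm (@chi_mod _ (chiP gd) _ 1) ?chi_one //; apply/eqP; rewrite eqz_mod_dvd.
  have sq : chi d e%:Z ^+ 2 = 1.
    apply: (chi_sqr (chiP gd)); rewrite /= coprime_sym; exact: good_coprime gde.
  by rewrite -[LHS]mulr1 -sq expr2 mulrA -(chiM (chiP gd)) chid1 mul1r.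
have hD : hq d (e%:R * mob2 g z) = (j2 g z / e%:R) ^+ wt d * ((chi d e%:Z)%:~R * hq d (z / e%:R)).
  pose g2 := Mat2 (e%:Z * ma g) (mb g) (mc g) m.
  have sg2 : sl2 g2 by rewrite /sl2 /=; move: sg; rewrite /sl2 hm => <-; ring.
  have jE : j2 g2 (z / e%:R) = j2 g z / e%:R.
    by rewrite /j2 /= hm intrM; field.
  have mE : mob2 g2 (z / e%:R) = e%:R * mob2 g z.
    rewrite /mob2 jE /= intrM.
    have -> : e%:~R * (ma g)%:~R * (z / e%:R) = (ma g)%:~R * z :> C by rewrite -[e%:~R]/(e%:R); field.
    by rewrite invf_div; ring.
  rewrite -mE -jE -cm; apply/(sl_eqP _ _ _ sg2 ze); rewrite hq_mod //.
rewrite /sl mulnC hq_mul hE hD wtM // exprD exprMn -exprM (mulnC (wt e)) expr_div_n.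
have -> : X ^+ d = 'i ^- (d * wt e) * (kap R e * e%:R ^+ wt d) * (eta z ^+ (e * d) / eta (z / e%:R) ^+ d).
  rewrite /X !exprMn -!exprVn -!exprM (mulnC (wt e)) exprVn; congr (_ * _ * _).
  by rewrite {1}(wt_odd od) exprS -mul2n exprM kap_sqr.
rewrite /hq /kd.
set a := eta (z / e%:R) ^+ d; set b := eta (d%:R * (z / e%:R)); set f := eta z ^+ _.
set J := j2 g z ^+ (d * wt e); set Q := j2 g z ^+ wt d; set s := e%:R ^+ wt d.
have a0 : a != 0 by rewrite expf_neq0 ?eta_neq0.
have b0 : b != 0 by rewrite eta_neq0.
have J0 : J != 0 by rewrite expf_neq0.
have Q0 : Q != 0 by rewrite expf_neq0.
have s0 : s != 0 by rewrite expf_neq0.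
clearbody a b f J Q s; move: ((chi d e)%:~R : C) (kap R e) ('i ^- _) => h x y.
by field; rewrite J0 Q0 s0 a0 b0.
Qed.

(** * Gauss sums of composite level *)

Definition gsum (N : nat) (t : int) : C := \sum_(r < N) (chi N r)%:~R * ee ((t * r%:Z)%:~R / N%:R).

Definition gauss (N : nat) : C := epsilon R N * kap R N.

Lemma gsum_prime p t : prime p -> (4 < p)%N -> gsum p t = (chi p t)%:~R * gauss p.
Proof.
move=> pp p4; have p2 : (2 < p)%N by rewrite (leq_trans _ p4).
have pC : p%:R != 0 :> C by rewrite pnatr_eq0 -lt0n prime_gt0.
have wp : (ee p%:R^-1 : C) ^+ p = 1 by rewrite -qvarMn mulVf // qvar1.
have mp (n : int) : ee (n%:~R / p%:R) = psiF (ee p%:R^-1 : C) (n%:~R : 'F_p).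
  have := Fp_int_eq n ((n%:~R : 'F_p) : nat)%:Z pp.
  rewrite -[X in _ == X]/((n%:~R : 'F_p) : nat)%:R Fp_nat eqxx => /esym.
  rewrite eqz_mod_dvd => /dvdzP[m hm]; rewrite /psiF -qvarMn; set x := (n%:~R : 'F_p) in hm *.
  apply: (@ee_eqmod _ _ _ m); have -> : n = (x : nat)%:Z + m * p%:Z by rewrite -hm; ring.
  by rewrite intrD intrM -[_%:~R in X in X = _]/(_%:R); field.
have sE : gsum p t = \sum_(x : 'F_p) (lgF x)%:~R * psiF (ee p%:R^-1 : C) (x * t%:~R).
  pose G (n : nat) : C := (chi p n)%:~R * ee ((t * n%:Z)%:~R / p%:R).
  rewrite /gsum -(sum_Fp G pp); apply: eq_bigr => x _; rewrite /G chi_prime // mp; congr (_ * psiF _ _).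
  by rewrite intrM mulrC; congr (_ * _); exact: Fp_nat.
rewrite sE chi_prime // -lgF_int // /gauss -gauss_prime //.
have [->|t0] := eqVneq (t%:~R : 'F_p) 0; last by rewrite gaussF_mul.
under eq_bigr do rewrite mulr0 /psiF expr0 mulr1.
by rewrite -rmorph_sum /= lgF_sum // /lgF lg_dvd ?dvdz0 // mul0r.
Qed.

Lemma ee_int_mod (N : nat) (a b : int) : (0 < N)%N -> (a = b %[mod N%:Z])%Z -> ee (a%:~R / N%:R) = ee (b%:~R / N%:R) :> C.
Proof.
move=> N0 /eqP; rewrite eqz_mod_dvd => /dvdzP[m hm].
have NC : N%:R != 0 :> C by rewrite pnatr_eq0 -lt0n.
apply: (@ee_eqmod _ _ _ m); have -> : a = b + m * N%:Z by rewrite -hm; ring.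
by rewrite intrD intrM -[N%:~R]/(N%:R); field.
Qed.

Lemma crt_sum (V : nmodType) (m n : nat) (F : nat -> V) : coprime m n -> (0 < m)%N -> (0 < n)%N ->
  (forall r, F (r %% (m * n))%N = F r) ->
  \sum_(r < m * n) F r = \sum_(x < m) \sum_(y < n) F (n * x + m * y)%N.
Proof.
move=> cmn m0 n0 hF; have mn0 : (0 < m * n)%N by rewrite muln_gt0 m0.
pose f (u : 'I_m * 'I_n) : 'I_(m * n) := Ordinal (ltn_pmod (n * u.1 + m * u.2) mn0).
have finj : injective f.
  have cancel (a b x x' : nat) : coprime a b -> (x < a)%N -> (x' < a)%N -> b * x = b * x' %[mod a] -> x = x'.
    move=> cab; wlog le : x x' / (x <= x')%N.
      by move=> H xa x'a e; case: (leqP x x') => [/H|/ltnW/H e']; [exact|apply/esym; exact: e'].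
    move=> xa x'a /esym/eqP; rewrite eqn_mod_dvd ?leq_mul2l ?le ?orbT // -mulnBr Gauss_dvdr // => /dvdnP[[|q] hq].
      by move: hq le; lia.
    by move: hq; rewrite mulSn; lia.
  move=> [x y] [x' y'] /(congr1 val) /= h.
  have hm (k : nat) : (k %| m * n)%N -> n * x + m * y = n * x' + m * y' %[mod k].
    by move=> kmn; rewrite -(modn_dvdm _ kmn) h modn_dvdm.
  have hx : (x : nat) = x'.
    apply: (cancel m n) => //; have := hm m (dvdn_mulr _ (dvdnn _)).
    by rewrite ![(n * _ + _)%N]addnC ![(m * _)%N]mulnC !modnMDl.
  have hy : (y : nat) = y'.
    apply: (cancel n m) => //; first by rewrite coprime_sym.
    by have := hm n (dvdn_mull _ (dvdnn _)); rewrite ![(n * _)%N]mulnC !modnMDl.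
  by congr (_, _); apply: val_inj.
have fbij : bijective f by apply: inj_card_bij finj _; rewrite card_prod !card_ord.
rewrite (reindex f) /=; last exact: onW_bij.
by rewrite pair_big /=; apply: eq_bigr => -[x y] _ /=; rewrite hF.
Qed.

(** The failure of epsilon to be multiplicative is exactly the sign of quadratic reciprocity. *)
Lemma epsilon_mul m n : odd m -> odd n ->
  (-1) ^+ (((m - 1) %/ 2) * ((n - 1) %/ 2)) * epsilon R m * epsilon R n = epsilon R (m * n).
Proof.
move=> om on; rewrite /epsilon imunitE.
have [x [hx|hx]] : exists x, m = (4 * x + 1)%N \/ m = (4 * x + 3)%N by exists (m %/ 4)%N; lia.
  have -> : (m %% 4 == 1)%N by lia.
  have -> : (((m - 1) %/ 2) = x * 2)%N by lia.
  have -> : (m * n %% 4 = n %% 4)%N.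
    by rewrite hx mulnDl mul1n -mulnA mulnC modnMDl.
  by rewrite (mulnC x) -mulnA exprM sqrrN expr1n expr1n !mul1r.
have [y [hy|hy]] : exists y, n = (4 * y + 1)%N \/ n = (4 * y + 3)%N by exists (n %/ 4)%N; lia.
  have -> : (n %% 4 == 1)%N by lia.
  have -> : (((n - 1) %/ 2) = 2 * y)%N by lia.
  have -> : (m * n %% 4 = m %% 4)%N.
    by rewrite hy mulnDr muln1 mulnCA mulnC modnMDl.
  by rewrite mulnCA exprM sqrrN expr1n expr1n mul1r mulr1.
have -> : (m %% 4 == 1)%N = false by lia.
have -> : (n %% 4 == 1)%N = false by lia.
have -> : (m * n %% 4 == 1)%N.
  have -> : (m * n = (4 * x * y + 3 * x + 3 * y + 2) * 4 + 1)%N by rewrite hx hy; ring.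
  by rewrite modnMDl.
have -> : (((m - 1) %/ 2) = (2 * x).+1)%N by lia.
have -> : (((n - 1) %/ 2) = (2 * y).+1)%N by lia.
rewrite -signr_odd oddM /= !oddM /= expr1 mulN1r mulNr -expr2 sqr_i opprK //.
Qed.

(** With r = M x + p y the sum factors; the cross symbols (M/p) and (p/M) multiply to the sign that
    turns the product of the two epsilons into that of p M. *)
Lemma gsumE N t : good N -> gsum N t = (chi N t)%:~R * gauss N.
Proof.
move=> gN; move: N gN t; apply: good_ind => [t|p M pp p4 gpM IH t].
  rewrite /gsum big_ord1 !chi_1 mulr0 mul0r qvar0 mulr1 mul1r /gauss /epsilon modn_small //=.
  by rewrite mul1r /kap mul1r vv_i.
have gM : good M by apply: good_dvd gpM _; rewrite dvdn_mull.
have gp : good p by apply: good_dvd gpM _; rewrite dvdn_mulr.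
have op := good_odd gp; have oM := good_odd gM; have p0 := prime_gt0 pp.
have M0 : (0 < M)%N by exact: odd_gt0.
have cpM := good_coprime gpM; have p2 : (2 < p)%N by rewrite (leq_trans _ p4).
have pC : p%:R != 0 :> C by rewrite pnatr_eq0 -lt0n.
have MC : M%:R != 0 :> C by rewrite pnatr_eq0 -lt0n.
pose F (r : nat) : C := (chi (p * M) r)%:~R * ee ((t * r%:Z)%:~R / (p * M)%:R).
have hF r : F (r %% (p * M))%N = F r.
  have e : ((r %% (p * M))%N%:Z = r%:Z %[mod (p * M)%N%:Z])%Z by rewrite -modz_nat modz_mod.
  rewrite /F (chi_mod (chiP gpM) e) (@ee_int_mod _ _ (t * r%:Z)) ?muln_gt0 ?p0 //.
  by rewrite -modzMmr e modzMmr.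
rewrite {1}/gsum -/(F _) (crt_sum cpM p0 M0 hF).
transitivity ((lg p M%:Z * chi M p%:Z)%:~R * (gsum p t * gsum M t)).
  rewrite /gsum mulr_suml mulr_sumr; apply: eq_bigr => x _; rewrite mulr_sumr mulr_sumr.
  apply: eq_bigr => y _; rewrite /F.
  have -> : chi (p * M) (M * x + p * y)%N = lg p M * chi M p * (chi p x * chi M y).
    rewrite chi_mulN //.
    have -> : chi p (M * x + p * y)%N = lg p M * chi p x.
      rewrite -(chi_prime _ pp p2) -(chiM (chiP gp)) -PoszM; apply: (chi_mod (chiP gp)).
      by rewrite !modz_nat; congr (Posz _); rewrite addnC mulnC modnMDl.
    have -> : chi M (M * x + p * y)%N = chi M p * chi M y.
      rewrite -(chiM (chiP gM)) -PoszM; apply: (chi_mod (chiP gM)).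
      by rewrite !modz_nat; congr (Posz _); rewrite (mulnC M) modnMDl.
    by ring.
  have -> : (t * (M * x + p * y)%N)%:~R / (p * M)%:R = (t * x%:Z)%:~R / p%:R + (t * y%:Z)%:~R / M%:R :> C.
    by rewrite natrM PoszD !PoszM mulrDr intrD !intrM -[p%:~R]/(p%:R) -[M%:~R]/(M%:R); field; rewrite pC MC.
  by rewrite qvarD !intrM; move: (ee _) (ee _) => X Y; ring.
rewrite gsum_prime // IH chi_mulN // /gauss kapM // -epsilon_mul //.
have -> : (-1) ^+ ((p - 1) %/ 2 * ((M - 1) %/ 2)) = (lg p M * chi M p)%:~R :> C.
  rewrite chi_reciprocity // /star (chiM (chiP gM)) -mulrA -expr2.
  have -> : chi M p ^+ 2 = 1 by apply: (chi_sqr (chiP gM)).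
  rewrite mulr1; have -> : chi M ((-1) ^+ ((p - 1) %/ 2)) = chi M (-1) ^+ ((p - 1) %/ 2).
    elim: ((p - 1) %/ 2)%N => [|n IHn]; first by rewrite !expr0 chi_one.
    by rewrite !exprS (chiM (chiP gM)) IHn.
  by rewrite (chiN1 (chiP gM)) -exprM mulnC rmorphXn rmorphN1.
rewrite !intrM; move: (epsilon R p) (epsilon R M) => a b; ring.
Qed.

End EtaQuotient.

(** * Eisenstein series attached to functions modulo N *)

Section Eisenstein.
Variable R : realType.
Local Notation C := R[i].
Local Open Scope complex_scope.
Variables (N k : nat).
Hypotheses (N0 : (0 < N)%N) (k1 : (1 < k)%N).

Let NC : N%:R != 0 :> C. Proof. by rewrite pnatr_eq0 -lt0n. Qed.
Let NR : 0 < N%:R :> R. Proof. by rewrite ltr0n. Qed.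

Lemma has_sum_int_mod (f : int -> C) l : has_sum f l ->
  has_sum (fun M : int => \sum_(u < N) f (M * N%:Z + u%:Z)) l.
Proof.
move=> H; have NZ : N%:Z != 0 by rewrite eqz_nat -lt0n.
pose h (x : int * 'I_N) : int := x.1 * N%:Z + (x.2 : nat)%:Z.
have modN (n : int) : (`|(n %% N%:Z)%Z| < N)%N by have := ltz_mod n NZ; have := modz_ge0 n NZ; lia.
pose g (n : int) : int * 'I_N := ((n %/ N%:Z)%Z, Ordinal (modN n)).
have hg : cancel h g.
  move=> [M u]; rewrite /g /h /=; congr (_, _).
    by rewrite divzMDl // divz_small ?addr0 //= ltz_nat ltn_ord.
  by apply: val_inj; rewrite /= modzMDl modz_small //= ltz_nat ltn_ord.
have gh : cancel g h.
  by move=> n; rewrite /g /h /= gez0_abs ?modz_ge0 // -divz_eq.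
apply: (has_sum_pair (has_sum_reindex hg gh H)) => M /=.
have := @has_sum_fin _ _ (fun u : 'I_N => f (h (M, u))) (index_enum 'I_N) (index_enum_uniq _).
by apply=> u; rewrite mem_index_enum.
Qed.

Definition periodic (f : int -> C) := forall n a : int, f (n + a * N%:Z) = f n.

Lemma psum_shift f a : periodic f -> \sum_(v < N) f (v%:Z + a) = \sum_(v < N) f v%:Z.
Proof.
move=> pf.
have nn (b : nat) : \sum_(v < N) f (v%:Z + b%:Z) = \sum_(v < N) f v%:Z.
  elim: b => [|b <-]; first by apply: eq_bigr => v _; rewrite addr0.
  pose g (n : nat) := f (n%:Z + b%:Z).
  have -> : \sum_(v < N) f (v%:Z + b.+1%:Z) = \sum_(v < N) g v.+1.
    by apply: eq_bigr => v _; rewrite /g; congr f; lia.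
  have -> : \sum_(v < N) f (v%:Z + b%:Z) = \sum_(v < N) g v by [].
  have gN : g N = g 0%N by rewrite /g -[RHS](pf _ 1); congr f; lia.
  apply/eqP; rewrite -subr_eq0 -sumrB -(big_mkord xpredT (fun v => g v.+1 - g v)).
  by rewrite telescope_sumr // gN subrr.
have -> : \sum_(v < N) f (v%:Z + a) = \sum_(v < N) f (v%:Z + `|(a + `|a|%N%:Z * N%:Z)%R|%N%:Z).
  apply: eq_bigr => v _; rewrite -(pf _ `|a|%N%:Z); congr f.
  have h1 : (`|a| <= `|a| * N)%N by rewrite leq_pmulr.
  have h2 : `|a|%N%:Z * N%:Z = (`|a| * N)%N%:Z by [].
  have h3 : 0 <= a + `|a|%N%:Z * N%:Z by rewrite h2; lia.
  by rewrite (gez0_abs h3) addrA.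
exact: nn.
Qed.

Lemma psum_neg f : periodic f -> \sum_(v < N) f (- v%:Z) = \sum_(v < N) f v%:Z.
Proof.
move=> pf; rewrite (reindex_inj rev_ord_inj) /= -[RHS](psum_shift 1 pf); apply: eq_bigr => v _.
by rewrite -(pf _ 1); congr f; have := ltn_ord v; lia.
Qed.

(** The conditions stable under S and T. The parity condition identifies the rows m and -m, and the
    vanishing mean provides the extra decay needed in weight 2. *)
Record adm (Phi : int -> int -> C) : Prop := Adm {
  adm_per1 : forall m n a, Phi (m + a * N%:Z) n = Phi m n;
  adm_per2 : forall m n a, Phi m (n + a * N%:Z) = Phi m n;
  adm_le : forall m n, nm (Phi m n) <= 1;
  adm_neg : forall m n, Phi (- m) (- n) = (-1) ^+ k * Phi m n;
  adm_sum : \sum_(u < N) \sum_(v < N) Phi u v = 0 }.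

(** For k > 0 the term at the origin is 0, as the inverse of 0, so no index is excluded from the
    lattice. *)
Definition ef (Phi : int -> int -> C) (z : C) (m n : int) : C :=
  Phi m n * (m%:~R * z + n%:~R) ^- k.
Definition erow Phi z (m : int) : C := tsum (ef Phi z m).
Definition eis Phi z : C := tsum (erow Phi z).

Lemma lattice_pow_le (z : C) : 0 < complex.Im z -> exists2 E : R, 0 <= E &
  forall m n : int, nm ((m%:~R * z + n%:~R) ^- k) <= E * ((`|m|%N + `|n|%N).+1%:R ^+ 2)^-1.
Proof.
move=> z0; have [c c0 Hc] := lattice_ge z0.
exists (4 * c ^- k); first by rewrite mulr_ge0 // invr_ge0 exprn_ge0 // ltW.
move=> m n; pose s := (`|m| + `|n|)%N; rewrite -/s.
have c' : 0 <= c ^- k by rewrite invr_ge0 exprn_ge0 // ltW.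
have [s0|s0] := posnP s.
  have [-> ->] : m = 0 /\ n = 0 by split; move: s0; rewrite /s; lia.
  rewrite mul0r add0r expr0n gtn_eqF ?(ltnW k1) // invr0 nm0 mulr_ge0 ?mulr_ge0 // invr_ge0 exprn_ge0 //.
have sR : 1 <= s%:R :> R by rewrite ler1n.
have h := Hc m n; have sE : `|m|%:~R + `|n|%:~R = s%:R :> R.
  by rewrite /s natrD !natr_absz.
rewrite sE in h; have sp : 0 < s%:R :> R by lra.
have cs : 0 < c * s%:R by rewrite mulr_gt0.
rewrite nmV nmX; apply: (@le_trans _ _ ((c * s%:R) ^- k)).
  rewrite lef_pV2 ?posrE ?exprn_gt0 // ?(lt_le_trans cs h) //.
  by apply: lerXn2r; rewrite ?nnegrE ?nm_ge0 ?(ltW cs).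
rewrite exprMn invfM (mulrC 4) -mulrA ler_wpM2l //.
apply: (@le_trans _ _ (s%:R ^- 2)).
  rewrite lef_pV2 ?posrE ?exprn_gt0 //; exact: ler_weXn2l.
have -> : 4 * (s.+1%:R ^+ 2)^-1 = (s.+1%:R ^+ 2 / 4)^-1 :> R by rewrite invf_div mulrC.
rewrite lef_pV2 ?posrE ?divr_gt0 ?exprn_gt0 // ler_pdivrMr // -natr1.
by nra.
Qed.

Lemma ef_row_asum Phi (z : C) m : adm Phi -> 0 < complex.Im z -> asum (ef Phi z m).
Proof.
move=> aP z0; have [E E0 HE] := lattice_pow_le z0.
apply: le_bsum (bsumZ E0 (w32_int_bsum R)) => n; rewrite /ef nmM.
apply: le_trans (ler_wpM2r (nm_ge0 _) (adm_le aP m n)) _; rewrite mul1r.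
apply: le_trans (HE m n) _; rewrite ler_wpM2l //; apply: le_trans (w32_sqr R `|n|%N).
by rewrite lef_pV2 ?posrE ?exprn_gt0 // ler_pXn2r ?nnegrE // ler_nat ltnS leq_addl.
Qed.

Lemma erowP Phi (z : C) m : adm Phi -> 0 < complex.Im z -> has_sum (ef Phi z m) (erow Phi z m).
Proof. by move=> aP z0; apply: tsumP; exact: ef_row_asum. Qed.

Lemma erow_neg Phi (z : C) m : adm Phi -> 0 < complex.Im z -> erow Phi z (- m) = erow Phi z m.
Proof.
move=> aP z0; apply: tsumE.
have := has_sum_reindex (@opprK int) (@opprK int) (erowP m aP z0); apply: eq_has_sum => n /=.
have e := adm_neg aP m (- n); rewrite opprK in e.
rewrite /ef e.
have -> : (- m)%:~R * z + n%:~R = - (m%:~R * z + (- n)%:~R) :> C by rewrite !intrN; ring.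
rewrite [(- (_ + _)) ^+ k]exprNn invfM; have := signr_eq0 C k; move: ((-1) ^+ k : C) => u /negbT u0.
by rewrite mulrACA divff // mul1r.
Qed.

(** The Lipschitz formula on each residue class of n modulo N. *)
Lemma erow_pos Phi (z : C) (m : nat) : adm Phi -> 0 < complex.Im z -> (0 < m)%N ->
  erow Phi z m = N%:R ^- k * lipc R k * \sum_(v < N) Phi m v * Tser k.-1 (ee ((m%:R * z + v%:R) / N%:R)).
Proof.
move=> aP z0 m0; have H := has_sum_int_mod (erowP m aP z0).
apply: has_sum_unique H _; rewrite mulr_sumr.
pose t (v : 'I_N) := (m%:R * z + (v : nat)%:R) / N%:R.
have t0 v : 0 < complex.Im (t v).
  rewrite /t (natC R N); apply: Im_gt0_div; rewrite ?NR // Im_add_nat; exact: Im_natM.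
have h := has_sum_sum (index_enum 'I_N) (P := xpredT)
  (fun v _ => has_sumZ (N%:R ^- k * Phi m v) (lipschitz_formula k1 (t0 v))).
have -> : \sum_(i < N) N%:R ^- k * lipc R k * (Phi m i * Tser k.-1 (ee ((m%:R * z + i%:R) / N%:R))) =
   \sum_(v < N) N%:R ^- k * Phi m v * (lipc R k * Tser k.-1 (ee (t v))).
  by apply: eq_bigr => v _; rewrite /t; ring.
apply: eq_has_sum h => L; apply: eq_bigr => v _.
rewrite /ef.
have -> : Phi m (L * N%:Z + v%:Z) = Phi m v by rewrite addrC (adm_per2 aP).
rewrite mulrAC mulrC; congr (_ * _).
rewrite -invfM -exprMn; congr (_ ^-1); congr (_ ^+ k).
by rewrite /t intrD intrM -[N%:~R]/(N%:R) -[v%:~R]/(v%:R) -[m%:~R]/(m%:R); field.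
Qed.

Lemma Tser_le j (r : R) : (0 < j)%N -> 0 < r < 1 -> exists2 K : R, 0 <= K &
  forall q : C, nm q <= r -> nm (Tser j q) <= K * nm q.
Proof.
move=> j0 /andP[r0 r1]; have hr : 0 <= r < 1 by rewrite (ltW r0).
have [M HM] := bsum_pow j hr.
have M0 : 0 <= M by have := HM [::] isT; rewrite big_nil.
exists (M / r); first by rewrite divr_ge0 // ltW.
move=> q qr; have q1 : nm q < 1 by apply: le_lt_trans r1.
apply: (has_sum_nm_le (g := fun t => nm q / r * (t%:R ^+ j * r ^+ t)) (TserP j q1)).
  move=> [|t]; first by rewrite !expr0n gtn_eqF // mul0r nm0 mul0r mulr0.
  have -> : nm q / r * (t.+1%:R ^+ j * r ^+ t.+1) = t.+1%:R ^+ j * (nm q * r ^+ t).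
    by rewrite [r ^+ t.+1]exprS; move: (r ^+ t) (_ ^+ j) => X Y; field; rewrite gt_eqF.
  rewrite nmM !nmX nm_nat ler_wpM2l ?exprn_ge0 // exprS ler_wpM2l ?nm_ge0 //.
  by apply: lerXn2r; rewrite ?nnegrE ?nm_ge0 // ltW.
move=> B uB; rewrite -mulr_sumr (_ : M / r * nm q = nm q / r * M); last by ring.
by rewrite ler_wpM2l ?divr_ge0 ?nm_ge0 ?(ltW r0) // HM.
Qed.

Lemma erow_le Phi (Y : R) : adm Phi -> 0 < Y -> exists2 K : R, 0 <= K &
  forall (z : C) (m : nat), Y <= complex.Im z -> (0 < m)%N ->
    nm (erow Phi z m) <= K * nm (ee (z / N%:R)) ^+ m.
Proof.
move=> aP Y0; pose r := expR (- (2 * pi * (Y / N%:R))).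
have r0 : 0 < r by exact: expR_gt0.
have r1 : r < 1 by rewrite expR_lt1 oppr_lt0 !mulr_gt0 ?pi_gt0 ?invr_gt0.
have kp : (0 < k.-1)%N by case: (k) k1 => [|[]].
have [K K0 HK] := Tser_le kp (introT andP (conj r0 r1)).
exists (nm (N%:R ^- k * lipc R k) * (N%:R * K)); first by rewrite !mulr_ge0 ?nm_ge0 // ltW.
move=> z m Yz m0; have z0 : 0 < complex.Im z by apply: lt_le_trans Yz.
rewrite erow_pos // nmM -[leRHS]mulrA ler_wpM2l ?nm_ge0 //.
apply: le_trans (nm_sum _ _ _) _.
have -> : N%:R * K * nm (ee (z / N%:R)) ^+ m = \sum_(v < N) K * nm (ee (z / N%:R)) ^+ m.
  by rewrite sumr_const card_ord -[RHS]mulr_natl mulrA.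
apply: ler_sum => v _; rewrite nmM.
have eE : nm (ee ((m%:R * z + v%:R) / N%:R)) = nm (ee (z / N%:R)) ^+ m.
  rewrite -nmX -qvarMn !nm_qvar; congr (expR (- (_ * _))).
  rewrite [X in complex.Im X]mulrC (natC R N) invC ImZ Im_add_nat (natC R m) ImZ.
  by rewrite [in RHS]mulrC ImZ (mulrC z) ImZ mulrCA.
have rz : nm (ee (z / N%:R)) <= r.
  rewrite nm_qvar ler_expR lerN2 ler_wpM2l ?mulr_ge0 ?pi_ge0 //.
  by rewrite (natC R N) invC (mulrC z) ImZ (mulrC Y) ler_wpM2l // invr_ge0 ltW.
have h := HK (ee ((m%:R * z + v%:R) / N%:R)); rewrite eE in h.
apply: le_trans (ler_wpM2r (nm_ge0 _) (adm_le aP _ _)) _; rewrite mul1r h //.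
case: (m) m0 => // m' _; rewrite exprS.
have e1 : nm (ee (z / N%:R)) <= 1 by rewrite (le_trans rz) // ltW.
by apply: le_trans rz; rewrite ler_piMr ?nm_ge0 // exprn_ile1 ?nm_ge0.
Qed.

Lemma ee_div_lt1 (z : C) : 0 < complex.Im z -> 0 <= nm (ee (z / N%:R)) < 1.
Proof.
by move=> z0; rewrite nm_ge0 nm_qvar_lt1 // (natC R N); apply: Im_gt0_div.
Qed.

Lemma erow_abs Phi (z : C) m : adm Phi -> 0 < complex.Im z -> erow Phi z m = erow Phi z `|m|%N.
Proof.
move=> aP z0; have [h|h] : m = `|m|%N%:Z \/ m = - `|m|%N%:Z by lia.
  by rewrite {1}h.
transitivity (erow Phi z (- `|m|%N%:Z)); last exact: erow_neg.
by rewrite {1}h.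
Qed.

Lemma erow_asum Phi (z : C) : adm Phi -> 0 < complex.Im z -> asum (erow Phi z).
Proof.
move=> aP z0; have [K K0 HK] := erow_le aP z0.
have hr := ee_div_lt1 z0; pose r := nm (ee (z / N%:R)).
pose A := K + nm (erow Phi z 0); have A0 : 0 <= A by rewrite addr_ge0 ?nm_ge0.
have bs : bsum (fun n : nat => A * r ^+ n).
  by apply: bsumZ => //; apply: le_bsum (bsum_pow 0 hr) => n; rewrite expr0 mul1r.
apply: (bsum_int (h := fun n => A * r ^+ n)) bs => [n|m].
  by rewrite mulr_ge0 // exprn_ge0 // nm_ge0.
rewrite (erow_abs m aP z0); have [->|m0] := posnP `|m|%N; first by rewrite expr0 mulr1 lerDr.
by apply: le_trans (HK z _ (lexx _) m0) _; rewrite ler_wpM2r ?exprn_ge0 ?nm_ge0 // lerDl nm_ge0.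
Qed.

Lemma eisP Phi (z : C) : adm Phi -> 0 < complex.Im z -> has_sum (erow Phi z) (eis Phi z).
Proof. by move=> aP z0; apply: tsumP; exact: erow_asum. Qed.

Definition econst (Phi : int -> int -> C) : C := tsum (fun n : int => Phi 0 n * n%:~R ^- k).

Lemma erow0 Phi (z : C) : erow Phi z 0 = econst Phi.
Proof. by apply: eq_tsum => n; rewrite /ef mul0r add0r. Qed.

Lemma eis_split Phi (z : C) : adm Phi -> 0 < complex.Im z ->
  exists2 a : C, has_sum (fun m : nat => erow Phi z m.+1) a & eis Phi z = econst Phi + 2 * a.
Proof.
move=> aP z0; have H := eisP aP z0.
have as1 := erow_asum aP z0.
have inj1 : injective (fun m : nat => m.+1%:Z) by move=> m n [].
have [a Ha] := asum_has_sum (bsum_inj inj1 as1).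
exists a => //; apply: has_sum_unique H _.
have -> : econst Phi + 2 * a = erow Phi z 0 + a + a by rewrite erow0; ring.
apply: has_sum_int; first exact: Ha.
have e (m : nat) : erow Phi z m.+1 = erow Phi z (- m.+1%:Z) := esym (erow_neg m.+1 aP z0).
exact: eq_has_sum e Ha.
Qed.

Lemma clim_eis Phi : adm Phi -> clim (ioo (R := R)) (eis Phi) (econst Phi).
Proof.
move=> aP; have [K K0 HK] := erow_le aP ltr01.
pose r := nm (ee ('i / N%:R : C)).
have i0 : 0 < complex.Im ('i : C) by rewrite cIm_i.
have hr : 0 <= r < 1 := ee_div_lt1 i0.
have [M M0 HM] := pow_sum_le hr.
apply: (@clim_squeeze _ _ _ _ _ _ (fun z => 2 * K * M * nm (ee (z / N%:R)))).
  apply: (near_ioo (A := 1)) => z z0 z1; have [a Ha ->] := eis_split aP z0.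
  rewrite addrC addKr nmM (nm_nat R 2) -!mulrA ler_wpM2l //.
  have rz : nm (ee (z / N%:R)) <= r.
    rewrite /r !nm_qvar ler_expR lerN2 ler_wpM2l ?mulr_ge0 ?pi_ge0 //.
    by rewrite (natC R N) invC !(mulrC _ (N%:R^-1)%:C) !ImZ ler_wpM2l ?invr_ge0 ?(ltW NR) // cIm_i ltW.
  apply: (has_sum_nm_le (g := fun m : nat => K * (nm (ee (z / N%:R)) * r ^+ m)) Ha).
    move=> m; apply: le_trans (HK z m.+1 (ltW z1) isT) _; rewrite ler_wpM2l // exprS.
    rewrite ler_wpM2l ?nm_ge0 //; apply: lerXn2r; rewrite ?nnegrE ?nm_ge0 //.
  move=> B uB; rewrite -mulr_sumr ler_wpM2l // -mulr_sumr mulrC ler_wpM2r ?nm_ge0 //.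
  pose L := (\max_(i <- B) i).+1.
  apply: le_trans (HM 0%N L); apply: sub_sum_le => // [i|i iB]; first by rewrite exprn_ge0 // nm_ge0.
  by rewrite mem_index_iota /L ltnS (leq_bigmax_seq (F := id)).
move=> e e0; have cM : 0 <= 2 * K * M by rewrite !mulr_ge0.
have e1 : 0 < e / (2 * K * M + 1) by rewrite divr_gt0 // ltr_wpDl.
have cN : 0 < N%:R^-1 :> R by rewrite invr_gt0.
have hI (z : C) : 0 < complex.Im z -> N%:R^-1 * complex.Im z <= complex.Im (z / N%:R).
  by move=> z0; rewrite (natC R N) invC (mulrC z) ImZ.
have := clim_ee_ioo cN hI e1; apply: filterS => z; rewrite subr0 ltr_pdivlMr ?ltr_wpDl //.
have := nm_ge0 (ee (z / N%:R)); move: (2 * K * M) cM => X X0; nra.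
Qed.

(** Evaluation of Phi at the row vector (m, n) times the inverse of g, so that the slash of the
    Eisenstein series of Phi is the series of [act g Phi]. *)
Definition act (g : mat2) (Phi : int -> int -> C) (m n : int) : C :=
  Phi (m * md g - n * mc g) (n * ma g - m * mb g).

Lemma act_mul g h Phi : act (mul2 g h) Phi = act h (act g Phi).
Proof. by apply/funext => m; apply/funext => n; rewrite /act /=; congr Phi; ring. Qed.

Lemma act_one Phi : act one2 Phi = Phi.
Proof. by apply/funext => m; apply/funext => n; rewrite /act /=; congr Phi; ring. Qed.

Lemma adm_T a Phi : adm Phi -> adm (act (T2 a) Phi).
Proof.
move=> aP; split=> [m n b|m n b|m n|m n|].
- rewrite /act /= -[RHS](adm_per1 aP _ _ b) -[RHS](adm_per2 aP _ _ (- (b * a))); congr Phi; ring.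
- by rewrite /act /= -[RHS](adm_per2 aP _ _ b); congr Phi; ring.
- by rewrite /act; exact: adm_le.
- by rewrite /act /= -(adm_neg aP); congr Phi; ring.
rewrite -[RHS](adm_sum aP); apply: eq_bigr => u _.
have pf : periodic (fun v => Phi u v) by move=> n b; exact: adm_per2.
rewrite -[RHS](psum_shift (- (u%:Z * a)) pf); apply: eq_bigr => v _.
by rewrite /act /=; congr Phi; ring.
Qed.

Lemma act_S Phi m n : act S2 Phi m n = Phi (- n) m.
Proof. by rewrite /act /=; congr Phi; ring. Qed.

Lemma adm_S Phi : adm Phi -> adm (act S2 Phi).
Proof.
move=> aP; split=> [m n b|m n b|m n|m n|]; rewrite ?act_S.
- exact: adm_per2.
- by rewrite -[RHS](adm_per1 aP _ _ (- b)); congr Phi; ring.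
- exact: adm_le.
- by rewrite (adm_neg aP).
under eq_bigr => u _ do under eq_bigr => v _ do rewrite act_S.
rewrite -[RHS](adm_sum aP) exchange_big /=.
rewrite [RHS]exchange_big /= exchange_big /=; apply: eq_bigr => u _.
have pf : periodic (fun v => Phi v u) by move=> n b; exact: adm_per1.
exact: (psum_neg pf).
Qed.

Lemma eis_T a Phi (z : C) : adm Phi -> 0 < complex.Im z -> eis Phi (z + a%:~R) = eis (act (T2 a) Phi) z.
Proof.
move=> aP z0; have z1 : 0 < complex.Im (z + a%:~R) by rewrite Im_add_int.
apply: eq_tsum => m; apply: tsumE.
have := has_sum_reindex (fun n => addrK (m * a) n) (fun n => subrK (m * a) n) (erowP m (adm_T a aP) z0).
apply: eq_has_sum => n /=; rewrite /ef /act /=; congr (_ * _^-1); first by congr Phi; ring.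
by congr (_ ^+ k); rewrite intrD intrM; ring.
Qed.

(** Factoring the difference of k-th powers gains one order of decay; since k >= 2 and |y| >= 1, the
    third power may be kept in every weight. *)
Lemma inv_pow_sub_le (x y : C) : 1 <= nm y -> nm (x - y) <= nm y / 2 ->
  nm (x ^- k - y ^- k) <= k%:R * 2 ^+ k.+1 * nm (x - y) * nm y ^- 3.
Proof.
move=> y1 xy; have yp : 0 < nm y by lra.
have xy' : nm y / 2 <= nm x.
  by have := nmB x (x - y); rewrite opprB addrC subrK; lra.
have xp : 0 < nm x by lra.
have x0 : x != 0 by rewrite -nm_gt0.
have y0 : y != 0 by rewrite -nm_gt0.
pose X := x^-1; pose Y := y^-1.
have Yv : nm Y = (nm y)^-1 by rewrite nmV.
have Y1 : nm Y <= 1 by rewrite Yv invf_le1.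
have Y0 := nm_ge0 Y.
have XY : nm X <= 2 * nm Y.
  rewrite /X nmV Yv -[2]invrK -invfM lef_pV2 ?posrE //; last by rewrite mulr_gt0.
  by rewrite mulrC.
have dXY : nm (X - Y) <= 2 * nm (x - y) * nm Y ^+ 2.
  have -> : X - Y = - (x - y) * X * Y by rewrite /X /Y; field; rewrite x0 y0.
  rewrite !nmM nmN expr2 !mulrA ler_wpM2r // -!mulrA (mulrCA 2) ler_wpM2l ?nm_ge0 //.
rewrite -!exprVn -/X -/Y subrXX nmM.
have S : nm (\sum_(i < k) X ^+ (k.-1 - i) * Y ^+ i) <= k%:R * (2 ^+ k * nm Y).
  apply: le_trans (nm_sum _ _ _) _.
  have -> : k%:R * (2 ^+ k * nm Y) = \sum_(i < k) 2 ^+ k * nm Y.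
    by rewrite sumr_const card_ord -[RHS]mulr_natl.
  apply: ler_sum => i _; rewrite nmM !nmX.
  have ik := ltn_ord i.
  apply: (@le_trans _ _ (2 ^+ k * nm Y ^+ (k.-1 - i) * nm Y ^+ i)).
    rewrite ler_wpM2r ?exprn_ge0 //.
    apply: (@le_trans _ _ ((2 * nm Y) ^+ (k.-1 - i))).
      by apply: lerXn2r; rewrite ?nnegrE ?nm_ge0 ?mulr_ge0.
    rewrite exprMn ler_wpM2r ?exprn_ge0 //; apply: ler_weXn2l; first by rewrite ler1n.
    by apply: leq_trans (leq_subr _ _) (leq_pred _).
  rewrite -mulrA ler_wpM2l ?exprn_ge0 // -exprD.
  rewrite -[leRHS]expr1; apply: ler_wiXn2l => //.
  by rewrite subnK; [case: (k) k1 => [|[]]|rewrite -ltnS prednK // (ltn_trans _ k1)].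
apply: le_trans (ler_pM _ _ dXY S) _; rewrite ?nm_ge0 //.
rewrite [2 ^+ k.+1]exprS -?exprVn -Yv.
by move: (nm Y) (nm (x - y)) (2 ^+ k : R) (k%:R : R) => a b c d; rewrite le_eqVlt; apply/orP; left; apply/eqP; ring.
Qed.

(* The lattice is cut into N x N blocks; since Phi has mean zero the blocks decay one power
   faster, so the double series converges absolutely even in weight 2. *)
Definition eblock Phi (z : C) (M L : int) : C :=
  \sum_(u < N) \sum_(v < N) ef Phi z (M * N%:Z + u%:Z) (L * N%:Z + v%:Z).

Lemma eblock_asum Phi (z : C) : adm Phi -> 0 < complex.Im z ->
  asum (fun x : int * int => eblock Phi z x.1 x.2).
Proof.
move=> aP z0; have [c c0 Hc] := lattice_ge z0; have [E E0 HE] := lattice_pow_le z0.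
pose W := N%:R * (nm z + 1); have W0 : 0 <= W by rewrite mulr_ge0 ?addr_ge0 ?nm_ge0.
pose T := (2 * W + 1) / c + 1.
have T0 : 0 <= T by rewrite addr_ge0 // divr_ge0 ?(ltW c0) // addr_ge0 // mulr_ge0.
pose Kk : R := k%:R * 2 ^+ k.+1.
have Kk0 : 0 <= Kk by rewrite mulr_ge0 // exprn_ge0.
pose K := N%:R * (N%:R * (Kk * W * (8 * c ^- 3) + E * T ^+ 3)).
have c3 : 0 <= c ^- 3 by rewrite invr_ge0 exprn_ge0 // ltW.
have K1 : 0 <= Kk * W * (8 * c ^- 3) by apply: mulr_ge0; apply: mulr_ge0.
have K2 : 0 <= E * T ^+ 3 by rewrite mulr_ge0 // exprn_ge0.
have K0 : 0 <= K by rewrite !mulr_ge0 // addr_ge0.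
have bs := bsumZ K0 (bsum_prod (fun n => ltW (w32_gt0 R _)) (fun n => ltW (w32_gt0 R _)) (w32_int_bsum R) (w32_int_bsum R)).
apply: le_bsum bs => -[M L] /=.
apply: (@le_trans _ _ (K * ((`|M|%N + `|L|%N).+1%:R ^+ 3)^-1)); last first.
  by rewrite ler_wpM2l //; have := w32_cube R `|M|%N `|L|%N; rewrite -natrD natr1.
pose s := (`|M| + `|L|)%N; rewrite -/s.
have sE : `|M|%:~R + `|L|%:~R = s%:R :> R by rewrite /s natrD !natr_absz.
pose lam : C := N%:R * (M%:~R * z + L%:~R).
have hlam : c * s%:R <= nm lam.
  rewrite /lam nmM nm_nat -sE; apply: le_trans (Hc M L) _.
  by rewrite ler_peMl ?nm_ge0 // ler1n.
pose wuv (u v : 'I_N) : C := (u : nat)%:R * z + (v : nat)%:R.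
have hw u v : nm (wuv u v) <= W.
  apply: le_trans (nmD _ _) _; rewrite nmM !nm_nat /W mulrDr mulr1; apply: lerD.
    by rewrite ler_wpM2r ?nm_ge0 // ler_nat ltnW.
  by rewrite ler_nat ltnW.
have efE (u v : 'I_N) : ef Phi z (M * N%:Z + u%:Z) (L * N%:Z + v%:Z) = Phi u v * (lam + wuv u v) ^- k.
  rewrite /ef [M * _ + _]addrC [L * _ + _]addrC (adm_per1 aP) (adm_per2 aP); congr (_ * (_ ^+ k)^-1).
  rewrite /lam /wuv !intrD !intrM -[N%:~R]/(N%:R) -[u%:~R]/(u%:R) -[v%:~R]/(v%:R); ring.
have cst (x : R) : N%:R * (N%:R * x) = \sum_(u < N) \sum_(v < N) x.
  have c1 (y : R) : \sum_(u < N) y = N%:R * y by rewrite sumr_const card_ord mulr_natl.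
  by rewrite (c1 (\sum_(v < N) x)) c1.
have s1 : 0 < s.+1%:R :> R by [].
have KE : K * (s.+1%:R ^+ 3)^-1 = \sum_(u < N) \sum_(v < N) (Kk * W * (8 * c ^- 3) + E * T ^+ 3) * (s.+1%:R ^+ 3)^-1.
  by rewrite -cst /K !mulrA.
have s3 : 0 <= (s.+1%:R ^+ 3)^-1 :> R by rewrite invr_ge0 exprn_ge0.
(* In a block far from the origin the mean zero of Phi allows the value at its corner to be
   subtracted; for the remaining blocks s + 1 is at most T, and a crude bound suffices. *)
rewrite KE; have [big|small] := lerP (2 * W + 1) (c * s%:R).
  have l1 : 1 <= nm lam by lra.
  have -> : eblock Phi z M L = \sum_(u < N) \sum_(v < N) Phi u v * ((lam + wuv u v) ^- k - lam ^- k).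
    have -> : eblock Phi z M L = \sum_(u < N) \sum_(v < N) Phi u v * (lam + wuv u v) ^- k.
      by apply: eq_bigr => u _; apply: eq_bigr => v _; exact: efE.
    have -> : \sum_(u < N) \sum_(v < N) Phi u v * ((lam + wuv u v) ^- k - lam ^- k) =
       \sum_(u < N) \sum_(v < N) Phi u v * (lam + wuv u v) ^- k - (\sum_(u < N) \sum_(v < N) Phi u v) * lam ^- k.
      rewrite mulr_suml -sumrB; apply: eq_bigr => u _; rewrite mulr_suml -sumrB; apply: eq_bigr => v _.
      by rewrite mulrBr.
    by rewrite (adm_sum aP) mul0r subr0.
  apply: le_trans (nm_sum _ _ _) _; apply: ler_sum => u _.
  apply: le_trans (nm_sum _ _ _) _; apply: ler_sum => v _.
  rewrite nmM; apply: le_trans (ler_wpM2r (nm_ge0 _) (adm_le aP _ _)) _; rewrite mul1r.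
  have dw : lam + wuv u v - lam = wuv u v by rewrite addrC addKr.
  have := @inv_pow_sub_le (lam + wuv u v) lam l1; rewrite dw => h.
  have hw' := hw u v; apply: le_trans (h _) _; first by lra.
  rewrite -/Kk mulrDl; apply: (@le_trans _ _ (Kk * W * (8 * c ^- 3) * (s.+1%:R ^+ 3)^-1)); last first.
    by rewrite lerDl mulr_ge0.
  rewrite -[leRHS]mulrA; apply: ler_pM; rewrite ?mulr_ge0 ?nm_ge0 ?invr_ge0 ?exprn_ge0 ?nm_ge0 //.
    by rewrite ler_wpM2l.
  have sp : 1 <= s%:R :> R.
    rewrite ler1n lt0n; apply: contraTneq big => ->; rewrite mulr0 -ltNge; lra.
  have cs : 0 < c * s%:R by rewrite mulr_gt0 //; lra.
  apply: (@le_trans _ _ ((c * s%:R) ^- 3)).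
    rewrite lef_pV2 ?posrE ?exprn_gt0 //; last by lra.
    by apply: lerXn2r; rewrite ?nnegrE ?nm_ge0 ?(ltW cs).
  have -> : 8 * c ^- 3 * (s.+1%:R ^+ 3)^-1 = ((c * (s.+1%:R / 2)) ^+ 3)^-1.
    by move: (s.+1%:R : R) s1 => X X0; field; rewrite !gt_eqF.
  have h2 : s.+1%:R / 2 <= s%:R :> R by rewrite -natr1; lra.
  have sp0 : 0 < s%:R :> R by lra.
  rewrite lef_pV2 ?posrE ?exprn_gt0 ?mulr_gt0 ?divr_gt0 //.
  apply: lerXn2r; rewrite ?nnegrE ?(ltW cs) ?mulr_ge0 ?divr_ge0 ?(ltW c0) //.
  by rewrite ler_wpM2l // ltW.
apply: le_trans (nm_sum _ _ _) _; apply: ler_sum => u _.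
apply: le_trans (nm_sum _ _ _) _; apply: ler_sum => v _.
rewrite /ef nmM; apply: le_trans (ler_wpM2r (nm_ge0 _) (adm_le aP _ _)) _; rewrite mul1r.
apply: le_trans (HE _ _) _.
apply: (@le_trans _ _ E).
  rewrite ler_piMr // invf_le1 ?exprn_gt0 // exprn_ege1 // ler1n //.
rewrite mulrDl; apply: (@le_trans _ _ (E * T ^+ 3 * (s.+1%:R ^+ 3)^-1)); last first.
  by rewrite lerDr mulr_ge0.
rewrite -mulrA ler_peMr // -exprVn -exprMn exprn_ege1 //.
rewrite ler_pdivlMr // mul1r -natr1 /T lerD2r ler_pdivlMr // mulrC ltW //.
Qed.

(** Summation by rows and summation by columns can both be grouped into N x N blocks, and on blocks
    the interchange is legitimate by absolute convergence. *)
Lemma eis_S Phi (z : C) : adm Phi -> 0 < complex.Im z ->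
  z ^- k * eis Phi (- z^-1) = eis (act S2 Phi) z.
Proof.
move=> aP z0; have zn := Im_gt0_neq0 z0; have aS := adm_S aP; have z1 := oppV_Im z0.
set Psi := act S2 Phi; pose f := ef Psi z.
have rowP (m : int) : has_sum (f m) (erow Psi z m) := erowP m aS z0.
pose col (n : int) := z ^- k * erow Phi (- z^-1) (- n).
have colP n : has_sum (fun m => f m n) (col n).
  have := has_sumZ (z ^- k) (erowP (- n) aP z1); apply: eq_has_sum => m.
  rewrite /f /ef /Psi act_S mulrCA -invfM -exprMn; congr (_ * (_ ^+ k)^-1).
  by rewrite intrN; field.
have colS : has_sum col (z ^- k * eis Phi (- z^-1)).
  apply: has_sumZ; exact: has_sum_reindex (@opprK int) (@opprK int) (eisP aP z1).
have B1 M : has_sum (eblock Psi z M) (\sum_(u < N) erow Psi z (M * N%:Z + u%:Z)).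
  by apply: has_sum_sum => u _; exact: has_sum_int_mod (rowP _).
have B2 L : has_sum (fun M => eblock Psi z M L) (\sum_(v < N) col (L * N%:Z + v%:Z)).
  have h := has_sum_sum (index_enum 'I_N) (P := xpredT)
    (fun v _ => has_sum_int_mod (colP (L * N%:Z + (v : nat)%:Z))).
  by apply: eq_has_sum h => M; rewrite /eblock exchange_big.
have S1 := has_sum_int_mod (eisP aS z0).
have S2' := has_sum_int_mod colS.
exact: has_sum_unique S2' (has_sum_swap (eblock_asum aS z0) B1 B2 S1).
Qed.

Lemma eis_slash Phi : adm Phi -> forall g, sl2 g -> adm (act g Phi) /\
  forall z : C, 0 < complex.Im z -> sl k (eis Phi) g z = eis (act g Phi) z.
Proof.
move=> aP; apply: (sl2_ind (P := fun g => adm (act g Phi) /\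
  forall z : C, 0 < complex.Im z -> sl k (eis Phi) g z = eis (act g Phi) z)).
- by rewrite act_one; split=> // z z0; rewrite /sl j2_one mob2_one expr1n invr1 mul1r.
- move=> g sg [ag IH]; rewrite act_mul; split=> [|z z0]; first exact: adm_T.
  have z1 : 0 < complex.Im (z + 1) by have := Im_add_nat z 1; rewrite mulr1n => ->.
  apply: etrans (sl_mul k (eis Phi) g (sl2_T 1) z0) _.
  apply: etrans (slT _ _ _) _; apply: etrans (IH _ z1) _.
  exact: (eis_T 1 ag z0).
- move=> g sg [ag IH]; rewrite act_mul; split=> [|z z0]; first exact: adm_T.
  have z1 : 0 < complex.Im (z - 1) by have := Im_add_int z (-1); rewrite rmorphN1 => ->.
  apply: etrans (sl_mul k (eis Phi) g (sl2_T (-1)) z0) _.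
  apply: etrans (slT' _ _ _) _; apply: etrans (IH _ z1) _.
  have h := eis_T (-1) ag z0; rewrite rmorphN1 in h; exact: h.
move=> g sg [ag IH]; rewrite act_mul; split=> [|z z0]; first exact: adm_S.
apply: etrans (sl_mul k (eis Phi) g sl2_S z0) _.
apply: etrans (eq_sl k IH sl2_S z0) _; apply: etrans (slS _ _ _) _; exact: eis_S.
Qed.

End Eisenstein.

(** * Generalized Bernoulli numbers *)

Section BernoulliLimit.
Variable R : realType.
Local Notation C := R[i].
Local Open Scope complex_scope.
Local Notation F := (at_right (0 : R)).

Lemma has_sum_shift (f : nat -> C) l (M : nat) : asum f -> has_sum f l ->
  has_sum (fun t => f (t + M)%N) (l - \sum_(t < M) f t).
Proof.
move=> af H; elim: M => [|M IH].
  by rewrite big_ord0 subr0; apply: eq_has_sum H => t; rewrite addn0.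
rewrite big_ord_recr /= opprD addrA.
have := has_sum_succE IH (bsum_inj (@addIn M) af).
by apply: eq_has_sum => t; rewrite addnS addSn.
Qed.

Definition itau (s : R) : C := s%:C * 'i.

Lemma Im_itau s : complex.Im (itau s) = s. Proof. by rewrite /itau ImZ cIm_i mulr1. Qed.

Lemma clim_itau : clim F itau 0.
Proof.
move=> e e0; near=> s.
have s0 : 0 < s by near: s; exact: nbhs_right_gt.
rewrite subr0 /itau nmM nm_real nm_i mulr1 gtr0_norm //.
Unshelve. all: by end_near. Qed.

Lemma le_nm_itau (s : R) (n : int) : `|n|%:~R <= nm (itau s + n%:~R).
Proof.
apply: le_trans (Re_le_nm _); rewrite ReD Re_int /itau ReZ /= mulr0 add0r.
by rewrite intr_norm.
Qed.

Lemma nm_inv_pow_le (x : C) (n : int) w : (1 < w)%N -> n != 0 -> `|n|%:~R <= nm x ->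
  nm (x ^- w) <= nm ((n%:~R : C) ^- 2).
Proof.
move=> w1 n0 nx; rewrite !nmV !nmX nm_int.
have p1 : 1 <= `|n|%:~R :> R by rewrite -[1]/(1%:~R) ler_int; lia.
have x1 : 1 <= nm x by apply: le_trans nx.
rewrite lef_pV2 ?posrE ?exprn_gt0 ?(lt_le_trans ltr01) //.
apply: (@le_trans _ _ (nm x ^+ 2)); first by rewrite lerXn2r ?nnegrE ?(le_trans ler01).
exact: ler_weXn2l.
Qed.

(** * Twisted power series, their limits at q = 1, and L-values *)

Section Char.
Variable N : nat.
Hypotheses (gN : good N) (N1 : (1 < N)%N).

Local Notation cc n := ((chi N n)%:~R : C).
Let N0 : (0 < N)%N := good_gt0 gN.
Let NC : N%:R != 0 :> C. Proof. by rewrite pnatr_eq0 -lt0n. Qed.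

Lemma chi_per (n a : int) : chi N (n + a * N%:Z) = chi N n.
Proof. by apply: (chi_mod (chiP gN)); rewrite addrC modzMDl. Qed.

Lemma nm_chi (n : int) : nm (cc n) <= 1.
Proof. by rewrite nm_int -[1]/(1%:~R) ler_int chi_le1. Qed.

Lemma chi_zero : chi N 0 = 0.
Proof. by rewrite chi0 // gtn_eqF. Qed.

Lemma chi_sum0 : \sum_(a < N) cc a = 0.
Proof.
have h := gsumE R 0 gN; rewrite chi_zero mul0r in h; rewrite -[RHS]h.
by apply: eq_bigr => a _; rewrite ?mul0r ?mulr0z ?mul0r qvar0 mulr1.
Qed.

Lemma gauss_neq0 : gauss R N != 0.
Proof.
rewrite /gauss mulf_neq0 ?kap_neq0 // /epsilon; case: ifP => _; first exact: oner_neq0.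
by rewrite imunitE i_neq0.
Qed.

Definition As (j : nat) (q : C) := tsum (fun t : nat => cc t%:Z * t%:R ^+ j * q ^+ t).

Lemma As_asum j (q : C) : nm q < 1 -> asum (fun t : nat => cc t%:Z * t%:R ^+ j * q ^+ t).
Proof.
move=> q1; apply: le_bsum (asum_pow j q1) => t; rewrite -mulrA nmM.
by rewrite ler_piMl ?nm_ge0 ?nm_chi.
Qed.

Lemma AsP j (q : C) : nm q < 1 -> has_sum (fun t : nat => cc t%:Z * t%:R ^+ j * q ^+ t) (As j q).
Proof. by move=> q1; apply: tsumP; exact: As_asum. Qed.

(** The constant of the Lipschitz formula twisted by [chi N]. *)
Definition Kw w : C := N%:R ^- w * lipc R w * gauss R N.

Lemma Kw_neq0 w : Kw w != 0.
Proof.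
apply: mulf_neq0; last exact: gauss_neq0.
by apply: mulf_neq0; [rewrite invr_eq0 expf_neq0|exact: lipc_neq0].
Qed.

(** The sum over v is a Gauss sum at the exponent u, that is chi(u) times the Gauss sum at 1. *)
Lemma chi_Tser j (t : C) : 0 < complex.Im t ->
  \sum_(v < N) cc v * Tser j (ee ((t + v%:R) / N%:R)) = gauss R N * As j (ee (t / N%:R)).
Proof.
move=> t0.
have tv (v : 'I_N) : 0 < complex.Im ((t + (v : nat)%:R) / N%:R).
  by rewrite (natC R N); apply: Im_gt0_div; rewrite ?ltr0n // Im_add_nat.
have t1 : nm (ee (t / N%:R)) < 1.
  by apply: nm_qvar_lt1; rewrite (natC R N); apply: Im_gt0_div; rewrite ?ltr0n.
apply: has_sum_unique (has_sumZ (gauss R N) (AsP j t1)).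
have h := has_sum_sum (index_enum 'I_N) (P := xpredT)
  (fun v _ => has_sumZ (cc v) (TserP j (nm_qvar_lt1 (tv v)))).
apply: eq_has_sum h => u /=.
have -> : gauss R N * (cc u%:Z * u%:R ^+ j * ee (t / N%:R) ^+ u) =
    gsum R N u%:Z * (u%:R ^+ j * ee (t / N%:R) ^+ u) by rewrite gsumE //; ring.
rewrite /gsum mulr_suml.
apply: eq_bigr => v _; rewrite -!mulrA; congr (_ * _).
rewrite -!qvarMn [RHS]mulrCA -qvarD; congr (_ * ee _).
by rewrite intrM -[u%:~R]/(u%:R) -[v%:~R]/(v%:R); field.
Qed.

Lemma chi_lipschitz w (t : C) : (1 < w)%N -> 0 < complex.Im t ->
  has_sum (fun n : int => cc n * (t + n%:~R) ^- w) (Kw w * As w.-1 (ee (t / N%:R))).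
Proof.
move=> w1 t0.
have af : asum (fun n : int => cc n * (t + n%:~R) ^- w).
  apply: le_bsum (asum_lattice_row w1 t0) => n; rewrite nmM nmV nmX.
  by rewrite ler_piMl ?nm_chi // invr_ge0 exprn_ge0 ?nm_ge0.
have H0 := tsumP af; have H := has_sum_int_mod N0 w1 H0.
suff <- : tsum (fun n : int => cc n * (t + n%:~R) ^- w) = Kw w * As w.-1 (ee (t / N%:R)) by [].
apply: has_sum_unique H _.
rewrite /Kw -[_ * As _ _]mulrA -chi_Tser // mulr_sumr.
have tv (v : 'I_N) : 0 < complex.Im ((t + (v : nat)%:R) / N%:R).
  by rewrite (natC R N); apply: Im_gt0_div; rewrite ?ltr0n // Im_add_nat.
have h := has_sum_sum (index_enum 'I_N) (P := xpredT)
  (fun v _ => has_sumZ (N%:R ^- w * cc v) (lipschitz_formula w1 (tv v))).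
have -> : \sum_(i < N) N%:R ^- w * lipc R w * (cc i * Tser w.-1 (ee ((t + i%:R) / N%:R))) =
   \sum_(v < N) N%:R ^- w * cc v * (lipc R w * Tser w.-1 (ee ((t + v%:R) / N%:R))).
  by apply: eq_bigr => v _; ring.
apply: eq_has_sum h => L; apply: eq_bigr => v _.
rewrite [L * _ + _]addrC chi_per mulrAC mulrC; congr (_ * _).
rewrite -invfM -exprMn; congr (_ ^-1); congr (_ ^+ w).
by rewrite intrD intrM -[N%:~R]/(N%:R) -[v%:~R]/(v%:R); field.
Qed.

(** The sum runs over positive and negative n: it is 2 L(w, chi_N) when the parities of chi_N and w
    agree. *)
Definition Lw w : C := tsum (fun n : int => cc n * (n%:~R) ^- w).

Lemma Lw_le w (x : C) n : (1 < w)%N -> `|n|%:~R <= nm x ->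
  nm (cc n * x ^- w) <= nm ((n%:~R : C) ^- 2).
Proof.
move=> w1 nx; have [->|n0] := eqVneq n 0.
  by rewrite chi_zero mul0r nm0 nm_ge0.
rewrite nmM; apply: le_trans (ler_wpM2r (nm_ge0 _) (nm_chi _)) _; rewrite mul1r.
exact: nm_inv_pow_le.
Qed.

Lemma LwP w : (1 < w)%N -> has_sum (fun n : int => cc n * (n%:~R) ^- w) (Lw w).
Proof.
move=> w1; apply: tsumP; apply: le_bsum (int_inv2_asum R) => n.
by apply: Lw_le => //; rewrite nm_int.
Qed.

Definition qs s : C := ee (itau s / N%:R).

Lemma near_qs : \forall s \near F, nm (qs s) < 1.
Proof.
near=> s; apply: nm_qvar_lt1; rewrite (natC R N); apply: Im_gt0_div; rewrite ?ltr0n // Im_itau.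
by near: s; exact: nbhs_right_gt.
Unshelve. all: by end_near. Qed.

Lemma clim_qs : clim F qs 1.
Proof.
have h : clim F (fun s => tpi R * (itau s / N%:R)) 0.
  have c1 : clim F (fun=> tpi R) (tpi R) by exact: clim_cst.
  have c2 : clim F (fun=> N%:R^-1 : C) (N%:R^-1) by exact: clim_cst.
  by rewrite -(mulr0 (tpi R)) -(mul0r (N%:R^-1 : C)); apply: climM => //; apply: climM => //; exact: clim_itau.
have h' : clim F (fun s => ce (tpi R * (itau s / N%:R))) (ce 0) by apply: clim_ce.
rewrite cexp0 in h'; apply: eq_near_clim h'.
by near=> s; rewrite /qs qvarE.
Unshelve. all: by end_near. Qed.

(** The twisted Lipschitz formula at i s with s tending to 0. Since |i s + n| >= |n| and chi(0) = 0,
    the series is dominated by the sum of n^-2 uniformly in s. *)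
Lemma clim_As_big j : (0 < j)%N -> clim F (fun s => As j (qs s)) (Lw j.+1 / Kw j.+1).
Proof.
move=> j0; have w1 : (1 < j.+1)%N by [].
have h : clim F (fun s => Kw j.+1 * As j (qs s)) (Lw j.+1).
  apply: (@tannery R R F _ _ (fun s (n : int) => cc n * (itau s + n%:~R) ^- j.+1)
    (fun n : int => cc n * n%:~R ^- j.+1) _ _ _ (int_inv2_asum R)).
  - by near=> s => n; apply: Lw_le => //; exact: le_nm_itau.
  - move=> n; have [->|n0] := eqVneq n 0.
      rewrite chi_zero mul0r.
      have c0 : clim F (fun=> 0 : C) 0 by exact: clim_cst.
      by apply: eq_near_clim c0; near=> s; rewrite mul0r.
    have c1 : clim F (fun=> cc n) (cc n) by exact: clim_cst.
    apply: climM => //.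
    apply: climV; first by rewrite expf_neq0 // intr_eq0.
    apply: climX; have c2 : clim F (fun=> n%:~R : C) n%:~R by exact: clim_cst.
    by rewrite -[n%:~R]add0r; apply: climD => //; rewrite ?add0r //; exact: clim_itau.
  - near=> s; apply: (chi_lipschitz w1); rewrite Im_itau.
    by near: s; exact: nbhs_right_gt.
  - exact: LwP.
have c1 : clim F (fun=> (Kw j.+1)^-1) ((Kw j.+1)^-1) by exact: clim_cst.
have h' : clim F (fun s => Kw j.+1 * As j (qs s) * (Kw j.+1)^-1) (Lw j.+1 / Kw j.+1) by apply: climM.
apply: eq_near_clim h'.
by near=> s; rewrite mulrC mulKf ?Kw_neq0.
Unshelve. all: by end_near. Qed.

Definition Pj j (q : C) : C := \sum_(a < N) cc a * (a : nat)%:R ^+ j * q ^+ a.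

(** The tail from t = N on is the whole series shifted by N; the period of chi and the binomial
    expansion of (t + N)^j express it through lower indices. *)
Lemma As_rec j (q : C) : nm q < 1 ->
  As j q = Pj j q + q ^+ N * \sum_(i < j.+1) 'C(j, i)%:R * N%:R ^+ (j - i) * As i q.
Proof.
move=> q1; have H := has_sum_shift N (As_asum j q1) (AsP j q1).
apply/eqP; rewrite addrC -subr_eq; apply/eqP; apply: has_sum_unique H _.
rewrite mulr_sumr.
have h := has_sum_sum (index_enum 'I_j.+1) (P := xpredT)
  (fun i _ => has_sumZ (q ^+ N * ('C(j, i)%:R * N%:R ^+ (j - i))) (AsP i q1)).
have -> : \sum_(i < j.+1) q ^+ N * ('C(j, i)%:R * N%:R ^+ (j - i) * As i q) =
  \sum_(i < j.+1) q ^+ N * ('C(j, i)%:R * N%:R ^+ (j - i)) * As i q.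
  by apply: eq_bigr => i _; rewrite mulrA.
apply: eq_has_sum h => t /=.
have -> : chi N (t + N)%N%:Z = chi N t%:Z by rewrite PoszD -[N%:Z]mul1r chi_per.
rewrite exprD natrD [_ + N%:R]addrC exprDn mulr_sumr mulr_suml; apply: eq_bigr => i _.
rewrite -mulr_natl; move: (q ^+ N) (q ^+ t) (N%:R ^+ (j - i) : C) (t%:R ^+ i : C) => a b c d; ring.
Qed.

(* The limit of sum chi(t) t^j q^t as q tends to 1; in weight 1 (j = 0) the Lipschitz formula
   is not available and the value is forced by the recursion for j = 1. *)
Definition el j : C := if j is i.+1 then Lw j.+1 / Kw j.+1 else - Pj 1 1 / N%:R.

Lemma clim_Pj j : clim F (fun s => Pj j (qs s)) (Pj j 1).
Proof.
apply: clim_sum => a _.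
have c1 : clim F (fun=> cc a * (a : nat)%:R ^+ j) (cc a * (a : nat)%:R ^+ j) by exact: clim_cst.
by apply: climM => //; apply: climX; exact: clim_qs.
Qed.

Lemma clim_As j : clim F (fun s => As j (qs s)) (el j).
Proof.
case: j => [|j]; last exact: clim_As_big.
have cN : clim F (fun s => qs s ^+ N) (1 ^+ N) by apply: climX; exact: clim_qs.
rewrite expr1n in cN.
have c1 : clim F (fun=> 1 : C) 1 by exact: clim_cst.
have cNn : clim F (fun=> N%:R^-1 : C) N%:R^-1 by exact: clim_cst.
have cA := clim_As_big (isT : (0 < 1)%N).
have h : clim F (fun s => ((1 - qs s ^+ N) * As 1 (qs s) - Pj 1 (qs s)) * (qs s ^+ N)^-1 * N%:R^-1)
    (((1 - 1) * (Lw 2 / Kw 2) - Pj 1 1) * 1^-1 * N%:R^-1).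
  apply: climM => //; apply: climM; last by apply: climV => //; exact: oner_neq0.
  apply: climB; last exact: clim_Pj.
  by apply: climM => //; apply: climB.
rewrite subrr mul0r sub0r invr1 mulr1 in h; apply: eq_near_clim h.
near=> s; have q1 : nm (qs s) < 1 by near: s; exact: near_qs.
have qn : qs s ^+ N != 0 by rewrite expf_neq0 // qvar_neq0.
have := As_rec 1 q1; rewrite big_ord_recr big_ord1 /= bin0 binn subn0 subnn expr0 expr1 !mul1r.
move: (qs s ^+ N) qn (As 1 _) (As 0 _) (Pj 1 _) => Q qn A1 A0 P e.
have -> : (1 - Q) * A1 - P = Q * N%:R * A0 by rewrite mulrBl mul1r {1}e; ring.
by field; rewrite NC qn.
Unshelve. all: by end_near. Qed.

(** The limit of the shift recursion at q = 1, where the top term i = j cancels against the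
    left-hand side. *)
Lemma el_rec j : Pj j 1 + \sum_(i < j) 'C(j, i)%:R * N%:R ^+ (j - i) * el i = 0.
Proof.
have h : clim F (fun s => Pj j (qs s) + qs s ^+ N * (\sum_(i < j.+1) 'C(j, i)%:R * N%:R ^+ (j - i) * As i (qs s)))
   (Pj j 1 + 1 * \sum_(i < j.+1) 'C(j, i)%:R * N%:R ^+ (j - i) * el i).
  apply: climD; first exact: clim_Pj.
  apply: climM; first by rewrite -(expr1n _ N); apply: climX; exact: clim_qs.
  apply: clim_sum => i _.
  have c1 : clim F (fun=> 'C(j, i)%:R * N%:R ^+ (j - i) : C) ('C(j, i)%:R * N%:R ^+ (j - i)) by exact: clim_cst.
  by apply: climM => //; exact: clim_As.
have h2 : clim F (fun s => As j (qs s)) (Pj j 1 + 1 * \sum_(i < j.+1) 'C(j, i)%:R * N%:R ^+ (j - i) * el i).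
  apply: eq_near_clim h; near=> s; have q1 : nm (qs s) < 1 by near: s; exact: near_qs.
  by rewrite -As_rec.
have := clim_unique _ (clim_As j) h2; rewrite mul1r big_ord_recr /= binn subnn expr0 !mul1r addrA => e.
by apply: (addIr (el j)); rewrite add0r -e.
Unshelve. all: by end_near. Qed.

(** The limits [el] play the role of L(1 - m, chi_N) at i = m - 1, and this is the classical B_m =
    -m L(1 - m, chi_N). *)
Definition bl m : C := if m is i.+1 then - i.+1%:R * el i else 0.

Lemma fact_neq0C m : m`!%:R != 0 :> C. Proof. by rewrite pnatr_eq0 -lt0n fact_gt0. Qed.

Lemma bl_rec m :
  \sum_(j < m.+1) bl j / j`!%:R * (N%:R ^+ (m.+1 - j) / (m.+1 - j)`!%:R) =
  \sum_(1 <= a < N.+1) cc a%:Z * (a%:R ^+ m / m`!%:R).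
Proof.
have -> : \sum_(1 <= a < N.+1) cc a%:Z * (a%:R ^+ m / m`!%:R) = Pj m 1 / m`!%:R.
  rewrite big_nat_recr //=.
  have -> : chi N N%:Z = 0 by rewrite -chi_zero -(chi_per 0 1) mul1r add0r.
  rewrite mul0r addr0 /Pj mulr_suml -(big_mkord xpredT (fun a => cc a%:Z * a%:R ^+ m * 1 ^+ a / m`!%:R)).
  rewrite [RHS](big_ltn N0) chi_zero !mul0r add0r; apply: eq_bigr => a _.
  by rewrite expr1n mulr1 mulrA.
have -> : Pj m 1 = - \sum_(i < m) 'C(m, i)%:R * N%:R ^+ (m - i) * el i.
  by apply/eqP; rewrite -addr_eq0 el_rec.
rewrite big_ord_recl /= mul0r mul0r add0r mulNr mulr_suml -sumrN; apply: eq_bigr => i _.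
rewrite /bump /= add1n subSS.
have h : 'C(m, i)%:R = m`!%:R / (i`!%:R * (m - i)`!%:R) :> C.
  rewrite -(bin_fact (ltnW (ltn_ord i))) !natrM mulfK // mulf_neq0 // fact_neq0C.
have i1 : i.+1%:R != 0 :> C by rewrite pnatr_eq0.
have := fact_neq0C i; have := fact_neq0C (m - i); have := fact_neq0C m.
rewrite h factS natrM.
move: i1; move: (i.+1%:R : C) (m`!%:R : C) ((m - i)`!%:R : C) (i`!%:R : C) (N%:R ^+ (m - i) : C) (el i) => a b c d e f a0 b0 c0 d0.
by field; rewrite a0 b0 c0 d0.
Qed.

(** Both sequences solve the same triangular recursion, whose leading coefficient N is
    invertible. *)
Lemma bernoulli_bl m : ratr (gen_bernoulli N m) = bl m.
Proof.
have H := (iffLR (bernoulli_gf_rec N _)) (gen_bernoulliP N0).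
elim/ltn_ind: m => m IH.
have := congr1 (ratr : rat -> C) (H m); have := bl_rec m; rewrite big_ord_recr /=.
have -> : (m.+1 - m)%N = 1%N by rewrite subSnn.
have f1 : 1`! = 1%N by [].
rewrite f1 expr1 divr1 rmorphD /= rmorphM /= fmorph_div /= !ratr_nat !rmorph_sum /=.
have -> : \sum_(1 <= a < N.+1) ratr ((chi N a)%:~R * exp_coef a m) =
   \sum_(1 <= a < N.+1) cc a%:Z * (a%:R ^+ m / m`!%:R) :> C.
  by apply: eq_bigr => a _; rewrite /exp_coef rmorphM /= ratr_int fmorph_div /= rmorphXn /= !ratr_nat.
move=> <-.
have -> : \sum_(i < m) ratr (gen_bernoulli N i / i`!%:R * exp_coef N (m.+1 - i)) =
   \sum_(i < m) bl i / i`!%:R * (N%:R ^+ (m.+1 - i) / (m.+1 - i)`!%:R) :> C.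
  apply: eq_bigr => i _; rewrite /exp_coef rmorphM /= !fmorph_div /= rmorphXn /= !ratr_nat IH //.
by move=> /addrI /(mulIf NC)/(mulIf (invr_neq0 (fact_neq0C m))).
Qed.

Lemma bernoulli_Lw k : (1 < k)%N -> ratr (gen_bernoulli N k) = - k%:R * (Lw k / Kw k).
Proof. by case: k => [|[|k]] // _; rewrite bernoulli_bl. Qed.

(** Telescoping majorant 1 / (m - 1/2) - 1 / (m + 1/2) of 1 / m^2, started at m = 2. *)
Lemma sum_inv_sqr_le (n : nat) : \sum_(i < n) (i.+2%:R ^+ 2)^-1 <= 2 / 3 :> R.
Proof.
suff : \sum_(i < n) (i.+2%:R ^+ 2)^-1 <= 2 / 3 - (n%:R + 3 / 2)^-1 :> R.
  move/le_trans; apply; rewrite lerBlDr lerDl invr_ge0 addr_ge0 ?ler0n // divr_ge0 //.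
elim: n => [|n IH]; first by rewrite big_ord0 add0r invf_div subrr.
rewrite big_ord_recr /=; apply: le_trans (lerD IH (lexx _)) _.
have e1 : n.+1%:R = n%:R + 1 :> R by rewrite natr1.
have e2 : n.+2%:R = n%:R + 1 + 1 :> R by rewrite !natr1.
rewrite -addrA lerD2l e1 e2.
have := ler0n R n; move: (n%:R : R) => x x0.
have p1 : 0 < x + 3 / 2 by lra.
have p2 : 0 < x + 1 + 3 / 2 by lra.
have p3 : 0 < (x + 1 + 1) ^+ 2 by rewrite exprn_gt0 //; lra.
rewrite -subr_ge0.
have -> : - (x + 1 + 3 / 2)^-1 - (- (x + 3 / 2)^-1 + ((x + 1 + 1) ^+ 2)^-1) =
  (4 * (x + 3 / 2) * (x + 1 + 3 / 2) * (x + 1 + 1) ^+ 2)^-1.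
  by field; rewrite !gt_eqF //; lra.
by rewrite invr_ge0 ltW // mulr_gt0 // !mulr_gt0.
Qed.

(** By parity the value is twice the sum over n >= 1, whose first term is 1 while the others add up
    to at most 2/3 in modulus. *)
Lemma Lw_neq0 k : (1 < k)%N -> chi N (-1) = (-1) ^+ k -> Lw k != 0.
Proof.
move=> k1 hk; pose f (n : int) : C := cc n * n%:~R ^- k.
have fN n : f (- n) = f n.
  rewrite /f -[- n]mulN1r (chiM (chiP gN)) hk !intrM rmorphXn rmorphN1 exprMn invfM mulrACA.
  by rewrite divff ?mul1r // expf_neq0 // oppr_eq0 oner_neq0.
have H := LwP k1.
have af : asum (fun n : nat => f n.+1%:Z).
  apply: (bsum_inj (h := fun n : nat => n.+1%:Z) (g := fun n : int => nm (f n))); first by move=> a b [].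
  apply: le_bsum (int_inv2_asum R) => n.
  by apply: Lw_le => //; rewrite nm_int.
have Ha := tsumP af; set a := tsum _ in Ha.
have Hb : has_sum (fun n : nat => f (- n.+1%:Z)) a by apply: eq_has_sum Ha => n; rewrite fN.
have f0 : f 0 = 0 by rewrite /f chi_zero mul0r.
have -> : Lw k = 2 * a.
  have h := has_sum_int (f := f) Ha Hb; rewrite f0 add0r in h.
  have -> : 2 * a = a + a by ring.
  exact: has_sum_unique H h.
rewrite mulf_neq0 ?pnatr_eq0 //.
have f1 : f 1%:Z = 1 by rewrite /f (chi_one gN) mul1r expr1n invr1.
have := has_sum_succE Ha af; rewrite f1 => Hr.
have : nm (a - 1) <= 2 / 3.
  apply: (clim_nm_le _ (has_sum_clim Hr)); near=> n.
  apply: le_trans (nm_sum _ _ _) _; apply: le_trans (sum_inv_sqr_le n); apply: ler_sum => i _.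
  apply: le_trans (Lw_le k1 _) _; first by rewrite nm_int.
  by rewrite nmV nmX nm_nat.
apply: contraTneq => ->; rewrite sub0r nmN nm1 -ltNge; lra.
Unshelve. all: by end_near. Qed.

End Char.
End BernoulliLimit.

(** * The Eisenstein series of the divisor d *)

Section Arith.

Lemma dvdzDr (m a b : int) : (m %| b)%Z -> (m %| a + b)%Z = (m %| a)%Z.
Proof. by move=> h; rewrite rpredDr. Qed.

Lemma dvdzBr (m a b : int) : (m %| b)%Z -> (m %| a - b)%Z = (m %| a)%Z.
Proof. by move=> h; rewrite rpredBr. Qed.

Lemma chi_eqd m (a b : int) : good m -> (m%:Z %| a - b)%Z -> chi m a = chi m b.
Proof. by move=> g h; apply: (chi_mod (chiP g)); apply/eqP; rewrite eqz_mod_dvd. Qed.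

Lemma chi_inv m (a b : int) : good m -> (m%:Z %| a * b - 1)%Z -> chi m a = chi m b.
Proof.
move=> g h; have := chi_eqd g h; rewrite (chiM (chiP g)) chi_one //.
have := chi_le1 a g; have := chi_le1 b g; move: (chi m a) (chi m b) => x y y1 x1 xy.
have [X|[X|X]] : x = 1 \/ x = -1 \/ x = 0 by lia.
- by move: xy; rewrite X; lia.
- by move: xy; rewrite X; lia.
by move: xy; rewrite X; lia.
Qed.

Lemma wt_half m : wt m = ((m - 1) %/ 2)%N.
Proof. by rewrite /wt subn1 divn2. Qed.

(** Jacobi reciprocity, by splitting primes off d; the exponents add up modulo 2 because all the
    factors are odd. *)
Lemma chi_recip d e : good d -> good e -> coprime d e -> chi e d%:Z * chi d e%:Z = (-1) ^+ (wt d * wt e).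
Proof.
move=> gd ge; move: d gd; apply: good_ind => [_|p M pp p4 gpM IH cop].
  by rewrite chi_1 chi_one.
have gM : good M by apply: good_dvd gpM _; rewrite dvdn_mull.
have gp : good p by apply: good_dvd gpM _; rewrite dvdn_mulr.
move: cop; rewrite coprimeMl => /andP[cp cM].
have p2 : (2 < p)%N by rewrite (leq_trans _ p4).
rewrite PoszM (chiM (chiP ge)) chi_mulN ?good_odd //.
have h : chi e p%:Z * chi p e%:Z = (-1) ^+ (wt p * wt e).
  rewrite (chi_prime _ pp p2) chi_reciprocity // /star (chiM (chiP ge)) mulrCA -expr2.
  have -> : chi e p ^+ 2 = 1 by apply: (chi_sqr (chiP ge)).
  rewrite mulr1; have -> : chi e ((-1) ^+ ((p - 1) %/ 2)) = chi e (-1) ^+ ((p - 1) %/ 2).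
    elim: ((p - 1) %/ 2)%N => [|n IHn]; first by rewrite !expr0 chi_one.
    by rewrite !exprS (chiM (chiP ge)) IHn.
  by rewrite (chiN1 (chiP ge)) -exprM mulnC -!wt_half.
rewrite mulrACA h (IH cM) -exprD -[LHS]signr_odd -[RHS]signr_odd; congr (_ ^+ _).
have E : odd (wt (p * M)) = odd (wt p) (+) odd (wt M) by rewrite (wtM (good_odd gp) (good_odd gM)) oddD oddM (good_odd gM).
rewrite oddD !oddM E.
by case: (odd (wt p)); case: (odd (wt e)); case: (odd (wt M)).
Qed.

(** Units modulo 24 have square 1, checked residue by residue. *)
Lemma good_sqr24 e : good e -> exists s, (e ^ 2 = 24 * s + 1)%N.
Proof.
move=> [_ c6]; have c24 : coprime e 24.
  by apply: (@coprime_dvdr 24 (6 ^ 3)); rewrite ?coprimeXr.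
have h : all (fun r => coprime r 24 ==> (r ^ 2 %% 24 == 1)%N) (iota 0 24) by [].
have := allP h (e %% 24)%N; rewrite mem_iota ltn_mod coprime_modl c24 /= => /(_ isT) /eqP.
by rewrite modnXm => e1; exists (e ^ 2 %/ 24)%N; rewrite {1}(divn_eq (e ^ 2) 24) e1 mulnC.
Qed.

Lemma good_ge5 N : good N -> (1 < N)%N -> (4 < N)%N.
Proof. by move=> [_ ]; move: N => [|[|[|[|[|N]]]]]. Qed.

Lemma wt_gt1 N : good N -> (1 < N)%N -> (1 < wt N)%N.
Proof. by move=> g /(good_ge5 g); rewrite /wt; lia. Qed.

Lemma chi_sign N : good N -> chi N (-1) = (-1) ^+ wt N.
Proof. by move=> g; rewrite (chiN1 (chiP g)) wt_half. Qed.

End Arith.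

Section EisPhi.
Variable R : realType.
Local Notation C := R[i].
Local Open Scope complex_scope.
Variables d e : nat.
Hypothesis gN : good (d * e).
Local Notation N := (d * e)%N.
Local Notation k := (wt N).

Let gd : good d := good_dvd gN (dvdn_mulr e (dvdnn d)).
Let ge : good e := good_dvd gN (dvdn_mull d (dvdnn e)).
Let od := good_odd gd.
Let oe := good_odd ge.
Let d0 : (0 < d)%N := good_gt0 gd.
Let N0 : (0 < N)%N := good_gt0 gN.

Definition Phi (m n : int) : C := if (d%:Z %| m)%Z then (chi e m * chi d n)%:~R else 0.

Lemma Phi_scale n x y : Phi (n * x) (n * y) = (chi N n)%:~R * Phi x y.
Proof.
rewrite /Phi (chi_mulN _ od oe) (chiM (chiP gd)) (chiM (chiP ge)).
have [c|c] := boolP (coprime `|n| d).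
  have -> : (d%:Z %| n * x)%Z = (d%:Z %| x)%Z by rewrite Gauss_dvdzr // coprimezE coprime_sym.
  by case: ifP => _; rewrite ?mulr0 //; rewrite !intrM; ring.
by rewrite (chi_eq0 (chiP gd) c) !mul0r mulr0 if_same.
Qed.

Lemma chi_sumN : (1 < d)%N -> \sum_(v < N) (chi d v)%:~R = 0 :> C.
Proof.
move=> d1; have cop := good_coprime gN; have e0 : (0 < e)%N := good_gt0 ge.
have hF r : (chi d (r %% N)%N%:Z)%:~R = (chi d r%:Z)%:~R :> C.
  congr (_%:~R); apply: chi_eqd => //; rewrite {2}(divn_eq r N) PoszD opprD addrCA subrr addr0.
  by rewrite rpredN PoszM dvdz_mull // PoszM dvdz_mulr.
rewrite (crt_sum (F := fun r => (chi d r%:Z)%:~R : C) cop d0 e0 hF).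
have -> : \sum_(x < d) \sum_(y < e) (chi d (e * x + d * y)%N)%:~R =
   \sum_(x < d) (chi d x)%:~R * \sum_(y < e) (chi d e%:Z)%:~R :> C.
  apply: eq_bigr => x _; rewrite mulr_sumr; apply: eq_bigr => y _; rewrite -intrM -(chiM (chiP gd)) [_ * e%:Z]mulrC.
  congr (_%:~R); apply: chi_eqd => //; rewrite PoszD !PoszM addrC addKr dvdz_mulr //.
by rewrite -mulr_suml chi_sum0 ?mul0r.
Qed.

(** The mean is a product of two sums: the one over n vanishes when d > 1, and for d = 1 the one
    over m does, chi_e being then the nontrivial chi_N. *)
Lemma adm_Phi : (1 < N)%N -> adm N k Phi.
Proof.
move=> N1; split.
- move=> m n a; rewrite /Phi.
  have -> : (d%:Z %| m + a * N%:Z)%Z = (d%:Z %| m)%Z by rewrite dvdzDr // PoszM mulrCA dvdz_mulr.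
  by rewrite PoszM mulrA chi_per.
- by move=> m n a; rewrite /Phi PoszM mulrA mulrAC chi_per.
- move=> m n; rewrite /Phi; case: ifP => _; last by rewrite nm0.
  by rewrite intrM nmM mulr_ile1 ?nm_ge0 ?nm_chi.
- move=> m n; have := Phi_scale (-1) m n; rewrite !mulN1r => ->.
  by rewrite chi_sign // rmorphXn rmorphN1.
have -> : \sum_(u < N) \sum_(v < N) Phi u v =
   (\sum_(u < N) (if (d%:Z %| u%:Z)%Z then (chi e u)%:~R else 0)) * (\sum_(v < N) (chi d v)%:~R).
  rewrite mulr_suml; apply: eq_bigr => u _; rewrite mulr_sumr; apply: eq_bigr => v _.
  by rewrite /Phi; case: ifP => _; rewrite ?intrM ?mul0r.
have [d1|d1] := ltnP 1 d; first by rewrite chi_sumN // mulr0.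
have d_1 : d = 1%N by lia.
suff -> : \sum_(u < N) (if (d%:Z %| u%:Z)%Z then (chi e u)%:~R else 0) = 0 :> C by rewrite mul0r.
rewrite -[RHS](chi_sum0 R gN N1); apply: eq_bigr => u _.
by rewrite chi_mulN //; move: (nat_of_ord u) => w; rewrite d_1 chi_1 mul1r dvd1z.
Qed.

Lemma Phi_gamma0 g m n : sl2 g -> (N%:Z %| mc g)%Z ->
  act g Phi m n = (chi N (md g))%:~R * Phi m n.
Proof.
rewrite /sl2 /act; case: g => a b c t /= det cN.
have dc : (d%:Z %| c)%Z by apply: dvdz_trans cN; rewrite PoszM dvdz_mulr.
have ec : (e%:Z %| c)%Z by apply: dvdz_trans cN; rewrite PoszM dvdz_mull.
have adE : a * t - 1 = b * c by rewrite -det; ring.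
have -> : chi N t = chi d t * chi e t by rewrite chi_mulN.
rewrite /Phi.
have -> : (d%:Z %| m * t - n * c)%Z = (d%:Z %| m)%Z.
  rewrite (dvdzBr _ (dvdz_mull n dc)); apply/idP/idP => h; last by rewrite dvdz_mulr.
  have -> : m = m * t * a - m * b * c by rewrite -[m in LHS]mulr1 -det; ring.
  by apply: rpredB; [exact: dvdz_mulr|exact: dvdz_mull].
case: ifP => dm; last by rewrite mulr0.
have -> : chi e (m * t - n * c) = chi e m * chi e t.
  rewrite -(chiM (chiP ge)); apply: chi_eqd => //; rewrite addrAC subrr add0r rpredN dvdz_mull //.
have -> : chi d (n * a - m * b) = chi d n * chi d t.
  have -> : chi d t = chi d a by apply: chi_inv => //; rewrite mulrC adE dvdz_mull.
  rewrite -(chiM (chiP gd)); apply: chi_eqd => //; rewrite addrAC subrr add0r rpredN dvdz_mulr //.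
by rewrite !intrM; ring.
Qed.

Section Big.
Hypothesis N1 : (1 < N)%N.
Let k1 : (1 < k)%N := wt_gt1 gN N1.
Let aP := adm_Phi N1.

(** The vector (0, n) times the inverse of g is n (-c, a), and Phi is homogeneous with character
    chi_N. *)
Lemma econst_act g : econst k (act g Phi) = Phi (- mc g) (ma g) * Lw R N k.
Proof.
have h := has_sumZ (Phi (- mc g) (ma g)) (@LwP R _ gN N1 _ k1).
rewrite /econst; apply: tsumE; apply: eq_has_sum h => n.
rewrite /act !mul0r sub0r subr0 -mulrN Phi_scale; ring.
Qed.

Lemma eis_gamma0 g (z : C) : sl2 g -> (N%:Z %| mc g)%Z -> 0 < complex.Im z ->
  sl k (eis k Phi) g z = (chi N (md g))%:~R * eis k Phi z.
Proof.
move=> sg cN z0; have [ag ->] := eis_slash N0 k1 aP sg; last by [].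
have er m : erow k (act g Phi) z m = (chi N (md g))%:~R * erow k Phi z m.
  apply: tsumE; apply: eq_has_sum (has_sumZ _ (erowP N0 k1 m aP z0)) => n.
  by rewrite /ef Phi_gamma0 // mulrA.
apply: tsumE; apply: eq_has_sum (has_sumZ _ (eisP N0 k1 aP z0)) => m.
by rewrite er.
Qed.

Lemma clim_eis_slash g : sl2 g ->
  clim (ioo (R := R)) (sl k (eis k Phi) g) (Phi (- mc g) (ma g) * Lw R N k).
Proof.
move=> sg; have [ag sE] := eis_slash N0 k1 aP sg.
have := clim_eis N0 k1 ag; rewrite econst_act => h; apply: eq_near_clim h.
by apply: (@near_ioo _ _ 0) => z z0 _; rewrite sE.
Qed.

Definition sg (n : nat) : C := if n == 0%N then 0 else sigma R k.-1%:Z (chi e) (chi d) n.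

(** Only rows of index divisible by d are nonzero; on these chi_e is constant along the row and the
    Lipschitz formula twisted by chi_d applies. *)
Lemma erow_Phi (z : C) (m : nat) : 0 < complex.Im z -> (0 < m)%N ->
  erow k Phi z (d * m)%N = (chi e d)%:~R * Kw R d k * ((chi e m)%:~R * As d k.-1 (ee z ^+ m)).
Proof.
move=> z0 m0; have t0 : 0 < complex.Im ((d * m)%:R * z) by apply: Im_natM; rewrite // muln_gt0 d0.
have h := has_sumZ (chi e (d * m)%N%:Z)%:~R (chi_lipschitz gd k1 t0).
have dC : d%:R != 0 :> C by rewrite pnatr_eq0 -lt0n.
have E : (d * m)%:R * z / d%:R = z * m%:R by rewrite natrM; field.
rewrite E qvarMn PoszM (chiM (chiP ge)) in h.
have -> : (chi e d)%:~R * Kw R d k * ((chi e m)%:~R * As d k.-1 (ee z ^+ m)) =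
  (chi e d * chi e m)%:~R * (Kw R d k * As d k.-1 (ee z ^+ m)) by rewrite intrM; ring.
apply: tsumE; apply: eq_has_sum h => n.
rewrite /ef /Phi; have -> : (d%:Z %| (d * m)%N%:Z)%Z by rewrite PoszM dvdz_mulr.
have -> : chi e (d * m)%N = chi e d * chi e m by rewrite PoszM (chiM (chiP ge)).
by rewrite [(chi e d * chi e m * chi d n)%:~R]intrM -mulrA.
Qed.

Lemma sg_has_sum (z : C) : 0 < complex.Im z ->
  has_sum (fun n => sg n * ee z ^+ n) (qser sg z) /\
  has_sum (fun m : nat => (chi e m.+1)%:~R * As d k.-1 (ee z ^+ m.+1)) (qser sg z).
Proof.
move=> z0; have q1 := nm_qvar_lt1 z0.
have qm (m : nat) : (0 < m)%N -> nm (ee z ^+ m) < 1.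
  by move=> m0; rewrite nmX exprn_ilt1 ?nm_ge0 // -lt0n.
have k0 : (0 < k.-1)%N by rewrite -subn1 subn_gt0.
have [L H1 H2] := lambert_sum (psi := fun n => (chi e n%:Z)%:~R) (phi := fun n => (chi d n%:Z)%:~R)
  (T := fun m => As d k.-1 (ee z ^+ m)) k0 q1 (fun n => nm_chi R ge n%:Z) (fun n => nm_chi R gd n%:Z)
  (fun m m0 => eq_has_sum (fun t => congr1 (fun x => _ * x) (esym (exprM (ee z) m t))) (AsP gd k.-1 (qm m m0))).
have -> : qser sg z = L by apply: tsumE; apply: eq_has_sum H1 => n.
by split=> //; apply: eq_has_sum H1 => n.
Qed.

Lemma eis_q (z : C) : 0 < complex.Im z -> eis k Phi z =
  (chi e 0)%:~R * Lw R N k + 2 * ((chi e d)%:~R * Kw R d k) * qser sg z.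
Proof.
move=> z0; have [a Ha ->] := eis_split N0 k1 aP z0.
have -> : econst k Phi = (chi e 0)%:~R * Lw R N k.
  have := econst_act one2; rewrite (_ : act one2 Phi = Phi); last by rewrite act_one.
  move=> ->; rewrite /Phi /= oppr0 dvdz0 chi_one // mulr1 //.
have [_ H2] := sg_has_sum z0.
suff -> : a = (chi e d)%:~R * Kw R d k * qser sg z by ring.
have nl (i : nat) : (d %| i.+1)%N -> (d * (i.+1 %/ d).-1.+1).-1 = i.
  by move=> dv; rewrite prednK; [rewrite mulnC divnK|rewrite divn_gt0 // dvdn_leq].
have hd (i : nat) : erow k Phi z i.+1%:Z != 0 -> (d %| i.+1)%N.
  apply: contraNT => nd; apply/eqP; apply: tsumE; apply: has_sum0 => n.
  by rewrite /ef /Phi ifF ?mul0r //; apply/negbTE.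
have := (iffLR (has_sum_supp (f := fun m : nat => erow k Phi z m.+1%:Z)
  (h := fun j => (d * j.+1).-1) (g := fun i => (i.+1 %/ d).-1) _ _ a)) Ha.
move=> h; apply: has_sum_unique (h _ _) _.
- by move=> i /hd dv; exact: nl.
- by move=> j; rewrite prednK ?muln_gt0 ?d0 // mulKn.
apply: eq_has_sum (has_sumZ _ H2) => j /=.
by rewrite prednK ?muln_gt0 ?d0 // erow_Phi.
Qed.

End Big.
End EisPhi.

(** * The partition series as a trace of the eta quotient *)

Section OrdMod.
Variable e : nat.
Hypothesis e0 : (0 < e)%N.

Lemma omod_lt (x : int) : (`|(x %% e%:Z)%Z| < e)%N.
Proof.
have eZ : e%:Z != 0 by rewrite eqz_nat -lt0n.
by have := ltz_mod x eZ; have := modz_ge0 x eZ; lia.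
Qed.

Definition omod x : 'I_e := Ordinal (omod_lt x).

Lemma omodP x : (e%:Z %| x - (omod x : nat)%:Z)%Z.
Proof.
have eZ : e%:Z != 0 by rewrite eqz_nat -lt0n.
rewrite /= gez0_abs ?modz_ge0 // {1}(divz_eq x e%:Z) -addrA subrr addr0.
exact: dvdz_mull.
Qed.

Lemma ord_dvd_eq (i j : 'I_e) : (e%:Z %| (i : nat)%:Z - (j : nat)%:Z)%Z -> i = j.
Proof.
rewrite -eqz_mod_dvd !modz_nat !modn_small // => /eqP[h]; exact: val_inj.
Qed.

End OrdMod.

Section ThetaQuot.
Variable R : realType.
Local Notation C := R[i].
Local Open Scope complex_scope.
Variables d e : nat.
Hypothesis gN : good (d * e).
Local Notation N := (d * e)%N.
Local Notation k := (wt N).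

Let gd : good d := good_dvd gN (dvdn_mulr e (dvdnn d)).
Let ge : good e := good_dvd gN (dvdn_mull d (dvdnn e)).
Let od := good_odd gd.
Let oe := good_odd ge.
Let d0 : (0 < d)%N := good_gt0 gd.
Let e0 : (0 < e)%N := good_gt0 ge.
Let N0 : (0 < N)%N := good_gt0 gN.
Let cop := good_coprime gN.

Variables u v : int.
Hypothesis uv : u * d%:Z + v * e%:Z = 1.

(* The bottom row is (0, 1) modulo d and (1, j) modulo e. *)
Definition gam (j : int) := Mat2 1 (j - 1) (u * d%:Z) (u * d%:Z * j + v * e%:Z).

Lemma sl2_gam j : sl2 (gam j).
Proof. by rewrite /sl2; apply: etrans uv => /=; ring. Qed.

Lemma gamT j : gam j = mul2 (gam 0) (T2 j).
Proof. by apply: eq_mat2 => /=; ring. Qed.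

Lemma slTz m (f : C -> C) (a : int) (z : C) : sl m f (T2 a) z = f (z + a%:~R).
Proof. by rewrite /sl /mob2 /j2 /= mul0r add0r expr1n invr1 mulr1 !mul1r. Qed.

Definition Ff (z : C) : C := \sum_(j < e) sl k (hq N) (gam (j : nat)%:Z) z.

Lemma sl_gam (j : nat) (z : C) : 0 < complex.Im z -> sl k (hq N) (gam j%:Z) z =
  kd R d e * (eta (z + j%:R) ^+ N / eta (d%:R * ((z + j%:R) / e%:R))).
Proof.
move=> z0; have z1 : 0 < complex.Im (z + j%:R) by rewrite Im_add_nat.
rewrite gamT; apply: etrans (sl_mul k (hq N) (gam 0) (sl2_T j%:Z) z0) _.
apply: etrans (slTz _ _ _ _) _.
apply: (hq_gamma0 gN (sl2_gam 0) z1) => /=; rewrite ?mulr0 ?add0r.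
- exact: dvdz_mull.
- by rewrite -uv opprD addrCA subrr addr0 rpredN dvdz_mull.
- by rewrite -uv opprD addrA subrr add0r rpredN dvdz_mull.
exact: dvdz_mull.
Qed.

Lemma sl_sum m (f : 'I_e -> C -> C) g (z : C) :
  sl m (fun z => \sum_(j < e) f j z) g z = \sum_(j < e) sl m (f j) g z.
Proof. by rewrite /sl mulr_sumr. Qed.

Lemma sl_Ff g (z : C) : sl2 g -> 0 < complex.Im z ->
  sl k Ff g z = \sum_(j < e) sl k (hq N) (mul2 (gam (j : nat)%:Z) g) z.
Proof.
move=> sg z0; rewrite /Ff sl_sum; apply: eq_bigr => j _.
by rewrite (sl_mul k (hq N) (gam (j : nat)%:Z) sg z0).
Qed.

Lemma dvdN x : (d%:Z %| x)%Z -> (e%:Z %| x)%Z -> (N%:Z %| x)%Z.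
Proof. by move=> h1 h2; rewrite PoszM Gauss_dvdz ?h1 // coprimezE. Qed.

Let c0E : u * d%:Z = 1 - v * e%:Z. Proof. by rewrite -uv addrK. Qed.
Let d0E : v * e%:Z = 1 - u * d%:Z. Proof. by rewrite -uv addrC addKr. Qed.

(* The bottom row of gam j * g is lam times that of gam j', for a permutation j -> j' of Z/e. *)
Lemma Ff_gamma0 g (z : C) : sl2 g -> (N%:Z %| mc g)%Z -> 0 < complex.Im z ->
  sl k Ff g z = (chi N (md g))%:~R * Ff z.
Proof.
move=> sg cN z0; rewrite (sl_Ff sg z0).
have [c' hc] : exists c', mc g = c' * d%:Z * e%:Z.
  by have /dvdzP[c' ->] := cN; exists c'; rewrite PoszM mulrA.
(* By the Chinese remainder theorem: the lower right entry of g modulo d and the upper left one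
   modulo e, which are inverse to each other modulo e. *)
pose lam := md g * (v * e%:Z) + ma g * (u * d%:Z).
have lam1 : lam = ma g + v * e%:Z * (md g - ma g) by rewrite /lam c0E; ring.
have lam2 : lam = md g + u * d%:Z * (ma g - md g) by rewrite /lam d0E; ring.
have hdet : ma g * md g = 1 + mb g * mc g by move: sg; rewrite /sl2 => <-; ring.
have chil : chi N lam = chi N (md g).
  rewrite !chi_mulN //; congr (_ * _).
    apply: chi_eqd => //; rewrite lam2 addrC addKr -mulrA mulrCA; exact: dvdz_mulr.
  have -> : chi e (md g) = chi e (ma g).
    by apply: chi_inv => //; rewrite mulrC hdet addrC addKr hc mulrA; exact: dvdz_mull.
  apply: chi_eqd => //; rewrite lam1 addrC addKr -mulrA mulrCA; exact: dvdz_mulr.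
pose h (j : 'I_e) := omod e0 ((mb g + (j : nat)%:Z * md g) * md g).
have row (j : 'I_e) : sl k (hq N) (mul2 (gam (j : nat)%:Z) g) z =
    (chi N (md g))%:~R * sl k (hq N) (gam (h j : nat)%:Z) z.
  rewrite -chil; have := omodP e0 ((mb g + (j : nat)%:Z * md g) * md g); rewrite -/(h j) => /dvdzP[t ht].
  have {}ht : (h j : nat)%:Z = (mb g + (j : nat)%:Z * md g) * md g - t * e%:Z by rewrite -ht; ring.
  apply: hq_row => //; first by apply: sl2_mul => //; exact: sl2_gam.
  - exact: sl2_gam.
  - move: (h j : nat) (j : nat) ht => j' i ht /=; apply: dvdN.
      rewrite hc; apply/dvdzP; exists (u * ma g + (u * d%:Z * i%:Z + v * e%:Z) * c' * e%:Z - lam * u); ring.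
    rewrite lam1 hc; move: (u * d%:Z) => c0; apply/dvdzP.
    exists ((c0 * i%:Z + v * e%:Z) * c' * d%:Z - v * (md g - ma g) * c0); ring.
  move: (h j : nat) (j : nat) ht => j' i ht /=; apply: dvdN.
    rewrite lam2; move: (v * e%:Z) => w0; apply/dvdzP.
    exists (u * (mb g + i%:Z * md g - md g * j'%:Z - (ma g - md g) * (u * d%:Z * j'%:Z + w0))); ring.
  have hx : mb g + i%:Z * md g - ma g * j'%:Z = e%:Z * (ma g * t - (mb g + i%:Z * md g) * mb g * c' * d%:Z).
    have -> : mb g + i%:Z * md g - ma g * j'%:Z =
       (mb g + i%:Z * md g) * (1 - ma g * md g) + ma g * t * e%:Z by rewrite ht; ring.
    by rewrite hdet hc; ring.
  rewrite lam1; move: hx; move: (u * d%:Z) => c0 hx.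
  have -> : c0 * mb g + (c0 * i%:Z + v * e%:Z) * md g - (ma g + v * e%:Z * (md g - ma g)) * (c0 * j'%:Z + v * e%:Z) =
     c0 * (mb g + i%:Z * md g - ma g * j'%:Z) +
     v * e%:Z * (md g - ma g - (md g - ma g) * (c0 * j'%:Z + v * e%:Z)) by ring.
  rewrite hx; apply: rpredD; first by rewrite mulrCA dvdz_mulr.
  by rewrite -mulrA mulrCA dvdz_mulr.
rewrite (eq_bigr _ (fun j _ => row j)) -mulr_sumr; congr (_ * _).
have hinj : injective h.
  move=> i j hij; apply: ord_dvd_eq.
  have h1 := omodP e0 ((mb g + (i : nat)%:Z * md g) * md g).
  have h2 := omodP e0 ((mb g + (j : nat)%:Z * md g) * md g).
  rewrite -/(h i) in h1; rewrite -/(h j) -hij in h2.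
  have h3 := rpredB h1 h2.
  have E : (mb g + (i : nat)%:Z * md g) * md g - (h i : nat)%:Z - ((mb g + (j : nat)%:Z * md g) * md g - (h i : nat)%:Z)
     = ((i : nat)%:Z - (j : nat)%:Z) * md g ^+ 2 by ring.
  rewrite E in h3.
  have E2 : (i : nat)%:Z - (j : nat)%:Z = ((i : nat)%:Z - (j : nat)%:Z) * md g ^+ 2 * ma g ^+ 2
     - ((i : nat)%:Z - (j : nat)%:Z) * (2 + mb g * mc g) * mb g * mc g.
    rewrite -mulrA -exprMn [md g * _]mulrC hdet; ring.
  rewrite E2; apply: rpredB; first exact: dvdz_mulr.
  by rewrite hc mulrA; exact: dvdz_mull.
by rewrite [RHS](reindex_inj hinj).
Qed.

(** A summand has a nonzero limit only if N divides its lower left entry, that is d | c and e | a +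
    j c. For c prime to e exactly one j qualifies; otherwise the character value is 0. *)
Lemma clim_Ff g : sl2 g -> clim (ioo (R := R)) (sl k Ff g) (Phi R d e (- mc g) (ma g)).
Proof.
move=> sg.
have hdet : ma g * md g = 1 + mb g * mc g by move: (sg); rewrite /sl2 => <-; ring.
pose V (j : 'I_e) : C := if (N%:Z %| mc (mul2 (gam (j : nat)%:Z) g))%Z
   then (chi N (md (mul2 (gam (j : nat)%:Z) g)))%:~R else 0.
have lim : clim (ioo (R := R)) (sl k Ff g) (\sum_(j < e) V j).
  have h : clim (ioo (R := R)) (fun z => \sum_(j < e) sl k (hq N) (mul2 (gam (j : nat)%:Z) g) z) (\sum_(j < e) V j).
    by apply: clim_sum => j _; apply: clim_hq_slash => //; apply: sl2_mul => //; exact: sl2_gam.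
  by apply: eq_near_clim h; apply: (@near_ioo _ _ 0) => z z0 _; rewrite sl_Ff.
suff <- : \sum_(j < e) V j = Phi R d e (- mc g) (ma g) by [].
have cjE (j : int) : mc (mul2 (gam j) g) = u * d%:Z * ma g + (u * d%:Z * j + v * e%:Z) * mc g by [].
have djE (j : int) : md (mul2 (gam j) g) = u * d%:Z * mb g + (u * d%:Z * j + v * e%:Z) * md g by [].
rewrite /Phi; have [dc|dc] := boolP (d%:Z %| - mc g)%Z; last first.
  apply: big1 => j _; rewrite /V ifF //; apply/negbTE; apply: contra dc => h.
  have {}h : (d%:Z %| mc (mul2 (gam (j : nat)%:Z) g))%Z by apply: dvdz_trans h; rewrite PoszM dvdz_mulr.
  rewrite rpredN; have -> : mc g = mc (mul2 (gam (j : nat)%:Z) g) - d%:Z * (u * (ma g + (j : nat)%:Z * mc g - mc g)).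
    rewrite cjE d0E; ring.
  by apply: rpredB => //; exact: dvdz_mulr.
rewrite rpredN in dc.
pose W : C := (chi e (- mc g) * chi d (ma g))%:~R.
have VE (j : 'I_e) : V j = if (e%:Z %| ma g + (j : nat)%:Z * mc g)%Z then W else 0.
  rewrite /V.
  have -> : (N%:Z %| mc (mul2 (gam (j : nat)%:Z) g))%Z = (e%:Z %| ma g + (j : nat)%:Z * mc g)%Z.
    apply/idP/idP => h.
      have {}h : (e%:Z %| mc (mul2 (gam (j : nat)%:Z) g))%Z by apply: dvdz_trans h; rewrite PoszM dvdz_mull.
      have -> : ma g + (j : nat)%:Z * mc g = mc (mul2 (gam (j : nat)%:Z) g) + e%:Z * (v * (ma g + (j : nat)%:Z * mc g - mc g)).
        rewrite cjE c0E; ring.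
      by apply: rpredD => //; exact: dvdz_mulr.
    apply: dvdN; rewrite cjE.
      by apply: rpredD; [rewrite mulrAC; exact: dvdz_mull|exact: dvdz_mull].
    have -> : u * d%:Z * ma g + (u * d%:Z * (j : nat)%:Z + v * e%:Z) * mc g =
       u * d%:Z * (ma g + (j : nat)%:Z * mc g) + e%:Z * (v * mc g) by ring.
    by apply: rpredD; [exact: dvdz_mull|exact: dvdz_mulr].
  case: ifP => // ej; rewrite /W; congr (_%:~R); rewrite chi_mulN // mulrC; congr (_ * _).
    have -> : chi e (md (mul2 (gam (j : nat)%:Z) g)) = chi e (mb g + (j : nat)%:Z * md g).
      apply: chi_eqd => //; rewrite djE c0E; apply/dvdzP.
      exists (v * (md g - (mb g + (j : nat)%:Z * md g))); ring.
    apply: chi_inv => //.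
    have -> : (mb g + (j : nat)%:Z * md g) * - mc g - 1 = - (md g * (ma g + (j : nat)%:Z * mc g)).
      have -> : 1 = ma g * md g - mb g * mc g by rewrite hdet; ring.
      by ring.
    by rewrite rpredN dvdz_mull.
  have -> : chi d (ma g) = chi d (md g).
    by apply: chi_inv => //; rewrite hdet addrC addKr dvdz_mull.
  apply: chi_eqd => //; rewrite djE d0E; apply/dvdzP.
  exists (u * (mb g + (j : nat)%:Z * md g - md g)); ring.
rewrite (eq_bigr _ (fun j _ => VE j)) -/W.
have [cc|cc] := boolP (coprime `|- mc g| e); last first.
  have W0 : W = 0 by rewrite /W (chi_eq0 (chiP ge) cc) mul0r.
  by rewrite W0 big1 // => j _; rewrite if_same.
have [x [y xy]] := Bezoutz (mc g) e%:Z.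
have {}xy : x * mc g + y * e%:Z = 1.
  by rewrite xy /gcdz; move: cc; rewrite abszN /coprime /= => /eqP ->.
pose j0 := omod e0 (- ma g * x); have hj0 := omodP e0 (- ma g * x); rewrite -/j0 in hj0.
have jE (j : 'I_e) : (e%:Z %| ma g + (j : nat)%:Z * mc g)%Z = (j == j0).
  apply/idP/eqP => [h|->].
    apply: ord_dvd_eq.
    have -> : (j : nat)%:Z - (j0 : nat)%:Z = x * (ma g + (j : nat)%:Z * mc g) + (- ma g * x - (j0 : nat)%:Z)
        + e%:Z * (y * (j : nat)%:Z).
      have -> : (j : nat)%:Z - (j0 : nat)%:Z = (j : nat)%:Z * (x * mc g + y * e%:Z) - (j0 : nat)%:Z by rewrite xy mulr1.
      by ring.
    by apply: rpredD; [apply: rpredD => //; exact: dvdz_mull|exact: dvdz_mulr].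
  have -> : ma g + (j0 : nat)%:Z * mc g = e%:Z * (y * ma g) - mc g * (- ma g * x - (j0 : nat)%:Z).
    have -> : ma g + (j0 : nat)%:Z * mc g = ma g * (x * mc g + y * e%:Z) + (j0 : nat)%:Z * mc g by rewrite xy mulr1.
    by ring.
  by apply: rpredB; [exact: dvdz_mulr|exact: dvdz_mull].
rewrite (eq_bigr (fun j => if j == j0 then W else 0)); last by move=> j _; rewrite jE.
by rewrite -big_mkcond big_pred1_eq.
Qed.

End ThetaQuot.

(** * Fourier coefficients *)

Section Partition.
Variable R : realType.
Local Notation C := R[i].
Local Open Scope complex_scope.
Variables d e s : nat.
Hypothesis gN : good (d * e).
Hypothesis e24 : (e ^ 2 = 24 * s + 1)%N.
Local Notation N := (d * e)%N.
Local Notation k := (wt N).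

Let gd : good d := good_dvd gN (dvdn_mulr e (dvdnn d)).
Let ge : good e := good_dvd gN (dvdn_mull d (dvdnn e)).
Let d0 : (0 < d)%N := good_gt0 gd.
Let e0 : (0 < e)%N := good_gt0 ge.
Let cop := good_coprime gN.

Lemma shift_val (F : numFieldType) : s%:R = (e%:R ^+ 2 - 1) / 24 :> F.
Proof.
have -> : e%:R ^+ 2 = 24 * s%:R + 1 :> F by rewrite -natrX e24 natrD natrM.
by rewrite addrK mulrC mulKf // pnatr_eq0.
Qed.

(** Since s = (e^2 - 1) / 24, the exponents of eta(z)^N / eta(d z / e), once the factor (q;q)^N is
    set aside, are d (n + s) / e; summing the translates by j modulo e keeps those with e | n +
    s. *)
Lemma Ff_has_sum u v (z : C) : u * d%:Z + v * e%:Z = 1 -> 0 < complex.Im z ->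
  has_sum (fun n : nat => kd R d e * qpoch (ee z) ^+ N * e%:R *
    (if (e %| n + s)%N then (partition_count n)%:R * ee z ^+ (d * ((n + s) %/ e)) else 0)) (Ff d e u v z).
Proof.
move=> uv z0; set Q := qpoch (ee z).
have eC : e%:R != 0 :> C by rewrite pnatr_eq0 -lt0n.
pose w (j : nat) : C := d%:R * ((z + j%:R) / e%:R).
have zj (j : nat) : 0 < complex.Im (z + j%:R) by rewrite Im_add_nat.
have qzj (j : nat) : ee (z + j%:R) = ee z by exact: (qvarDint z j%:Z).
have w0 j : 0 < complex.Im (w j).
  by rewrite /w; apply: Im_natM => //; rewrite (natC R e); apply: Im_gt0_div; rewrite ?ltr0n.
have etaV j : (eta (w j))^-1 = ee (- (w j / 24)) * (qpoch (ee (w j)))^-1.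
  by rewrite etaE // invfM qvarN.
have hj (j : 'I_e) : has_sum (fun n : nat => kd R d e * (eta (z + (j : nat)%:R) ^+ N *
    (ee (- (w j / 24)) * ((partition_count n)%:R * ee (w j) ^+ n)))) (sl k (hq N) (gam d e u v (j : nat)%:Z) z).
  rewrite (sl_gam gN uv _ z0) -/(w j) etaV.
  exact: (has_sumZ _ (has_sumZ _ (has_sumZ _ (partition_gf (w0 j))))).
have h := has_sum_sum (index_enum 'I_e) (P := xpredT) (fun j _ => hj j).
apply: eq_has_sum h => n /=.
pose t : int := (d * (n + s))%N%:Z.
pose E : C := ee ((d * (n + s))%:R / e%:R * z).
have term (j : 'I_e) : kd R d e * (eta (z + (j : nat)%:R) ^+ N *
    (ee (- (w j / 24)) * ((partition_count n)%:R * ee (w j) ^+ n))) =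
    kd R d e * Q ^+ N * (partition_count n)%:R * E * ee ((t * (j : nat)%:Z)%:~R / e%:R).
  have -> : eta (z + (j : nat)%:R) = ee ((z + (j : nat)%:R) / 24) * Q.
    by rewrite (etaE (zj j)) qzj.
  rewrite exprMn -!qvarMn.
  have -> : kd R d e * Q ^+ N * (partition_count n)%:R * E * ee ((t * (j : nat)%:Z)%:~R / e%:R) =
     kd R d e * Q ^+ N * (partition_count n)%:R * (E * ee ((t * (j : nat)%:Z)%:~R / e%:R)) by ring.
  have -> : E * ee ((t * (j : nat)%:Z)%:~R / e%:R) =
      ee ((z + (j : nat)%:R) / 24 * N%:R) * ee (- (w j / 24)) * ee (w j * n%:R).
    rewrite /E -!qvarD; congr ee; rewrite /w /t intrM -[(d * (n + s))%N%:~R]/((d * (n + s))%:R) -[((j : nat)%:Z)%:~R]/((j : nat)%:R).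
    rewrite !natrM natrD shift_val; move: ((j : nat)%:R : C) (n%:R : C) (d%:R : C) (e%:R : C) eC => a b c f f0.
    by field.
  by move: (ee _) (ee _) (ee _) => a b c; ring.
rewrite (eq_bigr _ (fun j _ => term j)) -mulr_sumr unity_sum //.
have ced : coprime e d by rewrite coprime_sym.
have -> : (e%:Z %| t)%Z = (e %| d * (n + s))%N by [].
rewrite (Gauss_dvdr _ ced).
case: ifP => [/dvdnP[m hm]|_]; last by rewrite !mulr0.
have -> : E = ee z ^+ (d * ((n + s) %/ e)).
  rewrite /E -qvarMn hm mulnK //; congr ee; rewrite !natrM; field.
  by [].
by ring.
Qed.

(** The argument of P simplifies to e n / d - s, an integer exactly when d divides n because d and e
    are coprime. *)
Lemma partition_funE (n : nat) :
  partition_fun (N%:R / d%:R ^+ 2 * n%:R - (N%:R ^+ 2 - d%:R ^+ 2) / (24%:R * d%:R ^+ 2)) =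
  if (d %| n)%N && (s <= e * (n %/ d))%N then partition_count (e * (n %/ d) - s) else 0%N.
Proof.
have dQ : d%:R != 0 :> rat by rewrite pnatr_eq0 -lt0n.
set x := (X in partition_fun X).
have xE : x = (e * n)%:R / d%:R - s%:R.
  rewrite /x shift_val !natrM; move: (d%:R : rat) (e%:R : rat) (n%:R : rat) dQ => a b c a0; by field.
have [dn|dn] /= := boolP (d %| n)%N; last first.
  rewrite /partition_fun ifF //; apply/negbTE; apply: contra dn => /natrP[t]; rewrite xE => /eqP.
  rewrite subr_eq -natrD => /eqP h.
  have : (e * n)%:R = ((t + s) * d)%:R :> rat by rewrite [RHS]natrM -h mulfVK.
  move/eqP; rewrite eqr_nat => /eqP h2.
  by rewrite -(Gauss_dvdr n cop) h2 dvdn_mull.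
have xE2 : x = (e * (n %/ d))%:R - s%:R.
  by rewrite xE -{1}(divnK dn) mulnA natrM mulfK.
case: leqP => h.
  have -> : x = (e * (n %/ d) - s)%:R by rewrite natrB.
  rewrite /partition_fun ifT; last by apply/natrP; exists (e * (n %/ d) - s)%N.
  by rewrite (@truncn_def _ _ (e * (n %/ d) - s)) // lexx ltr_nat ltnSn.
rewrite /partition_fun ifF //; apply/negbTE/negP => /natrP[t]; rewrite xE2 => /eqP.
rewrite subr_eq -natrD eqr_nat => /eqP h2; move: h; rewrite h2; lia.
Qed.

(** Both series run over the integers M with e M >= s: the index is e M - s in the first and d M in
    the second. *)
Lemma partition_has_sum (q X : C) :
  has_sum (fun n : nat => if (e %| n + s)%N then (partition_count n)%:R * q ^+ (d * ((n + s) %/ e)) else 0) X ->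
  has_sum (fun n : nat => (partition_fun (N%:R / d%:R ^+ 2 * n%:R -
     (N%:R ^+ 2 - d%:R ^+ 2) / (24%:R * d%:R ^+ 2)))%:R * q ^+ n) X.
Proof.
(* The ceiling of s / e, the least admissible M. *)
pose m0 := ((s + e.-1) %/ e)%N.
have hm0 M : (s <= e * M)%N = (m0 <= M)%N.
  by rewrite [RHS]leqNgt leq_divRL // mulSn mulnC; move: (M * e)%N => y; lia.
have le0 m : (s <= e * (m0 + m))%N by rewrite hm0 leq_addr.
move=> H.
have {}H := (iffLR (has_sum_supp (h := fun m : nat => (e * (m0 + m) - s)%N)
   (g := fun n : nat => ((n + s) %/ e - m0)%N) _ _ X)) H.
have h1 (n : nat) : (e %| n + s)%N -> (e * (m0 + ((n + s) %/ e - m0)) - s)%N = n.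
  move=> /dvdnP[M hM]; rewrite hM mulnK //.
  have sM : (s <= e * M)%N by rewrite mulnC -hM leq_addl.
  by rewrite subnKC -?hm0 // mulnC -hM addnK.
have h2 : cancel (fun m : nat => (e * (m0 + m) - s)%N) (fun n : nat => ((n + s) %/ e - m0)%N).
  by move=> m; rewrite subnK // mulKn // addKn.
have h3 (n : nat) : (d %| n)%N && (s <= e * (n %/ d))%N -> (d * (m0 + (n %/ d - m0)))%N = n.
  by rewrite hm0 => /andP[dn hn]; rewrite subnKC // mulnC divnK.
have h4 : cancel (fun m : nat => (d * (m0 + m))%N) (fun n : nat => (n %/ d - m0)%N).
  by move=> m; rewrite mulKn // addKn.
apply/(has_sum_supp (h := fun m : nat => (d * (m0 + m))%N) (g := fun n : nat => (n %/ d - m0)%N)) => //.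
  move=> n; rewrite partition_funE; case: ifP => [hn _|_]; first exact: h3.
  by rewrite mul0r eqxx.
apply: eq_has_sum (H _ h2) => [m|n] /=; last by case: ifP => [hn _|_]; [exact: h1|rewrite eqxx].
by rewrite partition_funE dvdn_mulr // mulKn // le0 subnK // dvdn_mulr // mulKn.
Qed.

End Partition.

(** * Comparison of the constants *)

Section Coefficient.
Variable R : realType.
Local Notation C := R[i].
Local Open Scope complex_scope.
Variables d e : nat.
Hypothesis gN : good (d * e).
Local Notation N := (d * e)%N.
Local Notation k := (wt N).

Let gd : good d := good_dvd gN (dvdn_mulr e (dvdnn d)).
Let ge : good e := good_dvd gN (dvdn_mull d (dvdnn e)).
Let od := good_odd gd.
Let oe := good_odd ge.
Let d0 : (0 < d)%N := good_gt0 gd.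
Let e0 : (0 < e)%N := good_gt0 ge.

(** For odd d and e all the exponents reduce modulo 4 to multiples of (e - 1) / 2. *)
Lemma CcoefE : Ccoef R d N = ('i : C) ^+ (d * wt e) / epsilon R e.
Proof.
pose a := wt d; pose b := wt e; pose Y := (a * a.+1)./2.
have dE : d = (2 * a + 1)%N by rewrite {1}(wt_odd od) -addnn /a; lia.
have eE : e = (2 * b + 1)%N by rewrite {1}(wt_odd oe) -addnn /b; lia.
have YE : (a * a.+1 = 2 * Y)%N.
  by rewrite -{1}(odd_double_half (a * a.+1)) -/Y oddM /= andbN add0n mul2n.
have E1 : ((d + 1) * (e - 1) %/ 4 = (a + 1) * b)%N.
  by rewrite dE eE (_ : (2 * a + 1 + 1) * (2 * b + 1 - 1) = (a + 1) * b * 4)%N ?mulnK //; lia.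
(* Here N d = d^2 e with d^2 = 8 Y + 1, so the exponent is -b modulo 4. *)
have E2 : ((1 - (N * d)%N%:Z) %/ 2)%Z = - (4 * (2 * b * Y + Y) + b)%N%:Z.
  have -> : (1 - (N * d)%N%:Z) = - (4 * (2 * b * Y + Y) + b)%N%:Z * 2.
    have -> : (N * d = (4 * (a * a.+1) + 1) * (2 * b + 1))%N by rewrite {1}dE eE dE; lia.
    rewrite YE; move: (Y) (b) => y x; lia.
  by rewrite mulzK.
rewrite /Ccoef /Acoef mulKn // E1 E2 -exprnN imunitE exprD exprM i_pow4 expr1n mul1r.
have key : ('i : C) ^+ (d * b) * ('i ^+ b * (-1) ^+ ((a + 1) * b)) = 1.
  rewrite -sqr_i -exprM -!exprD.
  have -> : (d * b + (b + 2 * ((a + 1) * b)) = 4 * (a * b + b))%N by rewrite dE; lia.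
  by rewrite exprM i_pow4 expr1n.
have n0 : ('i : C) ^+ b * (-1) ^+ ((a + 1) * b) != 0.
  by apply/negP => /eqP h; move: key; rewrite h mulr0 => /eqP; rewrite eq_sym oner_eq0.
rewrite invfM mulrA -invfM -/b; congr (_ / _).
by apply: (mulIf n0); rewrite mulVf.
Qed.

Lemma epsilon_neq0 m : epsilon R m != 0.
Proof. by rewrite /epsilon; case: ifP => _; rewrite ?oner_neq0 // imunitE i_neq0. Qed.

Lemma chiC_neq0 m (a : int) : good m -> coprime `|a| m -> (chi m a)%:~R != 0 :> C.
Proof.
move=> g c; rewrite intr_eq0; apply/negP => /eqP h.
by have := chi_sqr (chiP g) c; rewrite h.
Qed.

Lemma kd_neq0 : kd R d e != 0.
Proof.
rewrite /kd; apply: mulf_neq0; last by rewrite invr_eq0 expf_neq0 // i_neq0.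
apply: mulf_neq0; first exact: kap_neq0.
by apply: chiC_neq0 => //; rewrite /= coprime_sym good_coprime.
Qed.

(** Reciprocity between d and e is absorbed by the cocycle of epsilon, and e is the square of
    [kap e]. *)
Lemma kd_Ccoef : (chi e d)%:~R * gauss R d * e%:R = kd R d e * Ccoef R d N * gauss R N.
Proof.
have h := congr1 (fun x : int => x%:~R : C) (chi_recip gd ge (good_coprime gN)).
rewrite intrM rmorphXn rmorphN1 /= in h.
have ep := epsilon_mul R od oe; rewrite -!wt_half -h in ep.
have c1 : (chi d e)%:~R ^+ 2 = 1 :> C.
  by rewrite -rmorphXn (chi_sqr (chiP gd)) //= coprime_sym good_coprime.
rewrite CcoefE /gauss -ep (kapM _ d0 e0) /kd -(kap_sqr R e0).
have := epsilon_neq0 e; have : ('i : C) ^+ (d * wt e) != 0 by rewrite expf_neq0 // i_neq0.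
move: c1; move: ((chi d e)%:~R : C) ((chi e d)%:~R : C) (kap R d) (kap R e) (epsilon R d) (epsilon R e) (('i : C) ^+ _).
move=> x y K L E F I x2 I0 F0.
have -> : L * x / I * (I / F) * (y * x * E * F * (K * L)) = y * (E * K) * L ^+ 2 * x ^+ 2.
  by field; rewrite I0 F0.
by rewrite x2 mulr1.
Qed.

(** The Bernoulli number is -k times the L-value over the twisted Lipschitz constant of level N, and
    -2 k = 1 - N. Passing from level d to level N gives e^k, of which [kd_Ccoef] uses one factor. *)
Lemma eis_coef : (1 < N)%N ->
  2 * ((chi e d)%:~R * Kw R d k) / Lw R N k / kd R d e =
  Ccoef R d N * e%:R ^+ k.-1 * ((1 - N%:R) / ratr (gen_bernoulli N k)).
Proof.
move=> N1; have k1 := wt_gt1 gN N1; rewrite (@bernoulli_Lw R _ gN N1 _ k1).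
have L0 := @Lw_neq0 R _ gN N1 _ k1 (chi_sign gN); have K0 := Kw_neq0 R gN k; have D0 := kd_neq0.
have NE : N%:R = 2 * k%:R + 1 :> C.
  by rewrite {1}(wt_odd (good_odd gN)) -addnn -addn1 !natrD; ring.
have kC : k%:R != 0 :> C by rewrite pnatr_eq0 -lt0n (ltn_trans _ k1).
have dC : d%:R != 0 :> C by rewrite pnatr_eq0 -lt0n.
have eC : e%:R != 0 :> C by rewrite pnatr_eq0 -lt0n.
suff E : (chi e d)%:~R * Kw R d k = kd R d e * Ccoef R d N * e%:R ^+ k.-1 * Kw R N k.
  rewrite E NE; move: L0 K0 D0 kC.
  move: (Lw R N k) (Kw R N k) (kd R d e) (k%:R : C) (e%:R ^+ _ : C) (Ccoef R d N) => l K D x f c l0 K0 D0 x0.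
  by field; rewrite l0 K0 D0 x0.
rewrite /Kw natrM exprMn invfM.
have -> : e%:R ^+ k = e%:R ^+ k.-1 * e%:R :> C by rewrite -exprSr prednK // (ltn_trans _ k1).
have ek : e%:R ^+ k.-1 != 0 :> C by rewrite expf_neq0.
have G := kd_Ccoef.
have -> : (chi e d)%:~R * (d%:R ^- k * lipc R k * gauss R d) =
   d%:R ^- k * lipc R k * e%:R^-1 * ((chi e d)%:~R * gauss R d * e%:R) by field; rewrite eC expf_neq0.
rewrite G; field; rewrite eC ek expf_neq0 //.
Qed.

(** The constant term vanishes unless e = 1, and then [kd] is 1. *)
Lemma chi0_kd : (chi e 0)%:~R / kd R d e = (chi e 0)%:~R.
Proof.
have [e1|e1] := eqVneq e 1%N; last by rewrite chi0 // (negbTE e1) mul0r.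
suff -> : kd R d e = 1 by rewrite divr1.
have k1 : kap R 1 = 1 by rewrite /kap mul1r vv_i.
by rewrite e1 /kd k1 chi_one // /wt /= muln0 expr0 mul1r divr1.
Qed.

End Coefficient.

(** * The cusp form *)

Section Holomorphy.
Variable R : realType.
Local Notation C := R[i].
Local Open Scope complex_scope.

Definition hol (f : C -> C) (z : C) := exists l, cderiv f z l.

Lemma hol_cst c z : hol (fun=> c) z. Proof. by exists 0; exact: cderiv_cst. Qed.
Lemma holD f g z : hol f z -> hol g z -> hol (fun w => f w + g w) z.
Proof. by move=> [l hl] [m hm]; eexists; exact: cderivD hl hm. Qed.
Lemma holM f g z : hol f z -> hol g z -> hol (fun w => f w * g w) z.
Proof. by move=> [l hl] [m hm]; eexists; exact: cderivM hl hm. Qed.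
Lemma holB f g z : hol f z -> hol g z -> hol (fun w => f w - g w) z.
Proof. by move=> [l hl] [m hm]; eexists; exact: cderivB hl hm. Qed.
Lemma hol_comp f g z : hol f z -> hol g (f z) -> hol (fun w => g (f w)) z.
Proof. by move=> [l hl] [m hm]; eexists; exact: cderiv_comp hl hm. Qed.
Lemma holX f z n : hol f z -> hol (fun w => f w ^+ n) z.
Proof.
move=> h; elim: n => [|n IH].
  by have -> : (fun w => f w ^+ 0) = (fun=> 1) by []; exact: hol_cst.
have -> : (fun w => f w ^+ n.+1) = (fun w => f w * f w ^+ n) by apply/funext => w; rewrite exprS.
exact: holM.
Qed.
Lemma holV f z : f z != 0 -> hol f z -> hol (fun w => (f w)^-1) z.
Proof. by move=> f0 h; apply: (hol_comp h); eexists; exact: cderiv_inv. Qed.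
Lemma hol_sum n (f : 'I_n -> C -> C) z : (forall i, hol (f i) z) ->
  hol (fun w => \sum_(i < n) f i w) z.
Proof.
move=> h; elim: n f h => [|n IH] f h.
  have -> : (fun w => \sum_(i < 0) f i w) = (fun=> 0) by apply/funext => w; rewrite big_ord0.
  exact: hol_cst.
have -> : (fun w => \sum_(i < n.+1) f i w) = (fun w => f ord0 w + \sum_(i < n) f (lift ord0 i) w).
  by apply/funext => w; rewrite big_ord_recl.
by apply: holD => //; apply: IH.
Qed.

Lemma hol_eta (z : C) : 0 < complex.Im z -> hol (@eta R) z.
Proof.
move=> z0; have -> : @eta R = (fun w => ce (etal w)) by apply/funext => w; exact: eta_ce.
apply: (@hol_comp (@etal R) (@ce R)); first by eexists; exact: cderiv_etal.
by eexists; exact: cderiv_cexp.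
Qed.

Lemma eq_hol f g (z : C) : (forall w : C, 0 < complex.Im w -> f w = g w) ->
  0 < complex.Im z -> hol f z -> hol g z.
Proof. by move=> fg z0 [l hl]; exists l; exact: eq_cderiv fg z0 hl. Qed.

End Holomorphy.

Section CuspForm.
Variable R : realType.
Local Notation C := R[i].
Local Open Scope complex_scope.
Variables d e : nat.
Hypothesis gN : good (d * e).
Local Notation N := (d * e)%N.
Local Notation k := (wt N).
Hypothesis N1 : (1 < N)%N.
Variables u v : int.
Hypothesis uv : u * d%:Z + v * e%:Z = 1.

Let gd : good d := good_dvd gN (dvdn_mulr e (dvdnn d)).
Let ge : good e := good_dvd gN (dvdn_mull d (dvdnn e)).
Let d0 : (0 < d)%N := good_gt0 gd.
Let e0 : (0 < e)%N := good_gt0 ge.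
Let k1 : (1 < k)%N := wt_gt1 gN N1.
Let L0 : Lw R N k != 0 := @Lw_neq0 R _ gN N1 _ k1 (chi_sign gN).

Definition cform (z : C) : C :=
  (kd R d e)^-1 * ((Lw R N k)^-1 * eis k (Phi R d e) z - Ff d e u v z).

(** The divisor sum has at most n terms, each at most n^(k - 1). *)
Lemma radius1_sg : radius1 (sg R d e).
Proof.
apply: (@radius1_poly _ k _ 1) => n; rewrite mul1r /sg; case: eqP => [->|n0].
  by rewrite nm0 exprn_ge0.
have np : (0 < n)%N by rewrite lt0n; apply/eqP.
rewrite /sigma; apply: le_trans (nm_sum _ _ _) _.
apply: (@le_trans _ _ (\sum_(t <- divisors n) n%:R ^+ k.-1)).
  rewrite !big_seq; apply: ler_sum => t; rewrite -dvdn_divisors // => tn.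
  rewrite nmM nmM; apply: (@le_trans _ _ (1 * nm (t%:R ^ k.-1%:Z))).
    by rewrite ler_wpM2r ?nm_ge0 // mulr_ile1 ?nm_ge0 ?nm_chi.
  rewrite mul1r -exprnP nmX nm_nat; apply: lerXn2r; rewrite ?nnegrE ?ler0n // ler_nat.
  exact: dvdn_leq.
rewrite big_const_seq iter_addr_0 count_predT -[_ *+ size _]mulr_natl.
have -> : n%:R ^+ k = n%:R * n%:R ^+ k.-1 :> R by rewrite -exprS prednK // (ltn_trans _ k1).
rewrite ler_wpM2r ?exprn_ge0 // ler_nat -[X in (_ <= X)%N](size_iota 1).
apply: uniq_leq_size; first exact: divisors_uniq.
move=> t; rewrite -dvdn_divisors // mem_iota => tn.
by rewrite (dvdn_gt0 np tn) add1n ltnS dvdn_leq.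
Qed.

Lemma hol_cform (z : C) : 0 < complex.Im z -> hol cform z.
Proof.
move=> z0; apply: holM; first exact: hol_cst.
apply: holB.
  apply: holM; first exact: hol_cst.
  apply: (@eq_hol _ (fun w => (chi e 0)%:~R * Lw R N k + 2 * ((chi e d)%:~R * Kw R d k) * qser (sg R d e) w)) => //.
    by move=> w w0; rewrite (eis_q gN N1 w0).
  apply: holD; first exact: hol_cst.
  by apply: holM; [exact: hol_cst|eexists; exact: (cderiv_qser radius1_sg z0)].
apply: (@eq_hol _ (fun w => \sum_(j < e) kd R d e * (eta (w + (j : nat)%:R) ^+ N / eta (d%:R * ((w + (j : nat)%:R) / e%:R))))) => //.
  by move=> w w0; apply: eq_bigr => j _; rewrite (sl_gam gN uv _ w0).
apply: hol_sum => j; apply: holM; first exact: hol_cst.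
have h1 : hol (fun w : C => w + (j : nat)%:R) z.
  by apply: holD; [eexists; exact: cderiv_id|exact: hol_cst].
have zj : 0 < complex.Im (z + (j : nat)%:R) by rewrite Im_add_nat.
apply: holM.
  by apply: holX; apply: (hol_comp (f := fun w : C => w + (j : nat)%:R) h1); exact: hol_eta.
apply: holV; first exact: eta_neq0.
apply: (hol_comp (f := fun w : C => d%:R * ((w + (j : nat)%:R) / e%:R))).
  by apply: holM; [exact: hol_cst|apply: holM => //; exact: hol_cst].
apply: hol_eta; apply: Im_natM => //; rewrite (natC R e); apply: Im_gt0_div; rewrite ?ltr0n //.
Qed.

Lemma sl_cform g (z : C) : sl k cform g z =
  (kd R d e)^-1 * ((Lw R N k)^-1 * sl k (eis k (Phi R d e)) g z - sl k (Ff d e u v) g z).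
Proof. by rewrite /sl /cform; ring. Qed.

Lemma cform_gamma0 g (z : C) : sl2 g -> (N%:Z %| mc g)%Z -> 0 < complex.Im z ->
  sl k cform g z = (chi N (md g))%:~R * cform z.
Proof.
move=> sg cN z0; rewrite sl_cform (eis_gamma0 gN N1 sg cN z0) (Ff_gamma0 gN uv sg cN z0) /cform.
by ring.
Qed.

Lemma clim_cform g : sl2 g -> clim (ioo (R := R)) (sl k cform g) 0.
Proof.
move=> sg; have c1 := @clim_eis_slash R d e gN N1 g sg; have c2 := @clim_Ff R d e gN u v uv g sg.
have ck : clim (ioo (R := R)) (fun=> (kd R d e)^-1) (kd R d e)^-1 by exact: clim_cst.
have cl : clim (ioo (R := R)) (fun=> (Lw R N k)^-1) (Lw R N k)^-1 by exact: clim_cst.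
have h : clim (ioo (R := R)) (fun z => (kd R d e)^-1 * ((Lw R N k)^-1 * sl k (eis k (Phi R d e)) g z - sl k (Ff d e u v) g z))
   ((kd R d e)^-1 * ((Lw R N k)^-1 * (Phi R d e (- mc g) (ma g) * Lw R N k) - Phi R d e (- mc g) (ma g))).
  by apply: climM => //; apply: climB => //; apply: climM.
rewrite mulrCA mulVf // mulr1 subrr mulr0 in h.
by apply: eq_near_clim h; apply: (@near_ioo _ _ 0) => z z0 _; rewrite sl_cform.
Qed.

Definition m2 (g : 'M[int]_2) := Mat2 (g 0 0) (g 0 1) (g 1 0) (g 1 1).

Lemma sl2_m2 g : SL2Z g -> sl2 (m2 g).
Proof.
rewrite /SL2Z /sl2 /= => <-; rewrite (expand_det_row _ 0) !big_ord_recl big_ord0 addr0 /cofactor.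
rewrite ![\det (row' _ _)]det_mx11 !mxE /= expr0 expr1 mul1r mulN1r mulrN.
by congr (g _ _ * g _ _ - g _ _ * g _ _); apply: val_inj.
Qed.

Lemma cusp_cform : cusp_form k N (chi N) cform.
Proof.
split.
- by move=> z z0; have [l hl] := hol_cform z0; exact: cderiv_derivable hl.
- move=> g z [sg cN] z0; have s2 := sl2_m2 sg.
  have := cform_gamma0 s2 cN z0; rewrite /sl => h.
  have j0 : j2 (m2 g) z ^+ k != 0 by rewrite expf_neq0 // j2_neq0.
  have -> : cform (moebius g z) = j2 (m2 g) z ^+ k * (j2 (m2 g) z ^- k * cform (mob2 (m2 g) z)) by rewrite mulVKf.
  by rewrite h mulrCA mulrA.
move=> g sg eps eps0; have s2 := sl2_m2 sg.
have := clim_cform s2 eps0 => -[A HA]; exists A => z z0 zA.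
have := HA z z0 zA; rewrite subr0 /sl => h; rewrite nmE ltcR; exact: h.
Qed.

Lemma identity (z : C) s : (e ^ 2 = 24 * s + 1)%N -> 0 < complex.Im z ->
  (chi e 0)%:~R + Ccoef R d N * e%:R ^+ k.-1 * ((1 - N%:R) / ratr (gen_bernoulli N k)) *
    \big[+%R/0]_(1 <= n <oo) (sigma R k.-1%:Z (chi e) (chi d) n * qvar z ^+ n) =
  e%:R * qpoch (qvar z) ^+ N * \big[+%R/0]_(0 <= n <oo)
    ((partition_fun (N%:R / d%:R ^+ 2 * n%:R - (N%:R ^+ 2 - d%:R ^+ 2) / (24%:R * d%:R ^+ 2)))%:R * qvar z ^+ n)
  + cform z.
Proof.
move=> e24 z0; rewrite -eeE.
have D0 := kd_neq0 R gN; have Q0 : qpoch (ee z) ^+ N != 0 by rewrite expf_neq0 // qpoch_neq0.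
have eC : e%:R != 0 :> C by rewrite pnatr_eq0 -lt0n.
have -> : \big[+%R/0]_(1 <= n <oo) (sigma R k.-1%:Z (chi e) (chi d) n * ee z ^+ n) = qser (sg R d e) z.
  apply: has_sum_series1; have [H _] := sg_has_sum gN N1 z0.
  have := has_sum_succE H (radius1_asum radius1_sg z0); rewrite /sg /= mul0r subr0.
  by apply: eq_has_sum => n.
pose K := kd R d e * qpoch (ee z) ^+ N * e%:R.
have K0 : K != 0 by apply: mulf_neq0 => //; exact: mulf_neq0.
have H := has_sumZ K^-1 (Ff_has_sum gN e24 uv z0).
have {}H := partition_has_sum gN e24 (eq_has_sum (fun n => mulKf K0 _) H).
rewrite (has_sum_series H) /cform (eis_q gN N1 z0) -eis_coef // -[in LHS](chi0_kd R gN) /K.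
move: D0 Q0 eC L0; move: (kd R d e) (qpoch _ ^+ _) (e%:R : C) (Lw R N k) (Ff _ _ _ _ _) (qser _ _).
move=> D Q f l F q D0 Q0 f0 l0.
by field; rewrite D0 Q0 f0 l0.
Qed.

End CuspForm.

Theorem theorem5p2 (R : realType) (N d : nat) :
  squarefree N -> gcdn N 6 = 1%N -> (d %| N)%N ->
  exists C2 : R[i] -> R[i],
    cusp_form ((N - 1) %/ 2) N (chi N) C2 /\
    forall z : R[i], 0 < complex.Im z ->
      (chi (N %/ d) 0)%:~R
      + Ccoef R d N * (N %/ d)%N%:R ^ ((N%:Z - 3) %/ 2)%Z
        * ((1 - N%:R) / ratr (gen_bernoulli N ((N - 1) %/ 2)))
        * \big[+%R/0]_(1 <= n <oo)
            (sigma R ((N%:Z - 3) %/ 2)%Z (chi (N %/ d)) (chi d) n * qvar z ^+ n)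
      = (N %/ d)%N%:R * qpoch (qvar z) ^+ N
        * \big[+%R/0]_(0 <= n <oo)
            ((partition_fun (N%:R / d%:R ^+ 2 * n%:R
                - (N%:R ^+ 2 - d%:R ^+ 2) / (24%:R * d%:R ^+ 2)))%:R
             * qvar z ^+ n)
        + C2 z.
Proof.
move=> sqf g6 dN; have gN : good N by split=> //; rewrite /coprime g6.
have dgt : (0 < d)%N by apply: dvdn_gt0 dN; exact: good_gt0.
(* In weight 0 the factor 1 - N removes the divisor sums, and the identity is that (q;q) is inverse
   to the partition series, with zero cusp form. *)
have [N_1|N_1] := eqVneq N 1%N.
  have d_1 : d = 1%N by move: dN; rewrite N_1 dvdn1 => /eqP.
  subst N d; exists (fun=> 0); split.
    split=> [z z0|g z _ z0|g sg eps eps0]; first exact: cderiv_derivable (cderiv_cst 0 z).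
      by rewrite mulr0.
    by exists 0 => z z0 _; rewrite mulr0 normr0 ltcR.
  move=> z z0; rewrite subrr mul0r mulr0 mul0r addr0 divn1 chi_1 mul1r addr0 expr1 -eeE.
  have H : has_sum (fun n : nat => (partition_fun (1%:R / 1%:R ^+ 2 * n%:R -
     (1%:R ^+ 2 - 1%:R ^+ 2) / (24%:R * 1%:R ^+ 2)))%:R * ee z ^+ n) (qpoch (ee z))^-1.
    apply: eq_has_sum (partition_gf z0) => n.
    by have := @partition_funE 1 1 0 gN erefl n; rewrite !mul1n => ->; rewrite dvd1n divn1 leq0n subn0.
  by rewrite (has_sum_series H) divff // qpoch_neq0.
have N1 : (1 < N)%N by have := good_gt0 gN; lia.
pose e := (N %/ d)%N; have NE : N = (d * e)%N by rewrite /e mulnC divnK.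
rewrite -/e; move: NE; move: (e) => {}e NE.
have kN : (((N%:Z - 3) %/ 2)%Z = (wt N).-1%:Z).
  have -> : N%:Z - 3 = (wt N).-1%:Z * 2.
    by rewrite {1}(wt_odd (good_odd gN)); have := wt_gt1 gN N1; move: (wt N) => w; lia.
  by rewrite mulzK.
rewrite kN -wt_half; subst N.
have [s e24] := good_sqr24 (good_dvd gN (dvdn_mull d (dvdnn e))).
have [u [v uv]] := Bezoutz d%:Z e%:Z.
have {}uv : u * d%:Z + v * e%:Z = 1.
  by rewrite uv /gcdz /=; have := good_coprime gN; rewrite /coprime => /eqP ->.
exists (cform d e u v); split; first exact: cusp_cform.
by move=> z z0; apply: identity e24 z0.
Qed.
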